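(* Let $\Sigma$ be an ordered alphabet of size $\sigma$ and $n\ge 1$. Given a word $w\in\Sigma^n$, the position $\mathrm{occ}(w,\mathrm{dB}_n)$ of the unique occurrence of $w$ in the lexicographically minimal de Bruijn sequence $\mathrm{dB}_n$ can be computed in $O(n^2\log\sigma)$ time in the word-RAM model, and in $O(n^2)$ time in the unit-cost RAM model.
   Context: A de Bruijn sequence of rank $n$ over $\Sigma$ is a cyclic sequence of length $\sigma^n$ in which every word of $\Sigma^n$ occurs as a (cyclic) factor exactly once. $\mathrm{dB}_n$ denotes the lexicographically minimal such sequence; equivalently, it is the concatenation, in lexicographic order, of all Lyndon words over $\Sigma$ whose length divides $n$ (a Lyndon word being a primitive word strictly smaller than all its nontrivial cyclic rotations). $\mathrm{occ}(w,\mathrm{dB}_n)$ is the (1-based) position in $\mathrm{dB}_n$ at which the unique cyclic occurrence of $w$ starts. Word-RAM model: a machine word has at least $\max(\log\sigma,\log n)$ bits, arithmetic on numbers fitting in a constant number of machine words takes constant time, and basic arithmetic on numbers of size at most $\sigma^n$ takes $O(n)$ time. Unit-cost RAM model: every arithmetic operation takes constant time. *)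

(* Defs.v *)
From mathcomp Require Import all_boot all_order.
Import Order.TTheory.

Set Implicit Arguments.
Unset Strict Implicit.
Unset Printing Implicit Defensive.

(* [w] is the cyclic factor of [s] that starts at the 0-based position [i]; the
   cyclic reading may wrap around more than once, which happens over a
   one-letter alphabet. *)
Definition occurs_at (T : eqType) (s w : seq T) (i : nat) : bool :=
  all (fun j => onth s ((i + j) %% size s) == onth w j) (iota 0 (size w)).

Definition de_bruijn (sigma n : nat) (s : seq 'I_sigma) : bool :=
  (size s == sigma ^ n) &&
  [forall w : n.-tuple 'I_sigma, count (occurs_at s w) (iota 0 (size s)) == 1].

Definition lexle (sigma : nat) (s t : seq 'I_sigma) : bool :=
  ((s : seqlexi 'I_sigma) <= t)%O.

Definition min_de_bruijn (sigma n : nat) (s : (sigma ^ n).-tuple 'I_sigma) : bool :=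
  de_bruijn n s &&
  [forall t : (sigma ^ n).-tuple 'I_sigma, de_bruijn n t ==> lexle s t].

(* The value [::] would be taken only if no de Bruijn sequence existed. *)
Definition dB (sigma n : nat) : seq 'I_sigma :=
  if [pick s | @min_de_bruijn sigma n s] is Some s then tval s else [::].

(* 1-based position of the first cyclic occurrence. *)
Definition occ (T : eqType) (w s : seq T) : nat :=
  (find (occurs_at s w) (iota 0 (size s))).+1.

(* [Minus] is truncated subtraction; [Quo] and [Rem] are the total
   operations, with x %/ 0 = 0 and x %% 0 = x. *)
Inductive binop := Plus | Minus | Times | Quo | Rem.

Definition eval_binop (o : binop) (x y : nat) : nat :=
  match o with
  | Plus => x + y
  | Minus => x - y
  | Times => x * y
  | Quo => x %/ y
  | Rem => x %% y
  end.

(* Register arguments are register numbers. *)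
Inductive instr :=
  | Const (d k : nat)              (* r_d := k *)
  | Op (o : binop) (d x y : nat)   (* r_d := r_x o r_y *)
  | Read (d x : nat)               (* r_d := mem[r_x] *)
  | Write (x y : nat)              (* mem[r_x] := r_y *)
  | JumpLe (x y l : nat).          (* if r_x <= r_y then goto l *)

Definition program := seq instr.

Record state := State { pc : nat; reg : nat -> nat; cell : nat -> nat }.

Definition update (f : nat -> nat) (i v : nat) : nat -> nat :=
  fun j => if j == i then v else f j.

(* [norm] is applied to constants, results and inputs: the identity on the
   unit-cost RAM, reduction modulo a power of two on the word RAM. *)
Definition exec (norm : nat -> nat) (i : instr) (s : state) : state :=
  let: State p r m := s in
  match i with
  | Const d k => State p.+1 (update r d (norm k)) m
  | Op o d x y => State p.+1 (update r d (norm (eval_binop o (r x) (r y)))) m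
  | Read d x => State p.+1 (update r d (m (r x))) m
  | Write x y => State p.+1 r (update m (r x) (r y))
  | JumpLe x y l => State (if r x <= r y then l else p.+1) r m
  end.

Definition halted (P : program) (s : state) : bool := size P <= pc s.

(* A halted machine stays in its state. *)
Definition step (norm : nat -> nat) (P : program) (s : state) : state :=
  if onth P (pc s) is Some i then exec norm i s else s.

Definition run (norm : nat -> nat) (P : program) (t : nat) (s : state) : state :=
  iter t (step norm P) s.

(* [regs] fills r_0, r_1, ... and [cells] fills mem[0], mem[1], ...; every other
   register and memory cell initially contains 0. *)
Definition initial (norm : nat -> nat) (regs cells : seq nat) : state :=
  State 0 (fun i => norm (nth 0 regs i)) (fun i => norm (nth 0 cells i)).

Definition letters (sigma : nat) (w : seq 'I_sigma) : seq nat :=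
  [seq nat_of_ord a | a <- w].

(* Word RAM with [b]-bit machine words. Arithmetic on numbers that fit in a
   constant number [c] of machine words takes constant time, so registers and
   memory cells range over the numbers below 2 ^ (c * b). *)
Definition word_norm (c b x : nat) : nat := x %% 2 ^ (c * b).

(* A large number is output as [r_0] machine words mem[0], mem[1], ..., the
   least significant first. *)
Definition word_output (b : nat) (s : state) (v : nat) : Prop :=
  (forall i, i < reg s 0 -> cell s i < 2 ^ b) /\
  v = \sum_(i < reg s 0) cell s i * (2 ^ b) ^ i.

(* Input: r_0 = n, r_1 = sigma, r_2 = 2 ^ b (the radix of the machine; the
   constants of a program do not depend on b) and mem[0], ..., mem[n-1] = [w]. *)
Definition word_computes (P : program) (c b time sigma n : nat)
    (w : seq 'I_sigma) (v : nat) : Prop :=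
  let s := run (word_norm c b) P time
             (initial (word_norm c b) [:: n; sigma; 2 ^ b] (letters w)) in
  halted P s /\ word_output b s v.

(* Input as above, without the radix; the output is the number in [r_0]. *)
Definition unit_computes (P : program) (time sigma n : nat)
    (w : seq 'I_sigma) (v : nat) : Prop :=
  let s := run id P time (initial id [:: n; sigma] (letters w)) in
  halted P s /\ reg s 0 = v.

(* Rounded down, and at least 1 so that time bounds do not vanish over a
   one-letter alphabet; for sigma >= 2 it is the integer part of log_2 sigma. *)
Definition log2 (sigma : nat) : nat := maxn 1 (trunc_log 2 sigma).

(* Main.v *)
(* Words of length n are numbers below sigma^n, compared as such. The minimal de
   Bruijn sequence is generated by a successor rule that changes the rotated
   letter only if the result is a necklace. The position of a word w is then a
   count: the number of words whose least rotation is below a bound a read off w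
   (the least rotation of w, or w with its leading letters sigma-1 moved to the
   end), plus a correction between 0 and 2n. If q is the prenecklace that
   represents a and p its Duval period, the words x all of whose rotations are
   at least a correspond to closed walks in the automaton that matches x with
   the periodic continuation of q; cutting the walks at their returns to the
   initial state gives sum_l l a_l f(n-l) of them, where f(m) = sum_l a_l f(m-l)
   and a_l is the number of letters above q_(l-1), plus one if l = p.

   On the unit-cost RAM the recurrence is evaluated directly. On the word RAM, f
   is the power series inverse of 1 - sum_l a_l x^l. Its terms are packed into
   slots of d digits in a base B = sigma^e >= n with d e = O(n), so that Newton's
   iteration doubles the number of known terms with two integer products. They
   are computed with a complex fast Fourier transform in fixed-point arithmetic
   whose roots of unity come from repeated angle halving. A transform of length L
   costs O(L log L), which is O(n d log n) = O(n^2 log sigma) in total; the scale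
   B^256 makes the rounding errors harmless and fits in O(1) machine words.
   Complex numbers are quadruples of naturals, as the machine has no negative
   numbers. *)

Require Import Defs.
From mathcomp Require Import all_boot all_order.
From mathcomp Require Import zify.

Set Implicit Arguments.
Unset Strict Implicit.
Unset Printing Implicit Defensive.

(** * Words as numbers and their rotations *)

(** Correctness is carried by an explicit formula: [rank] increases by one along [next], which shows
    that the orbit of [start] runs through all words; and for a fixed context of [m] letters [rank]
    increases with the last letter, which gives minimality against every other de Bruijn sequence.
    The obstacle on the word RAM is that the recurrence has about n^2 terms, on numbers of n log
    sigma bits. With e letters per digit, d digits per slot and e d = O(n), the logarithm of a
    transform length is O(e log sigma), and its product with the number n d of digits is O(n^2 log
    sigma). Real closed fields enter only the error analysis; the programs handle naturals. The
    roots carry an error below 16^K / S with 2^K at most B^7; the rounding condition then holds as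
    soon as S exceeds B^105, and B^256 is reached by eight squarings. Since B <= n sigma, everything
    stays below a constant power of the machine radix. *)

Module Import Rotation.

Lemma modn_cat a b d : b < d -> (a * d + b) %% d = b.
Proof. by move=> h; rewrite modnMDl modn_small. Qed.

Lemma divn_cat a b d : b < d -> (a * d + b) %/ d = a.
Proof. by move=> h; rewrite divnMDl ?divn_small ?addn0 //; lia. Qed.

Lemma ltn_cat a b c d : a < c -> b < d -> a * d + b < c * d.
Proof.
move=> hac hbd; have h : a.+1 * d <= c * d by rewrite leq_mul2r hac orbT.
by rewrite mulSn in h; lia.
Qed.

Section Rotation.

Variables (s m : nat).
Hypothesis s_gt0 : 0 < s.

(** Words of length [m.+1] are read in base [s], most significant letter first; the leading letter
    moves to the end. *)
Definition rotw (x : nat) := (x %% s ^ m) * s + x %/ s ^ m.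

Lemma sp_gt0 k : 0 < s ^ k.
Proof. by rewrite expn_gt0 s_gt0. Qed.

Lemma divw_lt x : x < s ^ m.+1 -> x %/ s ^ m < s.
Proof. by move=> hx; rewrite ltn_divLR ?sp_gt0 // -expnS. Qed.

Lemma rotw_lt x : x < s ^ m.+1 -> rotw x < s ^ m.+1.
Proof.
move=> hx; rewrite /rotw expnSr; apply: ltn_cat; last exact: divw_lt.
by rewrite ltn_mod sp_gt0.
Qed.

Lemma rotw_cat c y : y < s ^ m -> rotw (c * s ^ m + y) = y * s + c.
Proof. by move=> hy; rewrite /rotw modn_cat // divn_cat. Qed.

Lemma iter_rotw_lt k x : x < s ^ m.+1 -> iter k rotw x < s ^ m.+1.
Proof. by move=> hx; elim: k => //= k /rotw_lt. Qed.

(** [a] is the prefix of [k] letters, [b] the rest. The induction peels the last letter off [a] and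
    lends it to [b], so that one more rotation carries it over. *)
Lemma iter_rotwE k a b : k <= m.+1 -> a < s ^ k -> b < s ^ (m.+1 - k) ->
  iter k rotw (a * s ^ (m.+1 - k) + b) = b * s ^ k + a.
Proof.
elim: k a b => [|k IH] a b hk ha hb.
  by move: ha; rewrite expn0 ltnS leqn0 => /eqP->; rewrite muln1 addn0.
have e1 : m.+1 - k = (m.+1 - k.+1).+1 by lia.
rewrite iterS.
have -> : a * s ^ (m.+1 - k.+1) + b
    = (a %/ s) * s ^ (m.+1 - k) + (a %% s * s ^ (m.+1 - k.+1) + b).
  by rewrite e1 expnS mulnA addnA -mulnDl -divn_eq.
rewrite IH; [|lia| |].
- set t := (m.+1 - k.+1).
  rewrite mulnDl -addnA -mulnA -expnD.
  have -> : t + k = m by rewrite /t; lia.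
  rewrite rotw_cat.
    by rewrite expnSr mulnA mulnDl -addnA -divn_eq.
  have -> : s ^ m = s ^ t * s ^ k by rewrite -expnD; congr (_ ^ _); rewrite /t; lia.
  by apply: ltn_cat => //; rewrite ltn_divLR // -expnSr.
- by rewrite ltn_divLR // -expnSr.
- by rewrite e1 expnS; apply: ltn_cat => //; rewrite ltn_mod.
Qed.

Lemma iter_rotw k x : k <= m.+1 -> x < s ^ m.+1 ->
  iter k rotw x = (x %% s ^ (m.+1 - k)) * s ^ k + x %/ s ^ (m.+1 - k).
Proof.
move=> hk hx; rewrite {1}(divn_eq x (s ^ (m.+1 - k))) iter_rotwE //.
  by rewrite ltn_divLR ?sp_gt0 // -expnD subnKC.
by rewrite ltn_mod sp_gt0.
Qed.

Lemma iter_rotw_n x : x < s ^ m.+1 -> iter m.+1 rotw x = x.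
Proof. by move=> hx; rewrite iter_rotw // subnn expn0 modn1 divn1. Qed.

Lemma iter_rotw_mod k x : x < s ^ m.+1 -> iter (k %% m.+1) rotw x = iter k rotw x.
Proof.
move=> hx; rewrite {2}(divn_eq k m.+1) addnC iterD.
suff -> : iter (k %/ m.+1 * m.+1) rotw x = x by [].
elim: (k %/ _) => [|q IH]; first by rewrite mul0n.
by rewrite mulSn iterD IH iter_rotw_n.
Qed.

Lemma rotw_inj x y : x < s ^ m.+1 -> y < s ^ m.+1 -> rotw x = rotw y -> x = y.
Proof.
by move=> hx hy e; rewrite -(iter_rotw_n hx) -(iter_rotw_n hy) !iterSr e.
Qed.

Lemma iter_rotw_inj k x y : x < s ^ m.+1 -> y < s ^ m.+1 ->
  iter k rotw x = iter k rotw y -> x = y.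
Proof.
by move=> hx hy; elim: k => //= k IH /rotw_inj h; apply/IH/h; exact: iter_rotw_lt.
Qed.

Definition minrot (x : nat) :=
  iter [arg min_(k < ord0 : 'I_m.+1) iter k rotw x] rotw x.

Lemma minrot_le k x : x < s ^ m.+1 -> minrot x <= iter k rotw x.
Proof.
move=> hx; rewrite /minrot; case: arg_minnP => // i _ h.
rewrite -(iter_rotw_mod k hx).
have hk : k %% m.+1 < m.+1 by rewrite ltn_mod.
exact: (h (Ordinal hk)).
Qed.

Lemma minrot_ex x : exists2 k, k < m.+1 & minrot x = iter k rotw x.
Proof. by exists [arg min_(k < ord0 : 'I_m.+1) iter k rotw x]. Qed.

Lemma minrot_lt x : x < s ^ m.+1 -> minrot x < s ^ m.+1.
Proof. by have [k _ ->] := minrot_ex x; apply: iter_rotw_lt. Qed.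

Lemma minrot_rotw x : x < s ^ m.+1 -> minrot (rotw x) = minrot x.
Proof.
move=> hx; apply/eqP; rewrite eqn_leq.
have [k _ e] := minrot_ex x; have [l _ e'] := minrot_ex (rotw x).
rewrite {2}e' -iterSr minrot_le // andbT e.
have -> : iter k rotw x = iter (k + m) rotw (rotw x).
  by rewrite -iterSr -addnS iterD iter_rotw_n.
by apply: minrot_le; exact: rotw_lt.
Qed.

Lemma minrot_iter k x : x < s ^ m.+1 -> minrot (iter k rotw x) = minrot x.
Proof.
by move=> hx; elim: k => //= k <-; apply: minrot_rotw; apply: iter_rotw_lt.
Qed.

Lemma minrot_id x : x < s ^ m.+1 -> minrot (minrot x) = minrot x.
Proof. by move=> hx; have [k _ {1}->] := minrot_ex x; rewrite minrot_iter. Qed.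

Definition necklace x := minrot x == x.

Lemma necklaceP x : x < s ^ m.+1 ->
  reflect (forall k, k <= m -> x <= iter k rotw x) (necklace x).
Proof.
move=> hx; apply: (iffP eqP) => [e k _|h]; first by rewrite -{1}e minrot_le.
apply/eqP; rewrite eqn_leq (minrot_le 0) //=.
by have [k hk ->] := minrot_ex x; apply: h.
Qed.

(** The search succeeds because [m.+1] rotations are the identity. *)
Definition per x := (find (fun k => iter k.+1 rotw x == x) (iota 0 m.+1)).+1.

Lemma per_le x : x < s ^ m.+1 -> per x <= m.+1.
Proof.
move=> hx; rewrite /per -[X in _ < X](size_iota 0) -has_find.
apply/hasP; exists m; first by rewrite mem_iota add0n /=.
by apply/eqP; exact: iter_rotw_n.
Qed.

Lemma iter_per x : x < s ^ m.+1 -> iter (per x) rotw x = x.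
Proof.
move=> hx; have h := per_le hx; rewrite /per in h *.
have := h; rewrite -{1}[X in _ < X](size_iota 0 m.+1) -has_find => /(nth_find 0).
by rewrite nth_iota // => /eqP.
Qed.

Lemma per_min x k : x < s ^ m.+1 -> 0 < k < per x -> iter k rotw x != x.
Proof.
move=> hx /andP[h1]; rewrite /per => h2; case: k h1 h2 => // k _.
rewrite ltnS => h2; have := before_find 0 h2.
rewrite nth_iota ?add0n; first by move=> ->.
by apply: leq_trans h2 _; rewrite -[X in _ <= X](size_iota 0 m.+1) find_size.
Qed.

Lemma iter_per_mod x k : x < s ^ m.+1 -> iter (k %% per x) rotw x = iter k rotw x.
Proof.
move=> hx; rewrite {2}(divn_eq k (per x)) addnC iterD.
suff -> : iter (k %/ per x * per x) rotw x = x by [].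
elim: (k %/ _) => [|q IH]; first by rewrite mul0n.
by rewrite mulSn iterD IH iter_per.
Qed.

Lemma iter_per_inj x i j : x < s ^ m.+1 -> i < per x -> j < per x ->
  iter i rotw x = iter j rotw x -> i = j.
Proof.
move=> hx; wlog hij : i j / i <= j.
  by move=> W hi hj e; case: (leqP i j) => h; [apply: W|symmetry; apply: W => //; apply: ltnW].
move=> hi hj e; apply/eqP; rewrite eqn_leq hij /=; rewrite leqNgt; apply/negP => hlt.
have h0 : 0 < j - i < per x by lia.
case/negP: (per_min hx h0).
apply/eqP; apply: (@iter_rotw_inj i) => //; first exact: iter_rotw_lt.
by rewrite -iterD subnKC.
Qed.

Lemma per_dvd x k : x < s ^ m.+1 -> iter k rotw x = x -> per x %| k.
Proof.
move=> hx e; rewrite /dvdn; apply/eqP.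
apply: (@iter_per_inj x) => //; first by rewrite ltn_mod.
by rewrite iter_per_mod.
Qed.

(** Offset of [x] in its rotation class, counted from the necklace; it becomes the fine part of the
    position. *)
Definition shift x := find (fun k => iter k rotw (minrot x) == x) (iota 0 (per (minrot x))).

Lemma shift_lt x : x < s ^ m.+1 -> shift x < per (minrot x).
Proof.
move=> hx; have hm := minrot_lt hx.
rewrite /shift -[X in _ < X](size_iota 0) -has_find; apply/hasP.
have [k hk e] := minrot_ex x.
exists ((m.+1 - k) %% per (minrot x)); first by rewrite mem_iota add0n ltn_mod.
by rewrite iter_per_mod // e -iterD subnK ?iter_rotw_n //; apply: ltnW.
Qed.

Lemma iter_shift x : x < s ^ m.+1 -> iter (shift x) rotw (minrot x) = x.
Proof.
move=> hx; have h := shift_lt hx; rewrite /shift in h *.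
have := h; rewrite -{1}[X in _ < X](size_iota 0 (per (minrot x))) -has_find => /(nth_find 0).
by rewrite nth_iota // => /eqP.
Qed.

Lemma shift_uniq x k : x < s ^ m.+1 -> k < per (minrot x) ->
  iter k rotw (minrot x) = x -> shift x = k.
Proof.
move=> hx hk e; apply: (iter_per_inj (minrot_lt hx)) => //; first exact: shift_lt.
by rewrite e iter_shift.
Qed.

(** The offset can only fall back to 0 when the rotation reaches the necklace again. *)
Lemma shift_rotw x : x < s ^ m.+1 -> ~~ necklace (rotw x) ->
  shift (rotw x) = (shift x).+1.
Proof.
move=> hx hn; have hr := rotw_lt hx; have hm := minrot_lt hx.
apply: shift_uniq; rewrite ?minrot_rotw // ?iterS ?iter_shift //.
have := shift_lt hx; rewrite leq_eqVlt => /orP[/eqP e|//].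
have := iter_per hm; rewrite -e iterS iter_shift // => e2.
by case/negP: hn; rewrite /necklace minrot_rotw // e2.
Qed.

Lemma shift_necklace x : necklace x -> shift x = 0.
Proof. by move=> /eqP e; rewrite /shift e /per /= eqxx. Qed.

(** This function jumps only at necklaces, each time by the size of the rotation class, so it is the
    coarse part of the position. *)
Definition cnt a := \sum_(0 <= x < s ^ m.+1) (minrot x < a).

Lemma cnt_le a b : a <= b -> cnt a <= cnt b.
Proof.
move=> h; apply: leq_sum => x _.
by case: (ltnP _ a) => // h1; rewrite (leq_trans h1 h).
Qed.

Lemma cnt_max : cnt (s ^ m.+1) = s ^ m.+1.
Proof.
rewrite /cnt big_nat_cond (eq_bigr (fun=> 1)).
  by rewrite -big_nat_cond sum_nat_const_nat subn0 muln1.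
by move=> x; rewrite andbT => h; rewrite minrot_lt.
Qed.

Lemma cnt0 : cnt 0 = 0.
Proof. by rewrite /cnt big1. Qed.

Lemma cntS a : cnt a.+1 = cnt a + count (fun x => minrot x == a) (iota 0 (s ^ m.+1)).
Proof.
rewrite -sum1_count big_mkcond /= /cnt /index_iota subn0 -big_split /=.
by apply: eq_bigr => x _; rewrite ltnS leq_eqVlt; case: eqP => [->|_]; rewrite ?ltnn //= addn0.
Qed.

Lemma cntS_necklace a : a < s ^ m.+1 -> necklace a -> cnt a.+1 = cnt a + per a.
Proof.
move=> ha hn; rewrite cntS; congr addn.
rewrite -size_filter -(size_iota 0 (per a)) -(size_map (fun k => iter k rotw a) (iota 0 (per a))).
apply/perm_size/uniq_perm.
- by rewrite filter_uniq ?iota_uniq.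
- rewrite map_inj_in_uniq ?iota_uniq // => i j; rewrite !mem_iota !add0n.
  exact: iter_per_inj.
- move=> x; rewrite mem_filter mem_iota add0n leq0n andTb; apply/andP/mapP.
    move=> [/eqP e hx]; exists (shift x); last by rewrite -e iter_shift.
    by rewrite mem_iota add0n -e shift_lt.
  move=> [k _ ->]; split; last exact: iter_rotw_lt.
  by rewrite minrot_iter.
Qed.

Lemma cntS_nonecklace a : ~~ necklace a -> cnt a.+1 = cnt a.
Proof.
move=> hn; rewrite cntS; have -> : count (fun x => minrot x == a) (iota 0 (s ^ m.+1)) = 0; last by rewrite addn0.
apply/eqP; rewrite -leqn0 leqNgt -has_count; apply/hasPn => x; rewrite mem_iota /= => hx.
by apply: contra hn => /eqP <-; rewrite /necklace minrot_id.
Qed.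

Lemma cnt_step a b : a < s ^ m.+1 -> necklace a -> a < b -> cnt a + per a <= cnt b.
Proof. by move=> ha hn h; rewrite -cntS_necklace //; apply: cnt_le. Qed.

Lemma cnt_eq a b : a <= b -> (forall x, a <= x < b -> ~~ necklace x) -> cnt a = cnt b.
Proof.
elim: b => [|b IH]; first by rewrite leqn0 => /eqP->.
rewrite leq_eqVlt => /orP[/eqP->//|]; rewrite ltnS => h hn.
rewrite cntS_nonecklace; last by apply: hn; rewrite h /=.
by apply: IH => // x /andP[h1 h2]; apply: hn; rewrite h1 ltnS ltnW.
Qed.

End Rotation.

End Rotation.

(** * Vertices of the de Bruijn graph and their leading maximal letters *)

Module Import Node.

Section Node.

Variables (s m : nat).
Hypothesis s_gt1 : 1 < s.

Let s_gt0 : 0 < s. Proof. exact: ltnW. Qed.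
Let z := s.-1.
Local Notation r := (rotw s m).
Local Notation M := (s ^ m.+1).
Local Notation nk := (necklace s m).

(* number of leading letters [z] of the node [y], a word of length [m] *)
Definition lead y := find (fun j => y < s ^ m - s ^ (m - j.+1)) (iota 0 m).
(** [s ^ m - s ^ (m - j)] is the word z^j 0^(m-j), so the subtraction strips the leading letters
    [z]. With j = [lead y], [low] and [fill] are the words tail c 0^j and tail c z^j; the latter is
    y c with its leading letters [z] moved to the end. *)
Definition tail y := y - (s ^ m - s ^ (m - lead y)).
Definition low y c := (tail y * s + c) * s ^ lead y.
Definition fill y c := low y c + (s ^ lead y).-1.

Lemma lead_le y : lead y <= m.
Proof. by rewrite /lead -[X in _ <= X](size_iota 0) find_size. Qed.

Lemma sp_le a b : a <= b -> s ^ a <= s ^ b.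
Proof. by move=> h; rewrite leq_pexp2l. Qed.

Lemma lead_ge y : s ^ m - s ^ (m - lead y) <= y.
Proof.
have h := lead_le y; case e : (lead y) => [|j]; first by rewrite subn0 subnn.
have hj : j < lead y by rewrite e.
have := before_find 0 hj; rewrite nth_iota; last by rewrite e in h.
by rewrite add0n => /negbT; rewrite -leqNgt.
Qed.

Lemma lead_lt y : lead y < m -> y < s ^ m - s ^ (m - (lead y).+1).
Proof.
move=> h; have h1 : has (fun j => y < s ^ m - s ^ (m - j.+1)) (iota 0 m).
  by rewrite has_find size_iota.
by have := nth_find 0 h1; rewrite nth_iota // add0n.
Qed.

Lemma node_eq y : y = s ^ m - s ^ (m - lead y) + tail y.
Proof. by rewrite /tail subnKC // lead_ge. Qed.

Lemma tail_lt y : y < s ^ m -> tail y < s ^ (m - lead y).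
Proof.
have := node_eq y; have := lead_ge y.
have : s ^ (m - lead y) <= s ^ m by apply: sp_le; lia.
lia.
Qed.

Lemma tail_lt_top y : lead y < m -> tail y < z * s ^ (m - (lead y).+1).
Proof.
move=> h; have := node_eq y; have := lead_lt h.
have e : m - lead y = (m - (lead y).+1).+1 by lia.
have : s ^ (m - lead y) <= s ^ m by apply: sp_le; lia.
rewrite e expnS.
have -> : s * s ^ (m - (lead y).+1) = z * s ^ (m - (lead y).+1) + s ^ (m - (lead y).+1).
  by rewrite -mulSnr prednK.
lia.
Qed.

Lemma lead_max y : lead y = m -> y < s ^ m -> tail y = 0.
Proof. by move=> e /tail_lt; rewrite e subnn expn0; lia. Qed.

Lemma word_eq y c : y * s + c =
  (s ^ lead y).-1 * s ^ (m.+1 - lead y) + (tail y * s + c).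
Proof.
rewrite {1}(node_eq y) mulnDl addnA; congr (_ + _ + _).
have h := lead_le y.
rewrite mulnBl -!expnSr -subn1 mulnBl mul1n -expnD.
by congr (s ^ _ - s ^ _); lia.
Qed.

Lemma rest_lt y c : y < s ^ m -> c < s -> tail y * s + c < s ^ (m.+1 - lead y).
Proof.
move=> hy hc; rewrite subSn ?lead_le // expnSr.
by apply: ltn_cat hc; exact: tail_lt.
Qed.

Lemma cat_lt y c : y < s ^ m -> c < s -> y * s + c < M.
Proof. by move=> hy hc; rewrite expnSr; apply: ltn_cat. Qed.

Lemma incat_lt y c : y < s ^ m -> c < s -> c * s ^ m + y < M.
Proof. by move=> hy hc; rewrite expnS; apply: ltn_cat. Qed.

Lemma iter_lead y c : y < s ^ m -> c < s -> iter (lead y) r (y * s + c) = fill y c.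
Proof.
move=> hy hc; rewrite word_eq iter_rotwE //.
- by have := lead_le y; lia.
- by rewrite prednK // sp_gt0.
- exact: rest_lt.
Qed.

Lemma fill_lt y c : y < s ^ m -> c < s -> fill y c < M.
Proof.
by move=> hy hc; rewrite -iter_lead //; apply: iter_rotw_lt => //; exact: cat_lt.
Qed.

Lemma fillS y c : (fill y c).+1 = low y c.+1.
Proof.
by rewrite /fill -addnS prednK ?sp_gt0 // /low addnS mulSnr.
Qed.

(** Fewer than [lead y] rotations leave a letter [z] in front, which the lower bound [z * s ^ m]
    expresses. *)
Lemma iter_lead_top y c l : y < s ^ m -> c < s -> l < lead y ->
  z * s ^ m <= iter l r (y * s + c).
Proof.
move=> hy hc hl; have hj := lead_le y.
have -> : y * s + c = (s ^ l).-1 * s ^ (m.+1 - l) +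
    ((s ^ (lead y - l)).-1 * s ^ (m.+1 - lead y) + (tail y * s + c)).
  rewrite word_eq [RHS]addnA; congr addn.
  rewrite -!subn1 !mulnBl !mul1n -!expnD.
  have -> : lead y - l + (m.+1 - lead y) = m.+1 - l by lia.
  have -> : l + (m.+1 - l) = m.+1 by lia.
  have -> : lead y + (m.+1 - lead y) = m.+1 by lia.
  have : s ^ (m.+1 - l) <= s ^ m.+1 by apply: sp_le; lia.
  have : s ^ (m.+1 - lead y) <= s ^ (m.+1 - l) by apply: sp_le; lia.
  lia.
have hz : z <= (s ^ (lead y - l)).-1 %/ s ^ (lead y - l).-1.
  rewrite leq_divRL ?sp_gt0 //.
  have -> : s ^ (lead y - l) = s * s ^ (lead y - l).-1 by rewrite -expnS prednK //; lia.
  have := sp_gt0 s_gt0 (lead y - l).-1; rewrite /z; case: (s) s_gt1 => // t _ /=; rewrite mulSn; lia.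
have hz2 : z * s ^ (lead y - l).-1 <= (s ^ (lead y - l)).-1 by rewrite -leq_divRL ?sp_gt0.
rewrite iter_rotwE //; first last.
- have -> : s ^ (m.+1 - l) = s ^ (lead y - l) * s ^ (m.+1 - lead y).
    by rewrite -expnD; congr (_ ^ _); lia.
  apply: ltn_cat; last exact: rest_lt.
  by rewrite prednK // sp_gt0.
- by rewrite prednK // sp_gt0.
- lia.
apply: leq_trans (leq_addr _ _); rewrite mulnDl.
apply: leq_trans (leq_addr _ _).
have -> : s ^ m = s ^ (lead y - l).-1 * s ^ (m.+1 - lead y) * s ^ l.
  by rewrite -!expnD; congr (_ ^ _); lia.
by rewrite !mulnA; rewrite !leq_mul2r hz2 !orbT.
Qed.

Lemma fill_lt_top y c : y < s ^ m -> c < s -> lead y < m -> fill y c < z * s ^ m.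
Proof.
move=> hy hc hj; have h := tail_lt_top hj; rewrite fillS /low.
have -> : z * s ^ m = z * s ^ (m - (lead y).+1) * s * s ^ lead y.
  by rewrite -!mulnA -!expnS -expnD; congr (_ * s ^ _); lia.
rewrite leq_mul2r; apply/orP; right.
by have := ltn_cat h hc; rewrite addnS.
Qed.

(** An increment confined to the last [t] letters does not touch the first [k], so no carry crosses
    the cut of the rotation. *)
Lemma iter_rotw_add k t x d : k + t <= m.+1 -> x + d < M ->
  (x + d) %/ s ^ t = x %/ s ^ t -> iter k r (x + d) = iter k r x + d * s ^ k.
Proof.
move=> hk hx e; have h : (x + d) %/ s ^ (m.+1 - k) = x %/ s ^ (m.+1 - k).
  have -> : s ^ (m.+1 - k) = s ^ t * s ^ (m.+1 - k - t) by rewrite -expnD; congr (_ ^ _); lia.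
  by rewrite !divnMA e.
rewrite !iter_rotw ?h //; [|lia|lia|lia].
have := divn_eq (x + d) (s ^ (m.+1 - k)); rewrite h {1}(divn_eq x (s ^ (m.+1 - k))) -addnA.
by move=> /addnI <-; rewrite mulnDl addnAC.
Qed.

(** A rotation that starts inside the final block of letters [z] begins with [z] and cannot be
    smaller; only the rotations that start before this block have to be compared. *)
Lemma fill_necklace y c : y < s ^ m -> c < s ->
  (forall k, k + lead y <= m -> fill y c <= iter k r (fill y c)) -> nk (fill y c).
Proof.
move=> hy hc h; have hX := fill_lt hy hc; have hj := lead_le y.
apply/(necklaceP s_gt0) => // k hk; case: (leqP (k + lead y) m) => hkj; first exact: h.
rewrite -{2}iter_lead // -iterD.
have -> : k + lead y = (k + lead y - m.+1) + m.+1 by lia.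
rewrite iterD iter_rotw_n //; last exact: cat_lt.
have htop := @iter_lead_top y c (k + lead y - m.+1) hy hc ltac:(lia).
move: hj; rewrite leq_eqVlt => /orP[/eqP ej|hj]; last first.
  by apply: leq_trans htop; apply/ltnW/fill_lt_top.
(* From here on [y] consists of letters [z] only; for [c = z] the word is constant and equals all
   its rotations. *)
have hv := lead_max ej hy.
case: (ltnP c z) => hcz.
  apply: leq_trans htop; apply: (@leq_trans (c.+1 * s ^ m)).
    by apply: ltnW; rewrite fillS /low hv mul0n ej.
  by rewrite leq_mul2r hcz orbT.
have ec : c = z by rewrite /z in hcz *; lia.
have ey : y = (s ^ m).-1 by rewrite (node_eq y) hv ej subnn expn0 addn0 subn1.
have eM : y * s + c = M.-1.
  rewrite ec ey expnSr /z; have := sp_gt0 s_gt0 m; case: (s ^ m) => // t _.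
  by rewrite mulSn; lia.
have hM := sp_gt0 s_gt0 m.+1.
have eX : fill y c = M.-1.
  have := fillS y c; rewrite /low hv mul0n add0n ej ec /z prednK // -expnS => <- //.
set l := k + lead y - m.+1.
have el : M.-1 = (s ^ l).-1 * s ^ (m.+1 - l) + (s ^ (m.+1 - l)).-1.
  rewrite -(subn1 (s ^ l)) mulnBl mul1n -expnD subnKC; last by rewrite /l; lia.
  have := sp_gt0 s_gt0 (m.+1 - l).
  have : s ^ (m.+1 - l) <= M by apply: sp_le; lia.
  lia.
have el' : M.-1 = (s ^ (m.+1 - l)).-1 * s ^ l + (s ^ l).-1.
  rewrite -(subn1 (s ^ (m.+1 - l))) mulnBl mul1n -expnD subnK; last by rewrite /l; lia.
  have := sp_gt0 s_gt0 l.
  have : s ^ l <= M by apply: sp_le; rewrite /l; lia.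
  lia.
rewrite eX eM {2}el iter_rotwE -?el' //; rewrite ?prednK ?sp_gt0 //.
by rewrite /l; lia.
Qed.

(** Raising the letter before the final block raises every relevant rotation at least as much as the
    word itself. Hence the letters [c] that make [fill y c] a necklace form an upper set. *)
Lemma fill_mono y c : y < s ^ m -> c.+1 < s -> nk (fill y c) -> nk (fill y c.+1).
Proof.
move=> hy hc hn; have hX := fill_lt hy (ltnW hc); have hX' := fill_lt hy hc.
have e : fill y c.+1 = fill y c + s ^ lead y.
  by rewrite /fill /low addnS mulSn; lia.
apply: fill_necklace => // k hk; rewrite {2}e (@iter_rotw_add k (lead y).+1); [|lia|lia|].
  rewrite e; apply: leq_add; last by rewrite leq_pmulr // sp_gt0.
  by move/(necklaceP s_gt0): hn => /(_ hX); apply; lia.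
have E d : fill y d = tail y * s ^ (lead y).+1 + (d * s ^ lead y + (s ^ lead y).-1).
  by rewrite expnS /fill /low mulnDl mulnA addnA.
have hp : (s ^ lead y).-1 < s ^ lead y by rewrite prednK // sp_gt0.
by rewrite -e !E !divn_cat //; rewrite expnS; apply: ltn_cat => //; apply: ltnW.
Qed.

Lemma fill_mono_le y c d : y < s ^ m -> c <= d -> d < s -> nk (fill y c) -> nk (fill y d).
Proof.
move=> hy; elim: d => [|d IH]; first by rewrite leqn0 => /eqP->.
rewrite leq_eqVlt => /orP[/eqP->//|h] hd hn.
by apply: fill_mono => //; apply: IH => //; apply: ltnW.
Qed.

(** Replacing the end of a necklace by letters [z] keeps it a necklace: the relevant rotations grow
    at least as much as the word. *)
Lemma fill_prefix y e x : y < s ^ m -> e < s -> x < M -> nk x ->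
  low y e <= x < low y e.+1 -> nk (fill y e).
Proof.
move=> hy he hx hn /andP[h1]; rewrite -fillS ltnS => h2.
have hX := fill_lt hy he.
apply: fill_necklace => // k hk.
have ef : fill y e = x + (fill y e - x) by lia.
rewrite {2}ef (@iter_rotw_add k (lead y)); [|lia|lia|].
  rewrite {1}ef; apply: leq_add; last by rewrite leq_pmulr // sp_gt0.
  by move/(necklaceP s_gt0): hn => /(_ hx); apply; lia.
rewrite -ef; have hp := sp_gt0 s_gt0 (lead y).
rewrite {1}/fill /low divn_cat; last lia.
have -> : x = (tail y * s + e) * s ^ lead y + (x - low y e) by rewrite -/(low y e); lia.
by rewrite divn_cat //; move: h2; rewrite /fill; lia.
Qed.

End Node.

End Node.

(** * The successor rule and the position of a word *)

Module Import Successor.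

Section Successor.

Variables (s m : nat).
Hypothesis s_gt1 : 1 < s.

Let s_gt0 : 0 < s. Proof. exact: ltnW. Qed.
Let z := s.-1.
Local Notation r := (rotw s m).
Local Notation M := (s ^ m.+1).
Local Notation nk := (necklace s m).
Local Notation lead := (lead s m).
Local Notation tail := (tail s m).
Local Notation low := (low s m).
Local Notation fill := (fill s m).
Local Notation cnt := (cnt s m).
Local Notation per := (per s m).
Local Notation minrot := (minrot s m).
Local Notation shift := (shift s m).

Definition first_fill y := find (fun c => nk (fill y c)) (iota 0 s).

(** A word c y passes to y c unless [fill y c] is a necklace. The letters [c] of the latter kind
    form an upper set and are permuted cyclically: [c] goes to [c.+1], and [z] goes back to the
    least of them. *)
Definition next x :=
  let y := x %% s ^ m in let c := x %/ s ^ m in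
  if nk (fill y c) then y * s + (if c == z then first_fill y else c.+1)
  else y * s + c.

(* position of the word [x] in the sequence, shifted by [m.+1]: the words
   z^j 0^(m+1-j) that wrap around get the values 1, ..., m *)
Definition rank x :=
  let y := x %/ s in let d := x %% s in
  if nk (fill y d) then cnt (low y d) + m.+1 - lead y
  else cnt (minrot x) + shift x + m.+1.

Lemma rank_cat y d : d < s -> rank (y * s + d) =
  if nk (fill y d) then cnt (low y d) + m.+1 - lead y
  else cnt (minrot (y * s + d)) + shift (y * s + d) + m.+1.
Proof. by move=> hd; rewrite /rank modn_cat // divn_cat. Qed.

Lemma next_cat c y : y < s ^ m -> next (c * s ^ m + y) =
  if nk (fill y c) then y * s + (if c == z then first_fill y else c.+1)
  else y * s + c.
Proof. by move=> hy; rewrite /next modn_cat // divn_cat. Qed.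

Lemma full_necklace y c : y < s ^ m -> c < s -> lead y = m -> nk (fill y c).
Proof.
by move=> hy hc e; apply: fill_necklace => // k; rewrite e -{2}[m]add0n leq_add2r leqn0 => /eqP->.
Qed.

Lemma lead_uniq y j : j <= m -> s ^ m - s ^ (m - j) <= y ->
  (j < m -> y < s ^ m - s ^ (m - j.+1)) -> lead y = j.
Proof.
move=> hj h1 h2; have h3 := lead_ge s m y; have h4 := lead_le s m y.
case: (ltngtP (lead y) j) => // h.
  have := lead_lt (leq_trans h hj).
  have : s ^ (m - j) <= s ^ (m - (lead y).+1) by apply: sp_le => //; lia.
  lia.
have := h2 (leq_trans h h4).
have : s ^ (m - lead y) <= s ^ (m - j.+1) by apply: sp_le => //; lia.
lia.
Qed.

Lemma full_eq y : y < s ^ m -> lead y = m -> y = (s ^ m).-1.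
Proof.
by move=> hy e; rewrite (node_eq s m y) (lead_max s_gt1 e hy) e subnn expn0 addn0 subn1.
Qed.

Lemma Mpred : (s ^ m).-1 * s + z = M.-1.
Proof.
rewrite expnSr /z; have := sp_gt0 s_gt0 m; case: (s ^ m) => // t _.
by rewrite mulSn; lia.
Qed.

Lemma Mpred' : z * s ^ m + (s ^ m).-1 = M.-1.
Proof.
rewrite expnS /z; have := sp_gt0 s_gt0 m; case: (s) s_gt1 => // t _ /=.
by rewrite mulSn; lia.
Qed.

Lemma lead0 x : x < M -> x < z * s ^ m ->
  [/\ lead (x %/ s) = 0, low (x %/ s) (x %% s) = x & fill (x %/ s) (x %% s) = x].
Proof.
move=> hx hz.
have hy : x %/ s < s ^ m by rewrite ltn_divLR // -expnSr.
have hd : x %% s < s by rewrite ltn_mod.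
have e0 : lead (x %/ s) = 0.
  case e : (lead _) => [//|j]; have := @iter_lead_top s m s_gt1 (x %/ s) (x %% s) 0 hy hd.
  by rewrite e => /(_ isT) /=; rewrite -divn_eq leqNgt hz.
split=> //.
  have := node_eq s m (x %/ s); rewrite /low e0 subn0 subnn add0n => <-.
  by rewrite muln1 -divn_eq.
by rewrite -iter_lead // e0 /= -divn_eq.
Qed.

Lemma rank_low x : x < M -> x < z * s ^ m ->
  rank x = cnt (minrot x) + shift x + m.+1.
Proof.
move=> hx hz; have [e0 e1 e2] := lead0 hx hz.
rewrite /rank e0 e1 e2; case: ifP => // hn.
by rewrite shift_necklace // (eqP hn) addn0 subn0.
Qed.

Lemma lead_z y : y < s ^ m -> lead y < m ->
  let x := z * s ^ m + y in lead (x %/ s) = (lead y).+1.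
Proof.
move=> hy hl x; have h1 := lead_ge s m y; have h2 := lead_lt hl.
have eM : z * s ^ m + s ^ m = M by rewrite expnS -mulSnr prednK.
apply: lead_uniq => //.
  rewrite leq_divRL // mulnBl -!expnSr.
  have -> : (m - (lead y).+1).+1 = m - lead y by lia.
  have : s ^ (m - lead y) <= s ^ m by apply: sp_le => //; lia.
  by rewrite /x; lia.
move=> hl2; rewrite ltn_divLR // mulnBl -!expnSr.
have -> : (m - (lead y).+2).+1 = m - (lead y).+1 by lia.
have : s ^ (m - (lead y).+1) <= s ^ m by apply: sp_le => //; lia.
by rewrite /x; lia.
Qed.

(** A further [z] in front lengthens the block moved to the end by one letter, so the threshold
    becomes the word tail 0 0^j. *)
Lemma rank_z y : y < s ^ m -> lead y < m ->
  let x := z * s ^ m + y in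
  rank x = if nk (fill y z) then cnt (tail y * s ^ (lead y).+1) + m - lead y
           else cnt (minrot x) + shift x + m.+1.
Proof.
move=> hy hl x; have hz : z < s by rewrite /z prednK.
have hx : x < M by apply: incat_lt.
have e1 : lead (x %/ s) = (lead y).+1 by exact: lead_z.
have hy2 : x %/ s < s ^ m by rewrite ltn_divLR // -expnSr.
have hd : x %% s < s by rewrite ltn_mod.
have e2 : fill (x %/ s) (x %% s) = fill y z.
  by rewrite -iter_lead // e1 iterSr -divn_eq rotw_cat // iter_lead.
have e3 : low (x %/ s) (x %% s) = tail y * s ^ (lead y).+1.
  have ez : z.+1 = s by rewrite /z prednK.
  have := fillS m s_gt1 (x %/ s) (x %% s); rewrite e2 fillS // /Node.low ez e1 addnS -mulSnr.
  by rewrite -mulnA -expnS mulSnr mulSnr => /addIn.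
by rewrite /rank e2 e3 e1; case: ifP => // _; rewrite addnS subSS.
Qed.

Lemma first_fill_lt y c : c < s -> nk (fill y c) -> first_fill y < s /\ nk (fill y (first_fill y)).
Proof.
move=> hc hn; have h : has (fun c => nk (fill y c)) (iota 0 s).
  by apply/hasP; exists c; rewrite ?mem_iota.
have h2 : first_fill y < s by move: (h); rewrite has_find size_iota.
by split=> //; have := nth_find 0 h; rewrite nth_iota.
Qed.

Lemma next_lt x : x < M -> next x < M.
Proof.
move=> hx; have hy : x %% s ^ m < s ^ m by rewrite ltn_mod sp_gt0.
have hc := divw_lt s_gt0 hx; rewrite /next; case: ifP => h; last exact: cat_lt.
apply: cat_lt => //; case: eqP => e; first by have [] := first_fill_lt hc h.
by rewrite /z in e; lia.
Qed.

Lemma next_div x : x < M -> next x %/ s = x %% s ^ m.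
Proof.
move=> hx; have hc := divw_lt s_gt0 hx; rewrite /next.
case: ifP => h; rewrite divn_cat //; case: eqP => e; last by rewrite /z in e; lia.
by have [] := first_fill_lt hc h.
Qed.

Lemma iter_comm_per N k : N < M -> iter (per N) r (iter k r N) = iter k r N.
Proof. by move=> hN; rewrite -iterD addnC iterD iter_per. Qed.

(** [(lead y).+1] rotations bring c y to its necklace. They do not complete a period, since
    otherwise c y, which starts with c < z, would be met among the rotations of y c that start with
    [z]. So the offset of c y is the period minus their number. *)
Lemma shift_fill y c : y < s ^ m -> c < z -> nk (fill y c) ->
  shift (c * s ^ m + y) + (lead y).+1 = per (fill y c).
Proof.
move=> hy hc hn; set x := c * s ^ m + y; set N := fill y c; set j := lead y.
have hcs : c < s by rewrite /z in hc; lia.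
have hx : x < M by apply: incat_lt.
have hN : N < M by apply: fill_lt.
have eN : iter j.+1 r x = N by rewrite iterSr rotw_cat // iter_lead.
have emin : minrot x = N by rewrite -(minrot_iter s_gt0 j.+1) // eN; apply/eqP.
have hsh := shift_lt s_gt0 hx; rewrite emin in hsh.
have esh := iter_shift s_gt0 hx; rewrite emin in esh.
have hjp : j < per N.
  rewrite ltnNge; apply/negP => hp.
  have e : iter (per N) r x = x by rewrite -esh iter_comm_per.
  have hp0 : 0 < per N by [].
  have : iter (per N).-1 r (y * s + c) = x by rewrite -(rotw_cat c hy) -iterSr prednK.
  move=> e2; have := @iter_lead_top s m s_gt1 y c (per N).-1 hy hcs.
  rewrite e2 -/j -/z => /(_ ltac:(lia)).
  by apply/negP; rewrite -ltnNge; apply: ltn_cat.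
have hd : per N %| shift x + j.+1.
  by apply: per_dvd => //; rewrite addnC iterD esh eN.
case/dvdnP: hd => q e; rewrite e.
have : 0 < q by case: q e => //; lia.
rewrite leq_eqVlt => /orP[/eqP<-|hq]; first by rewrite mul1n.
have : 2 * per N <= q * per N by rewrite leq_mul2r hq orbT.
by rewrite -e; lia.
Qed.

(** Three cases. A pure rotation increases the offset inside one class. An increase of [c] adds the
    period of the necklace [fill y c] to [cnt], and [shift_fill] balances this against the offset.
    In the step from [z] to [first_fill] both thresholds have the same [cnt], and the loss of one
    leading [z] accounts for the increment. *)
Lemma rank_next x : x < M -> x != M.-1 -> rank (next x) = (rank x).+1.
Proof.
move=> hx hne; have hy : x %% s ^ m < s ^ m by rewrite ltn_mod sp_gt0.
have hc := divw_lt s_gt0 hx; move: hne hx; rewrite (divn_eq x (s ^ m)).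
move: (x %/ s ^ m) (x %% s ^ m) hy hc => c y hy hc hne hx.
have hz : z < s by rewrite /z prednK.
have hl := lead_le s m y.
have hyc := cat_lt hy hc.
rewrite next_cat //; case: ifP => hn; last first.
  have hlm : lead y < m.
    by rewrite ltn_neqAle hl andbT; apply/eqP => e; rewrite full_necklace in hn.
  rewrite rank_cat // hn -(rotw_cat c hy).
  have -> : rank (c * s ^ m + y) = cnt (minrot (c * s ^ m + y)) + shift (c * s ^ m + y) + m.+1.
    case: (ltnP c z) => hcz; first by rewrite rank_low //; apply: ltn_cat.
    have ec : c = z by rewrite /z in hcz *; lia.
    by rewrite ec in hn *; rewrite rank_z // hn.
  rewrite minrot_rotw // shift_rotw ?addnS ?addSn //.
  rewrite rotw_cat //; apply/negP => hn2.
  case e : (lead y) => [|j].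
    by move: hn; rewrite -iter_lead // e /= hn2.
  have h1 := @iter_lead_top s m s_gt1 y c 0 hy hc ltac:(lia).
  have h2 := fill_lt_top s_gt1 hy hc hlm.
  have := minrot_le s_gt0 (lead y) hyc; rewrite iter_lead // (eqP hn2).
  by rewrite /= -/z in h1 h2; lia.
case: eqP => [ec|/eqP ec].
  have [hf hnf] := first_fill_lt hc hn.
  have hlm : lead y < m.
    rewrite ltn_neqAle hl andbT; apply/eqP => e; move/eqP: hne; apply.
    by rewrite ec (full_eq hy e) Mpred'.
  rewrite rank_cat // hnf ec rank_z // -ec hn.
  (* A necklace between the two thresholds would start with the tail followed by a letter e below
     [first_fill y], and by [fill_prefix] this e would have been found first. *)
  have -> : cnt (low y (first_fill y)) = cnt (tail y * s ^ (lead y).+1).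
    apply/esym/(cnt_eq s_gt0).
      by rewrite /Node.low expnS mulnA leq_mul2r leq_addr orbT.
    move=> w /andP[h1 h2]; apply/negP => hw.
    have hp := sp_gt0 s_gt0 (lead y).
    set e := w %/ s ^ lead y - tail y * s.
    have he : tail y * s <= w %/ s ^ lead y by rewrite leq_divRL // -mulnA -expnS.
    have hwl : low y e <= w < low y e.+1.
      by rewrite /low addnS subnKC // leq_trunc_div /= ltn_ceil.
    have hef : e < first_fill y.
      rewrite ltnNge; apply/negP => hle; move: h2; rewrite ltnNge; case/negP.
      case/andP: hwl => hwl _; apply: leq_trans hwl.
      by rewrite /low leq_mul2r leq_add2l hle orbT.
    have := before_find 0 hef; rewrite nth_iota; last exact: ltn_trans hf.
    rewrite add0n => /negP; apply; apply: (fill_prefix s_gt1 _ _ _ hw) => //.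
      exact: ltn_trans hf.
    by apply: ltn_trans h2 _; apply: leq_trans (fill_lt s_gt1 hy hf); rewrite ltnS leq_addr.
  by lia.
have hcz : c < z by rewrite /z in ec *; lia.
have hc1 : c.+1 < s by rewrite /z in hcz; lia.
have hN := fill_lt s_gt1 hy hc.
rewrite rank_cat // (fill_mono s_gt1 hy hc1 hn) rank_low //; last exact: ltn_cat.
have emin : minrot (c * s ^ m + y) = fill y c.
  by rewrite -(minrot_rotw s_gt0) // rotw_cat // -(minrot_iter s_gt0 (lead y)) // iter_lead //; apply/eqP.
rewrite emin -fillS // cntS_necklace // -(shift_fill hy hcz hn); lia.
Qed.

(** For a word starting with [z], rotation multiplies the distance to the largest word by [s]; the
    word can be at most its rotation only if this distance is 0. *)
Lemma necklace_top x : x < M -> nk x -> z * s ^ m <= x -> x = M.-1.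
Proof.
move=> hx hn hz; have hM := Mpred'.
have h0 := sp_gt0 s_gt0 m; have hM0 := sp_gt0 s_gt0 m.+1.
have := minrot_le s_gt0 1 hx; rewrite (eqP hn) /=.
have hy : x - z * s ^ m < s ^ m by lia.
rewrite -{2}(subnKC hz) rotw_cat // => h3.
set d := M.-1 - x; have ed : x - z * s ^ m + d = (s ^ m).-1 by rewrite /d; lia.
have e1 : (x - z * s ^ m) * s + d * s + z = M.-1 by rewrite -mulnDl ed Mpred.
have : d * 2 <= d * s by rewrite leq_mul2l s_gt1 orbT.
by rewrite /d in e1 *; lia.
Qed.

Lemma rotw_max : r M.-1 = M.-1.
Proof. by rewrite -{1}Mpred' rotw_cat ?Mpred // prednK // sp_gt0. Qed.

Lemma cnt_top : cnt (z * s ^ m) = M.-1.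
Proof.
have hM := Mpred'; have h0 := sp_gt0 s_gt0 m; have hM0 := sp_gt0 s_gt0 m.+1.
have -> : cnt (z * s ^ m) = cnt M.-1.
  apply: (cnt_eq s_gt0); first by lia.
  move=> x /andP[h1 h2]; apply/negP => hn; have := necklace_top _ hn h1; lia.
have hlt : M.-1 < M by rewrite prednK.
have hi k : iter k r M.-1 = M.-1 by elim: k => //= k ->; exact: rotw_max.
have hn : nk M.-1 by apply/(necklaceP s_gt0) => // k _; rewrite hi.
have := cntS_necklace s_gt0 hlt hn; rewrite prednK // cnt_max //.
have -> : per M.-1 = 1; last by lia.
apply/eqP; rewrite -dvdn1; apply: per_dvd => //; exact: rotw_max.
Qed.

(** The word z^j 0^(m-j). Followed by one more 0, and for 0 < j, these are the words whose
    occurrence wraps around the end of the sequence. *)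
Definition ones j := (s ^ j).-1 * s ^ (m - j).

Lemma ones_lt j : j <= m -> ones j < s ^ m.
Proof.
move=> hj; rewrite /ones -[in X in _ < X](subnKC hj) expnD ltn_mul2r !sp_gt0 //=.
by rewrite prednK ?sp_gt0.
Qed.

Lemma ones_eq j : j <= m -> ones j = s ^ m - s ^ (m - j).
Proof. by move=> hj; rewrite /ones -subn1 mulnBl mul1n -expnD subnKC. Qed.

Lemma lead_ones j : j <= m -> lead (ones j) = j.
Proof.
move=> hj; apply: lead_uniq => //; first by rewrite ones_eq.
move=> hlt; rewrite ones_eq //; have : s ^ (m - j.+1) < s ^ (m - j) by rewrite ltn_exp2l //; lia.
have : s ^ (m - j) <= s ^ m by apply: sp_le => //; lia.
lia.
Qed.

Lemma tail_ones j : j <= m -> tail (ones j) = 0.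
Proof. by move=> hj; rewrite /Node.tail lead_ones // ones_eq // subnn. Qed.

Lemma fill_ones j d : j <= m -> fill (ones j) d = d * s ^ j + (s ^ j).-1.
Proof. by move=> hj; rewrite /Node.fill /Node.low tail_ones // lead_ones // mul0n. Qed.

Lemma necklace_ones j d : j <= m -> d < s -> nk (fill (ones j) d).
Proof.
move=> hj hd; apply: (@fill_mono_le _ _ s_gt1 _ 0) => //; first exact: ones_lt.
apply: fill_necklace => //; first exact: ones_lt.
move=> k; rewrite lead_ones // => hk; rewrite fill_ones // mul0n add0n.
have e : iter k r (0 * s ^ (m.+1 - k) + (s ^ j).-1) = (s ^ j).-1 * s ^ k + 0.
  apply: iter_rotwE => //; rewrite ?sp_gt0 //; first lia.
  have : s ^ j <= s ^ (m.+1 - k) by apply: sp_le => //; lia.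
  by have := sp_gt0 s_gt0 j; lia.
by rewrite mul0n add0n addn0 in e; rewrite e leq_pmulr // sp_gt0.
Qed.

Lemma rank_ones j d : j <= m -> d < s ->
  rank (ones j * s + d) = cnt (d * s ^ j) + m.+1 - j.
Proof.
move=> hj hd; rewrite rank_cat // necklace_ones // lead_ones //.
by rewrite /Node.low tail_ones // lead_ones // mul0n.
Qed.

Lemma rank_zeros j : j <= m -> rank (ones j * s) = m.+1 - j.
Proof. by move=> hj; rewrite -[_ * s]addn0 rank_ones // mul0n cnt0. Qed.

(** The necklace [fill (ones i) e] lies between the two thresholds, so its period is gained. The
    period exceeds j - i: the necklace starts with m - i zeros, and rotating over zeros only
    multiplies it by a power of [s]. *)
Lemma rank_ones_lt i j d e : i < j -> j <= m -> 0 < d < s -> 0 < e < s ->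
  rank (ones i * s + e) < rank (ones j * s + d).
Proof.
move=> hij hj /andP[hd0 hd] /andP[he0 he].
have hi : i <= m by lia.
rewrite !rank_ones //; set N := fill (ones i) e.
have eN : N = e * s ^ i + (s ^ i).-1 by rewrite /N fill_ones.
have hN : N < M by apply: fill_lt => //; apply: ones_lt.
have hsi := sp_gt0 s_gt0 i.
have hNs : N < s ^ i.+1 by rewrite eN expnS; apply: ltn_cat => //; rewrite prednK.
have h1 : cnt (e * s ^ i) <= cnt N by apply: cnt_le; rewrite eN leq_addr.
have h2 : cnt N + per N <= cnt (d * s ^ j).
  apply: cnt_step => //; first exact: necklace_ones.
  apply: leq_trans hNs _; apply: (@leq_trans (s ^ j)); first exact: sp_le.
  by rewrite leq_pmull.
have h3 : j - i < per N.
  rewrite ltnNge; apply/negP => hp.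
  have e1 : iter (per N) r (0 * s ^ (m.+1 - per N) + N) = N * s ^ per N + 0.
    apply: iter_rotwE; rewrite ?sp_gt0 //; first lia.
    by apply: leq_trans hNs _; apply: sp_le => //; lia.
  rewrite mul0n add0n addn0 iter_per // in e1.
  have hN0 : 0 < N by rewrite eN; lia.
  have hpp : 0 < per N by [].
  have hh : 1 < s ^ per N by rewrite -(expn0 s) ltn_exp2l.
  have : N * 2 <= N * s ^ per N by rewrite leq_mul2l hh orbT.
  by rewrite -e1; lia.
by lia.
Qed.

Definition start := ones m * s.

Lemma start_lt : start < M.
Proof. by rewrite -[start]addn0; apply: cat_lt => //; apply: ones_lt. Qed.

Lemma onesm : ones m = (s ^ m).-1.
Proof. by rewrite /ones subnn muln1. Qed.

Lemma rank_max : rank M.-1 = M.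
Proof.
have hz : z < s by rewrite /z prednK.
rewrite -Mpred -onesm rank_ones // cnt_top.
by have := sp_gt0 s_gt0 m.+1; lia.
Qed.

Lemma next_max : next M.-1 = start.
Proof.
have hz : z < s by rewrite /z prednK.
have h0 : (s ^ m).-1 < s ^ m by rewrite prednK // sp_gt0.
rewrite -Mpred' next_cat // -onesm necklace_ones // eqxx.
suff -> : first_fill (ones m) = 0 by rewrite addn0.
rewrite /first_fill; move: (@necklace_ones m 0 (leqnn m) s_gt0).
by case: (s) s_gt1 => // t _ /= ->.
Qed.

Lemma rank_iter i : i < M -> iter i next start < M /\ rank (iter i next start) = i.+1.
Proof.
elim: i => [|i IH] hi; first by split; [exact: start_lt | rewrite /= rank_zeros // subSn // subnn].
have [h1 h2] := IH (ltnW hi); split; first exact: next_lt.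
rewrite iterS rank_next ?h2 //; apply/eqP => e.
by move: h2; rewrite e rank_max; lia.
Qed.

(** The words of the orbit have the distinct ranks 1, ..., s^(m+1); being that many, they exhaust
    all words, and [rank] inverts the iteration. *)
Lemma rankK x : x < M -> [/\ 0 < rank x, rank x <= M & iter (rank x).-1 next start = x].
Proof.
move=> hx; pose l := [seq iter i next start | i <- iota 0 M].
have u : uniq l.
  rewrite map_inj_in_uniq ?iota_uniq // => i j; rewrite !mem_iota !add0n.
  move=> hi hj e; have [_ e1] := rank_iter hi; have [_ e2] := rank_iter hj.
  by move: e1; rewrite e e2 => -[].
have sub : {subset l <= iota 0 M}.
  move=> w /mapP[i]; rewrite !mem_iota !add0n /= => hi ->.
  by have [] := rank_iter hi.
have hs : size (iota 0 M) <= size l by rewrite size_map.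
have [_ h] := uniq_min_size u sub hs.
have : x \in l by rewrite h mem_iota.
case/mapP => i; rewrite mem_iota add0n /= => hi ->; have [_ ->] := rank_iter hi.
by split.
Qed.

Lemma rank_inj x y : x < M -> y < M -> rank x = rank y -> x = y.
Proof. by move=> /rankK[_ _ {2}<-] /rankK[_ _ {2}<-] ->. Qed.

Lemma iter_next_M : iter M next start = start.
Proof.
have hM0 := sp_gt0 s_gt0 m.+1.
have hlt : M.-1 < M by rewrite prednK.
by have [_ _] := rankK hlt; rewrite rank_max -{3}(prednK hM0) iterS => ->; rewrite next_max.
Qed.

Lemma iter_next_lt i : iter i next start < M.
Proof. by elim: i => [|i IH] /=; [exact: start_lt | exact: next_lt]. Qed.

Lemma rank_small x : x < M -> rank x <= m -> x = ones (m.+1 - rank x) * s.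
Proof.
move=> hx hr; have [h0 _ _] := rankK hx.
have hj : m.+1 - rank x <= m by lia.
apply: rank_inj => //; first by rewrite -[_ * s]addn0; apply: cat_lt => //; exact: ones_lt.
by rewrite rank_zeros //; lia.
Qed.

(** After each context [y] the sequence uses the letters in increasing order; this is the greedy
    property behind minimality. *)
Lemma rank_mono y c d : y < s ^ m -> c < d -> d < s -> rank (y * s + c) < rank (y * s + d).
Proof.
move=> hy hcd hd; have hc : c < s by apply: ltn_trans hd.
have hl := lead_le s m y.
have hxc := cat_lt hy hc; have hxd := cat_lt hy hd.
have hXc := fill_lt s_gt1 hy hc.
have hlow : fill y c < low y d.
  by rewrite fillS // /Node.low leq_mul2r leq_add2l hcd orbT.
rewrite !rank_cat //; case: ifP => hnc; case: ifP => hnd.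
- have := cnt_step s_gt0 hXc hnc hlow.
  have : cnt (low y c) <= cnt (fill y c) by apply: cnt_le; rewrite /Node.fill leq_addr.
  by rewrite /Rotation.per; lia.
- by rewrite (fill_mono_le s_gt1 hy (ltnW hcd) hd hnc) in hnd.
- set x := y * s + c in hxc *; set mu := minrot x.
  have hmu : mu < M by apply: minrot_lt.
  have nmu : nk mu by rewrite /necklace minrot_id.
  have mul : mu <= fill y c by rewrite -iter_lead //; apply: minrot_le.
  have := cnt_step s_gt0 hmu nmu (leq_ltn_trans mul hlow).
  (* Otherwise at most [lead y] rotations lead from [x] to its necklace. If exactly [lead y], then
     [fill y c] is that necklace, which this case excludes; if fewer, the necklace starts with [z]
     and exceeds [fill y c]. *)
  suff : shift x + lead y < per mu by lia.
  have hsh := shift_lt s_gt0 hxc; have esh := iter_shift s_gt0 hxc.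
  rewrite -/mu in hsh esh.
  rewrite ltnNge; apply/negP => hp.
  have hlm : lead y < m.
    by rewrite ltn_neqAle hl andbT; apply/eqP => e; rewrite full_necklace in hnc.
  have e : iter (per mu - shift x) r x = mu.
    by rewrite -{2}esh -iterD subnK ?iter_per // ltnW.
  have : per mu - shift x <= lead y by lia.
  rewrite leq_eqVlt => /orP[/eqP e1|h1].
    by move: e hnc; rewrite e1 iter_lead // => ->; rewrite nmu.
  have := iter_lead_top s_gt1 hy hc h1; rewrite -/x e.
  by have := fill_lt_top s_gt1 hy hc hlm; lia.
- have [k hk ek] := minrot_ex s m (y * s + d).
  have hlt : minrot (y * s + c) < minrot (y * s + d).
    rewrite ek; apply: leq_ltn_trans (minrot_le s_gt0 k hxc) _.
    have e : y * s + c + (d - c) = y * s + d by lia.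
    have := @iter_rotw_add s m s_gt1 k 1 (y * s + c) (d - c); rewrite e expn1 !divn_cat //.
    rewrite addn1 => /(_ hk hxd erefl) ->.
    have : 0 < (d - c) * s ^ k by rewrite muln_gt0 sp_gt0 // subn_gt0 hcd.
    by rewrite -(ltn_add2l (iter k r (y * s + c))) addn0.
  have hmu := minrot_lt s_gt0 hxc.
  have nmu : nk (minrot (y * s + c)) by rewrite /necklace minrot_id.
  have := cnt_step s_gt0 hmu nmu hlt; have := shift_lt s_gt0 hxc; lia.
Qed.

End Successor.

End Successor.

(** * The lexicographically minimal de Bruijn sequence *)

Fixpoint wval (s : nat) (l : seq nat) : nat :=
  if l is d :: l' then d * s ^ size l' + wval s l' else 0.

Lemma wval_lt s l : all (fun d => d < s) l -> wval s l < s ^ size l.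
Proof.
elim: l => [|d l IH] //= /andP[hd hl]; rewrite expnS.
by apply: ltn_cat => //; apply: IH.
Qed.

Lemma wval_inj s l l' : all (fun d => d < s) l -> all (fun d => d < s) l' ->
  size l = size l' -> wval s l = wval s l' -> l = l'.
Proof.
elim: l l' => [|d l IH] [|d' l'] //= /andP[hd hl] /andP[hd' hl'] [e].
have h := wval_lt hl; have h' := wval_lt hl'; rewrite e in h *.
move=> ev; have e1 : d = d' by rewrite -(divn_cat d h) ev divn_cat.
by congr (_ :: _) => //; apply: IH => //; move: ev; rewrite e1 => /addnI.
Qed.

Lemma wval_rcons s l d : wval s (rcons l d) = wval s l * s + d.
Proof.
elim: l => [|e l IH] /=; first by rewrite muln1 addn0.
by rewrite IH size_rcons expnSr mulnA mulnDl addnA.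
Qed.

Lemma wval_nseq0 s k : wval s (nseq k 0) = 0.
Proof. by elim: k => //= k ->; rewrite mul0n. Qed.

Definition cyc (u : seq nat) i := nth 0 u (i %% size u).
Definition window (D : nat -> nat) p k := [seq D i | i <- iota p k].

Lemma window_cat D p a b : window D p (a + b) = window D p a ++ window D (p + a) b.
Proof. by rewrite /window iotaD map_cat. Qed.

Lemma windowS D p a : window D p a.+1 = D p :: window D p.+1 a.
Proof. by []. Qed.

Lemma windowSr D p a : window D p a.+1 = rcons (window D p a) (D (p + a)).
Proof. by rewrite -addn1 window_cat /= cats1. Qed.

Lemma size_window D p a : size (window D p a) = a.
Proof. by rewrite size_map size_iota. Qed.

Lemma eq_window D D' p k : (forall i, p <= i < p + k -> D i = D' i) ->
  window D p k = window D' p k.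
Proof. by move=> h; apply/eq_in_map => i; rewrite mem_iota => /h. Qed.

Lemma all_window (P : pred nat) D p k : (forall i, P (D i)) -> all P (window D p k).
Proof. by move=> h; rewrite all_map; apply/allP => i _ /=. Qed.

Lemma wval_windowS s D m p : (forall i, D i < s) ->
  wval s (window D p.+1 m.+1) =
  (wval s (window D p m.+1) %% s ^ m) * s + D (p + m.+1).
Proof.
move=> hD; rewrite windowSr wval_rcons addSnnS; congr (_ * s + _).
rewrite windowS /= size_window modnMDl modn_small //.
by have := @wval_lt s (window D p.+1 m); rewrite size_window; apply; apply: all_window.
Qed.

Lemma window_nth D p k i : i < k -> nth 0 (window D p k) i = D (p + i).
Proof. by move=> h; rewrite (nth_map 0) ?size_iota // nth_iota. Qed.

(** Sliding window in abstract form: if [F] drops the first letter and appends some letter, prefixes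
    of an iterate are spelled by the leading letters of the iterates that follow. It serves both
    [next] and [rotw]. *)
Lemma shift_prefix s m F x k i : 0 < s ->
  (forall i, iter i F x < s ^ m.+1) ->
  (forall i, iter i.+1 F x %/ s = iter i F x %% s ^ m) -> k <= m.+1 ->
  iter i F x %/ s ^ (m.+1 - k) = wval s (window (fun i => iter i F x %/ s ^ m) i k).
Proof.
move=> hs hlt hF; elim: k i => [|k IH] i hk; first by rewrite subn0 divn_small.
rewrite windowS /= size_window -IH; last lia.
rewrite (_ : m.+1 - k = (m - k).+1); last lia.
rewrite (_ : m.+1 - k.+1 = m - k); last lia.
rewrite expnS divnMA hF {1}(divn_eq (iter i F x) (s ^ m)).
have -> : s ^ m = s ^ k * s ^ (m - k) by rewrite -expnD subnKC.
by rewrite mulnA divnMDl ?sp_gt0.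
Qed.

Lemma size_letters s (w : seq 'I_s) : size (letters w) = size w.
Proof. exact: size_map. Qed.

Lemma all_letters s (w : seq 'I_s) : all (fun d => d < s) (letters w).
Proof. by rewrite all_map; apply/allP => i _ /=. Qed.

Lemma onth_letters s (w : seq 'I_s) i : onth (letters w) i = omap (@nat_of_ord s) (onth w i).
Proof. by elim: w i => [|a w IH] [|i] //=; apply: IH. Qed.

Lemma onth_in (T : Type) (x0 : T) (w : seq T) i : i < size w -> onth w i = Some (nth x0 w i).
Proof. by elim: w i => [|a w IH] [|i] //= h; apply: IH. Qed.

Lemma occurs_atE s (u w : seq 'I_s) p : 0 < size u ->
  occurs_at u w p = (window (cyc (letters u)) p (size w) == letters w).
Proof.
move=> hu; have inj : injective (omap (@nat_of_ord s)).
  by move=> [a|] [b|] //= [/val_inj->].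
have hk k : onth (letters u) (k %% size u) = Some (cyc (letters u) k).
  by rewrite (onth_in 0) /cyc size_letters // ltn_mod.
apply/allP/eqP => h.
  apply: (@eq_from_nth _ 0); rewrite size_window ?size_letters // => j hj.
  rewrite window_nth //.
  have /h /eqP : j \in iota 0 (size w) by rewrite mem_iota.
  move=> /(congr1 (omap (@nat_of_ord s))); rewrite -!onth_letters hk.
  by rewrite (onth_in 0) ?size_letters // => -[].
move=> j; rewrite mem_iota add0n /= => hj; apply/eqP/inj.
by rewrite -!onth_letters hk (onth_in 0) ?size_letters // -h window_nth.
Qed.

Lemma not_lexle s (a b : seq 'I_s) : size a = size b -> ~~ lexle a b ->
  exists i, [/\ i < size a, forall k, k < i -> nth 0 (letters b) k = nth 0 (letters a) k
    & nth 0 (letters b) i < nth 0 (letters a) i].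
Proof.
rewrite /lexle; elim: a b => [|x a IH] [|y b] // [e].
rewrite Order.SeqLexiOrder.lexi_cons; case: (ltngtP x y) => hxy.
- by rewrite !leEord (ltnW hxy) /= leqNgt hxy.
- by move=> _; exists 0.
- rewrite !leEord -hxy leqnn /= => /(IH _ e)[i [h1 h2 h3]].
  by exists i.+1; split=> // -[|k] //= hk; apply: h2.
Qed.

Lemma cyc_lt s (u : seq 'I_s) i : 0 < size u -> cyc (letters u) i < s.
Proof.
move=> hu; rewrite /cyc; apply: (allP (all_letters u)); apply: mem_nth.
by rewrite size_letters ltn_mod.
Qed.

Lemma count1_inj (P : pred nat) N p q : count P (iota 0 N) == 1 ->
  p < N -> q < N -> P p -> P q -> p = q.
Proof.
rewrite -size_filter => hs hp hq Pp Pq.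
have : p \in filter P (iota 0 N) by rewrite mem_filter Pp mem_iota.
have : q \in filter P (iota 0 N) by rewrite mem_filter Pq mem_iota.
by case: (filter _ _) hs => [|a [|b l]] // _; rewrite !inE => /eqP-> /eqP->.
Qed.

Lemma count1_intro (P : pred nat) N p : p < N -> P p ->
  (forall q, q < N -> P q -> q = p) -> count P (iota 0 N) == 1.
Proof.
move=> hp Pp h; rewrite -size_filter -[1]/(size [:: p]).
apply/eqP/perm_size/uniq_perm => //; first by rewrite filter_uniq ?iota_uniq.
move=> q; rewrite mem_filter mem_iota add0n inE /=; apply/andP/eqP.
  by move=> [Pq hq]; apply: h.
by move=> ->.
Qed.

Section Sequence.

Variables (s m : nat).
Hypothesis s_gt1 : 1 < s.

Let s_gt0 : 0 < s. Proof. exact: ltnW. Qed.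
Local Notation M := (s ^ m.+1).
Local Notation next := (next s m).
Local Notation start := (start s m).
Local Notation rank := (rank s m).
Local Notation ones := (ones s m).

(** The offset [m] skips the words that wrap around the end, so that the window at position 0 is the
    zero word. *)
Definition letter i := iter (i + m) next start %/ s ^ m.

Lemma letter_lt i : letter i < s.
Proof. by apply: divw_lt => //; apply: iter_next_lt. Qed.

Lemma iter_nextMD i : iter (i + M) next start = iter i next start.
Proof. by rewrite iterD iter_next_M. Qed.

Lemma iter_next_mod i : iter (i %% M + m) next start = iter (i + m) next start.
Proof.
rewrite {2}(divn_eq i M) -addnA [in RHS]addnC.
elim: (i %/ M) => [|q IH]; first by rewrite mul0n addn0.
by rewrite mulSn [M + _]addnC addnA iter_nextMD.
Qed.

Lemma letter_mod i : letter (i %% M) = letter i.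
Proof. by rewrite /letter iter_next_mod. Qed.

Lemma iter_prefix k i : k <= m.+1 ->
  iter (i + m) next start %/ s ^ (m.+1 - k) = wval s (window letter i k).
Proof.
move=> hk; rewrite iterD (@shift_prefix s m next (iter m next start) k i s_gt0) //.
- by congr wval; apply: eq_window => j _; rewrite /letter iterD.
- by move=> j; rewrite -iterD; apply: iter_next_lt.
- by move=> j; rewrite -iterD iterS next_div // -?iterD //; apply: iter_next_lt.
Qed.

Lemma window_iter i : wval s (window letter i m.+1) = iter (i + m) next start.
Proof. by rewrite -iter_prefix // subnn divn1. Qed.

Definition fkm : M.-tuple 'I_s := [tuple Ordinal (letter_lt i) | i < M].

Lemma M_gt0 : 0 < M. Proof. exact: sp_gt0. Qed.

Lemma M_gtm : m < M.
Proof. by apply: (@ltn_trans m.+1) => //; apply: ltn_expl. Qed.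

Lemma cyc_fkm i : cyc (letters fkm) i = letter i.
Proof.
have hi : i %% M < M by rewrite ltn_mod M_gt0.
rewrite /cyc size_letters size_tuple /letters.
rewrite (nth_map (tnth_default fkm (Ordinal hi))) ?size_tuple //.
by rewrite -(tnth_nth _ fkm (Ordinal hi)) tnth_mktuple /= letter_mod.
Qed.

Lemma wval_letters_lt (w : m.+1.-tuple 'I_s) : wval s (letters w) < M.
Proof. by have := wval_lt (all_letters w); rewrite size_letters size_tuple. Qed.

Lemma occurs_fkm (w : m.+1.-tuple 'I_s) p :
  occurs_at fkm w p = (iter (p + m) next start == wval s (letters w)).
Proof.
rewrite occurs_atE ?size_tuple ?M_gt0 //.
rewrite (@eq_window _ letter); last by move=> i _; exact: cyc_fkm.
rewrite -window_iter; apply/eqP/eqP => [->//|e].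
apply: wval_inj e; rewrite ?all_letters ?size_letters ?size_window ?size_tuple //.
by apply: all_window; exact: letter_lt.
Qed.

Lemma iter_rank x : x < M -> iter (rank x).-1 next start = x.
Proof. by move=> h; have [] := rankK s_gt1 h. Qed.

(** 0-based position; the ranks up to [m] belong to the last [m] positions. *)
Definition wpos x := if rank x <= m then rank x + M - m.+1 else rank x - m.+1.

Lemma wpos_lt x : x < M -> wpos x < M.
Proof.
move=> h; have [h1 h2 _] := rankK s_gt1 h; have hm := M_gtm.
by rewrite /wpos; case: (leqP (rank x) m); lia.
Qed.

Lemma iter_wpos x : x < M -> iter (wpos x + m) next start = x.
Proof.
move=> h; have [h1 h2 e] := rankK s_gt1 h; have hm := M_gtm.
rewrite /wpos; case: (leqP (rank x) m) => h3.
  have -> : rank x + M - m.+1 + m = (rank x).-1 + M by lia.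
  by rewrite iter_nextMD.
by have -> : rank x - m.+1 + m = (rank x).-1 by lia.
Qed.

Lemma wpos_uniq p x : p < M -> iter (p + m) next start = x -> p = wpos x.
Proof.
move=> hp e; have hx : x < M by rewrite -e; apply: iter_next_lt.
have hm := M_gtm; have [h1 h2 e2] := rankK s_gt1 hx.
case: (ltnP (p + m) M) => hpm.
  have [_] := rank_iter s_gt1 hpm; rewrite e /wpos => ->.
  by case: (leqP _ m); lia.
have hpm' : p + m - M < M by lia.
have [_] := rank_iter s_gt1 hpm'; rewrite -iter_nextMD subnK // e /wpos => ->.
by case: (leqP _ m); lia.
Qed.

Lemma fkm_de_bruijn : de_bruijn m.+1 fkm.
Proof.
rewrite /de_bruijn size_tuple eqxx /=; apply/forallP => w.
have hx := wval_letters_lt w.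
apply: (count1_intro (wpos_lt hx)); rewrite ?occurs_fkm ?iter_wpos //.
by move=> q hq; rewrite occurs_fkm => /eqP /(wpos_uniq hq).
Qed.

Lemma iter_m_start : iter m next start = 0.
Proof.
have [h1 h2] := rank_iter s_gt1 M_gtm.
apply: (rank_inj s_gt1); [exact: h1|exact: M_gt0|].
by have := rank_zeros s_gt1 (leq0n m); rewrite /Successor.ones expn0 !mul0n subn0 h2 => ->.
Qed.

Lemma letter0 i : i <= m -> letter i = 0.
Proof.
move=> hi; have := window_iter 0; rewrite add0n iter_m_start -{2}(wval_nseq0 s m.+1).
move=> /wval_inj e; have {}e : window letter 0 m.+1 = nseq m.+1 0.
  apply: e; rewrite ?size_window ?size_nseq //.
    by apply: all_window; exact: letter_lt.
  by rewrite all_nseq s_gt0 orbT.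
by have := window_nth letter 0 (_ : i < m.+1); rewrite e nth_nseq ltnS hi => <-.
Qed.

Lemma ones_mod a : 0 < a -> a <= m -> (ones a * s) %% s ^ m = ones a.-1.
Proof.
move=> h0 ha; have hm : 0 < m by lia.
have -> : ones a * s = s.-1 * s ^ m + ones a.-1; last first.
  by rewrite modn_cat //; apply: ones_lt => //; lia.
rewrite !ones_eq //; last lia.
have -> : m - a.-1 = (m - a).+1 by lia.
have h1 : s ^ (m - a).+1 <= s ^ m by apply: sp_le => //; lia.
have h2 : s ^ m <= s ^ m.+1 by apply: sp_le.
rewrite mulnBl -!expnSr -subn1 mulnBl mul1n -expnS; lia.
Qed.

(** * Comparison with an arbitrary de Bruijn sequence *)

Section Minimality.

Variable t : M.-tuple 'I_s.
Hypothesis t_db : de_bruijn m.+1 t.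

Let T := cyc (letters t).
Let W p := wval s (window T p m.+1).

Let T_lt i : T i < s.
Proof. by apply: cyc_lt; rewrite size_tuple M_gt0. Qed.

Let W_inj p q : p < M -> q < M -> W p = W q -> p = q.
Proof.
move=> hp hq e; have {}e : window T p m.+1 = window T q m.+1.
  by apply: wval_inj e; rewrite ?size_window //; apply: all_window.
have hsz : size [seq Ordinal (T_lt i) | i <- iota q m.+1] == m.+1.
  by rewrite size_map size_iota.
pose w := Tuple hsz.
have ew : letters w = window T q m.+1 by rewrite /letters /= -map_comp.
move/andP: t_db => [_ /forallP /(_ w)]; rewrite size_tuple => h.
by apply: (count1_inj h); rewrite ?occurs_atE ?size_tuple ?M_gt0 // ew ?eqxx // -e eqxx.
Qed.

(** At the first difference i, suppose that [t] has the smaller letter. By [rank_mono] the window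
    that [t] reads there has rank at most i. Either it was read before, or it wraps around in [fkm],
    being z^j followed by zeros; then the next letters of [t] are forced to be 0 until the zero word
    is read for the second time. *)
Lemma fkm_le : lexle fkm t.
Proof.
apply/negPn/negP => /not_lexle; rewrite !size_tuple => /(_ erefl)[i [hi hlt hd]].
have cycE (u : M.-tuple 'I_s) k : k < M -> nth 0 (letters u) k = cyc (letters u) k.
  by move=> hk; rewrite /cyc size_letters size_tuple modn_small.
have {}hlt k : k < i -> T k = letter k.
  by move=> hk; have hkM := ltn_trans hk hi; rewrite -cyc_fkm /T -!cycE // hlt.
rewrite !cycE // cyc_fkm -/T in hd.
have him : m < i.
  by rewrite ltnNge; apply/negP => /letter0 e; rewrite e in hd.
have hm := M_gtm.
pose p := i - m; have epm : p + m = i by rewrite /p; lia.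
have hpM : p < M by lia.
have Wsame q : q + m < i -> W q = iter (q + m) next start.
  move=> hq; rewrite -window_iter /W; congr wval.
  by apply: eq_window => k /andP[_ hk]; apply: hlt; lia.
(* A word of rank between m + 1 and i is read inside the common prefix; a second reading at [p] or
   later contradicts uniqueness. *)
have dup x k : x < M -> m < rank x -> rank x <= i -> p <= k -> k < M -> W k = x -> False.
  move=> hx h1 h2 h3 h4 h5.
  have e : W (rank x - m.+1) = x.
    rewrite Wsame; last lia.
    by rewrite -{2}(iter_rank hx); congr (iter _ _ _); lia.
  have : rank x - m.+1 = k by apply: W_inj; rewrite ?e //; lia.
  lia.
pose y := wval s (window letter p m).
have hy : y < s ^ m.
  by have := @wval_lt s (window letter p m); rewrite size_window; apply; apply: all_window; exact: letter_lt.
have eW : W p = y * s + T i.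
  rewrite /W windowSr wval_rcons epm; congr (wval _ _ * s + _).
  by apply: eq_window => k /andP[_ hk]; apply: hlt; lia.
have eD : iter i next start = y * s + letter i.
  by rewrite -epm -window_iter windowSr wval_rcons epm.
have hr : rank (y * s + letter i) = i.+1.
  by rewrite -eD; have [_ ->] := rank_iter s_gt1 hi.
have hrT : rank (y * s + T i) <= i.
  by rewrite -ltnS -hr; apply: rank_mono => //; apply: letter_lt.
have hx : y * s + T i < M by apply: cat_lt.
case: (ltnP m (rank (y * s + T i))) => hrm.
  exact: (dup _ p hx hrm hrT).
have ex := rank_small s_gt1 hx hrm.
set j := m.+1 - _ in ex.
have [hr0 _ _] := rankK s_gt1 hx.
have hj0 : 0 < j by rewrite /j; lia.
have hjm : j <= m by rewrite /j; lia.
have ey : y = ones j.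
  by rewrite -(divn_cat y (T_lt i)) ex mulnK.
(* A nonzero next letter would give a word that [rank_ones_lt] places before y followed by
   [letter i], hence one already read. *)
have walk k : k <= j -> W (p + k) = ones (j - k) * s.
  elim: k => [|k IH] hk; first by rewrite addn0 subn0 eW ex.
  rewrite addnS /W wval_windowS // -/(W _) IH; last by lia.
  rewrite ones_mod; [|lia|lia].
  have -> : (j - k).-1 = j - k.+1 by lia.
  set e := T _; case: (posnP e) => [->|he]; first by rewrite addn0.
  have ha : j - k.+1 <= m by lia.
  have hv : ones (j - k.+1) * s + e < M by apply: cat_lt; [exact: ones_lt|exact: T_lt].
  have hrk : rank (ones (j - k.+1) * s + e) <= i.
    rewrite -ltnS -hr ey; apply: rank_ones_lt => //; first by lia.
      by rewrite letter_lt andbT; lia.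
    by rewrite he T_lt.
  exfalso; apply: (dup _ (p + k).+1 hv _ hrk); [|lia|lia|].
    rewrite ltnNge; apply/negP => /(rank_small s_gt1 hv) e2.
    have : (ones (j - k.+1) * s + e) %% s = 0 by rewrite e2 modnMl.
    by rewrite modn_cat ?T_lt //; lia.
  rewrite /W wval_windowS // -/(W _) IH; last by lia.
  rewrite ones_mod; [|lia|lia].
  by have -> : (j - k).-1 = j - k.+1 by lia.
have := walk j (leqnn j); rewrite subnn /Successor.ones expn0 !mul0n => e.
have e0 : W 0 = 0 by rewrite Wsame ?add0n // iter_m_start.
have : p + j = 0 by apply: W_inj; rewrite ?e ?e0 //; lia.
lia.
Qed.

End Minimality.

(** [pick] may return any minimal sequence; antisymmetry of the lexicographic order identifies it
    with [fkm]. *)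
Lemma dB_fkm : dB s m.+1 = fkm.
Proof.
have hmin : min_de_bruijn fkm.
  rewrite /min_de_bruijn fkm_de_bruijn /=; apply/forallP => t; apply/implyP.
  exact: fkm_le.
rewrite /dB; case: pickP => [u|/(_ fkm)]; last by rewrite hmin.
move=> /andP[hu /forallP /(_ fkm)]; rewrite fkm_de_bruijn /= => h1.
have h2 := fkm_le hu.
by have := @Order.le_anti _ (seqlexi 'I_s) u fkm; rewrite /= /lexle in h1 h2 *; rewrite h1 h2 => /(_ isT).
Qed.

Lemma occ_dB (w : m.+1.-tuple 'I_s) :
  occ w (dB s m.+1) = (wpos (wval s (letters w))).+1.
Proof.
have hx := wval_letters_lt w; rewrite /occ dB_fkm size_tuple; congr _.+1.
have hp := wpos_lt hx.
have hh : has (occurs_at fkm w) (iota 0 M).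
  by apply/hasP; exists (wpos (wval s (letters w))); rewrite ?mem_iota // occurs_fkm iter_wpos.
have := nth_find 0 hh; have := hh; rewrite has_find size_iota => hf.
by rewrite nth_iota // add0n occurs_fkm => /eqP /(wpos_uniq hf).
Qed.

End Sequence.

(** Over one letter the sequence has length 1 and every cyclic reading of it is constant, so the
    search stops at once. *)
Lemma occ_unary n (w : n.-tuple 'I_1) : occ w (dB 1 n) = 1.
Proof.
rewrite /occ /dB; case: pickP => [u _|//].
have hu : size u = 1 by rewrite size_tuple exp1n.
rewrite hu /=; suff -> : occurs_at u w 0 by [].
rewrite occurs_atE ?hu //; apply/eqP.
apply: (@eq_from_nth _ 0); rewrite size_window ?size_letters // => j hj.
have h0 a : a < 1 -> a = 0 by case: a.
rewrite window_nth // (h0 _ (cyc_lt _ _)) ?hu //.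
by apply/esym/h0; apply: (allP (all_letters w)); rewrite mem_nth // size_letters.
Qed.

(** * Counting words by first returns *)

Lemma sum_nat_mul a b (F : nat -> nat) :
  \sum_(0 <= x < a * b) F x = \sum_(c < a) \sum_(0 <= y < b) F (c * b + y).
Proof.
rewrite big_nat_mul big_mkord; apply: eq_bigr => c _.
rewrite mulSn -{1}[c * b]add0n big_addn addnK.
by apply: eq_bigr => y _; rewrite addnC.
Qed.

Lemma eq_sum_range lo hi lo' hi' (P P' : pred nat) (F : nat -> nat) :
  (forall i, (lo <= i < hi) && P i = (lo' <= i < hi') && P' i) ->
  \sum_(lo <= i < hi | P i) F i = \sum_(lo' <= i < hi' | P' i) F i.
Proof.
move=> h; have E a b (Q : pred nat) : b <= hi + hi' ->
    \sum_(a <= i < b | Q i) F i = \sum_(0 <= i < hi + hi' | (a <= i < b) && Q i) F i.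
  move=> hb; rewrite (@big_nat_widenl _ _ _ a 0) // (@big_nat_widen _ _ _ 0 b (hi + hi')) //.
  by apply: eq_bigl => i; case: (Q i); case: (a <= i); case: (i < b).
rewrite E ?leq_addr // [RHS]E ?leq_addl //; exact: eq_bigl.
Qed.

Fixpoint sum_words (s m : nat) (g : seq nat -> nat) : nat :=
  if m is m'.+1 then \sum_(c < s) sum_words s m' (fun l => g (nat_of_ord c :: l))
  else g [::].

Fixpoint digits (s m x : nat) : seq nat :=
  if m is m'.+1 then x %/ s ^ m' :: digits s m' (x %% s ^ m') else [::].

Lemma sum_words_digits s m g : 0 < s ->
  \sum_(0 <= x < s ^ m) g (digits s m x) = sum_words s m g.
Proof.
move=> hs; elim: m g => [|m IH] g /=; first by rewrite big_nat1.
rewrite expnS sum_nat_mul; apply: eq_bigr => c _; rewrite -IH.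
apply: eq_big_nat => y /andP[_ hy].
by rewrite divn_cat // modn_cat.
Qed.

Lemma eq_sum_words s m g h : (forall l, g l = h l) -> sum_words s m g = sum_words s m h.
Proof.
elim: m g h => [|m IH] g h e //=; apply: eq_bigr => c _; apply: IH => l.
exact: e.
Qed.

Lemma sum_wordsD s m g h :
  sum_words s m (fun l => g l + h l) = sum_words s m g + sum_words s m h.
Proof.
elim: m g h => [|m IH] g h //=; rewrite -big_split /=.
by apply: eq_bigr => c _; rewrite IH.
Qed.

Lemma sum_words0 s m : sum_words s m (fun=> 0) = 0.
Proof. by elim: m => //= m IH; rewrite big1. Qed.

Lemma sum_words_sum s m k (g : nat -> seq nat -> nat) :
  sum_words s m (fun l => \sum_(0 <= i < k) g i l) = \sum_(0 <= i < k) sum_words s m (g i).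
Proof.
elim: k => [|k IH].
  by rewrite big_geq // -[RHS](sum_words0 s m); apply: eq_sum_words => l; rewrite big_geq.
rewrite big_nat_recr //= -IH -sum_wordsD; apply: eq_sum_words => l.
by rewrite big_nat_recr.
Qed.

Lemma sum_words_rcons s m g : sum_words s m.+1 g =
  sum_words s m (fun l => \sum_(c < s) g (rcons l c)).
Proof.
elim: m g => [|m IH] g //; rewrite -[LHS]/(\sum_(c < s) sum_words s m.+1 (fun l => g (nat_of_ord c :: l))).
by apply: eq_bigr => c _; rewrite IH.
Qed.

Lemma sum_words_le s m (P : pred (seq nat)) : sum_words s m (fun l => P l : nat) <= s ^ m.
Proof.
elim: m P => [|m IH] P /=; first by case: (P _).
rewrite expnS -[s in s * _](card_ord s) -sum_nat_const; apply: leq_sum => c _.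
exact: IH.
Qed.

Lemma sum_eq1 s b : b < s -> \sum_(c < s) (nat_of_ord c == b) = 1.
Proof.
move=> hb; rewrite (bigD1 (Ordinal hb)) //= eqxx big1 ?addn0 // => i hi.
by case: eqP => // e; case/eqP: hi; apply: val_inj.
Qed.

Lemma sum_gt s b : b < s -> \sum_(c < s) (b < nat_of_ord c) = s - b.+1.
Proof.
move=> hb; elim: s hb => [//|s IH]; rewrite ltnS leq_eqVlt => /orP[/eqP->|h].
  rewrite subnn big1 // => i _; apply/eqP; rewrite eqb0 -leqNgt -ltnS; exact: ltn_ord.
by rewrite big_ord_recr /= IH // h; lia.
Qed.

Section Automaton.

Variables (s : nat) (q : nat -> nat) (p : nat).
Hypothesis q_lt : forall i, i < p -> q i < s.
Hypothesis p_gt0 : 0 < p.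
Hypothesis lyndon : forall k, 0 < k < p -> exists i,
  [/\ k + i < p, forall j, j < i -> q (k + j) = q j & q i < q (k + i)].

(* [a] is the length of the current match with the periodic word (q_0...q_(p-1))^oo *)
Definition delta a c := if c == q a then (if a.+1 == p then 0 else a.+1) else 0.

(** A letter below the expected one ends the walk: the word then contains a factor smaller than the
    prefix of [q] being matched. *)
Fixpoint walk a (l : seq nat) : option nat :=
  if l is c :: l' then (if c < q a then None else walk (delta a c) l') else Some a.

Lemma delta_lt a c : a < p -> delta a c < p.
Proof. by rewrite /delta; case: eqP => // _; case: eqP => // h1 h2; lia. Qed.

Lemma walk_rcons a l c : walk a (rcons l c) =
  if walk a l is Some b then (if c < q b then None else Some (delta b c)) else None.
Proof. by elim: l a => [|d l IH] a //=; case: ifP => //. Qed.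

Lemma walk_lt a l b : a < p -> walk a l = Some b -> b < p.
Proof.
elim: l a => [|d l IH] a ha /=; first by move=> [<-].
by case: ifP => // _; apply: IH; exact: delta_lt.
Qed.

Definition walks m a b := sum_words s m (fun l => (walk a l == Some b) : nat).

Lemma walks0 a b : walks 0 a b = (a == b).
Proof. by []. Qed.

(** Each of the [s - (q a).+1] larger letters resets the match; the equal letter prolongs it. *)
Lemma walksS m a b : a < p -> walks m.+1 a b =
  (s - (q a).+1) * walks m 0 b + walks m (if a.+1 == p then 0 else a.+1) b.
Proof.
move=> ha; have hq := q_lt ha; rewrite /walks /=.
set W0 := sum_words s m _; set W1 := sum_words s m _.
rewrite (eq_bigr (fun c : 'I_s => (q a < c) * W0 + (nat_of_ord c == q a) * W1)); last first.
  move=> c _; case: (ltngtP c (q a)) => h.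
  - rewrite !mul0n addn0 -[RHS](sum_words0 s m).
    exact: eq_sum_words.
  - rewrite mul1n mul0n addn0; apply: eq_sum_words => l.
    by rewrite /delta gtn_eqF.
  - rewrite mul0n mul1n; apply: eq_sum_words => l.
    by rewrite /delta h eqxx.
by rewrite big_split /= -!big_distrl /= sum_gt // sum_eq1 // mul1n.
Qed.

(** A nonzero state is entered only from its predecessor, by a single letter. *)
Lemma walksSr m a b : a < p -> b.+1 < p -> walks m.+1 a b.+1 = walks m a b.
Proof.
move=> ha hb; have hq : q b < s by apply: q_lt; apply: ltnW.
rewrite /walks sum_words_rcons; apply: eq_sum_words => l.
case e : (walk a l) => [b'|]; last first.
  by rewrite big1 // => c _; rewrite walk_rcons e.
have hb' := walk_lt ha e.
rewrite (eq_bigr (fun c : 'I_s => (b' == b) * (nat_of_ord c == q b))).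
  by rewrite -big_distrr /= sum_eq1 // muln1.
move=> c _; rewrite walk_rcons e.
case: ltnP => h.
  by case: (eqVneq b' b) => [<-|_]; rewrite ?(ltn_eqF h) ?muln0 ?mul0n.
rewrite /delta; case: (eqVneq (nat_of_ord c) (q b')) => e1; last first.
  by case: (eqVneq b' b) => [<-|_]; rewrite ?(negbTE e1) ?mul0n ?muln0.
case: (b'.+1 =P p) => e2.
  by case: (eqVneq b' b) => [e3|_]; [exfalso; lia|rewrite mul0n].
case: (eqVneq b' b) => [<-|hne]; first by rewrite e1 !eqxx.
by rewrite mul0n -[LHS]/(b' == b : nat) (negbTE hne).
Qed.

Lemma walks_shift m a b : a < p -> b < p -> walks (m + b) a b = walks m a 0.
Proof.
move=> ha; elim: b => [|b IH] hb; first by rewrite addn0.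
by rewrite addnS walksSr // IH // ltnW.
Qed.

(** Number of first returns to state 0 of length [l]: l - 1 matching letters, then a larger one, or
    the completion of the period if [l == p]. *)
Definition coef l := if 0 < l <= p then s - (q l.-1).+1 + (l == p) else 0.
Definition returns m := walks m 0 0.

Lemma returns0 : returns 0 = 1.
Proof. by []. Qed.

Lemma returns_le m : returns m <= s ^ m.
Proof. exact: sum_words_le. Qed.

(** Cut at the first arrival in 0: a start in [a] behaves like a walk that left 0 earlier by [a]
    steps, so its first return has total length l > a. *)
Lemma walksE m a : a < p -> 0 < m + a ->
  walks m a 0 = \sum_(a.+1 <= l < p.+1 | l <= m + a) coef l * returns (m + a - l).
Proof.
move: {2}(p - a) (leqnn (p - a)) => k; elim: k m a => [|k IH] m a hk ha h0; first lia.
case: m h0 => [|m] h0.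
  rewrite walks0 big_nat_cond big_pred0; first by case: a h0 {ha hk}.
  by move=> i; rewrite add0n; case: (ltnP a i) => //= h; rewrite andbF.
have hb : a.+1 <= m.+1 + a by lia.
rewrite walksS // (@big_ltn_cond _ _ _ a.+1 p.+1 _ _ ha) hb.
have -> : m.+1 + a - a.+1 = m by lia.
rewrite {1}/coef /= ha; case: eqP => e.
  rewrite -e big_geq // addn0 mulnDl mul1n //.
rewrite addn0 (IH m a.+1); [|lia|lia|lia].
by congr (_ + _); apply: eq_big => [i|i _]; rewrite addnS.
Qed.

Lemma returnsE m : 0 < m ->
  returns m = \sum_(1 <= l < m.+1) coef l * returns (m - l).
Proof.
move=> hm; rewrite /returns walksE ?addn0 // -/returns.
transitivity (\sum_(1 <= l < p.+1 | l < m.+1) coef l * returns (m - l)) => //.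
have e l : coef l * returns (m - l) = if l <= p then coef l * returns (m - l) else 0.
  by case: leqP => // h; rewrite /coef (leqNgt l) h andbF.
rewrite [RHS](eq_bigr _ (fun l _ => e l)) -big_mkcondr.
by apply: eq_sum_range => i; lia.
Qed.

(** A closed walk at [a] is, up to the position of the cut, a walk from 0 whose first return has
    some length l > a. Each l occurs for exactly [l] states a, whence the weight. *)
Lemma sum_closed_walks n : p <= n ->
  \sum_(0 <= a < p) walks n a a = \sum_(1 <= l < p.+1) l * coef l * returns (n - l).
Proof.
move=> hpn; transitivity (\sum_(0 <= a < p) \sum_(1 <= l < p.+1 | a < l) coef l * returns (n - l)).
  apply: eq_big_nat => a /andP[_ ha].
  have -> : walks n a a = walks (n - a) a 0 by rewrite -{1}(@subnK a n) ?walks_shift //; lia.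
  rewrite walksE //; last lia.
  rewrite subnK; last lia.
  by apply: eq_sum_range => i; lia.
rewrite (exchange_big_dep_nat xpredT) //=; apply: eq_big_nat => l /andP[hl hlp].
rewrite -mulnA (@eq_sum_range _ _ 0 l _ xpredT); last by move=> i; lia.
by rewrite sum_nat_const_nat subn0.
Qed.

End Automaton.

Lemma wval_ltP s l l' : all (fun d => d < s) l -> all (fun d => d < s) l' ->
  size l = size l' -> reflect
    (exists i, [/\ i < size l, forall j, j < i -> nth 0 l j = nth 0 l' j
      & nth 0 l i < nth 0 l' i])
    (wval s l < wval s l').
Proof.
elim: l l' => [|d l IH] [|d' l'] //= h1 h2 h3.
  by rewrite ltnn; constructor; case=> i [].
move: h1 h2 h3 => /andP[hd hl] /andP[hd' hl'] [e].
have h := wval_lt hl; have h' := wval_lt hl'; rewrite e in h *.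
case: (ltngtP d d') => hdd.
- by rewrite (leq_trans (ltn_cat hdd h)) ?leq_addr //; constructor; exists 0.
- rewrite ltnNge (leq_trans (ltnW (ltn_cat hdd h'))) ?leq_addr //=; constructor.
  case=> -[|i] [h3 h4 h5] /=; first by rewrite /= in h5; lia.
  by have := h4 0 isT; rewrite /=; lia.
- rewrite hdd ltn_add2l; apply: (iffP (IH _ hl hl' e)) => -[i [h3 h4 h5]].
    exists i.+1; split=> //; last by case=> [|j] //= hj; apply: h4.
    by rewrite -e.
  case: i h3 h4 h5 => [|i] h3 h4 h5; first by rewrite /= in h5; lia.
  exists i; split=> //; first by rewrite e.
  by move=> j hj; apply: (h4 j.+1).
Qed.

(** * Prenecklaces and Duval periods *)

Definition prenecklace (q : nat -> nat) r := forall k i, k + i < r ->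
  (forall j, j < i -> q (k + j) = q j) -> q i <= q (k + i).

Definition lyndon (q : nat -> nat) p := forall k, 0 < k < p -> exists i,
  [/\ k + i < p, forall j, j < i -> q (k + j) = q j & q i < q (k + i)].

Definition periodic (q : nat -> nat) p r := forall i, p <= i < r -> q i = q (i - p).

(** Duval's algorithm: a letter that continues the current period keeps it, any other letter makes
    the whole prefix the new period. *)
Fixpoint duval (q : nat -> nat) i :=
  if i is i'.+1 then
    if i' == 0 then 1 else if q i' == q (i' - duval q i') then duval q i' else i
  else 1.

Lemma periodic_mod q p r i : 0 < p -> periodic q p r -> i < r -> q i = q (i %% p).
Proof.
move=> hp hper; elim/ltn_ind: i => i IH hi; case: (ltnP i p) => h; first by rewrite modn_small.
rewrite hper ?h // IH; [|lia|lia].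
by rewrite -{2}(subnK h) modnDr.
Qed.

(** In a prenecklace a letter that breaks the period is larger than the one it replaces, and the
    whole prefix becomes Lyndon: a border of it would contradict the old period or the old Lyndon
    prefix. *)
Lemma duval_spec q r i : prenecklace q r -> 0 < i <= r ->
  [/\ 0 < duval q i, duval q i <= i, periodic q (duval q i) i & lyndon q (duval q i)].
Proof.
move=> hq; elim: i => // i IH /andP[_ hi]; rewrite /=.
case: (posnP i) => [->|hi0] /=.
  by split=> // [k|k]; lia.
have [h1 h2 h3 h4] := IH ltac:(lia); move: (duval q i) h1 h2 h3 h4 => p h1 h2 h3 h4.
have hle : q (i - p) <= q i.
  have := hq p (i - p); rewrite subnKC // => /(_ hi); apply=> j hj.
  by rewrite h3 ?addKn //; lia.
case: eqP => e.
  split=> //; first lia.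
  by move=> j /andP[ha]; rewrite ltnS leq_eqVlt => /orP[/eqP->//|hb]; apply: h3; rewrite ha.
split=> //; first by move=> j; lia.
move=> k /andP[k1 k2].
have hex : exists j, (k + j < i.+1) && (q (k + j) != q j).
  case: (boolP (has (fun j => q (k + j) != q j) (iota 0 (i.+1 - k)))).
    by move=> /hasP[j]; rewrite mem_iota => /andP[_ hj] hj2; exists j; rewrite hj2 andbT; lia.
  move=> /hasPn hall; have {}hall j : k + j < i.+1 -> q (k + j) = q j.
    by move=> hj; apply/eqP/negPn/hall; rewrite mem_iota; lia.
  exfalso; have hki := hall (i - k); rewrite subnKC in hki; last lia.
  have {hki} hki := hki ltac:(lia).
  have hper j : j < i -> q j = q (j %% p) by apply: periodic_mod.
  have ei : q (i - p) = q (i %% p).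
    by rewrite hper; [rewrite -{2}(subnK h2) modnDr|lia].
  case: (posnP (k %% p)) => hk0.
    have : q (i - k) = q (i %% p).
      rewrite hper; last lia.
      by rewrite -{2}(subnK (_ : k <= i)); [rewrite -modnDmr hk0 addn0|lia].
    lia.
  have hkp : k %% p < p by rewrite ltn_mod.
  (* The offset [k] falls strictly inside a period, where the old Lyndon prefix supplies a mismatch
     [m0]. Whether [k + m0] lies before, at or after the last letter, it contradicts the supposed
     border. *)
  have [m0 [m1 m2 m3]] := h4 (k %% p) ltac:(lia).
  have hmod t : k %% p + t < p -> (k + t) %% p = k %% p + t.
    by move=> ht; rewrite -modnDml modn_small.
  case: (ltngtP (k + m0) i) => hm.
  - have := hall m0 ltac:(lia); rewrite hper // hmod //; lia.
  - have hm2 : k %% p + (i - k) < p by lia.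
    have := hmod (i - k) hm2; rewrite subnKC; last lia.
    move=> e2; have := m2 (i - k) ltac:(lia); rewrite -e2 -ei; lia.
  - have := hmod m0 m1; rewrite hm => e2.
    have : q (i - k) = q m0 by rewrite -hm addKn.
    by move: m3; rewrite -e2 -ei; lia.
have [m0 /andP[m1 m2] m3] := find_ex_minn hex.
exists m0; have hag j : j < m0 -> q (k + j) = q j.
  move=> hj; apply/eqP/negPn/negP => hne.
  have := m3 j; rewrite hne andbT; lia.
split=> //; rewrite ltn_neqAle eq_sym m2 /=; apply: hq => //; lia.
Qed.

(** * Cyclic words and closed walks of the automaton *)

Section Good.

Variables (s : nat) (q : nat -> nat) (p : nat).
Hypothesis q_lt : forall i, i < p -> q i < s.
Hypothesis p_gt0 : 0 < p.
Hypothesis q_lyn : lyndon q p.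

Local Notation delta := (delta q p).

Fixpoint state_at (X : nat -> nat) a t :=
  if t is t'.+1 then delta (state_at X a t') (X t') else a.

Definition safe X a t := forall j, j < t -> q (state_at X a j) <= X j.

Lemma state_at_lt X a t : a < p -> state_at X a t < p.
Proof. by move=> ha; elim: t => //= t IH; apply: delta_lt. Qed.

Lemma state_atD X a t u :
  state_at X a (t + u) = state_at (fun i => X (t + i)) (state_at X a t) u.
Proof. by elim: u => [|u IH]; rewrite ?addn0 // addnS /= IH. Qed.

Lemma eq_state_at X Y a t : (forall i, X i = Y i) -> state_at X a t = state_at Y a t.
Proof. by move=> e; elim: t => //= t ->; rewrite e. Qed.

Lemma walkP X a b t : reflect (safe X a t /\ state_at X a t = b)
  (walk q p a (window X 0 t) == Some b).
Proof.
have H : (safe X a t /\ walk q p a (window X 0 t) = Some (state_at X a t)) \/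
    (~ safe X a t /\ walk q p a (window X 0 t) = None).
  elim: t => [|t [[h e]|[h e]]]; first by left.
    rewrite windowSr walk_rcons e add0n; case: ltnP => h2; [right|left]; split=> //.
      by move=> /(_ t (leqnn _)); lia.
    by move=> j; rewrite ltnS leq_eqVlt => /orP[/eqP->|/h].
  rewrite windowSr walk_rcons e; right; split=> // h2; apply: h => j hj; apply: h2.
  exact: ltnW.
apply: (iffP eqP); first by case: H => -[h ->] // [<-].
by case: H => -[h ->] [h2 h3] //; rewrite h3.
Qed.

(* both matches end at the same place, so the shorter one is a border of the longer one *)
Definition border a b := [/\ a <= b, b < p & forall i, i < a -> q (b - a + i) = q i].

Lemma border0 b : b < p -> border 0 b.
Proof. by []. Qed.

(** By the Lyndon property the letter expected by the shorter match is at most the one expected by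
    the longer. So a letter accepted by the longer match is accepted by both, and either they merge
    or the longer one just grows. *)
Lemma border_step a b c : border a b -> q b <= c ->
  [/\ q a <= c, border (delta a c) (delta b c) &
      delta a c = delta b c \/ delta b c = b.+1].
Proof.
move=> [hab hb hbord] hc; move: (hab); rewrite leq_eqVlt => /orP[/eqP e|hlt].
  by rewrite e; split=> //; [split=> //; [exact: delta_lt|move=> i _; rewrite subnn]|left].
have [m [m1 m2 m3]] := @q_lyn (b - a) ltac:(lia).
have ham : a <= m by rewrite leqNgt; apply/negP => /hbord; lia.
have hcase : q a < q b \/ (q a = q b /\ b.+1 < p).
  move: ham; rewrite leq_eqVlt => /orP[/eqP e|h].
    by left; move: m3; rewrite -e subnK.
  by right; split; [rewrite -m2 // subnK|lia].
split; first by case: hcase => [|[]]; lia.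
  rewrite /delta; case: (eqVneq c (q b)) => [->|h].
    case: hcase => [h|[e h]].
      rewrite (gtn_eqF h); apply: border0; case: eqP => //; lia.
    rewrite e eqxx; have -> : (b.+1 == p) = false by lia.
    have -> : (a.+1 == p) = false by lia.
    split=> // i; rewrite subSS ltnS leq_eqVlt => /orP[/eqP->|hi]; last exact: hbord.
    by rewrite subnK.
  have -> : (c == q a) = false by case: hcase => [|[]]; lia.
  exact: border0.
rewrite /delta; case: (eqVneq c (q b)) => [->|h].
  case: (eqVneq b.+1 p) => [e|_]; last by right.
  by left; case: hcase => [h|[_ h]]; [rewrite (gtn_eqF h)|lia].
by left; case: hcase => [|[]] h1; case: eqP => //; lia.
Qed.

Lemma border_run X a b t : border a b -> safe X b t ->
  [/\ safe X a t, border (state_at X a t) (state_at X b t) &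
      state_at X a t = state_at X b t \/ state_at X b t = b + t].
Proof.
move=> hab; elim: t => [|t IH] hs; first by split=> //; right; rewrite addn0.
have [h1 h2 h3] := IH (fun j hj => hs j (ltnW hj)).
have [h4 h5 h6] := border_step h2 (hs t (leqnn _)).
split=> //=; first by move=> j; rewrite ltnS leq_eqVlt => /orP[/eqP->|/h1].
case: h3 => [->|h3]; first by left.
by case: h6 => [|->]; [left|right; rewrite h3 addnS].
Qed.

(** A match that has not merged has grown at every step, but states stay below [p]. *)
Lemma border_merge X a b t : border a b -> p <= t -> safe X b t ->
  state_at X a t = state_at X b t.
Proof.
move=> hab ht hs; have [_ [_ h _] []] := border_run hab hs => // e.
by move: h; rewrite e; lia.
Qed.

Section Cyclic.

Variables (X : nat -> nat) (n : nat).
Hypothesis X_per : forall i, X (n + i) = X i.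
Hypothesis n_gt0 : 0 < n.

(** Every rotation of [X] is at least the periodic continuation of [q], expressed through the first
    letter that could fall short. *)
Let good := forall i k, k < p -> (forall j, j < k -> X (i + j) = q j) -> q k <= X (i + k).

Let X_perM k i : X (n * k + i) = X i.
Proof. by elim: k => [|k IH]; rewrite ?muln0 // mulnS -addnA X_per. Qed.

Lemma safe_good a : safe X a n -> state_at X a n = a -> forall t, safe X a t.
Proof.
move=> hs e t j _; move: {2}j (leqnn j) => N; elim: N j => [|N IH] j hj.
  by move: hj; rewrite leqn0 => /eqP->; apply: hs.
case: (ltnP j n) => h; first exact: hs.
rewrite -(subnKC h) X_per state_atD e (@eq_state_at _ X) //; apply: IH; lia.
Qed.

Lemma state_fix a k : state_at X a n = a -> state_at X a (n * k) = a.
Proof.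
move=> e; elim: k => [|k IH]; first by rewrite muln0.
by rewrite mulnS state_atD e (@eq_state_at _ X).
Qed.

Lemma fix_good a : a < p -> safe X a n -> state_at X a n = a -> good.
Proof.
move=> ha hs e i k hk hm; have hsafe := safe_good hs e.
have hb := border0 (state_at_lt X i ha).
have hs2 : safe (fun j => X (i + j)) (state_at X a i) k.+1.
  by move=> j hj; rewrite -state_atD; apply: (hsafe (i + j).+1).
have [h1 _ _] := border_run hb hs2.
have hst N : N <= k -> state_at (fun j => X (i + j)) 0 N = N.
  elim: N => //= N IH hN; rewrite IH ?hm // /delta; last lia.
  by rewrite eqxx; case: eqP => //; lia.
by have := h1 k (leqnn _); rewrite hst.
Qed.

(** The bound on the state excludes a match that reaches back before the first letter read. *)
Lemma match_state a t : state_at X a t <= t ->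
  forall j, j < state_at X a t -> X (t - state_at X a t + j) = q j.
Proof.
elim: t => [|t IH] /=; first by move=> h j; lia.
rewrite /delta; case: eqP => e //; case: eqP => e2 // h j.
rewrite subSS ltnS leq_eqVlt => /orP[/eqP->|hj]; last by apply: IH.
by rewrite subnK.
Qed.

(** After [p] turns both states are matches with letters actually read, so the smaller is a border
    of the larger; the two walks then merge, although each returns to its own start. *)
Lemma fix_uniq a b : a < p -> b < p -> safe X a n -> state_at X a n = a ->
  safe X b n -> state_at X b n = b -> a = b.
Proof.
wlog hab : a b / a <= b.
  by move=> W *; case: (leqP a b) => h; [apply: W|symmetry; apply: W => //; apply: ltnW].
move=> ha hb sa ea sb eb.
have fa := state_fix p ea; have fb := state_fix p eb.
have hnp : p <= n * p by rewrite leq_pmull.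
have ma := @match_state a (n * p); have mb := @match_state b (n * p).
rewrite fa in ma; rewrite fb in mb.
have bord : border a b.
  split=> // i hi; rewrite -(ma _ i hi) -?mb; [|lia|lia|lia].
  by congr X; lia.
by rewrite -fa -fb; apply: border_merge => //; exact: safe_good.
Qed.

Lemma good_safe : good -> forall t, safe X 0 t.
Proof.
move=> hg; have le0 t : state_at X 0 t <= t.
  by elim: t => //= t IH; rewrite /delta; case: ifP => // _; case: ifP.
move=> t j _; have := @match_state 0 j (le0 j) => h.
have := hg (j - state_at X 0 j) _ (state_at_lt X j p_gt0) h.
by rewrite subnK.
Qed.

(** The walk from 0 and the walk from its state after one turn merge within [p] turns; hence the
    state reached after [p] turns is fixed by one more turn. *)
Lemma good_fix : good -> exists a, [/\ a < p, safe X a n & state_at X a n = a].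
Proof.
move=> /good_safe hs.
have hb : state_at X 0 n < p by apply: state_at_lt.
have hs2 t : safe X (state_at X 0 n) t.
  move=> j hj; have := hs (n + j).+1 (n + j) (leqnn _).
  by rewrite state_atD X_per (@eq_state_at _ X).
have hnp : p <= n * p by rewrite leq_pmull.
have e := border_merge (border0 hb) hnp (hs2 _).
exists (state_at X 0 (n * p)); split; first exact: state_at_lt.
  move=> j hj; have := hs (n * p + j).+1 (n * p + j) (leqnn _).
  by rewrite state_atD X_perM (@eq_state_at _ X).
rewrite [RHS]e -(@eq_state_at (fun i => X (n * p + i)) X) // -state_atD.
by rewrite addnC state_atD (@eq_state_at _ X).
Qed.

(** A good word labels exactly one closed walk, so summing over the states counts words. *)
Lemma count_fix (g : bool) : reflect good g ->
  \sum_(0 <= a < p) (walk q p a (window X 0 n) == Some a) = g.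
Proof.
move=> hg; case: hg => [/good_fix[a [ha sa ea]]|hn].
  have hw : walk q p a (window X 0 n) == Some a by apply/walkP; split; [exact: sa|exact: ea].
  rewrite big_mkord (bigD1 (Ordinal ha)) // hw big1 //.
  move=> b hb; apply/eqP; rewrite eqb0; apply/walkP => -[sb eb].
  by case/eqP: hb; apply: val_inj; exact: (fix_uniq (ltn_ord b) ha sb eb sa ea).
rewrite big_nat_cond big1 // => a /andP[/andP[_ ha] _]; apply/eqP; rewrite eqb0.
by apply/walkP => -[sa ea]; apply: hn; apply: (fix_good ha).
Qed.

End Cyclic.

End Good.

Lemma wval_digits s m x : x < s ^ m -> wval s (digits s m x) = x.
Proof.
have sz k y : size (digits s k y) = k by elim: k y => //= k IH y; rewrite IH.
elim: m x => [|m IH] x /=; first by rewrite expn0 ltnS leqn0 => /eqP->.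
move=> hx; rewrite sz IH ?[RHS](divn_eq x (s ^ m)) // ltn_mod expn_gt0.
by move: hx; case: (s) => //; rewrite exp0n.
Qed.

Lemma size_digits s m x : size (digits s m x) = m.
Proof. by elim: m x => //= m IH x; rewrite IH. Qed.

Lemma all_digits s m x : x < s ^ m -> all (fun d => d < s) (digits s m x).
Proof.
elim: m x => //= m IH x hx; have hs : 0 < s by move: hx; case: (s) => //; rewrite exp0n.
by rewrite IH ?ltn_mod ?expn_gt0 ?hs // ltn_divLR ?expn_gt0 ?hs // -expnS hx.
Qed.

(** * From closed walks to the position of a word *)

Section Count.

Variables (s m : nat).
Hypothesis s_gt1 : 1 < s.

Let s_gt0 : 0 < s. Proof. exact: ltnW. Qed.
Local Notation r := (rotw s m).
Local Notation M := (s ^ m.+1).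

Definition dg x i := iter i r x %/ s ^ m.

Lemma dg_lt x i : x < M -> dg x i < s.
Proof. by move=> hx; apply: divw_lt => //; apply: iter_rotw_lt. Qed.

Lemma dg_per x i : x < M -> dg x (m.+1 + i) = dg x i.
Proof. by move=> hx; rewrite /dg addnC iterD iter_rotw_n. Qed.

Lemma dg_prefix x k R : x < M -> R <= m.+1 ->
  iter k r x %/ s ^ (m.+1 - R) = wval s (window (dg x) k R).
Proof.
move=> hx hR; apply: shift_prefix => // i; first exact: iter_rotw_lt.
rewrite iterS /rotw divn_cat //; apply: divw_lt => //; exact: iter_rotw_lt.
Qed.

Lemma dg_window x k : x < M -> wval s (window (dg x) k m.+1) = iter k r x.
Proof. by move=> hx; rewrite -dg_prefix // subnn divn1. Qed.

Lemma digits_window x : x < M -> digits s m.+1 x = window (dg x) 0 m.+1.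
Proof.
move=> hx; apply: (@wval_inj s).
- exact: all_digits.
- by apply: all_window => i; apply: dg_lt.
- by rewrite size_digits size_window.
- by rewrite wval_digits // dg_window.
Qed.

Lemma minrot_prenecklace x st R : x < M -> iter st r x = minrot s m x -> R <= m.+1 ->
  prenecklace (fun i => dg x (st + i)) R.
Proof.
move=> hx e hR k i hki hag; rewrite leqNgt; apply/negP => hlt.
have sz : i.+1 <= m.+1 by lia.
have : wval s (window (dg x) (st + k) i.+1) < wval s (window (dg x) st i.+1).
  apply/wval_ltP; rewrite ?size_window //; try by apply: all_window => ?; apply: dg_lt.
  exists i; split=> // [j hj|]; rewrite !window_nth //; try lia.
    by rewrite -addnA hag.
  by rewrite -addnA.
rewrite -!dg_prefix // ltnNge => /negP; apply; apply: leq_div2r.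
by rewrite e; apply: minrot_le.
Qed.

Definition closed_sum (q : nat -> nat) p n :=
  \sum_(1 <= l < p.+1) l * coef s q p l * returns s q p (n - l).

(** The words whose least rotation reaches the bound are the good ones. The bound is padded with
    zeros, so comparison with it concerns the first [R] letters, while the automaton knows only the
    first period of [q]. *)
Lemma cnt_closed_sum q R : 0 < R <= m.+1 -> (forall i, i < R -> q i < s) ->
  prenecklace q R ->
  cnt s m (wval s (window q 0 R) * s ^ (m.+1 - R)) + closed_sum q (duval q R) m.+1 = M.
Proof.
move=> /andP[R0 hR] hq hpre; set p := duval q R.
have hRR : 0 < R <= R by rewrite R0 leqnn.
have [] := duval_spec hpre hRR; rewrite -/p => p0 hpR hper hlyn.
have hqp i : i < p -> q i < s by move=> h; apply: hq; lia.
set a0 := _ * _.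
rewrite /closed_sum -sum_closed_walks //; last lia.
transitivity (cnt s m a0 + \sum_(0 <= x < M) (a0 <= minrot s m x)).
  congr (_ + _); rewrite -sum_words_sum -(sum_words_digits _ _ s_gt0).
  apply: eq_big_nat => x /andP[_ hx].
  rewrite digits_window //; apply: (count_fix p0 hlyn) => // [i|]; first exact: dg_per.
  have hlow k : (a0 <= iter k r x) = ~~ (wval s (window (dg x) k R) < wval s (window q 0 R)).
    by rewrite -leqNgt -dg_prefix // leq_divRL // sp_gt0.
  have hall q' k : (forall i, i < R -> q' (k + i) < s) -> all (fun d => d < s) (window q' k R).
    move=> h; rewrite all_map; apply/allP => i; rewrite mem_iota => hi /=.
    by rewrite -(@subnKC k i); [apply: h; lia|lia].
  have Hlt k := @wval_ltP s (window (dg x) k R) (window q 0 R)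
    (hall _ _ (fun i _ => dg_lt _ hx)) (hall _ _ (fun i hi => hq i hi))
    (etrans (size_window _ _ _) (esym (size_window _ _ _))).
  apply: (iffP idP) => [h i k hk hag|hg].
    have := hlow i; rewrite (leq_trans h (minrot_le s_gt0 i hx)) => /esym/Hlt hn.
    rewrite leqNgt; apply/negP => hlt; apply: hn; exists k; rewrite size_window.
    split; first by lia.
      by move=> j hj; rewrite !window_nth ?add0n ?hag //; lia.
    by rewrite !window_nth ?add0n //; lia.
  have [k _ ->] := minrot_ex s m x; rewrite hlow; apply/Hlt => -[i]; rewrite size_window.
  move=> [hi hag hlt].
  have {}hag j : j < i -> dg x (k + j) = q j.
    by move=> hj; have := hag j hj; rewrite !window_nth ?add0n //; lia.
  rewrite !window_nth ?add0n // in hlt.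
  have hmod j : j <= i -> q j = q (j %% p).
    by move=> hj; apply: (periodic_mod p0 hper); lia.
  (* A deficit at index [i] beyond the first period is seen as a deficit at index [i %% p] of the
     factor that starts whole periods later. *)
  have := hg (k + i %/ p * p) (i %% p); rewrite ltn_mod p0 => /(_ isT) H.
  have e : k + i %/ p * p + i %% p = k + i by rewrite -addnA -divn_eq.
  rewrite e -hmod // in H; have := H _; rewrite leqNgt hlt => {}H.
  suff : false by []; apply: H => j hj.
  rewrite -addnA hag.
    rewrite hmod; first by rewrite modnMDl modn_small //; apply: ltn_trans hj _; rewrite ltn_mod.
    by rewrite [X in _ <= X](divn_eq i p); lia.
  by rewrite [X in _ < X](divn_eq i p); lia.
rewrite /cnt -big_split /= -[RHS](subn0 M) -[RHS]muln1 -sum_nat_const_nat.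
by apply: eq_bigr => x _; case: ltnP.
Qed.

Lemma duval0 q R : (forall i, i < R -> q i = 0) -> duval q R = 1.
Proof.
move=> h; elim: R h => //= R IH h; rewrite IH; last by move=> i hi; apply: h; lia.
by case: posnP => // hR; rewrite !h ?eqxx //; lia.
Qed.

Lemma wval_eq0 q R : (forall i, i < R -> q i = 0) -> wval s (window q 0 R) = 0.
Proof.
move=> h; rewrite -[RHS](wval_nseq0 s R); congr wval.
apply: (@eq_from_nth _ 0) => [|i]; rewrite size_window ?size_nseq // => hi.
by rewrite window_nth // nth_nseq hi h.
Qed.

Section Word.

Variable w : m.+1.-tuple 'I_s.
Let x := wval s (letters w).
Let j := lead s m (x %/ s).

Let x_lt : x < M. Proof. exact: wval_letters_lt. Qed.
Let y_lt : x %/ s < s ^ m. Proof. by rewrite ltn_divLR // -expnSr. Qed.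
Let d_lt : x %% s < s. Proof. by rewrite ltn_mod. Qed.
Let j_le : j <= m. Proof. exact: lead_le. Qed.

Lemma dg_letters i : dg x i = cyc (letters w) i.
Proof.
have hi : i %% m.+1 < m.+1 by rewrite ltn_mod.
have -> : dg x i = dg x (i %% m.+1) by rewrite /dg iter_rotw_mod.
rewrite /cyc size_letters size_tuple -[i %% m.+1]add0n -(window_nth _ _ hi) -digits_window //.
rewrite add0n; congr nth; apply: (@wval_inj s).
- exact: all_digits.
- exact: all_letters.
- by rewrite size_digits size_letters size_tuple.
- by rewrite wval_digits.
Qed.

Lemma iter_lead_word : iter j r x = fill s m (x %/ s) (x %% s).
Proof. by rewrite -iter_lead // -divn_eq. Qed.

Lemma minrot_fill : minrot s m (fill s m (x %/ s) (x %% s)) = minrot s m x.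
Proof. by rewrite -iter_lead_word minrot_iter. Qed.

(** The threshold [low] ends in [j] zeros, so the prenecklace has n - j letters. The boolean detects
    the words z^j 0^(n-j) with 0 < j, whose occurrence wraps around: for them a whole turn is
    added. *)
Lemma occ_necklace : iter j r x = minrot s m x ->
  let q := fun i => dg x (j + i) in let p := duval q (m.+1 - j) in
  occ w (dB s m.+1) + closed_sum q p m.+1 + j =
  M * (1 + [&& 0 < j, p == 1 & q 0 == 0]) + 1.
Proof.
move=> e q p; set R := m.+1 - j in p *.
have hR : 0 < R <= m.+1 by rewrite /R; lia.
have hRle : R <= m.+1 by lia.
have hpre : prenecklace q R by apply: minrot_prenecklace.
have := cnt_closed_sum hR (fun i _ => dg_lt (j + i) x_lt) hpre.
rewrite -/q -/p.
have ew : wval s (window q 0 R) = tail s m (x %/ s) * s + x %% s.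
  have -> : window q 0 R = window (dg x) j R.
    by rewrite /window -[in RHS](addn0 j) iotaDl -map_comp.
  rewrite -dg_prefix // iter_lead_word /fill /low.
  have -> : m.+1 - R = j by rewrite /R; lia.
  by rewrite divn_cat // prednK // sp_gt0.
have hn : necklace s m (fill s m (x %/ s) (x %% s)).
  by rewrite /necklace minrot_fill -e iter_lead_word.
have elow : wval s (window q 0 R) * s ^ (m.+1 - R) = low s m (x %/ s) (x %% s).
  by rewrite ew /low -/j; congr (_ * s ^ _); rewrite /R; lia.
rewrite elow => hc.
have hrank : rank s m x = cnt s m (low s m (x %/ s) (x %% s)) + m.+1 - j.
  by rewrite /rank hn.
rewrite occ_dB // /wpos -/x.
have [r1 r2 _] := rankK s_gt1 x_lt.
have hM := M_gtm m s_gt1.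
have -> : [&& 0 < j, p == 1 & q 0 == 0] = (rank s m x <= m).
  apply/idP/idP => [/and3P[j0 /eqP p1 /eqP q0]|hr].
    have hz i : i < R -> q i = 0.
      move=> hi; have hRR : 0 < R <= R by lia.
      have [_ _] := duval_spec hpre hRR; rewrite -/p p1 => hper _.
      by rewrite (periodic_mod (isT : 0 < 1) hper hi) modn1.
    by rewrite hrank -elow wval_eq0 // mul0n cnt0; lia.
  have ex := rank_small s_gt1 x_lt hr; set j' := m.+1 - _ in ex.
  have hj' : 0 < j' <= m by rewrite /j'; lia.
  have ey : x %/ s = ones s m j' by rewrite ex mulnK.
  have ed : x %% s = 0 by rewrite ex modnMl.
  have ej : j = j' by rewrite /j ey lead_ones //; lia.
  have hz i : i < R -> q i = 0.
    move=> hi; have e0 : wval s (window q 0 R) = wval s (nseq R 0).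
      by rewrite wval_nseq0 ew ed ey tail_ones //; lia.
    have := @wval_inj s (window q 0 R) (nseq R 0) _ _ _ e0.
    rewrite size_window size_nseq => H.
    have <- : nth 0 (window q 0 R) i = q i by rewrite window_nth.
    rewrite H ?nth_nseq ?hi //; first by apply: all_window => ?; apply: dg_lt.
    by rewrite all_nseq s_gt0 orbT.
  by rewrite ej /p duval0 // hz ?eqxx; lia.
case: (leqP (rank s m x) m) => h.
  by rewrite mulnDr !muln1; lia.
by rewrite addn0 muln1; lia.
Qed.

(** The last index at which the least rotation occurs is taken, since n - i0 is then below the
    period and equals the offset of the word in its class. *)
Lemma occ_nonecklace i0 : iter j r x != minrot s m x -> i0 <= m ->
  iter i0 r x = minrot s m x ->
  (forall i, i0 < i <= m -> iter i r x != minrot s m x) ->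
  let q := fun i => dg x (i0 + i) in let p := duval q m.+1 in
  occ w (dB s m.+1) + closed_sum q p m.+1 = M + 1 + (m.+1 - i0).
Proof.
move=> hne hi0 e hlast q p.
have hpre : prenecklace q m.+1 by apply: minrot_prenecklace.
have := cnt_closed_sum (_ : 0 < m.+1 <= m.+1) (fun i _ => dg_lt (i0 + i) x_lt) hpre.
rewrite leqnn => /(_ isT); rewrite -/q -/p subnn muln1.
have -> : window q 0 m.+1 = window (dg x) i0 m.+1.
  by rewrite /window -[in RHS](addn0 i0) iotaDl -map_comp.
rewrite dg_window // e => hc.
have hn : ~~ necklace s m (fill s m (x %/ s) (x %% s)).
  by rewrite /necklace minrot_fill -iter_lead_word eq_sym.
have hrank : rank s m x = cnt s m (minrot s m x) + shift s m x + m.+1.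
  by rewrite /rank (negbTE hn).
have hs : shift s m x = m.+1 - i0.
  have hmu := minrot_lt s_gt0 x_lt.
  have h1 := shift_lt s_gt0 x_lt; have h2 := iter_shift s_gt0 x_lt.
  have h3 := per_le s_gt0 hmu.
  (* The word is not its own least rotation: without leading [z] this is the hypothesis, and a
     necklace starting with [z] is constant, so all its rotations agree. *)
  have h0 : 0 < shift s m x.
    rewrite lt0n; apply/eqP => e0; rewrite e0 /= in h2.
    have hnx : necklace s m x by rewrite /necklace h2.
    case: (posnP j) => j0; first by move: hne; rewrite j0 h2 eqxx.
    have := @iter_lead_top s m s_gt1 _ _ 0 y_lt d_lt j0; rewrite /= -divn_eq => htop.
    have ex := necklace_top s_gt1 x_lt hnx htop.
    have hi k : iter k r x = x by rewrite ex; elim: k => //= k ->; exact: rotw_max.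
    by move: hne; rewrite hi h2 eqxx.
  have hle : m.+1 - shift s m x <= i0.
    rewrite leqNgt; apply/negP => hlt; have := hlast (m.+1 - shift s m x).
    rewrite hlt /= => H; have/negP := H ltac:(lia); apply.
    by rewrite -{2}h2 -iterD subnK ?iter_rotw_n //; lia.
  apply: shift_uniq => //; first by lia.
  by rewrite -e -iterD subnK ?iter_rotw_n //; lia.
have [r1 r2 _] := rankK s_gt1 x_lt.
rewrite occ_dB // /wpos -/x; case: leqP; lia.
Qed.

End Word.

End Count.

(** * A structured language compiled to RAM programs *)

Module Import Lang.

Arguments update : simpl never.

Inductive expr :=
  | Var (x : nat)
  | Num (k : nat)
  | Bin (o : binop) (e1 e2 : expr)
  | Get (a : nat) (e : expr).

Inductive cmd :=
  | Asg (x : nat) (e : expr)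
  | Put (a : nat) (e1 e2 : expr)
  | Inp (x : nat) (e : expr)
  | Out (e1 e2 : expr)
  | Seq (c1 c2 : cmd)
  | Cond (e1 e2 : expr) (c1 c2 : cmd)
  | While (e1 e2 : expr) (c : cmd).

(* [io] is the memory region shared by the input and the output; the other
   memory cells are split into the unbounded arrays [arr 0], [arr 1], ... *)
Record store := Store { var : nat -> nat; arr : nat -> nat -> nat; io : nat -> nat }.

Definition setv s x v := Store (update (var s) x v) (arr s) (io s).
Definition seta s a i v :=
  Store (var s) (fun b => if b == a then update (arr s a) i v else arr s b) (io s).
Definition seto s i v := Store (var s) (arr s) (update (io s) i v).

Fixpoint eval (s : store) (e : expr) : nat :=
  match e with
  | Var x => var s x
  | Num k => k
  | Bin o e1 e2 => eval_binop o (eval s e1) (eval s e2)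
  | Get a e => arr s a (eval s e)
  end.

Section Semantics.

(* [ok] bounds the stored values and [lim] is the size of the input/output region *)
Variables (ok : nat -> Prop) (lim : nat).

Inductive exec : cmd -> store -> nat -> store -> Prop :=
  | ExecAsg x e s : ok (eval s e) -> exec (Asg x e) s 1 (setv s x (eval s e))
  | ExecPut a e1 e2 s : ok (eval s e2) ->
      exec (Put a e1 e2) s 1 (seta s a (eval s e1) (eval s e2))
  | ExecInp x e s : eval s e < lim -> exec (Inp x e) s 1 (setv s x (io s (eval s e)))
  | ExecOut e1 e2 s : eval s e1 < lim -> ok (eval s e2) ->
      exec (Out e1 e2) s 1 (seto s (eval s e1) (eval s e2))
  | ExecSeq c1 c2 s s1 s2 t1 t2 : exec c1 s t1 s1 -> exec c2 s1 t2 s2 ->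
      exec (Seq c1 c2) s (t1 + t2) s2
  | ExecCond1 e1 e2 c1 c2 s s1 t : eval s e1 <= eval s e2 -> exec c1 s t s1 ->
      exec (Cond e1 e2 c1 c2) s t.+1 s1
  | ExecCond2 e1 e2 c1 c2 s s1 t : eval s e2 < eval s e1 -> exec c2 s t s1 ->
      exec (Cond e1 e2 c1 c2) s t.+1 s1
  | ExecDone e1 e2 c s : eval s e2 < eval s e1 -> exec (While e1 e2 c) s 1 s
  | ExecLoop e1 e2 c s s1 s2 t1 t2 : eval s e1 <= eval s e2 -> exec c s t1 s1 ->
      exec (While e1 e2 c) s1 t2 s2 -> exec (While e1 e2 c) s (t1 + t2).+1 s2.

Definition runs c s (Q : nat -> store -> Prop) := exists t s', exec c s t s' /\ Q t s'.

Fixpoint vars_set c : seq nat :=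
  match c with
  | Asg x _ | Inp x _ => [:: x]
  | Put _ _ _ | Out _ _ => [::]
  | Seq c1 c2 | Cond _ _ c1 c2 => vars_set c1 ++ vars_set c2
  | While _ _ c => vars_set c
  end.

Fixpoint arrs_set c : seq nat :=
  match c with
  | Put a _ _ => [:: a]
  | Asg _ _ | Inp _ _ | Out _ _ => [::]
  | Seq c1 c2 | Cond _ _ c1 c2 => arrs_set c1 ++ arrs_set c2
  | While _ _ c => arrs_set c
  end.

Fixpoint io_set c : bool :=
  match c with
  | Out _ _ => true
  | Asg _ _ | Inp _ _ | Put _ _ _ => false
  | Seq c1 c2 | Cond _ _ c1 c2 => io_set c1 || io_set c2
  | While _ _ c => io_set c
  end.

Definition frame c (s s' : store) :=
  [/\ forall x, x \notin vars_set c -> var s' x = var s x,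
      forall a, a \notin arrs_set c -> arr s' a = arr s a &
      ~~ io_set c -> io s' = io s].

Lemma frame_refl c s : frame c s s. Proof. by []. Qed.

Lemma frame_trans c s1 s2 s3 : frame c s1 s2 -> frame c s2 s3 -> frame c s1 s3.
Proof.
move=> [a1 a2 a3] [b1 b2 b3]; split=> *; first by rewrite b1 ?a1.
  by rewrite b2 ?a2.
by rewrite b3 ?a3.
Qed.

Lemma exec_frame c s t s' : exec c s t s' -> frame c s s'.
Proof.
elim=> {c s t s'} //=.
- by move=> x e s _; split=> //= y; rewrite inE /update => /negbTE->.
- by move=> a e1 e2 s _; split=> //= b; rewrite inE => /negbTE->.
- by move=> x e s _; split=> //= y; rewrite inE /update => /negbTE->.
- move=> c1 c2 s s1 s2 t1 t2 _ [a1 a2 a3] _ [b1 b2 b3]; split=> /=.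
  + by move=> x; rewrite mem_cat negb_or => /andP[h1 h2]; rewrite b1 ?a1.
  + by move=> x; rewrite mem_cat negb_or => /andP[h1 h2]; rewrite b2 ?a2.
  + by rewrite negb_or => /andP[h1 h2]; rewrite b3 ?a3.
- move=> e1 e2 c1 c2 s s1 t _ _ [a1 a2 a3]; split=> /=.
  + by move=> x; rewrite mem_cat negb_or => /andP[h1 h2]; rewrite a1.
  + by move=> x; rewrite mem_cat negb_or => /andP[h1 h2]; rewrite a2.
  + by rewrite negb_or => /andP[h1 h2]; rewrite a3.
- move=> e1 e2 c1 c2 s s1 t _ _ [a1 a2 a3]; split=> /=.
  + by move=> x; rewrite mem_cat negb_or => /andP[h1 h2]; rewrite a1.
  + by move=> x; rewrite mem_cat negb_or => /andP[h1 h2]; rewrite a2.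
  + by rewrite negb_or => /andP[h1 h2]; rewrite a3.
- by move=> e1 e2 c s s1 s2 t1 t2 _ _ h1 _; apply: frame_trans.
Qed.

Lemma runs_frame c s Q : runs c s Q -> runs c s (fun t s' => frame c s s' /\ Q t s').
Proof.
by move=> [t [s' [h1 h2]]]; exists t, s'; split=> //; split=> //; apply: exec_frame h1.
Qed.

Lemma runs_call c s (P Q : nat -> store -> Prop) : runs c s P ->
  (forall t s', frame c s s' -> P t s' -> Q t s') -> runs c s Q.
Proof. by move=> /runs_frame[t [s' [h1 [h2 h3]]]] h; exists t, s'; split; auto. Qed.

Lemma runs_asg x e s (Q : nat -> store -> Prop) :
  ok (eval s e) -> Q 1 (setv s x (eval s e)) -> runs (Asg x e) s Q.
Proof. by move=> h1 h2; exists 1, (setv s x (eval s e)); split=> //; constructor. Qed.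

Lemma runs_put a e1 e2 s (Q : nat -> store -> Prop) : ok (eval s e2) ->
  Q 1 (seta s a (eval s e1) (eval s e2)) -> runs (Put a e1 e2) s Q.
Proof. by move=> h1 h2; exists 1; eexists; split; [constructor|]. Qed.

Lemma runs_inp x e s (Q : nat -> store -> Prop) : eval s e < lim ->
  Q 1 (setv s x (io s (eval s e))) -> runs (Inp x e) s Q.
Proof. by move=> h1 h2; exists 1; eexists; split; [constructor|]. Qed.

Lemma runs_out e1 e2 s (Q : nat -> store -> Prop) : eval s e1 < lim -> ok (eval s e2) ->
  Q 1 (seto s (eval s e1) (eval s e2)) -> runs (Out e1 e2) s Q.
Proof. by move=> h1 h2 h3; exists 1; eexists; split; [constructor|]. Qed.

Lemma runs_seq c1 c2 s (Q : nat -> store -> Prop) :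
  runs c1 s (fun t1 s1 => runs c2 s1 (fun t2 s2 => Q (t1 + t2) s2)) ->
  runs (Seq c1 c2) s Q.
Proof.
by move=> [t1 [s1 [h1 [t2 [s2 [h2 h]]]]]]; exists (t1 + t2), s2; split=> //; econstructor; eauto.
Qed.

Lemma runs_cond e1 e2 c1 c2 s (Q : nat -> store -> Prop) :
  (eval s e1 <= eval s e2 -> runs c1 s (fun t s' => Q t.+1 s')) ->
  (eval s e2 < eval s e1 -> runs c2 s (fun t s' => Q t.+1 s')) ->
  runs (Cond e1 e2 c1 c2) s Q.
Proof.
move=> h1 h2; case: (leqP (eval s e1) (eval s e2)) => h.
  by have [t [s' [h3 h4]]] := h1 h; exists t.+1, s'; split=> //; constructor.
by have [t [s' [h3 h4]]] := h2 h; exists t.+1, s'; split=> //; apply: ExecCond2.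
Qed.

(** The number [N] of turns is known beforehand and the invariant is indexed by the turn. The frame
    is supplied with every hypothesis, so invariants speak only of what changes. *)
Lemma runs_while e1 e2 c s N (I : nat -> store -> Prop) (cost : nat -> nat) Q :
  I 0 s ->
  (forall i s', i < N -> I i s' -> frame c s s' -> eval s' e1 <= eval s' e2 /\
     runs c s' (fun t s'' => t <= cost i /\ I i.+1 s'')) ->
  (forall s', I N s' -> frame c s s' -> eval s' e2 < eval s' e1) ->
  (forall t s', frame c s s' -> t <= \sum_(i < N) (cost i).+1 + 1 -> I N s' -> Q t s') ->
  runs (While e1 e2 c) s Q.
Proof.
move=> h0 hstep hend hQ.
have H k : k <= N -> forall s', I (N - k) s' -> frame c s s' ->
    runs (While e1 e2 c) s' (fun t s'' => [/\ frame c s s'',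
      t <= \sum_(N - k <= i < N) (cost i).+1 + 1 & I N s'']).
  elim: k => [|k IH] hk s' hI hf.
    exists 1, s'; rewrite subn0 in hI *; split; last by split=> //; rewrite big_geq.
    by apply: ExecDone; apply: hend.
  have [h1 [t1 [s1 [x1 [c1 I1]]]]] := hstep (N - k.+1) s' ltac:(lia) hI hf.
  have e : (N - k.+1).+1 = N - k by lia.
  rewrite e in I1; have hf1 := frame_trans hf (exec_frame x1).
  have [t2 [s2 [x2 [f2 c2 I2]]]] := IH (ltnW hk) s1 I1 hf1.
  exists (t1 + t2).+1, s2; split; first by econstructor; eauto.
  split=> //; rewrite big_ltn ?e; last lia.
  by lia.
have := H N (leqnn N) s; rewrite subnn => /(_ h0 (frame_refl _ _))[t [s' [x [f hc hI]]]].
by exists t, s'; split=> //; apply: hQ => //; rewrite big_mkord in hc.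
Qed.

(** The language tests only [<=], hence the [+ 1]. The bound [e] is evaluated anew at each turn,
    which is why [runs_for] asks that its value stays [hi]. *)
Definition For x e c := While (Bin Plus (Var x) (Num 1)) e (Seq c (Asg x (Bin Plus (Var x) (Num 1)))).

Lemma runs_for x e c s lo hi (I : nat -> store -> Prop) (cost : nat -> nat) Q :
  var s x = lo -> lo <= hi -> I lo s ->
  x \notin vars_set c ->
  (forall i, lo < i <= hi -> ok i) ->
  (forall i s', lo <= i <= hi -> I i s' -> var s' x = i -> frame (For x e c) s s' ->
     eval s' e = hi) ->
  (forall i s', lo <= i < hi -> I i s' -> var s' x = i -> frame (For x e c) s s' ->
     runs c s' (fun t s'' => t <= cost i /\ (frame c s' s'' -> I i.+1 (setv s'' x i.+1)))) ->
  (forall t s', frame (For x e c) s s' -> t <= \sum_(lo <= i < hi) (cost i + 2) + 1 ->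
     I hi s' -> var s' x = hi -> Q t s') ->
  runs (For x e c) s Q.
Proof.
move=> hx hlh h0 hxc hok hev hbody hQ.
have fr s' : frame (Seq c (Asg x (Bin Plus (Var x) (Num 1)))) s s' -> frame (For x e c) s s'.
  by [].
apply: (@runs_while _ _ _ _ (hi - lo) (fun i s' => I (lo + i) s' /\ var s' x = lo + i)
   (fun i => (cost (lo + i)).+1)).
- by rewrite addn0.
- move=> i s' hi1 [hI hv] hf; split.
    by rewrite (hev (lo + i)) //=; [rewrite hv; lia|lia].
  apply: runs_seq.
  apply: runs_call (hbody (lo + i) s' _ hI hv (fr _ hf)) _; first by lia.
  move=> t1 s1 f1 [ht hI1]; have hv1 : var s1 x = lo + i by case: f1 => ->.
  apply: runs_asg; first by rewrite /= hv1; apply: hok; lia.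
  have -> : eval s1 (Bin Plus (Var x) (Num 1)) = (lo + i).+1 by rewrite /= hv1 addn1.
  split; first lia.
  by rewrite addnS; split; [exact: hI1|rewrite /= /update eqxx].
- move=> s' [hI hv] hf; rewrite subnKC // in hI hv.
  by rewrite (hev hi) ?hlh ?leqnn //= hv addn1.
- move=> t s' hf ht [hI hv]; rewrite subnKC // in hI hv; apply: hQ => //.
  apply: leq_trans ht _; rewrite leq_add2r -[X in \sum_(X <= _ < _) _](add0n lo) big_addn big_mkord.
  by apply: leq_sum => i _; rewrite [i + lo]addnC; lia.
Qed.

End Semantics.

Arguments exec_frame {ok lim c s t s'}.
Arguments runs_call {ok lim c s P Q}.

End Lang.

(* Registers below [base_reg] hold the variables, [base_reg] holds the address
   of the first array cell, and the registers from [tmp] on are scratch. *)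
Definition base_reg := 40.
Definition tmp := 41.
Definition n_arr := 24.

(** The arrays are interleaved with stride [n_arr] above the input and output region, so each of
    them is unbounded. *)
Definition locate a d :=
  [:: Const d.+1 n_arr; Op Times d d d.+1; Const d.+1 a; Op Plus d d d.+1;
      Op Plus d d base_reg].

Fixpoint comp_expr e d : seq instr :=
  match e with
  | Var x => [:: Const d 0; Op Plus d d x]
  | Num k => [:: Const d k]
  | Bin o e1 e2 => comp_expr e1 d ++ comp_expr e2 d.+1 ++ [:: Op o d d d.+1]
  | Get a e => comp_expr e d ++ locate a d ++ [:: Read d d]
  end.

(** Jumps are absolute, so the code depends on its address [p]. A move is an addition to 0, and
    [JumpLe 0 0] is an unconditional jump. *)
Fixpoint comp c p : seq instr :=
  match c with
  | Asg x e => comp_expr e tmp ++ [:: Const x 0; Op Plus x x tmp]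
  | Put a e1 e2 => comp_expr e1 tmp ++ locate a tmp ++ comp_expr e2 tmp.+1
      ++ [:: Write tmp tmp.+1]
  | Inp x e => comp_expr e tmp ++ [:: Read x tmp]
  | Out e1 e2 => comp_expr e1 tmp ++ comp_expr e2 tmp.+1 ++ [:: Write tmp tmp.+1]
  | Seq c1 c2 => let k1 := comp c1 p in k1 ++ comp c2 (p + size k1)
  | Cond e1 e2 c1 c2 =>
      let b := comp_expr e1 tmp ++ comp_expr e2 tmp.+1 in
      let p2 := p + (size b).+1 in let k2 := comp c2 p2 in
      let p1 := p2 + (size k2).+1 in let k1 := comp c1 p1 in
      b ++ JumpLe tmp tmp.+1 p1 :: k2 ++ JumpLe 0 0 (p1 + size k1) :: k1
  | While e1 e2 c =>
      let b := comp_expr e1 tmp ++ comp_expr e2 tmp.+1 in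
      let p1 := p + (size b).+2 in let k := comp c p1 in
      b ++ [:: JumpLe tmp tmp.+1 p1; JumpLe 0 0 (p1 + (size k).+1)] ++ k ++ [:: JumpLe 0 0 p]
  end.

(* all intermediate results in the evaluation of an expression of degree [d] are
   at most [X ^ d] if variables and array cells are at most [X] *)
Fixpoint deg e :=
  match e with
  | Var _ => 1
  | Num k => k.+1
  | Bin _ e1 e2 => deg e1 + deg e2
  | Get a e => deg e + n_arr + a + 4
  end.

Fixpoint wf_expr D e :=
  (deg e <= D) && match e with
  | Var x => x < base_reg
  | Num _ => true
  | Bin _ e1 e2 => wf_expr D e1 && wf_expr D e2
  | Get a e => (a < n_arr) && wf_expr D e
  end.

Fixpoint wf D c :=
  match c with
  | Asg x e | Inp x e => (x < base_reg) && wf_expr D e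
  | Put a e1 e2 => [&& wf_expr D (Get a e1) & wf_expr D e2]
  | Out e1 e2 => wf_expr D e1 && wf_expr D e2
  | Seq c1 c2 => wf D c1 && wf D c2
  | Cond e1 e2 c1 c2 => [&& wf_expr D e1, wf_expr D e2, wf D c1 & wf D c2]
  | While e1 e2 c => [&& wf_expr D e1, wf_expr D e2 & wf D c]
  end.

Arguments Defs.run : simpl never.

(** * Correctness of the compiler *)

Section Compiler.

Variables (norm : nat -> nat) (fits : nat -> nat -> Prop) (D lim : nat).
Hypothesis fits_mono : forall d d' v, d <= d' -> fits d v -> fits d' v.
Hypothesis fits_num : forall k, fits k.+1 k.
Hypothesis fits_bin : forall o d1 d2 x y, 0 < d1 -> 0 < d2 -> fits d1 x -> fits d2 y ->
  fits (d1 + d2) (eval_binop o x y).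
Hypothesis fits_norm : forall d v, d <= D -> fits d v -> norm v = v.
Hypothesis fits_lim : fits 1 lim.

Variable P : program.

Local Notation run := (run norm P).

Definition code_at p (k : seq instr) := forall i, i < size k -> onth P (p + i) = onth k i.

Lemma onth_cat1 (T : Type) (k1 k2 : seq T) i : i < size k1 -> onth (k1 ++ k2) i = onth k1 i.
Proof. by elim: k1 i => [|a k1 IH] [|i] //= h; apply: IH. Qed.

Lemma onth_cat2 (T : Type) (k1 k2 : seq T) i : onth (k1 ++ k2) (size k1 + i) = onth k2 i.
Proof. by elim: k1. Qed.

Lemma code_at_cat p k1 k2 : code_at p (k1 ++ k2) -> code_at p k1 /\ code_at (p + size k1) k2.
Proof.
move=> h; split=> i hi.
  by rewrite h ?onth_cat1 // size_cat ltn_addr.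
by rewrite -addnA h ?onth_cat2 // size_cat ltn_add2l.
Qed.

Lemma code_at_cons p i k : code_at p (i :: k) -> onth P p = Some i /\ code_at p.+1 k.
Proof.
move=> h; split; first by have := h 0 isT; rewrite addn0.
by move=> j hj; rewrite addSnnS h.
Qed.

Lemma code_at_eq p p' k : p = p' -> code_at p k -> code_at p' k.
Proof. by move=> ->. Qed.

Lemma run_step m i : onth P (pc m) = Some i -> run 1 m = Defs.exec norm i m.
Proof. by rewrite /Defs.run /= /step => ->. Qed.

Lemma runD t1 t2 m : run (t1 + t2) m = run t2 (run t1 m).
Proof. by rewrite /Defs.run addnC iterD. Qed.

Definition bounded s := [/\ forall x, fits 1 (var s x), forall a i, fits 1 (arr s a i)
  & forall i, fits 1 (io s i)].

Definition cell_of a i := i * n_arr + a + lim.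

Definition rep s m := [/\ forall x, x < base_reg -> reg m x = var s x,
  reg m base_reg = lim,
  forall a i, a < n_arr -> cell m (cell_of a i) = arr s a i
  & forall i, i < lim -> cell m i = io s i].

Lemma cell_of_inj a b i j : a < n_arr -> b < n_arr -> cell_of a i = cell_of b j ->
  a = b /\ i = j.
Proof.
move=> ha hb /addIn e; split.
  by rewrite -(modn_small ha) -(modnMDl i) e modnMDl modn_small.
by have := congr1 (divn^~ n_arr) e; rewrite !divnMDl // !divn_small // !addn0.
Qed.

Lemma deg_gt0 e : 0 < deg e.
Proof. by elim: e => //= *; lia. Qed.

Lemma wf_deg E e : wf_expr E e -> deg e <= E.
Proof. by case: e => [x|k|o e1 e2|a e] /= /andP[]. Qed.

Lemma fits_eval s e : bounded s -> fits (deg e) (eval s e).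
Proof.
move=> [b1 b2 b3]; elim: e => [x|k|o e1 IH1 e2 IH2|a e IH] //=.
  by apply: fits_bin => //; exact: deg_gt0.
by apply: fits_mono (b2 _ _); lia.
Qed.

Lemma run_op o d x y p m : code_at p [:: Op o d x y] -> pc m = p ->
  norm (eval_binop o (reg m x) (reg m y)) = eval_binop o (reg m x) (reg m y) ->
  run 1 m = State p.+1 (update (reg m) d (eval_binop o (reg m x) (reg m y))) (cell m).
Proof.
by move=> /code_at_cons[h _] e hn; rewrite -e in h; rewrite (run_step h); case: m e hn {h} => p' r c /= -> ->.
Qed.

Lemma run_const d k p m : code_at p [:: Const d k] -> pc m = p -> norm k = k ->
  run 1 m = State p.+1 (update (reg m) d k) (cell m).
Proof.
by move=> /code_at_cons[h _] e hn; rewrite -e in h; rewrite (run_step h); case: m e {h} => p' r c /= ->; rewrite hn.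
Qed.

Lemma run_read d x p m : code_at p [:: Read d x] -> pc m = p ->
  run 1 m = State p.+1 (update (reg m) d (cell m (reg m x))) (cell m).
Proof.
by move=> /code_at_cons[h _] e; rewrite -e in h; rewrite (run_step h); case: m e {h} => p' r c /= ->.
Qed.

Lemma run_write x y p m : code_at p [:: Write x y] -> pc m = p ->
  run 1 m = State p.+1 (reg m) (update (cell m) (reg m x) (reg m y)).
Proof.
by move=> /code_at_cons[h _] e; rewrite -e in h; rewrite (run_step h); case: m e {h} => p' r c /= ->.
Qed.

Lemma run_jump x y l p m : code_at p [:: JumpLe x y l] -> pc m = p ->
  run 1 m = State (if reg m x <= reg m y then l else p.+1) (reg m) (cell m).
Proof.
by move=> /code_at_cons[h _] e; rewrite -e in h; rewrite (run_step h); case: m e {h} => p' r c /= ->.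
Qed.

Lemma norm_num k d : d <= D -> k < d -> norm k = k.
Proof. by move=> h1 h2; apply: (fits_norm h1); apply: fits_mono (fits_num k). Qed.

Lemma run_locate p a d e m v : code_at p (locate a d) -> pc m = p ->
  reg m base_reg = lim -> base_reg < d -> reg m d = v -> 0 < e -> fits e v ->
  e + n_arr + a + 4 <= D ->
  let m' := run 5 m in
  [/\ pc m' = p + 5, reg m' d = cell_of a v, cell m' = cell m &
      forall x, x < d -> reg m' x = reg m x].
Proof.
move=> hc hp hb hd hv he hf hD.
have [c1 hc1] := @code_at_cat p [:: _] _ hc.
have [c2 hc2] := @code_at_cat _ [:: _] _ hc1.
have [c3 hc3] := @code_at_cat _ [:: _] _ hc2.
have [c4 c5] := @code_at_cat _ [:: _] _ hc3.
have f1 : fits (e + n_arr.+1) (v * n_arr) by apply: (@fits_bin Times).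
have f2 : fits (e + n_arr.+1 + a.+1) (v * n_arr + a) by apply: (@fits_bin Plus) => //; lia.
have f3 : fits (e + n_arr.+1 + a.+1 + 1) (v * n_arr + a + lim).
  by apply: (@fits_bin Plus) => //; lia.
have ud (r : nat -> nat) x w : update r d w x = if x == d then w else r x by [].
rewrite /= addn1 in c2 c3 c4 c5; rewrite !addn1 in c3 c4 c5.
rewrite -[5]/(1 + (1 + (1 + (1 + 1)))) !runD.
have e1 : (d == d.+1) = false by rewrite ltn_eqF.
have e3 : (base_reg == d) = false by rewrite ltn_eqF.
have e4 : (base_reg == d.+1) = false by rewrite ltn_eqF // ltnS ltnW.
rewrite (run_const c1 hp); last by apply: (@norm_num _ n_arr.+1) => //; lia.
set m1 := State _ _ _; rewrite (@run_op _ _ _ _ _ m1 c2) //=; last first.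
  by rewrite /update eqxx e1 hv; apply: fits_norm f1; lia.
set m2 := State _ _ _; rewrite (@run_const _ _ _ m2 c3) //; last first.
  by apply: (@norm_num _ a.+1) => //; lia.
set m3 := State _ _ _; rewrite (@run_op _ _ _ _ _ m3 c4) //=; last first.
  by rewrite /update !eqxx e1 hv; apply: fits_norm f2; lia.
set m4 := State _ _ _; rewrite (@run_op _ _ _ _ _ m4 c5) //=; last first.
  by rewrite /update !eqxx e1 e3 e4 hv hb; apply: fits_norm f3; lia.
split=> //; first by lia.
  by rewrite /update !eqxx e1 e3 e4 hv hb.
move=> x hx; rewrite /update ltn_eqF // [x == _]ltn_eqF //; lia.
Qed.

Lemma run_expr e d p s m : wf_expr D e -> base_reg < d -> code_at p (comp_expr e d) ->
  pc m = p -> rep s m -> bounded s ->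
  let m' := run (size (comp_expr e d)) m in
  [/\ pc m' = p + size (comp_expr e d), reg m' d = eval s e, cell m' = cell m &
      forall x, x < d -> reg m' x = reg m x].
Proof.
elim: e d p m => [x|k|o e1 IH1 e2 IH2|a e IH] d p m.
- move=> /= /andP[hD hx] hd hc hp hr hb.
  have [c1 c2] := @code_at_cat p [:: _] _ hc; rewrite /= addn1 in c2.
  have hxd : (x == d) = false by rewrite ltn_eqF // (ltn_trans hx).
  have [r1 _ _ _] := hr; have [b1 _ _] := hb.
  rewrite -[2]/(1 + 1) runD (run_const c1 hp); last by apply: (@norm_num _ 1).
  rewrite (run_op c2) //=; last first.
    by rewrite /update eqxx hxd r1 // add0n; apply: (fits_norm hD).
  rewrite /update !eqxx hxd r1 // add0n; split=> //; first by rewrite addn2.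
  by move=> y hy; rewrite ltn_eqF.
- move=> /= /andP[hD _] hd hc hp hr hb.
  rewrite (run_const hc hp); last by apply: (@norm_num _ k.+1).
  by rewrite /= addn1 /update eqxx; split=> // x hx; rewrite ltn_eqF.
- move=> /= /and3P[hD h1 h2] hd hc hp hr hb.
  have [c1 hc1] := code_at_cat hc; have [c2 c3] := code_at_cat hc1.
  have [p1 v1 k1 r1] := IH1 d p m h1 hd c1 hp hr hb.
  rewrite !size_cat !runD; move: p1 v1 k1 r1; set m1 := run _ m => p1 v1 k1 r1.
  have rep1 : rep s m1.
    case: hr => q1 q2 q3 q4; split; rewrite ?k1 //; last by rewrite r1.
    by move=> x hx; rewrite r1 ?q1 // (ltn_trans hx).
  have [p2 v2 k2 r2] := IH2 d.+1 _ m1 h2 (leqW hd) c2 p1 rep1 hb.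
  move: p2 v2 k2 r2; set m2 := run _ m1 => p2 v2 k2 r2.
  rewrite (run_op c3) //=; last first.
    rewrite v2 r2 // v1; apply: (fits_norm hD); apply: fits_bin; rewrite ?deg_gt0 //; exact: fits_eval.
  rewrite /update eqxx v2 r2 // v1 k2 k1; split=> //; first by lia.
  by move=> x hx; rewrite ltn_eqF // r2 ?r1 // ltnW.
- move=> /= /and3P[hD ha h1] hd hc hp hr hb.
  have [c1 hc1] := code_at_cat hc; have [c2 c3] := @code_at_cat _ (locate a d) _ hc1.
  have [p1 v1 k1 r1] := IH d p m h1 hd c1 hp hr hb.
  rewrite size_cat runD; move: p1 v1 k1 r1; set m1 := run _ m => p1 v1 k1 r1.
  have hb1 : reg m1 base_reg = lim by case: hr => _ q2 _ _; rewrite r1.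
  rewrite -[size _]/(5 + 1) runD.
  have [p2 v2 k2 r2] := run_locate c2 p1 hb1 hd v1 (deg_gt0 e) (fits_eval e hb) hD.
  move: p2 v2 k2 r2; set m2 := run _ m1 => p2 v2 k2 r2.
  rewrite (run_read c3) //= v2 k2 k1 /update eqxx; split=> //; first by lia.
    by case: hr => _ _ q3 _; rewrite q3.
  by move=> x hx; rewrite ltn_eqF // r2 ?r1.
Qed.

Lemma run_expr2 e1 e2 p s m : wf_expr D e1 -> wf_expr D e2 ->
  code_at p (comp_expr e1 tmp ++ comp_expr e2 tmp.+1) -> pc m = p -> rep s m -> bounded s ->
  let k := size (comp_expr e1 tmp ++ comp_expr e2 tmp.+1) in let m' := run k m in
  [/\ pc m' = p + k, reg m' tmp = eval s e1, reg m' tmp.+1 = eval s e2 & rep s m'].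
Proof.
move=> h1 h2 /code_at_cat[c1 c2] hp hr hb; rewrite /= size_cat runD.
have [p1 v1 k1 r1] := run_expr h1 (leqnn _) c1 hp hr hb.
move: p1 v1 k1 r1; set m1 := run _ m => p1 v1 k1 r1.
have rep1 : rep s m1.
  case: hr => q1 q2 q3 q4; split; rewrite ?k1 //; last by rewrite r1.
  by move=> x hx; rewrite r1 ?q1 // (ltn_trans hx).
have [p2 v2 k2 r2] := @run_expr e2 tmp.+1 _ s m1 h2 isT c2 p1 rep1 hb.
move: p2 v2 k2 r2; set m2 := run _ m1 => p2 v2 k2 r2; split=> //; first by lia.
  by rewrite r2.
case: rep1 => q1 q2 q3 q4; split; rewrite ?k2 //; last by rewrite r2.
by move=> x hx; rewrite r2 ?q1 // (ltn_trans hx).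
Qed.

Lemma exec_bounded c s t s' : exec (fits 1) lim c s t s' -> bounded s -> bounded s'.
Proof.
elim=> {c s t s'} //=.
- by move=> x e s h [b1 b2 b3]; split=> //= y; rewrite /update; case: ifP.
- move=> a e1 e2 s h [b1 b2 b3]; split=> //= b i; case: ifP => // _.
  by rewrite /update; case: ifP.
- by move=> x e s _ [b1 b2 b3]; split=> //= y; rewrite /update; case: ifP.
- by move=> e1 e2 s _ h [b1 b2 b3]; split=> //= i; rewrite /update; case: ifP.
- by move=> *; auto.
- by move=> *; auto.
Qed.

(** Between two cost units at most the code of the whole command is executed, so one bound [K] on
    its size serves for all subcommands and all turns of a loop. *)
Lemma comp_correct c s t s' : exec (fits 1) lim c s t s' -> forall K p m, wf D c ->
  code_at p (comp c p) -> size (comp c p) <= K -> pc m = p -> rep s m -> bounded s ->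
  exists t', [/\ t' <= K * t, pc (run t' m) = p + size (comp c p) & rep s' (run t' m)].
Proof.
elim=> {c s t s'}.
- move=> x e s hok K p m /= /andP[hx he] /code_at_cat[c1 hc] hK hp hr hb.
  have [c2 c3] := @code_at_cat _ [:: _] _ hc.
  exists (size (comp_expr e tmp) + (1 + 1)); rewrite size_cat in hK *.
  have [p1 v1 k1 r1] := run_expr he (leqnn _) c1 hp hr hb.
  rewrite !runD; move: p1 v1 k1 r1; set m1 := run _ m => p1 v1 k1 r1.
  have hxt : (tmp == x) = false by rewrite gtn_eqF // (ltn_trans hx).
  have hwd := wf_deg he; have hd0 := deg_gt0 e.
  rewrite (run_const c2 p1) //; last by apply: (@norm_num _ 1); lia.
  rewrite (run_op c3) //=; last 2 first.
  + by rewrite addn1.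
  + by rewrite /update eqxx hxt v1 add0n; apply: (@fits_norm 1) => //; lia.
  case: hr => q1 q2 q3 q4; split; [by rewrite /= in hK *; lia|by rewrite ?size_cat /=; lia|].
  split; rewrite ?k1 //.
  + move=> y hy; rewrite [reg _]/= [var _]/= /update eqxx hxt v1 add0n; case: eqP => // _.
    by rewrite r1 ?q1 // (ltn_trans hy).
  + by rewrite [reg _]/= /update !gtn_eqF // r1.
- move=> a e1 e2 s hok K p m /= /andP[/and3P[hD ha h1] h2] /code_at_cat[c1 hc1] hK hp hr hb.
  have [c2 hc2] := @code_at_cat _ (locate a tmp) _ hc1; have [c3 c4] := code_at_cat hc2.
  rewrite size_cat in hK *; rewrite -[size (_ :: _)]/(5 + size (comp_expr e2 tmp.+1 ++ [:: Write tmp tmp.+1])) in hK *.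
  rewrite size_cat in hK *.
  exists (size (comp_expr e1 tmp) + (5 + (size (comp_expr e2 tmp.+1) + 1))); rewrite !runD.
  have [p1 v1 k1 r1] := run_expr h1 (leqnn _) c1 hp hr hb.
  move: p1 v1 k1 r1; set m1 := run _ m => p1 v1 k1 r1.
  have hb1 : reg m1 base_reg = lim by case: hr => _ q2 _ _; rewrite r1.
  have [p2 v2 k2 r2] := run_locate c2 p1 hb1 (leqnn _) v1 (deg_gt0 e1) (fits_eval e1 hb) hD.
  move: p2 v2 k2 r2; set m2 := run _ m1 => p2 v2 k2 r2.
  have rep2 : rep s m2.
    case: hr => q1 q2 q3 q4; split; rewrite ?k2 ?k1 //; last by rewrite r2 ?r1.
    by move=> x hx; rewrite r2 ?r1 ?q1 // (ltn_trans hx).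
  have [p3 v3 k3 r3] := @run_expr e2 tmp.+1 _ s m2 h2 isT c3 p2 rep2 hb.
  move: p3 v3 k3 r3; set m3 := run _ m2 => p3 v3 k3 r3.
  rewrite (run_write c4) //= v3 r3 // v2 k3.
  case: rep2 => q1 q2 q3 q4; split; [by rewrite /= in hK *; lia|by rewrite /= ?size_cat /= in p3 *; lia|split].
  + by move=> x hx; rewrite r3 ?q1 // (ltn_trans hx).
  + by rewrite r3.
  + move=> b i hbn; rewrite [cell _]/= [arr _]/= /update; case: (eqVneq (cell_of b i) (cell_of a (eval s e1))) => e.
      by have [-> ->] := cell_of_inj hbn ha e; rewrite !eqxx.
    case: eqP => [eb|_]; last by rewrite q3.
    by case: eqP => [ei|_]; [rewrite eb ei eqxx in e|rewrite q3 ?eb].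
  + by move=> i hi; rewrite [cell _]/= [io _]/= /update ltn_eqF ?q4 // /cell_of; lia.
- move=> x e s hl K p m /= /andP[hx he] /code_at_cat[c1 c2] hK hp hr hb.
  exists (size (comp_expr e tmp) + 1); rewrite size_cat in hK *.
  have [p1 v1 k1 r1] := run_expr he (leqnn _) c1 hp hr hb.
  rewrite !runD; move: p1 v1 k1 r1; set m1 := run _ m => p1 v1 k1 r1.
  rewrite (run_read c2) //=; case: hr => q1 q2 q3 q4; split; [by rewrite /= in hK *; lia|by rewrite ?size_cat /=; lia|].
  split; rewrite ?k1 //.
  + move=> y hy; rewrite [reg _]/= [var _]/= /update v1; case: eqP => // _; first by rewrite q4.
    by rewrite r1 ?q1 // (ltn_trans hy).
  + by rewrite [reg _]/= /update gtn_eqF // r1.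
- move=> e1 e2 s hl hok K p m /= /andP[h1 h2]; rewrite catA.
  set b := comp_expr e1 tmp ++ _ => /code_at_cat[c1 c2]; rewrite size_cat => hK hp hr hb.
  have [p1 v1 v2 rep1] := run_expr2 h1 h2 c1 hp hr hb.
  rewrite -/b in p1 v1 v2 rep1; set m1 := run _ m in p1 v1 v2 rep1.
  exists (size b + 1); rewrite runD -/m1 (run_write c2) // v1 v2.
  case: rep1 => q1 q2 q3 q4; split; [by rewrite /= in hK *; lia|by rewrite /= addn1 addnS|split=> //].
  + by move=> a i ha; rewrite [cell _]/= /update gtn_eqF ?q3 // /cell_of; lia.
  + by move=> i hi; rewrite [cell _]/= [io _]/= /update; case: eqP => // _; apply: q4.
- move=> c1 c2 s s1 s2 t1 t2 x1 IH1 x2 IH2 K p m /= /andP[h1 h2] /code_at_cat[d1 d2] hK hp hr hb.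
  rewrite size_cat in hK *.
  have [u1 [a1 a2 a3]] := IH1 K p m h1 d1 ltac:(lia) hp hr hb.
  have [u2 [b1 b2 b3]] := IH2 K _ _ h2 d2 ltac:(lia) a2 a3 (exec_bounded x1 hb).
  by exists (u1 + u2); rewrite runD; split=> //; [lia|rewrite b2; lia].
- move=> e1 e2 c1 c2 s s1 t hle x1 IH K p m /= /and4P[h1 h2 w1 w2].
  set b := comp_expr e1 tmp ++ comp_expr e2 tmp.+1 => /code_at_cat[d1 hd]; rewrite size_cat /= size_cat /= => hK hp hr hb.
  have [p1 v1 v2 rep1] := run_expr2 h1 h2 d1 hp hr hb.
  rewrite -/b in p1 v1 v2 rep1; set m1 := run _ m in p1 v1 v2 rep1.
  have [d2 hd2] := @code_at_cat _ [:: _] _ hd.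
  have [d3 hd3] := code_at_cat hd2; have [d4 d5] := @code_at_cat _ [:: _] _ hd3.
  set q2 := p + (size b).+1 in d2 d3 d4 d5 hK *.
  set k2 := comp c2 q2 in d2 d3 d4 d5 hK *; set q1 := q2 + (size k2).+1 in d2 d4 d5 hK *.
  have {}d5 : code_at q1 (comp c1 q1).
    by apply: code_at_eq d5; rewrite /q1 /q2 /=; lia.
  have [u [a1 a2 a3]] := IH K q1 (run 1 m1) w1 d5 ltac:(lia)
    ltac:(by rewrite (run_jump d2) //= v1 v2 hle) ltac:(by rewrite (run_jump d2)) hb.
  exists (size b + (1 + u)); rewrite !runD -/m1; split=> //; first lia.
  by rewrite a2 /q1 /q2; lia.
- move=> e1 e2 c1 c2 s s1 t hle x1 IH K p m /= /and4P[h1 h2 w1 w2].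
  set b := comp_expr e1 tmp ++ comp_expr e2 tmp.+1 => /code_at_cat[d1 hd]; rewrite size_cat /= size_cat /= => hK hp hr hb.
  have [p1 v1 v2 rep1] := run_expr2 h1 h2 d1 hp hr hb.
  rewrite -/b in p1 v1 v2 rep1; set m1 := run _ m in p1 v1 v2 rep1.
  have [d2 hd2] := @code_at_cat _ [:: _] _ hd.
  have [d3 hd3] := code_at_cat hd2; have [d4 d5] := @code_at_cat _ [:: _] _ hd3.
  set q2 := p + (size b).+1 in d2 d3 d4 d5 hK *.
  set k2 := comp c2 q2 in d2 d3 d4 d5 hK *; set q1 := q2 + (size k2).+1 in d2 d4 d5 hK *.
  have {}d3 : code_at q2 k2 by apply: code_at_eq d3; rewrite /q2 /=; lia.
  have {}d4 : code_at (q2 + size k2) [:: JumpLe 0 0 (q1 + size (comp c1 q1))].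
    by apply: code_at_eq d4; rewrite /q2 /=; lia.
  have hfalse : (reg m1 tmp <= reg m1 tmp.+1) = false by rewrite v1 v2 leqNgt hle.
  have [u [a1 a2 a3]] := IH K q2 (run 1 m1) w2 d3 ltac:(rewrite -/k2; lia)
    ltac:(by rewrite (run_jump d2) //= hfalse /q2; lia) ltac:(by rewrite (run_jump d2)) hb.
  exists (size b + (1 + (u + 1))); rewrite !runD -/m1 (run_jump d4) // leqnn.
  by split=> //; [lia|rewrite /= /q1 /q2; lia].
- move=> e1 e2 c s hlt K p m /= /and3P[h1 h2 w1].
  set b := comp_expr e1 tmp ++ comp_expr e2 tmp.+1 => /code_at_cat[d1 hd]; rewrite size_cat /= size_cat /= => hK hp hr hb.
  have [p1 v1 v2 rep1] := run_expr2 h1 h2 d1 hp hr hb.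
  rewrite -/b in p1 v1 v2 rep1; set m1 := run _ m in p1 v1 v2 rep1.
  have [d2 hd2] := @code_at_cat _ [:: _] _ hd; have [d3 _] := @code_at_cat _ [:: _] _ hd2.
  have hfalse : (reg m1 tmp <= reg m1 tmp.+1) = false by rewrite v1 v2 leqNgt hlt.
  exists (size b + (1 + 1)); rewrite !runD -/m1 (run_jump d2 p1) hfalse.
  rewrite (run_jump d3) ?leqnn; last by rewrite /= addn1.
  clearbody b; split=> //; rewrite /= ?size_cat /= ?size_cat /=; lia.
- move=> e1 e2 c s s1 s2 t1 t2 hle x1 IH1 x2 IH2 K p m hw hc hK hp hr hb.
  move: (hw) (hc) (hK) => /= /and3P[h1 h2 w1].
  set b := comp_expr e1 tmp ++ comp_expr e2 tmp.+1 => /code_at_cat[d1 hd]; rewrite size_cat /= size_cat /= => hK' .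
  have [p1 v1 v2 rep1] := run_expr2 h1 h2 d1 hp hr hb.
  rewrite -/b in p1 v1 v2 rep1; set m1 := run _ m in p1 v1 v2 rep1.
  have [d2 hd2] := @code_at_cat _ [:: _] _ hd; have [_ hd3] := @code_at_cat _ [:: _] _ hd2.
  set q := p + (size b).+2 in d2 hd3 hK' *.
  have {}hd3 : code_at q (comp c q ++ [:: JumpLe 0 0 p]).
    by apply: code_at_eq hd3; rewrite /q /=; lia.
  have [d3 d4] := code_at_cat hd3.
  have [u1 [a1 a2 a3]] := IH1 K q (run 1 m1) w1 d3 ltac:(lia)
    ltac:(by rewrite (run_jump d2) //= v1 v2 hle) ltac:(by rewrite (run_jump d2)) hb.
  set m2 := run u1 _ in a2 a3.
  have r3 : rep s1 (run 1 m2) by rewrite (run_jump d4 a2); case: a3.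
  have e3 : pc (run 1 m2) = p by rewrite (run_jump d4 a2) leqnn.
  have [u2 [b1 b2 b3]] := IH2 K p (run 1 m2) hw hc hK e3 r3 (exec_bounded x1 hb).
  exists (size b + (1 + (u1 + (1 + u2)))); rewrite !runD -/m1 -/m2; split=> //.
  - lia.
  - by rewrite b2 [comp _ _]/= -/b -/q size_cat /= size_cat.
Qed.

End Compiler.

(** * The string phase *)

Notation "a +' b" := (Bin Plus a b) (at level 50, left associativity).
Notation "a -' b" := (Bin Minus a b) (at level 50, left associativity).
Notation "a *' b" := (Bin Times a b) (at level 40, left associativity).
Notation "a /' b" := (Bin Quo a b) (at level 40, left associativity).
Notation "a %' b" := (Bin Rem a b) (at level 40, left associativity).
Notation "c1 ;; c2" := (Seq c1 c2) (at level 70, right associativity).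
Notation "x ::= e" := (Asg x e) (at level 65).

Definition skip := 39 ::= Num 0.

Lemma runs_skip (ok : nat -> Prop) lim s (Q : nat -> store -> Prop) :
  ok 0 -> Q 1 (setv s 39 0) -> runs ok lim skip s Q.
Proof. by move=> h1 h2; apply: runs_asg. Qed.

Lemma sum_cost lo hi c : \sum_(lo <= i < hi) (c + 2) = (hi - lo) * (c + 2).
Proof. by rewrite sum_nat_const_nat. Qed.

Arguments window : simpl never.

Ltac simp_store := rewrite /= /update /=.

Ltac use_frame F :=
  let f1 := fresh "f" in let f2 := fresh "f" in let f3 := fresh "f" in
  case: (F) => f1 f2 f3;
  repeat match goal with
  | |- context [var _ ?x] => rewrite (f1 x isT)
  | |- context [arr _ ?a] => rewrite (f2 a isT)
  | |- context [io _] => rewrite (f3 isT)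
  end;
  clear f1 f2 f3.

Section StringPhase.

Variables (ok : nat -> Prop) (lim : nat) (s m : nat).
Hypothesis s_gt1 : 1 < s.
Hypothesis ok_small : forall v, v <= m + s + 3 -> ok v.
Hypothesis lim_ge : m < lim.

Local Notation n := m.+1.

(* Variables of the string phase: 0 is n, 1 is sigma, 6 the number of leading
   letters z, 7 the best rotation, 8 and 9 the start and the length of the
   prenecklace in the doubled input (array 0), 10 its period, and 11, 12 and 13
   the correction terms of the position; array 1 receives the coefficients. *)
Definition load :=
  3 ::= Num 0 ;;
  For 3 (Var 0) (Inp 4 (Var 3) ;; Put 0 (Var 3) (Var 4) ;; Put 0 (Var 0 +' Var 3) (Var 4)).

Variable L : seq nat.
Hypothesis L_size : size L = n.
Hypothesis L_lt : all (fun d => d < s) L.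

Let L_nth i : nth 0 L i < s.
Proof.
case: (ltnP i (size L)) => h; first by apply: (allP L_lt); apply: mem_nth.
by rewrite nth_default // ltnW.
Qed.

Definition loaded st := [/\ var st 0 = n, var st 1 = s &
  forall i, i < n + n -> arr st 0 i = cyc L i].

Lemma load_spec st : var st 0 = n -> var st 1 = s -> (forall i, i < n -> io st i = nth 0 L i) ->
  runs ok lim load st (fun t st' => t <= 5 * n + 2 /\ loaded st').
Proof.
move=> h0 h1 hio; apply: runs_seq; apply: runs_asg; first exact: ok_small.
pose I k st' := forall i, (i < k -> arr st' 0 i = nth 0 L i) /\
  (i < k -> arr st' 0 (n + i) = nth 0 L i).
apply: (@runs_for _ _ _ _ _ _ 0 n I (fun=> 3)) => //.
- by move=> i hi; apply: ok_small; lia.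
- by move=> i st' hi hI hv fr; simp_store; use_frame fr.
- move=> i st' /andP[_ hi] hI hv fr.
  have e0 : var st' 0 = n by use_frame fr.
  have eio : io st' = io st by use_frame fr.
  apply: runs_seq; apply: runs_inp; first by rewrite /= hv; lia.
  have hin : io st' i = nth 0 L i by rewrite eio hio.
  apply: runs_seq; apply: runs_put.
    by simp_store; rewrite hv hin; apply: ok_small; have := L_nth i; lia.
  apply: runs_put.
    by simp_store; rewrite hv hin; apply: ok_small; have := L_nth i; lia.
  split=> // _ k; simp_store; rewrite hv e0 hin.
  have [a1 a2] := hI k; split=> hk.
    case: eqP => [e|_]; first by lia.
    by case: eqP => [->//|ne]; apply: a1; lia.
  case: eqP => [/addnI->//|ne].
  by case: eqP => [e|_]; [lia|apply: a2; lia].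
- move=> t st' fr ht hI _; rewrite sum_cost subn0 in ht; split; first by lia.
  split; try by use_frame fr.
  move=> i hi; rewrite /cyc L_size; case: (ltnP i n) => hin.
    by rewrite modn_small //; apply (hI i).
  rewrite -{1}(subnKC hin) -{2}(subnKC hin) modnDl modn_small; last lia.
  by apply (hI (i - n)); lia.
Qed.


Local Notation W := (cyc L).

Let W_lt i : W i < s. Proof. exact: L_nth. Qed.

Definition find_lead :=
  6 ::= Num 0 ;; 3 ::= Num 0 ;;
  For 3 (Var 0 -' Num 1)
    (Cond (Var 1) (Get 0 (Var 3) +' Num 1)
      (Cond (Var 3) (Var 6) (6 ::= Var 6 +' Num 1) skip) skip).

Definition is_lead j := [/\ j <= m, forall i, i < j -> W i = s.-1 & j < m -> W j != s.-1].

Lemma find_lead_spec st : loaded st -> runs ok lim find_lead st (fun t st' =>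
  t <= 5 * n + 3 /\ is_lead (var st' 6)).
Proof.
move=> [h0 h1 hW]; apply: runs_seq; apply: runs_asg; first exact: ok_small.
apply: runs_seq; apply: runs_asg; first exact: ok_small.
pose I k st' := [/\ var st' 6 <= k, forall i, i < var st' 6 -> W i = s.-1
  & var st' 6 < k -> W (var st' 6) != s.-1].
apply: (@runs_for _ _ _ _ _ _ 0 m I (fun=> 3)) => //.
- by move=> i hi; apply: ok_small; lia.
- by move=> i st' hi hI hv fr; simp_store; use_frame fr; simp_store; rewrite h0; lia.
- move=> i st' /andP[_ hi] [i1 i2 i3] hv fr.
  have e1 : var st' 1 = s by use_frame fr.
  have eW : arr st' 0 i = W i by use_frame fr; rewrite [LHS]hW //; lia.
  have hWi := W_lt i.
  apply: runs_cond; rewrite /= e1 hv eW => hc.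
    apply: runs_cond; rewrite /= hv => hc2.
      apply: runs_asg; first by apply: ok_small; rewrite /=; lia.
      split=> // _; have e6 : var st' 6 = i by lia.
      split; simp_store; rewrite e6; [lia| |lia].
      move=> k hk; case: (eqVneq k i) => [->|ne]; first by lia.
      by apply: i2; lia.
    apply: runs_skip; first exact: ok_small.
    split=> // _; split; simp_store; [lia|exact: i2|move=> hk; apply: i3; lia].
  apply: runs_skip; first exact: ok_small.
  split=> // _; split; simp_store; [lia|exact: i2|].
  move=> hk; case: (eqVneq (var st' 6) i) => [->|ne]; first by apply/eqP; lia.
  by apply: i3; lia.
- move=> t st' fr ht [i1 i2 i3] _; rewrite sum_cost subn0 in ht; split; first by lia.
  by split.
Qed.

(* lexicographic comparison of the rotations of the input by the variables 14 and 15 *)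
Definition compare :=
  5 ::= Num 0 ;; 4 ::= Num 0 ;;
  For 4 (Var 0)
    (Cond (Var 5) (Num 0)
      (Cond (Get 0 (Var 14 +' Var 4) +' Num 1) (Get 0 (Var 15 +' Var 4))
        (5 ::= Num 1)
        (Cond (Get 0 (Var 15 +' Var 4) +' Num 1) (Get 0 (Var 14 +' Var 4))
          (5 ::= Num 2) skip))
      skip).

Definition cmp3 (u v : nat) := if u < v then 1 else if v < u then 2 else 0.

Lemma cmp3_cat u v a b : a < s -> b < s -> cmp3 (u * s + a) (v * s + b) =
  if cmp3 u v == 0 then cmp3 a b else cmp3 u v.
Proof.
move=> ha hb; rewrite /cmp3; case: (ltngtP u v) => h.
- by rewrite (leq_trans (ltn_cat h ha)) ?leq_addr.
- by rewrite ltnNge ltnW /= ?(leq_trans (ltn_cat h hb)) ?leq_addr.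
- by rewrite h !ltn_add2l.
Qed.

Lemma compare_spec st : loaded st -> var st 14 <= m -> var st 15 <= m ->
  runs ok lim compare st (fun t st' => t <= 6 * n + 3 /\
    var st' 5 = cmp3 (wval s (window W (var st 14) n)) (wval s (window W (var st 15) n))).
Proof.
move=> [h0 h1 hW] ha hb; set a := var st 14 in ha *; set b := var st 15 in hb *.
apply: runs_seq; apply: runs_asg; first exact: ok_small.
apply: runs_seq; apply: runs_asg; first exact: ok_small.
pose I k st' := var st' 5 = cmp3 (wval s (window W a k)) (wval s (window W b k)).
apply: (@runs_for _ _ _ _ _ _ 0 n I (fun=> 4)) => //.
- by move=> i hi; apply: ok_small; lia.
- by move=> i st' hi hI hv fr; simp_store; use_frame fr.
- move=> i st' /andP[_ hi] hI hv fr; rewrite /I in hI.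
  have ea : arr st' 0 (a + i) = W (a + i) by use_frame fr; rewrite [LHS]hW //; lia.
  have eb : arr st' 0 (b + i) = W (b + i) by use_frame fr; rewrite [LHS]hW //; lia.
  have e14 : var st' 14 = a by use_frame fr.
  have e15 : var st' 15 = b by use_frame fr.
  have hS : (if var st' 5 == 0 then cmp3 (W (a + i)) (W (b + i)) else var st' 5) =
      cmp3 (wval s (window W a i.+1)) (wval s (window W b i.+1)).
    by rewrite !windowSr !wval_rcons cmp3_cat // hI.
  apply: runs_cond; rewrite /= => hc0.
    have e5 : var st' 5 = 0 by lia.
    rewrite e5 /= in hS.
    apply: runs_cond; rewrite /= hv e14 e15 ea eb => hc1.
      apply: runs_asg; first by apply: ok_small; rewrite /=; lia.
      by split=> // _; rewrite /I; simp_store; rewrite -hS /cmp3; case: ltnP hc1; lia.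
    apply: runs_cond; rewrite /= hv e14 e15 ea eb => hc2.
      apply: runs_asg; first by apply: ok_small; rewrite /=; lia.
      by split=> // _; rewrite /I; simp_store; rewrite -hS /cmp3; do 2![case: ltnP => //]; lia.
    apply: runs_skip; first exact: ok_small.
    by split=> // _; rewrite /I; simp_store; rewrite -hS e5 /cmp3; do 2![case: ltnP => //]; lia.
  apply: runs_skip; first exact: ok_small.
  split=> // _; rewrite /I; simp_store; rewrite -hS.
  by have -> : (var st' 5 == 0) = false by lia.
- by move=> t st' fr ht hI _; rewrite sum_cost subn0 in ht; split; first by lia.
Qed.

Lemma loaded_frame c st st' : frame c st st' -> 0 \notin vars_set c -> 1 \notin vars_set c ->
  0 \notin arrs_set c -> loaded st -> loaded st'.
Proof. by move=> [f1 f2 _] a1 a2 a3 [h0 h1 hW]; split; rewrite ?f1 ?f2. Qed.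

Local Notation rot i := (wval s (window W i n)).

(** Ties also update the index, so the last occurrence of the least rotation is kept, as
    [occ_nonecklace] requires. *)
Definition find_best :=
  7 ::= Num 0 ;; 3 ::= Num 0 ;;
  For 3 (Var 0)
    (14 ::= Var 3 ;; 15 ::= Var 7 ;; compare ;;
     Cond (Var 5) (Num 1) (7 ::= Var 3) skip).

Definition is_best b := b <= m /\
  forall i, i < n -> rot b <= rot i /\ (b < i -> rot b < rot i).

Lemma find_best_spec st : loaded st -> runs ok lim find_best st (fun t st' =>
  t <= n * (6 * n + 9) + 3 /\ is_best (var st' 7)).
Proof.
move=> hl; apply: runs_seq; apply: runs_asg; first exact: ok_small.
apply: runs_seq; apply: runs_asg; first exact: ok_small.
pose I k st' := var st' 7 <= m /\
  forall i, i < k -> rot (var st' 7) <= rot i /\ (var st' 7 < i -> rot (var st' 7) < rot i).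
have [h0 h1 hW] := hl.
apply: (@runs_for _ _ _ _ _ _ 0 n I (fun=> 6 * n + 7)) => //.
- by move=> i hi; apply: ok_small; lia.
- by move=> i st' hi hI hv fr; simp_store; use_frame fr.
- move=> i st' /andP[_ hi] [i1 i2] hv fr.
  have hl' : loaded st' by apply: (loaded_frame fr).
  apply: runs_seq; apply: runs_asg; first by apply: ok_small; rewrite /=; lia.
  apply: runs_seq; apply: runs_asg; first by apply: ok_small; simp_store; lia.
  apply: runs_seq; apply: runs_call (compare_spec _ _ _) _ => //.
  + by simp_store; lia.
  move=> t1 st1 f1; simp_store; rewrite hv => -[ht1 e5].
  have e7 : var st1 7 = var st' 7 by use_frame f1; simp_store.
  have e3 : var st1 3 = i by use_frame f1; simp_store.
  apply: runs_cond; rewrite /= e5 => hc.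
    apply: runs_asg; first by apply: ok_small; rewrite /= e3; lia.
    split; first by lia.
    move=> _; split; simp_store; rewrite e3; first by lia.
    have hle : rot i <= rot (var st' 7).
      by move: hc; rewrite /cmp3; case: (ltngtP (rot i) (rot (var st' 7))).
    move=> k; rewrite ltnS leq_eqVlt => /orP[/eqP->|hk]; first by rewrite ltnn.
    by have [a1 _] := i2 k hk; split; [apply: leq_trans a1|lia].
  apply: runs_skip; first exact: ok_small.
  split; first by lia.
  move=> _; split; simp_store; rewrite e7; first by lia.
  have hlt : rot (var st' 7) < rot i.
    by move: hc; rewrite /cmp3; case: (ltngtP (rot i) (rot (var st' 7))).
  move=> k; rewrite ltnS leq_eqVlt => /orP[/eqP->|hk]; last exact: i2.
  by split; rewrite ?(ltnW hlt).
- move=> t st' fr ht [i1 i2] _; rewrite sum_cost subn0 in ht; split; first by lia.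
  by split.
Qed.

(** The branches prepare the two position formulas: variable 11 is the correction added, variable 12
    the one subtracted. *)
Definition select :=
  14 ::= Var 6 ;; 15 ::= Var 7 ;; compare ;;
  Cond (Var 5) (Num 0)
    (8 ::= Var 6 ;; 9 ::= Var 0 -' Var 6 ;; 11 ::= Num 0 ;; 12 ::= Var 6)
    (8 ::= Var 7 ;; 9 ::= Var 0 ;; 11 ::= Var 0 -' Var 7 ;; 12 ::= Num 0).

Definition selected j b st := if rot j == rot b
  then [/\ var st 8 = j, var st 9 = n - j, var st 11 = 0 & var st 12 = j]
  else [/\ var st 8 = b, var st 9 = n, var st 11 = n - b & var st 12 = 0].

Lemma select_spec st : loaded st -> var st 6 <= m -> var st 7 <= m ->
  runs ok lim select st (fun t st' => t <= 6 * n + 10 /\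
     selected (var st 6) (var st 7) st').
Proof.
move=> hl h6 h7; have [h0 h1 hW] := hl.
apply: runs_seq; apply: runs_asg; first by apply: ok_small; rewrite /=; lia.
apply: runs_seq; apply: runs_asg; first by apply: ok_small; simp_store; lia.
apply: runs_seq; apply: runs_call (compare_spec _ _ _) _ => //.
move=> t1 st1 f1; simp_store => -[ht1 e5].
have e6 : var st1 6 = var st 6 by use_frame f1; simp_store.
have e7 : var st1 7 = var st 7 by use_frame f1; simp_store.
have e0 : var st1 0 = n by use_frame f1; simp_store.
rewrite /selected; apply: runs_cond; rewrite /= e5 => hc.
  have -> : rot (var st 6) == rot (var st 7).
    by move: hc; rewrite /cmp3; case: (ltngtP (rot (var st 6)) (rot (var st 7))).
  do 3![apply: runs_seq; apply: runs_asg; first by apply: ok_small; simp_store; lia].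
  apply: runs_asg; first by apply: ok_small; simp_store; lia.
  by simp_store; rewrite e6 e0; split; first lia.
have -> : (rot (var st 6) == rot (var st 7)) = false.
  by move: hc; rewrite /cmp3; case: (ltngtP (rot (var st 6)) (rot (var st 7))).
do 3![apply: runs_seq; apply: runs_asg; first by apply: ok_small; simp_store; lia].
apply: runs_asg; first by apply: ok_small; simp_store; lia.
by simp_store; rewrite e7 e0; split; first lia.
Qed.

Definition find_period :=
  10 ::= Num 1 ;; 3 ::= Num 1 ;;
  For 3 (Var 9)
    (Cond (Get 0 (Var 8 +' Var 3)) (Get 0 (Var 8 +' Var 3 -' Var 10))
      (Cond (Get 0 (Var 8 +' Var 3 -' Var 10)) (Get 0 (Var 8 +' Var 3))
        skip (10 ::= Var 3 +' Num 1))
      (10 ::= Var 3 +' Num 1)).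

Lemma find_period_spec st b r : loaded st -> var st 8 = b -> var st 9 = r -> b <= m ->
  0 < r <= n -> prenecklace (fun i => W (b + i)) r ->
  runs ok lim find_period st (fun t st' => t <= 5 * n + 3 /\
    var st' 10 = duval (fun i => W (b + i)) r).
Proof.
move=> hl h8 h9 hb /andP[r0 hr] hq; have [h0 h1 hW] := hl.
set q := fun i => W (b + i) in hq *.
apply: runs_seq; apply: runs_asg; first by apply: ok_small; rewrite /=; lia.
apply: runs_seq; apply: runs_asg; first by apply: ok_small; rewrite /=; lia.
pose I k st' := var st' 10 = duval q k.
apply: (@runs_for _ _ _ _ _ _ 1 r I (fun=> 3)) => //.
- by move=> i hi; apply: ok_small; lia.
- by move=> i st' hi hI hv fr; simp_store; use_frame fr; simp_store.
- move=> i st' /andP[i1 hi] hI hv fr; rewrite /I in hI.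
  have hir : 0 < i <= r by lia.
  have [d1 d2 _ _] := duval_spec hq hir.
  have e8 : var st' 8 = b by use_frame fr.
  have ea : arr st' 0 (b + i) = q i by use_frame fr; rewrite [LHS]hW //; lia.
  have eb : arr st' 0 (b + i - duval q i) = q (i - duval q i).
    by use_frame fr; rewrite [LHS]hW; [rewrite /q addnBA|lia].
  have eS : duval q i.+1 = if q i == q (i - duval q i) then duval q i else i.+1.
    by rewrite /=; case: posnP i1.
  have oki : ok (eval st' (Var 3 +' Num 1)) by apply: ok_small; rewrite /= hv; lia.
  apply: runs_cond; rewrite /= e8 hv hI ea eb => hc.
    apply: runs_cond; rewrite /= e8 hv hI ea eb => hc2.
      apply: runs_skip; first exact: ok_small.
      split=> // _; rewrite /I eS; simp_store; rewrite hI.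
      by have -> : q i == q (i - duval q i) by rewrite eqn_leq hc hc2.
    apply: runs_asg => //; split=> // _; rewrite /I eS; simp_store; rewrite hv.
    by case: eqP => [e|_]; lia.
  apply: runs_asg => //; split=> // _; rewrite /I eS; simp_store; rewrite hv.
  by case: eqP => [e|_]; lia.
- by move=> t st' fr ht hI _; rewrite sum_cost in ht; split; first by lia.
Qed.

Definition find_zero :=
  13 ::= Num 0 ;;
  Cond (Num 1) (Var 12)
    (Cond (Var 10) (Num 1)
      (Cond (Get 0 (Var 8)) (Num 0) (13 ::= Num 1) skip) skip) skip.

Lemma find_zero_spec st b : loaded st -> var st 8 = b -> b <= m -> 0 < var st 10 ->
  runs ok lim find_zero st (fun t st' => t <= 5 /\
    var st' 13 = [&& 0 < var st 12, var st 10 == 1 & W b == 0]).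
Proof.
move=> hl h8 hb h10; have [h0 h1 hW] := hl.
apply: runs_seq; apply: runs_asg; first exact: ok_small.
have sk Q st' : (forall t, t <= 1 -> Q t (setv st' 39 0)) -> runs ok lim skip st' Q.
  by move=> h; apply: runs_skip; [exact: ok_small|exact: h].
have eW : arr st 0 b = W b by apply: hW; lia.
apply: runs_cond; simp_store => hc.
  rewrite hc; apply: runs_cond; simp_store => hc2.
    have -> : var st 10 == 1 by lia.
    apply: runs_cond; simp_store; rewrite h8 eW => hc3.
      apply: runs_asg; first by apply: ok_small; rewrite /=; lia.
      by simp_store; have -> : W b == 0 by lia.
    by apply: sk => t ht; simp_store; rewrite gtn_eqF //; lia.
  by apply: sk => t ht; simp_store; have -> : (var st 10 == 1) = false; lia.
by apply: sk => t ht; simp_store; case: posnP hc; lia.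
Qed.

Definition fill_coef :=
  3 ::= Num 0 ;;
  For 3 (Var 10)
    (Put 1 (Var 3 +' Num 1) (Var 1 -' (Get 0 (Var 8 +' Var 3) +' Num 1))) ;;
  Put 1 (Var 10) (Get 1 (Var 10) +' Num 1).

Lemma fill_coef_spec st b p : loaded st -> (forall l, arr st 1 l = 0) -> var st 8 = b ->
  b <= m -> var st 10 = p -> 0 < p <= n ->
  runs ok lim fill_coef st (fun t st' => t <= 3 * n + 3 /\
    forall l, arr st' 1 l = coef s (fun i => W (b + i)) p l).
Proof.
move=> hl hz h8 hb h10 /andP[p0 hp]; have [h0 h1 hW] := hl.
apply: runs_seq; apply: runs_asg; first exact: ok_small.
apply: runs_seq.
pose I k st' := forall l, arr st' 1 l = if 0 < l <= k then s - (W (b + l.-1)).+1 else 0.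
apply: (@runs_for _ _ _ _ _ _ 0 p I (fun=> 1)) => //.
- by move=> l; rewrite hz; case: ifP; lia.
- by move=> i hi; apply: ok_small; lia.
- by move=> i st' hi hI hv fr; simp_store; use_frame fr; simp_store.
- move=> i st' /andP[_ hi] hI hv fr.
  have e8 : var st' 8 = b by use_frame fr.
  have e1 : var st' 1 = s by use_frame fr.
  have ea : arr st' 0 (b + i) = W (b + i) by use_frame fr; rewrite [LHS]hW //; lia.
  apply: runs_put; first by apply: ok_small; rewrite /= e1; lia.
  split=> // _ l; simp_store; rewrite e1 e8 hv ea !addn1.
  case: eqP => [->|ne]; first by rewrite leqnn.
  by rewrite hI; case: l ne => // l ne; congr (if _ then _ else _); lia.
- move=> t st' fr ht hI hv; rewrite sum_cost subn0 in ht.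
  have e10 : var st' 10 = p by use_frame fr; simp_store.
  have ep : arr st' 1 p = s - (W (b + p.-1)).+1 by rewrite hI p0 leqnn.
  apply: runs_put; first by apply: ok_small; rewrite /= e10 ep; lia.
  split; first by lia.
  move=> l; simp_store; rewrite e10 ep /coef.
  case: eqP => [->|ne]; first by rewrite p0 leqnn.
  by rewrite hI addn0.
Qed.

End StringPhase.

Definition string_phase :=
  load ;; find_lead ;; find_best ;; select ;; find_period ;; find_zero ;; fill_coef.

Definition prepared s m (w : m.+1.-tuple 'I_s) (st : store) := exists q p,
  [/\ [/\ 0 < p <= m.+1, forall i, i < p -> q i < s & forall l, arr st 1 l = coef s q p l],
      [/\ var st 0 = m.+1, var st 1 = s, var st 11 <= m.+1, var st 12 <= m.+1 & var st 13 <= 1] &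
      occ w (dB s m.+1) + closed_sum s q p m.+1 + var st 12 =
      s ^ m.+1 * (1 + var st 13) + 1 + var st 11].

Section StringPhase.

Variables (ok : nat -> Prop) (lim : nat) (s m : nat).
Hypothesis s_gt1 : 1 < s.
Hypothesis ok_small : forall v, v <= m + s + 3 -> ok v.
Hypothesis lim_ge : m < lim.

Let s_gt0 : 0 < s. Proof. exact: ltnW. Qed.
Local Notation n := m.+1.

Variable w : n.-tuple 'I_s.
Let L := letters w.
Let x := wval s L.

Let L_size : size L = n. Proof. by rewrite size_letters size_tuple. Qed.
Let L_lt : all (fun d => d < s) L. Proof. exact: all_letters. Qed.
Let x_lt : x < s ^ n. Proof. exact: wval_letters_lt. Qed.
Let dgE i : dg s m x i = cyc L i. Proof. exact: dg_letters. Qed.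

Lemma rotE i : wval s (window (cyc L) i n) = iter i (rotw s m) x.
Proof. by rewrite -dg_window //; congr wval; apply: eq_window => k _. Qed.

Lemma lead_char j : is_lead s m L j -> lead s m (x %/ s) = j.
Proof.
move=> [j1 j2 j3]; set l := lead s m _.
have hy : x %/ s < s ^ m by rewrite ltn_divLR // -expnSr.
have hd : x %% s < s by rewrite ltn_mod.
have hl : l <= m := lead_le s m (x %/ s).
have z1 i : i < l -> cyc L i = s.-1.
  move=> hi; have := iter_lead_top s_gt1 hy hd hi; rewrite -divn_eq -leq_divRL ?sp_gt0 //.
  by rewrite -/(dg s m x i) -dgE; have := @dg_lt s m s_gt1 x i x_lt; rewrite dgE; lia.
have z2 : l < m -> cyc L l != s.-1.
  move=> h; have := fill_lt_top s_gt1 hy hd h; rewrite -iter_lead // -divn_eq.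
  by rewrite -ltn_divLR ?sp_gt0 // -/l -/(dg s m x l) dgE => h2; rewrite ltn_eqF.
case: (ltngtP l j) => // h.
  by have := z2 (leq_trans h j1); rewrite j2 // eqxx.
by have := j3 (leq_trans h hl); rewrite z1 // eqxx.
Qed.

(** The only quadratic stage is the search for the least rotation, with [n] comparisons of linear
    cost. *)
Lemma string_phase_spec st : var st 0 = n -> var st 1 = s ->
  (forall i, i < n -> io st i = nth 0 L i) -> (forall l, arr st 1 l = 0) ->
  runs ok lim string_phase st (fun t st' => t <= 70 * n ^ 2 /\ prepared w st').
Proof.
move=> h0 h1 hio hz; have h3 : m < s ^ n := M_gtm m s_gt1.
apply: runs_seq; apply: runs_call (load_spec s_gt1 ok_small lim_ge L_size L_lt h0 h1 hio) _.
move=> t1 s1 f1 [ht1 l1].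
have hz1 l : arr s1 1 l = 0 by use_frame f1.
apply: runs_seq; apply: runs_call (find_lead_spec s_gt1 ok_small lim_ge L_size L_lt l1) _.
move=> t2 s2 f2 [ht2 ld]; set j := var s2 6 in ld.
have l2 : loaded s m L s2 by apply: (loaded_frame f2).
apply: runs_seq; apply: runs_call (find_best_spec s_gt1 ok_small lim_ge L_size L_lt l2) _.
move=> t3 s3 f3 [ht3 bst]; set b := var s3 7 in bst.
have l3 : loaded s m L s3 by apply: (loaded_frame f3).
have e6 : var s3 6 = j by use_frame f3.
have jm : j <= m by case: ld.
have [bm bb] := bst.
apply: runs_seq; apply: runs_call (select_spec s_gt1 ok_small lim_ge L_size L_lt l3 _ _) _; rewrite ?e6 //.
move=> t4 s4 f4 [ht4 sel].
have l4 : loaded s m L s4 by apply: (loaded_frame f4).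
have ej := lead_char ld.
have emin : iter b (rotw s m) x = minrot s m x.
  have [k hk ek] := minrot_ex s m x; have [h _] := bb k hk.
  apply/eqP; rewrite eqn_leq minrot_le // andbT ek -!rotE //.
have hsel : exists i r, [/\ var s4 8 = i, var s4 9 = r, i <= m, 0 < r <= n &
    iter i (rotw s m) x = minrot s m x].
  move: sel; rewrite /selected -/b !rotE; case: eqP => e [a1 a2 _ _].
    by exists j, (n - j); split=> //; [lia|rewrite e].
  by exists b, n; split=> //; lia.
have {hsel} [i [r [e8 e9 him hr ei]]] := hsel.
set q := fun k => cyc L (i + k).
have hq : prenecklace q r.
  move=> k t hkt hag; rewrite /q -!dgE.
  apply: (@minrot_prenecklace s m s_gt1 x i r x_lt ei _ k t hkt); first by lia.
  by move=> u hu; rewrite !dgE; apply: hag.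
apply: runs_seq; apply: runs_call (find_period_spec s_gt1 ok_small lim_ge L_size L_lt l4 e8 e9 him hr hq) _.
move=> t5 s5 f5 [ht5 e10]; rewrite -/q in e10.
have l5 : loaded s m L s5 by apply: (loaded_frame f5).
have hrr : 0 < r <= r by lia.
have [p0 hp _ _] := duval_spec hq hrr; set p := duval q r in e10 p0 hp.
have e8' : var s5 8 = i by use_frame f5.
apply: runs_seq; apply: runs_call (find_zero_spec s_gt1 ok_small lim_ge L_size L_lt l5 e8' him _) _; rewrite ?e10 //.
move=> t6 s6 f6 [ht6 e13].
have l6 : loaded s m L s6 by apply: (loaded_frame f6).
have e8'' : var s6 8 = i by use_frame f6.
have e10' : var s6 10 = p by use_frame f6.
have hz6 l : arr s6 1 l = 0.
  by use_frame f6; use_frame f5; use_frame f4; use_frame f3; use_frame f2.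
have hpn : 0 < p <= n by lia.
apply: runs_call (fill_coef_spec s_gt1 ok_small lim_ge L_size L_lt l6 hz6 e8'' him e10' hpn) _.
move=> t7 s7 f7 [ht7 hc]; split.
  have : n * n = n ^ 2 by [].
  have : n <= n * n by rewrite leq_pmulr.
  by lia.
exists q, p; split.
- by split=> // k hk; rewrite /q -dgE; apply: dg_lt.
- have [a0 a1 _] := l6.
  have v11 : var s7 11 = var s4 11 by use_frame f7; use_frame f6; use_frame f5.
  have v12 : var s7 12 = var s4 12 by use_frame f7; use_frame f6; use_frame f5.
  have v13 : var s7 13 <= 1 by use_frame f7; rewrite e13; case: [&& _, _ & _].
  split=> //; try by use_frame f7.
    by rewrite v11; move: sel; rewrite /selected; case: ifP => _ [_ _ -> _]; lia.
  by rewrite v12; move: sel; rewrite /selected; case: ifP => _ [_ _ _ ->]; lia.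
have -> : var s7 11 = var s4 11 by use_frame f7; use_frame f6; use_frame f5.
have -> : var s7 12 = var s4 12 by use_frame f7; use_frame f6; use_frame f5.
have -> : var s7 13 = var s6 13 by use_frame f7.
have e12 : var s5 12 = var s4 12 by use_frame f5.
rewrite e13 e12.
have eqq k : q k = dg s m x (i + k) by rewrite dgE.
(* Letters obtained from rotations and letters read from the input agree only pointwise, so the
   three constructions are shown to respect pointwise equality. *)
have duv_ext q1 q2 k : (forall i, q1 i = q2 i) -> duval q1 k = duval q2 k.
  by move=> e; elim: k => //= k ->; rewrite !e.
have del_ext q1 q2 p' a l : (forall i, q1 i = q2 i) -> walk q1 p' a l = walk q2 p' a l.
  by move=> e; elim: l a => //= c l IH a; rewrite e /delta e IH.
have cs_ext q1 q2 p' k : (forall i, q1 i = q2 i) -> closed_sum s q1 p' k = closed_sum s q2 p' k.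
  move=> e; apply: eq_bigr => l _; rewrite /coef e; congr (_ * _).
  by apply: eq_sum_words => u; rewrite (del_ext _ _ _ _ _ e).
move: sel; rewrite /selected -/b !rotE; case: eqP => e [b8 b9 b11 b12].
  have [ei' er] : i = j /\ r = n - j by rewrite -e8 -e9.
  rewrite b11 b12 addn0 (cs_ext _ _ _ _ eqq) /p (duv_ext _ _ _ eqq).
  have H := @occ_necklace s m s_gt1 w; rewrite -/L -/x ej in H.
  have {}H := H (etrans e emin); rewrite /= addn0 dgE in H.
  by rewrite ei' er; apply: H.
have [ei' er] : i = b /\ r = n by rewrite -e8 -e9.
rewrite b11 b12 addn0 ltnn /= addn0 muln1 (cs_ext _ _ _ _ eqq) /p (duv_ext _ _ _ eqq) ei' er.
have := @occ_nonecklace s m s_gt1 w b; rewrite -/L -/x ej; apply=> //.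
  by apply/eqP => e2; apply: e; rewrite e2 emin.
move=> k /andP[k1 k2]; have [_] := bb k k2; rewrite !rotE => /(_ k1).
by rewrite emin => h; rewrite gtn_eqF.
Qed.

End StringPhase.

(** * The unit-cost RAM *)

(** Computes 2n + 2, the size of the input and output region: it has room for n letters and for n +
    2 output words. *)
Definition prelude :=
  [:: Const base_reg 2; Op Times base_reg base_reg 0; Const tmp 2;
      Op Plus base_reg base_reg tmp].

Definition compile c : program := prelude ++ comp c 4.

Lemma run_halted norm P t st : halted P st -> run norm P t st = st.
Proof.
move=> h; elim: t => //= t IH; rewrite [run _ _ _ _]iterS -/(run norm P t st) IH.
rewrite /step (_ : onth P (pc st) = None) //.
by move: h; rewrite /halted; move: (pc st) => i; elim: P i {IH} => [|a P IH] [|i] //= h; exact: IH.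
Qed.

Section Machine.

Variables (norm : nat -> nat) (fits : nat -> nat -> Prop) (D : nat) (regs cells : seq nat).
Let lim := 2 * nth 0 regs 0 + 2.
Hypothesis fits_mono : forall d d' v, d <= d' -> fits d v -> fits d' v.
Hypothesis fits_num : forall k, fits k.+1 k.
Hypothesis fits_bin : forall o d1 d2 x y, 0 < d1 -> 0 < d2 -> fits d1 x -> fits d2 y ->
  fits (d1 + d2) (eval_binop o x y).
Hypothesis fits_norm : forall d v, d <= D -> fits d v -> norm v = v.
Hypothesis fits_lim : fits 1 lim.
Hypothesis fits_regs : forall x, fits 1 (nth 0 regs x).
Hypothesis fits_cells : forall i, fits 1 (nth 0 cells i).
Hypothesis cells_lim : size cells <= lim.
Hypothesis D_ge : 8 <= D.

Definition initial_store := Store (nth 0 regs) (fun _ _ => 0) (nth 0 cells).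

Lemma compile_correct c t st T : wf D c ->
  Lang.exec (fits 1) lim c initial_store t st -> 4 + size (comp c 4) * t <= T ->
  let m := run norm (compile c) T (initial norm regs cells) in
  [/\ halted (compile c) m, forall x, x < base_reg -> reg m x = var st x
    & forall i, i < lim -> cell m i = io st i].
Proof.
move=> hw hx hT; set P := compile c; set m0 := initial norm regs cells.
have hn1 v : fits 1 v -> norm v = v by apply: fits_norm; lia.
have e0 x : reg m0 x = nth 0 regs x by exact: hn1.
have c0 i : cell m0 i = nth 0 cells i by exact: hn1.
have hcode : code_at P 0 (compile c) by [].
have [hc1 hc2] := code_at_cat hcode; rewrite add0n in hc2.
have [d1 hd1] := @code_at_cat P _ [:: _] _ hc1.
have [d2 hd2] := @code_at_cat P _ [:: _] _ hd1.
have [d3 d4] := @code_at_cat P _ [:: _] _ hd2.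
have n2 : norm 2 = 2 by apply: (@fits_norm 3); [lia|exact: fits_num].
have f1 : fits 4 (2 * nth 0 regs 0) := @fits_bin Times 3 1 2 _ isT isT (fits_num 2) (fits_regs 0).
have f2 : fits 7 lim by apply: fits_mono fits_lim.
set m4 := run norm P 4 m0.
have E1 : run norm P 1 m0 = State 1 (update (reg m0) base_reg 2) (cell m0).
  by apply: (run_const d1).
have E2 : run norm P 1 (run norm P 1 m0) =
    State 2 (update (update (reg m0) base_reg 2) base_reg (2 * nth 0 regs 0)) (cell m0).
  have eb : update (reg m0) base_reg 2 base_reg = 2 by [].
  have ez : update (reg m0) base_reg 2 0 = nth 0 regs 0 by rewrite -e0.
  rewrite E1 (@run_op _ _ _ _ _ _ _ (State 1 _ _) d2) //= eb ez //.
  by apply: (@fits_norm 4) f1; lia.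
set r2 := update _ _ _ in E2.
have E3 : run norm P 1 (run norm P 1 (run norm P 1 m0)) = State 3 (update r2 tmp 2) (cell m0).
  by rewrite E2 (@run_const _ _ _ _ _ (State 2 _ _) d3).
have E4 : m4 = State 4 (update (update r2 tmp 2) base_reg lim) (cell m0).
  rewrite /m4 -[4]/(1 + (1 + (1 + 1))) !runD E3.
  have eb : update r2 tmp 2 base_reg = 2 * nth 0 regs 0 by [].
  have et : update r2 tmp 2 tmp = 2 by [].
  rewrite (@run_op _ _ _ _ _ _ _ (State 3 _ _) d4) //= eb et //.
  by apply: (@fits_norm 7) f2; lia.
have rep4 : rep lim initial_store m4.
  rewrite E4; split=> [x hxb|//|a i ha|i hi].
  - have b1 : (x == base_reg) = false by rewrite ltn_eqF.
    have b2 : (x == tmp) = false by rewrite ltn_eqF // ltnW.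
    by rewrite /= /r2 /update b1 b2 e0.
  - rewrite (_ : cell _ _ = cell m0 (cell_of lim a i)) // c0 nth_default // /cell_of; by apply: leq_trans cells_lim _; rewrite leq_addl.
  - exact: c0.
have bnd : bounded fits initial_store by split=> //= a i; exact: fits_num.
have hc2' : code_at P 4 (comp c 4) by exact: hc2.
have [u [h1 h2 h3]] := comp_correct fits_mono fits_num fits_bin fits_norm fits_lim hx hw hc2'
  (leqnn _) (congr1 pc E4) rep4 bnd.
have hsz : size P = 4 + size (comp c 4) by rewrite /P /compile size_cat.
have hh : halted P (run norm P u m4) by rewrite /halted h2 hsz.
have -> : run norm P T m0 = run norm P u m4.
  rewrite -(@subnKC (4 + u) T); last by lia.
  by rewrite !runD -/m4 run_halted.
by case: h3 => r1 _ _ r4.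
Qed.

End Machine.

Lemma closed_sumE s q p n : p <= n ->
  closed_sum s q p n = \sum_(1 <= l < n.+1) l * coef s q p l * returns s q p (n - l).
Proof.
move=> hp; have e l : l * coef s q p l * returns s q p (n - l) =
    if l <= p then l * coef s q p l * returns s q p (n - l) else 0.
  by case: leqP => // h; rewrite /coef (leqNgt l) h andbF muln0.
rewrite [RHS](eq_bigr _ (fun l _ => e l)) -big_mkcondr.
by apply: eq_sum_range => i; lia.
Qed.

Definition unit_returns :=
  Put 2 (Num 0) (Num 1) ;; 3 ::= Num 1 ;;
  For 3 (Var 0 +' Num 1)
    (20 ::= Num 0 ;; 4 ::= Num 1 ;;
     For 4 (Var 3 +' Num 1)
       (20 ::= Var 20 +' Get 1 (Var 4) *' Get 2 (Var 3 -' Var 4)) ;;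
     Put 2 (Var 3) (Var 20)).

Definition unit_sum :=
  20 ::= Num 0 ;; 4 ::= Num 1 ;;
  For 4 (Var 0 +' Num 1)
    (20 ::= Var 20 +' Var 4 *' Get 1 (Var 4) *' Get 2 (Var 0 -' Var 4)).

Definition unit_power :=
  21 ::= Num 1 ;; 3 ::= Num 0 ;; For 3 (Var 0) (21 ::= Var 21 *' Var 1).

(** All additions precede the single truncated subtraction, so that nothing is cut off. *)
Definition unit_answer :=
  0 ::= Var 21 *' (Num 1 +' Var 13) +' Num 1 +' Var 11 -' (Var 20 +' Var 12).

Definition unit_main :=
  Cond (Var 1) (Num 1) (0 ::= Num 1)
    (string_phase ;; unit_returns ;; unit_sum ;; unit_power ;; unit_answer).

Section UnitCost.

Variables (lim s m : nat) (q : nat -> nat) (p : nat).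
Hypothesis p_gt0 : 0 < p.
Hypothesis q_lt : forall i, i < p -> q i < s.

Local Notation n := m.+1.
Local Notation runs := (runs (fun=> True) lim).
Local Notation f := (returns s q p).
Local Notation a := (coef s q p).

Lemma unit_returns_spec st : var st 0 = n -> (forall l, arr st 1 l = a l) ->
  runs unit_returns st (fun t st' => t <= n * (3 * n + 6) + 3 /\
    forall i, i <= n -> arr st' 2 i = f i).
Proof.
move=> h0 ha; apply: runs_seq; apply: runs_put => //.
apply: runs_seq; apply: runs_asg => //.
pose I k st' := forall i, i < k -> arr st' 2 i = f i.
apply: (@runs_for _ _ _ _ _ _ 1 n.+1 I (fun=> 3 * n + 4)) => //.
- by case=> // _; simp_store; rewrite returns0.
- by move=> i st' hi hI hv fr; simp_store; use_frame fr; simp_store; rewrite h0 addn1.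
- move=> i st' /andP[i1 hi] hI hv fr.
  have ea l : arr st' 1 l = a l by use_frame fr; simp_store.
  apply: runs_seq; apply: runs_asg => //; apply: runs_seq; apply: runs_asg => //.
  apply: runs_seq.
  pose J k st'' := var st'' 20 = \sum_(1 <= l < k) a l * f (i - l).
  apply: (@runs_for _ _ _ _ _ _ 1 i.+1 J (fun=> 1)) => //.
  + by rewrite /J; simp_store; rewrite big_geq.
  + by move=> j st2 hj hJ hv2 fr2; simp_store; use_frame fr2; simp_store; rewrite hv addn1.
  + move=> j st2 /andP[j1 hj] hJ hv2 fr2; apply: runs_asg => //; split=> // _.
    have e1 : arr st2 1 j = a j by use_frame fr2; simp_store.
    have e3 : var st2 3 = i by use_frame fr2; simp_store.
    have e2 : arr st2 2 (i - j) = f (i - j) by use_frame fr2; simp_store; rewrite hI //; lia.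
    by rewrite /J; simp_store; rewrite hv2 hJ e1 e3 e2 big_nat_recr.
  move=> t1 st1 fr1; rewrite sum_cost => ht1 hJ hv1; apply: runs_put => //.
  split; first by lia.
  move=> _ k; simp_store; have -> : var st1 3 = i by use_frame fr1; simp_store.
  have e2 : arr st1 2 = arr st' 2 by use_frame fr1.
  case: eqP => [-> _|ne hk]; first by rewrite hJ returnsE.
  by rewrite e2 hI //; lia.
- by move=> t st' fr; rewrite sum_cost => ht hI _; split; [lia|move=> i hi; apply: hI].
Qed.

Lemma unit_sum_spec st : var st 0 = n -> (forall l, arr st 1 l = a l) ->
  (forall i, i <= n -> arr st 2 i = f i) -> p <= n ->
  runs unit_sum st (fun t st' => t <= 3 * n + 3 /\ var st' 20 = closed_sum s q p n).
Proof.
move=> h0 ha hf hp; apply: runs_seq; apply: runs_asg => //.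
apply: runs_seq; apply: runs_asg => //.
pose J k st' := var st' 20 = \sum_(1 <= l < k) l * a l * f (n - l).
apply: (@runs_for _ _ _ _ _ _ 1 n.+1 J (fun=> 1)) => //.
- by rewrite /J; simp_store; rewrite big_geq.
- by move=> j st2 hj hJ hv fr; simp_store; use_frame fr; simp_store; rewrite h0 addn1.
- move=> j st2 /andP[j1 hj] hJ hv fr; apply: runs_asg => //; split=> // _.
  have e1 : arr st2 1 j = a j by use_frame fr; simp_store.
  have e0 : var st2 0 = n by use_frame fr; simp_store.
  have e2 : arr st2 2 (n - j) = f (n - j) by use_frame fr; simp_store; rewrite hf //; lia.
  by rewrite /J; simp_store; rewrite hv hJ e1 e0 e2 big_nat_recr.
- by move=> t st' fr; rewrite sum_cost => ht hJ _; rewrite closed_sumE //; split; [lia|].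
Qed.

Lemma unit_power_spec st : var st 0 = n -> var st 1 = s ->
  runs unit_power st (fun t st' => t <= 3 * n + 3 /\ var st' 21 = s ^ n).
Proof.
move=> h0 h1; apply: runs_seq; apply: runs_asg => //.
apply: runs_seq; apply: runs_asg => //.
apply: (@runs_for _ _ _ _ _ _ 0 n (fun k st' => var st' 21 = s ^ k) (fun=> 1)) => //.
- by move=> j st2 hj hJ hv fr; simp_store; use_frame fr; simp_store.
- move=> j st2 hj hJ hv fr; apply: runs_asg => //; split=> // _.
  have e1 : var st2 1 = s by use_frame fr; simp_store.
  by simp_store; rewrite hJ e1 expnSr.
- by move=> t st' fr; rewrite sum_cost => ht hJ _; split; [lia|].
Qed.

End UnitCost.

Lemma unit_main_spec lim s m (w : m.+1.-tuple 'I_s) st : 1 < s -> m < lim ->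
  var st 0 = m.+1 -> var st 1 = s ->
  (forall i, i < m.+1 -> io st i = nth 0 (letters w) i) -> (forall l, arr st 1 l = 0) ->
  runs (fun=> True) lim unit_main st (fun t st' => t <= 100 * m.+1 ^ 2 /\
    var st' 0 = occ w (dB s m.+1)).
Proof.
move=> hs hl h0 h1 hio hz; apply: runs_cond; rewrite /= h1 => hc; first by lia.
apply: runs_seq; apply: runs_call (string_phase_spec hs _ hl h0 h1 hio hz) _ => //.
move=> t1 s1 f1 [ht1 [q [p [[hp hq ha] [v0 v1 v11 v12 v13] hocc]]]].
have p0 : 0 < p by case/andP: hp.
have hpn : p <= m.+1 by case/andP: hp.
apply: runs_seq; apply: runs_call (unit_returns_spec lim p0 hq v0 ha) _ => t2 s2 f2 [ht2 hf].
have ha2 l : arr s2 1 l = coef s q p l by use_frame f2.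
have v02 : var s2 0 = m.+1 by use_frame f2.
apply: runs_seq; apply: runs_call (unit_sum_spec lim p0 v02 ha2 hf hpn) _ => t3 s3 f3 [ht3 e20].
have v03 : var s3 0 = m.+1 by use_frame f3.
have v13' : var s3 1 = s by use_frame f3; use_frame f2.
apply: runs_seq; apply: runs_call (unit_power_spec lim p0 v03 v13') _ => t4 s4 f4 [ht4 e21].
apply: runs_asg => //; split.
  have : m.+1 * m.+1 = m.+1 ^ 2 by [].
  have : m.+1 <= m.+1 * m.+1 by rewrite leq_pmulr.
  by lia.
simp_store; rewrite e21.
have -> : var s4 20 = closed_sum s q p m.+1 by use_frame f4.
have -> : var s4 11 = var s1 11 by use_frame f4; use_frame f3; use_frame f2.
have -> : var s4 12 = var s1 12 by use_frame f4; use_frame f3; use_frame f2.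
have -> : var s4 13 = var s1 13 by use_frame f4; use_frame f3; use_frame f2.
by rewrite -hocc -addnA addnK.
Qed.

Lemma occ_unit_cost : exists (P : program) (C : nat),
  forall (sigma n : nat) (w : n.-tuple 'I_sigma), 1 <= n ->
    unit_computes P (C * n ^ 2) n w (occ w (dB sigma n)).
Proof.
exists (compile unit_main), (4 + size (comp unit_main 4) * 100) => s n w hn.
case: n w hn => // m w _.
have hs0 : 0 < s by have := tnth w ord0; case: (s) => // -[].
have hlim : m < 2 * nth 0 [:: m.+1; s] 0 + 2 by rewrite /=; lia.
have hexec : exists t st, Lang.exec (fun=> True) (2 * nth 0 [:: m.+1; s] 0 + 2) unit_main
    (initial_store [:: m.+1; s] (letters w)) t st /\
    (t <= 100 * m.+1 ^ 2 /\ var st 0 = occ w (dB s m.+1)).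
  case: (ltnP 1 s) => hs.
    by have [t [st [h1 h2]]] := @unit_main_spec _ s m w (initial_store [:: m.+1; s] (letters w)) hs hlim
      erefl erefl (fun _ _ => erefl) (fun _ => erefl); exists t, st.
  have es : s = 1 by lia.
  subst s; exists 2, (setv (initial_store [:: m.+1; 1] (letters w)) 0 1); split.
    by apply: ExecCond1 => //; apply: ExecAsg.
  by rewrite occ_unary; split=> //; rewrite (@leq_trans (100 * 1)) // leq_mul2l expn_gt0.
have [t [st [hx [ht hv]]]] := hexec.
have sz : size (letters w) = m.+1 by rewrite size_letters size_tuple.
have hsz : size (letters w) <= 2 * nth 0 [:: m.+1; s] 0 + 2 by rewrite sz /=; lia.
have hT : 4 + size (comp unit_main 4) * t <= (4 + size (comp unit_main 4) * 100) * m.+1 ^ 2.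
  rewrite mulnDl -mulnA; apply: leq_add; first by rewrite leq_pmulr // expn_gt0.
  by rewrite leq_mul2l ht orbT.
have hwf : wf 1000 unit_main by [].
(* Every number fits on this machine, so [fits] is trivial; 1000 only has to exceed the degrees of
   the expressions. *)
have [h1 h2 _] := @compile_correct id (fun _ _ => True) 1000 [:: m.+1; s] (letters w)
  (fun _ _ _ _ _ => I) (fun _ => I) (fun _ _ _ _ _ _ _ _ _ => I) (fun _ _ _ _ => erefl)
  I (fun _ => I) (fun _ => I) hsz isT unit_main t st _ hwf hx hT.
by split=> //; rewrite h2.
Qed.

(** * Fast Fourier transform *)

From mathcomp Require Import all_algebra complex realalg.
From mathcomp Require Import ring lra.
Require Import Defs.
Import Order.TTheory GRing.Theory Num.Theory.

Section ExactFFT.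

Variables (C : comNzRingType) (r ri : nat -> C).

Local Open Scope ring_scope.

(* the node [b] of depth [j] of the tree stands for reduction modulo
   'X^(2^(k-j)) - node b *)
Definition node b : C := (-1) ^+ odd b * r b./2.

Hypothesis r_sq : forall b, r b ^+ 2 = node b.
Hypothesis r_inv : forall b, r b * ri b = 1.

(** Splits the modulus X^(2 hf) - (r b)^2 into X^hf - r b and X^hf + r b. The children of node [b]
    are 2b and 2b + 1, so one table of roots serves all depths. *)
Definition fwd hf (a : nat -> C) i :=
  let b := (i %/ hf.*2)%N in
  if (i %% hf.*2 < hf)%N then a i + r b * a (i + hf)%N else a (i - hf)%N - r b * a i.

Definition bwd hf (a : nat -> C) i :=
  let b := (i %/ hf.*2)%N in
  if (i %% hf.*2 < hf)%N then a i + a (i + hf)%N else (a (i - hf)%N - a i) * ri b.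

Fixpoint fft k j a := if j is j'.+1 then fwd (2 ^ (k - j)) (fft k j' a) else a.
Fixpoint ifft j a := if j is j'.+1 then bwd (2 ^ j') (ifft j' a) else a.

Lemma half_lo i hf : (0 < hf)%N -> (i %% hf.*2 < hf)%N ->
  ((i + hf) %/ hf.*2 = i %/ hf.*2 /\ (i + hf) %% hf.*2 = i %% hf.*2 + hf)%N.
Proof.
move=> h0 h; have e : (i + hf = i %/ hf.*2 * hf.*2 + (i %% hf.*2 + hf))%N by rewrite addnA -divn_eq.
have h2 : (i %% hf.*2 + hf < hf.*2)%N by lia.
by rewrite e modn_cat // divn_cat.
Qed.

Lemma half_hi i hf : (0 < hf)%N -> (hf <= i %% hf.*2)%N ->
  [/\ (hf <= i)%N, ((i - hf) %/ hf.*2 = i %/ hf.*2)%N & ((i - hf) %% hf.*2 = i %% hf.*2 - hf)%N].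
Proof.
move=> h0 h; have hi : (hf <= i)%N by apply: leq_trans h (leq_mod _ _).
have e : (i - hf = i %/ hf.*2 * hf.*2 + (i %% hf.*2 - hf))%N by rewrite addnBA // -divn_eq.
have h2 : (i %% hf.*2 - hf < hf.*2)%N.
  by apply: leq_ltn_trans (leq_subr _ _) _; rewrite ltn_mod; lia.
by split=> //; rewrite e ?modn_cat ?divn_cat.
Qed.

Lemma bwd_fwd hf a i : (0 < hf)%N -> bwd hf (fwd hf a) i = a i *+ 2.
Proof.
move=> h0; rewrite /bwd; case: ltnP => h.
  have [e1 e2] := half_lo h0 h; rewrite /fwd h e1 e2 ltnNge leq_addl /= addnK mulr2n; ring.
have [h1 e1 e2] := half_hi h0 h; have h3 : (i %% hf.*2 - hf < hf)%N.
  by rewrite ltn_subLR // addnn ltn_mod; lia.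
rewrite /fwd e1 e2 h3 ltnNge h /= subnK // mulr2n.
by have := r_inv (i %/ hf.*2); set u := r _; set v := ri _ => e; ring: e.
Qed.

Lemma bwd_scale hf a b c : (forall i, a i = c * b i) -> forall i, bwd hf a i = c * bwd hf b i.
Proof. by move=> e i; rewrite /bwd !e; case: ifP => _; ring. Qed.

(** Halving is postponed at every level; the power of two that accumulates is removed by the final
    rounding. *)
Lemma ifft_fft k j a i : (j <= k)%N -> ifft j (fft k k a) i = 2%:R ^+ j * fft k (k - j) a i.
Proof.
elim: j i => [|j IH] i hj; first by rewrite subn0 expr0 mul1r.
rewrite [LHS](bwd_scale _ (fun i => IH i (ltnW hj))).
have -> : (k - j = (k - j.+1).+1)%N by lia.
rewrite [fft k _.+1 a]/= (_ : (k - (k - j.+1).+1 = j)%N); last by lia.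
by rewrite bwd_fwd ?expn_gt0 // exprSr -mulrA mulr_natl.
Qed.

Lemma bwd_local hf a b N i : (0 < hf)%N -> (hf.*2 %| N)%N -> (i < N)%N ->
  (forall i, (i < N)%N -> a i = b i) -> bwd hf a i = bwd hf b i.
Proof.
move=> h0 /dvdnP[q eN] hi e; rewrite /bwd; case: ltnP => h.
  rewrite !e //; have : (i %/ hf.*2 < q)%N by rewrite ltn_divLR; lia.
  rewrite {2}(divn_eq i hf.*2) eN -addnA => hq.
  by apply: (leq_trans _ (leq_mul hq (leqnn hf.*2))); rewrite mulSn; lia.
by rewrite !e //; apply: leq_ltn_trans (leq_subr _ _) hi.
Qed.

Lemma ifft_local k j a b i : (j <= k)%N -> (i < 2 ^ k)%N ->
  (forall i, (i < 2 ^ k)%N -> a i = b i) -> ifft j a i = ifft j b i.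
Proof.
move=> hj hi e; elim: j i hi hj => [|j IH] i hi hj /=; first exact: e.
apply: (@bwd_local _ _ _ (2 ^ k)) => //; first by rewrite expn_gt0.
  by rewrite -mul2n -expnS dvdn_exp2l.
by move=> l hl; apply: IH => //; apply: ltnW.
Qed.

Lemma node_sq b : node b ^+ 2 = node b./2.
Proof. by rewrite /node exprMn -exprM mulnC exprM sqrrN expr1n expr1n mul1r r_sq. Qed.

(** The block of node [b] is the remainder modulo its polynomial, so it takes the value of the whole
    polynomial at each root of that modulus. *)
Lemma fft_eval k j a b y : (j <= k)%N -> y ^+ (2 ^ (k - j)) = node b ->
  (b < 2 ^ j)%N -> \sum_(t < 2 ^ (k - j)) fft k j a (b * 2 ^ (k - j) + t)%N * y ^+ t =
  \sum_(t < 2 ^ k) a t * y ^+ t.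
Proof.
elim: j b => [|j IH] b hj hy hb.
  by move: hb; rewrite expn0 ltnS leqn0 => /eqP->; rewrite subn0; apply: eq_bigr => t _; rewrite mul0n.
set hf := (2 ^ (k - j.+1))%N in hy *; have h0 : (0 < hf)%N by rewrite expn_gt0.
have ehf : (2 ^ (k - j) = hf.*2)%N by rewrite -mul2n -expnS; congr (_ ^ _)%N; lia.
rewrite -(IH b./2); first last.
- by rewrite ltn_half_double -mul2n -expnS.
- by rewrite ehf -addnn exprD hy -expr2 node_sq.
- exact: ltnW.
rewrite ehf -[in RHS]addnn big_split_ord /= -big_split /=; apply: eq_bigr => t _.
have eb : (b * hf + t = b./2 * hf.*2 + (odd b * hf + t))%N.
  by rewrite {1}(_ : b = odd b + b./2 * 2)%N ?muln2 ?odd_double_half // -mul2n; nia.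
have ht := ltn_ord t.
have hd : (odd b * hf + t < hf.*2)%N by case: (odd b); lia.
rewrite {1}/fwd eb divnMDl ?double_gt0 // modnMDl (divn_small hd) (modn_small hd) addn0.
rewrite exprD hy /node addnn -/hf; case: (odd b); rewrite ?mul1n ?mul0n ?add0n.
  rewrite ltnNge leq_addr /= expr1 -addnBA ?leq_addr // addKn; ring.
by rewrite ht expr0 -addnA [(t + hf)%N]addnC; ring.
Qed.

Lemma fft_leaf k a b : (b < 2 ^ k)%N -> fft k k a b = \sum_(t < 2 ^ k) a t * node b ^+ t.
Proof.
move=> hb; have := @fft_eval k k a b (node b) (leqnn k); rewrite subnn expn0 expr1 => /(_ erefl hb) <-.
by rewrite big_ord1 muln1 addn0 expr0 mulr1.
Qed.

Definition conv (a b : nat -> C) i := \sum_(j < i.+1) a j * b (i - j)%N.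

(** The leaves are values at points, hence multiplicative; [la + lb <= 2 ^ k] keeps the product
    polynomial within the transform length. *)
Lemma fft_conv k a b la lb i : (forall i, (la <= i)%N -> a i = 0) ->
  (forall i, (lb <= i)%N -> b i = 0) -> (la + lb <= 2 ^ k)%N -> (i < 2 ^ k)%N ->
  fft k k (conv a b) i = fft k k a i * fft k k b i.
Proof.
move=> ha hb hk hi; rewrite !fft_leaf //; set y := node i; set N := (2 ^ k)%N in hk *.
have E (u : nat -> C) l : (forall i, (l <= i)%N -> u i = 0) -> (l <= N)%N ->
    \sum_(t < N) u t * y ^+ t = (\poly_(t < l) u t).[y].
  move=> hu hl; rewrite horner_poly [RHS](big_ord_widen N (fun t => u t * y ^+ t)) //.
  rewrite [RHS]big_mkcond /=; apply: eq_bigr => t _; case: ltnP => // h.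
  by rewrite hu // mul0r.
rewrite (E a la) //; last by lia.
rewrite (E b lb) //; last by lia.
rewrite -hornerM.
rewrite (E (conv a b) (la + lb)%N) //; last first.
  move=> j hj; rewrite /conv big1 // => l _; case: (leqP la l) => h; first by rewrite ha ?mul0r.
  by rewrite hb ?mulr0 //; lia.
congr (_.[y]); apply/polyP => j; rewrite coefM coef_poly /conv.
have Ec (u : nat -> C) l t : (forall i, (l <= i)%N -> u i = 0) -> (\poly_(t < l) u t)`_t = u t.
  by move=> hu; rewrite coef_poly; case: ltnP => // h; rewrite hu.
rewrite [RHS](eq_bigr (fun t : 'I_j.+1 => a t * b (j - t)%N)); last by move=> t _; rewrite !Ec.
case: ltnP => // hj; apply/esym/big1 => l _; case: (leqP la l) => h; first by rewrite ha ?mul0r.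
by rewrite hb ?mulr0 //; lia.
Qed.

Lemma ifft_conv k a b la lb i : (forall i, (la <= i)%N -> a i = 0) ->
  (forall i, (lb <= i)%N -> b i = 0) -> (la + lb <= 2 ^ k)%N -> (i < 2 ^ k)%N ->
  ifft k (fun i => fft k k a i * fft k k b i) i = 2%:R ^+ k * conv a b i.
Proof.
move=> ha hb hk hi.
rewrite (@ifft_local k k _ (fft k k (conv a b))) ?ifft_fft ?subnn //.
by move=> j hj; rewrite (fft_conv ha hb hk).
Qed.

End ExactFFT.

(** * Fixed-point complex numbers *)

(* [Quad a b c d] represents the complex number (a - c) + i (b - d); products and
   sums of quads are those of the semiring N[t]/(t^4-1), and t^2 acts as -1 *)
Inductive quad := Quad (q0 q1 q2 q3 : nat).
Definition q0 q := let: Quad a _ _ _ := q in a.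
Definition q1 q := let: Quad _ a _ _ := q in a.
Definition q2 q := let: Quad _ _ a _ := q in a.
Definition q3 q := let: Quad _ _ _ a := q in a.

Definition qsum p := q0 p + q1 p + q2 p + q3 p.
Definition qadd p r := Quad (q0 p + q0 r) (q1 p + q1 r) (q2 p + q2 r) (q3 p + q3 r).
Definition qsub p r := Quad (q0 p + q2 r) (q1 p + q3 r) (q2 p + q0 r) (q3 p + q1 r).
Definition qconj p := Quad (q0 p) (q3 p) (q2 p) (q1 p).
Definition qprod p r := Quad
  (q0 p * q0 r + q1 p * q3 r + q2 p * q2 r + q3 p * q1 r)
  (q0 p * q1 r + q1 p * q0 r + q2 p * q3 r + q3 p * q2 r)
  (q0 p * q2 r + q1 p * q1 r + q2 p * q0 r + q3 p * q3 r)
  (q0 p * q3 r + q1 p * q2 r + q2 p * q1 r + q3 p * q0 r).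
Definition qdiv S p := Quad (q0 p %/ S) (q1 p %/ S) (q2 p %/ S) (q3 p %/ S).
Definition qmul S p r := qdiv S (qprod p r).
(* without this normalization the sums of products of several quads would grow *)
Definition qred p := Quad (q0 p - q2 p) (q1 p - q3 p) (q2 p - q0 p) (q3 p - q1 p).

Lemma qsum_prod p r : qsum (qprod p r) = qsum p * qsum r.
Proof. case: p => a b c d; case: r => a' b' c' d'; rewrite /qsum /=; nia. Qed.

Section Near.

Variable R : rcfType.
Local Open Scope ring_scope.
Local Open Scope complex_scope.
Local Notation C := R[i].

Definition qre q : R := (q0 q)%:R - (q2 q)%:R.
Definition qim q : R := (q1 q)%:R - (q3 q)%:R.
Definition nrm (z : C) : R := `|complex.Re z| + `|complex.Im z|.
(* [q], read as a fraction with denominator [S], approximates [z] up to [E / S] *)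
Definition near (S E : nat) q (z : C) :=
  `|qre q - S%:R * complex.Re z| + `|qim q - S%:R * complex.Im z| <= E%:R.

Lemma near_le S E E' q z : (E <= E')%N -> near S E q z -> near S E' q z.
Proof. by move=> h /le_trans; apply; rewrite ler_nat. Qed.

Lemma qre_prod p r : qre (qprod p r) = qre p * qre r - qim p * qim r.
Proof. by case: p => a b c d; case: r => a' b' c' d'; rewrite /qre /qim /= !natrD !natrM; ring. Qed.

Lemma qim_prod p r : qim (qprod p r) = qre p * qim r + qim p * qre r.
Proof. by case: p => a b c d; case: r => a' b' c' d'; rewrite /qre /qim /= !natrD !natrM; ring. Qed.

Lemma norm_qsum p : `|qre p| + `|qim p| <= (qsum p)%:R.
Proof.
case: p => a b c d; rewrite /qre /qim /qsum /= !natrD.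
have [h1 h2 h3 h4] : [/\ 0 <= a%:R :> R, 0 <= b%:R :> R, 0 <= c%:R :> R & 0 <= d%:R :> R] by [].
have := ler_normB (a%:R : R) c%:R; have := ler_normB (b%:R : R) d%:R.
by rewrite !normr_nat; lra.
Qed.

Lemma near_add S E E' p r z w : near S E p z -> near S E' r w ->
  near S (E + E') (qadd p r) (z + w).
Proof.
case: z => za zb; case: w => wa wb; rewrite /near natrD.
have -> : qre (qadd p r) = qre p + qre r by rewrite /qre /= !natrD; ring.
have -> : qim (qadd p r) = qim p + qim r by rewrite /qim /= !natrD; ring.
move=> /= h1 h2.
have := ler_normD (qre p - S%:R * za) (qre r - S%:R * wa).
have := ler_normD (qim p - S%:R * zb) (qim r - S%:R * wb).
have -> : qim p - S%:R * zb + (qim r - S%:R * wb) = qim p + qim r - S%:R * (zb + wb) by ring.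
have -> : qre p - S%:R * za + (qre r - S%:R * wa) = qre p + qre r - S%:R * (za + wa) by ring.
lra.
Qed.

Lemma near_sub S E E' p r z w : near S E p z -> near S E' r w ->
  near S (E + E') (qsub p r) (z - w).
Proof.
case: z => za zb; case: w => wa wb; rewrite /near natrD.
have -> : qre (qsub p r) = qre p - qre r by rewrite /qre /= !natrD; ring.
have -> : qim (qsub p r) = qim p - qim r by rewrite /qim /= !natrD; ring.
move=> /= h1 h2.
have := ler_normB (qre p - S%:R * za) (qre r - S%:R * wa).
have := ler_normB (qim p - S%:R * zb) (qim r - S%:R * wb).
have -> : qim p - S%:R * zb - (qim r - S%:R * wb) = qim p - qim r - S%:R * (zb - wb) by ring.
have -> : qre p - S%:R * za - (qre r - S%:R * wa) = qre p - qre r - S%:R * (za - wa) by ring.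
lra.
Qed.

Lemma near_conj S E p z : near S E p z -> near S E (qconj p) (conjc z).
Proof.
case: z => a b; rewrite /near /=.
have -> : qre (qconj p) = qre p by [].
have -> : qim (qconj p) = - qim p by rewrite /qim /= opprB.
have -> : - qim p - S%:R * - b = - (qim p - S%:R * b) by ring.
by rewrite normrN.
Qed.

Lemma near_red S E p z : near S E p z -> near S E (qred p) z.
Proof.
have e a b : ((a - b)%N%:R : R) - (b - a)%N%:R = a%:R - b%:R.
  by case: (leqP a b) => h; [rewrite (eqP h) natrB // | rewrite natrB ?(ltnW h) // (eqP (ltnW h))]; lra.
by rewrite /near /qre /qim /= !e.
Qed.

Lemma qsum_red p : (qsum (qred p))%:R = `|qre p| + `|qim p|.
Proof.
have e a b : ((a - b)%N%:R : R) + (b - a)%N%:R = `|a%:R - b%:R|.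
  case: (leqP a b) => h.
    by rewrite (eqP h) natrB // add0r distrC ger0_norm // subr_ge0 ler_nat.
  by rewrite natrB ?(ltnW h) // (eqP (ltnW h)) addr0 ger0_norm // subr_ge0 ler_nat ltnW.
by rewrite /qsum /qre /qim /= !natrD -!e; lra.
Qed.

Lemma qdiv_err S p : (0 < S)%N ->
  `|qre p - S%:R * qre (qdiv S p)| + `|qim p - S%:R * qim (qdiv S p)| <= 2 * S%:R.
Proof.
move=> hS; have e a b : `|(a%:R - b%:R) - S%:R * ((a %/ S)%N%:R - (b %/ S)%N%:R)| <= S%:R :> R.
  have h c : c%:R = S%:R * (c %/ S)%N%:R + (c %% S)%N%:R :> R.
    by rewrite -natrM -natrD mulnC -divn_eq.
  have h2 c : (c %% S)%N%:R <= S%:R :> R by rewrite ler_nat ltnW // ltn_mod.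
  have h3 c : 0 <= (c %% S)%N%:R :> R by [].
  rewrite {1}(h a) {1}(h b) ler_norml; have := h2 a; have := h2 b; have := h3 a; have := h3 b.
  by move=> *; apply/andP; split; lra.
have := e (q0 p) (q2 p); have := e (q1 p) (q3 p); rewrite /qre /qim /=; lra.
Qed.

Lemma qsum_div S p : (0 < S)%N -> (S * qsum (qdiv S p) <= qsum p)%N.
Proof.
move=> hS; have h a : (S * (a %/ S) <= a)%N by rewrite mulnC leq_trunc_div.
by rewrite /qsum /= !mulnDr; do 3![apply: leq_add => //].
Qed.

Lemma norm_mul2 (a b c d : R) : `|a * c - b * d| + `|a * d + b * c| <= (`|a| + `|b|) * (`|c| + `|d|).
Proof.
have := ler_normB (a * c) (b * d); have := ler_normD (a * d) (b * c).
by rewrite !normrM; lra.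
Qed.

Lemma qdiv_near S (T : nat) p z : (0 < S)%N ->
  `|qre p - S%:R * (S%:R * complex.Re z)| + `|qim p - S%:R * (S%:R * complex.Im z)| <= S%:R * T%:R ->
  near S (T + 2) (qdiv S p) z.
Proof.
move=> hS h; have := qdiv_err p hS; rewrite /near; case: z h => za zb; rewrite ![complex.Re _]/= ![complex.Im _]/= => h.
have S0 : 0 < S%:R :> R by rewrite ltr0n.
move: (qre p) (qim p) (qre (qdiv S p)) (qim (qdiv S p)) h => a b u v h1 h2.
have e (x : R) : S%:R * `|x| = `|S%:R * x| by rewrite normrM (gtr0_norm S0).
rewrite natrD -(ler_pM2l S0) (mulrDr S%:R `|_|) !e [leRHS]mulrDr.
have := ler_normB (a - S%:R * (S%:R * za)) (a - S%:R * u).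
have := ler_normB (b - S%:R * (S%:R * zb)) (b - S%:R * v).
have -> : a - S%:R * (S%:R * za) - (a - S%:R * u) = S%:R * (u - S%:R * za) by ring.
have -> : b - S%:R * (S%:R * zb) - (b - S%:R * v) = S%:R * (v - S%:R * zb) by ring.
lra.
Qed.

(** Multiplication by a root: the error of [p] is scaled by the norm bound 2 of [w], the error of
    the root by the size of [p], and the last 2 pays for the four floors. *)
Lemma near_mul S E M e eta p r z w : (0 < S)%N -> near S E p z -> near S eta r w ->
  nrm w <= 2 -> (qsum p <= M)%N -> (M * eta <= S * e)%N ->
  near S (2 * E + e + 2) (qmul S p r) (z * w).
Proof.
move=> hS h1 h2 hw hM he; apply: qdiv_near => //; rewrite qre_prod qim_prod.
have S0 : 0 < S%:R :> R by rewrite ltr0n.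
have hp := norm_qsum p; have hp2 : (qsum p)%:R <= M%:R :> R by rewrite ler_nat.
have he2 : M%:R * eta%:R <= S%:R * e%:R :> R by rewrite -!natrM ler_nat.
case: z h1 => za zb; case: w h2 hw => wa wb; rewrite /near /nrm /= natrD natrM.
move: (qre p) (qim p) (qre r) (qim r) hp => a b c d hp h2 hw h1.
have m1 := norm_mul2 a b (c - S%:R * wa) (d - S%:R * wb).
have m2 := norm_mul2 (a - S%:R * za) (b - S%:R * zb) wa wb.
have k1 : (`|a| + `|b|) * (`|c - S%:R * wa| + `|d - S%:R * wb|) <= M%:R * eta%:R.
  by apply: ler_pM => //; [rewrite addr_ge0|rewrite addr_ge0|lra].
have k2 : (`|a - S%:R * za| + `|b - S%:R * zb|) * (`|wa| + `|wb|) <= E%:R * 2.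
  by apply: ler_pM => //; rewrite addr_ge0.
have e1 : a * c - b * d - S%:R * (S%:R * (za * wa - zb * wb)) =
  (a * (c - S%:R * wa) - b * (d - S%:R * wb)) +
  S%:R * ((a - S%:R * za) * wa - (b - S%:R * zb) * wb) by ring.
have e2 : a * d + b * c - S%:R * (S%:R * (za * wb + zb * wa)) =
  (a * (d - S%:R * wb) + b * (c - S%:R * wa)) +
  S%:R * ((a - S%:R * za) * wb + (b - S%:R * zb) * wa) by ring.
rewrite e1 e2; set A := a * _ - _; set A' := a * _ + _; set B := (a - _) * _ - _ ; set B' := (a - _) * _ + _.
have n1 := ler_normD A (S%:R * B); have n2 := ler_normD A' (S%:R * B').
rewrite !normrM !(gtr0_norm S0) in n1 n2.
have n3 : S%:R * (`|B| + `|B'|) <= S%:R * (E%:R * 2).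
  by rewrite ler_pM2l //; apply: le_trans k2; apply: m2.
rewrite /A /A' in m1; lra.
Qed.

(** Here both factors are large. The exact second factor has size at most M + E <= 2M, whence three
    times M E. *)
Lemma near_mul2 S E M e p r z w : (0 < S)%N -> near S E p z -> near S E r w ->
  (qsum p <= M)%N -> (qsum r <= M)%N -> (E <= M)%N -> (3 * M * E <= S * e)%N ->
  near S (e + 2) (qmul S p r) (z * w).
Proof.
move=> hS h1 h2 hM hM' hEM he; apply: qdiv_near => //; rewrite qre_prod qim_prod.
have S0 : 0 < S%:R :> R by rewrite ltr0n.
have hp := norm_qsum p; have hp2 : (qsum p)%:R <= M%:R :> R by rewrite ler_nat.
have hr := norm_qsum r; have hr2 : (qsum r)%:R <= M%:R :> R by rewrite ler_nat.
have hE2 : E%:R <= M%:R :> R by rewrite ler_nat.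
have he2 : 3 * M%:R * E%:R <= S%:R * e%:R :> R by rewrite -[3]/(3%:R) -!natrM ler_nat.
case: z h1 => za zb; case: w h2 => wa wb; rewrite /near /=.
move: (qre p) (qim p) (qre r) (qim r) hp hr => a b c d hp hr h2 h1.
have m1 := norm_mul2 a b (c - S%:R * wa) (d - S%:R * wb).
have m2 := norm_mul2 (a - S%:R * za) (b - S%:R * zb) (S%:R * wa) (S%:R * wb).
have k1 : (`|a| + `|b|) * (`|c - S%:R * wa| + `|d - S%:R * wb|) <= M%:R * E%:R.
  by apply: ler_pM => //; [rewrite addr_ge0|rewrite addr_ge0|lra].
have k3 : `|S%:R * wa| + `|S%:R * wb| <= 2 * M%:R.
  have := ler_normB c (c - S%:R * wa); have := ler_normB d (d - S%:R * wb).
  have -> : c - (c - S%:R * wa) = S%:R * wa by ring.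
  have -> : d - (d - S%:R * wb) = S%:R * wb by ring.
  lra.
have k2 : (`|a - S%:R * za| + `|b - S%:R * zb|) * (`|S%:R * wa| + `|S%:R * wb|) <= E%:R * (2 * M%:R).
  by apply: ler_pM => //; rewrite addr_ge0.
have e1 : a * c - b * d - S%:R * (S%:R * (za * wa - zb * wb)) =
  (a * (c - S%:R * wa) - b * (d - S%:R * wb)) +
  ((a - S%:R * za) * (S%:R * wa) - (b - S%:R * zb) * (S%:R * wb)) by ring.
have e2 : a * d + b * c - S%:R * (S%:R * (za * wb + zb * wa)) =
  (a * (d - S%:R * wb) + b * (c - S%:R * wa)) +
  ((a - S%:R * za) * (S%:R * wb) + (b - S%:R * zb) * (S%:R * wa)) by ring.
rewrite e1 e2; set A := a * _ - _; set A' := a * _ + _; set B := (a - _) * _ - _ ; set B' := (a - _) * _ + _.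
have n1 := ler_normD A B; have n2 := ler_normD A' B'.
rewrite -/A -/A' in m1; rewrite -/B -/B' in m2; lra.
Qed.

(** Half of the denominator is added before the floor; as E < H, the truncated subtraction does not
    truncate. *)
Lemma near_round H E q c : (0 < H)%N -> (E < H)%N -> near (H * 2) E q c%:R ->
  ((q0 q + H - q2 q) %/ (H * 2) = c)%N.
Proof.
move=> hH hE; rewrite /near; have -> : complex.Re (c%:R : C) = c%:R.
  by elim: c => // c IH; rewrite -!natr1 -IH; case: (c%:R).
have := normr_ge0 (qim q - (H * 2)%:R * complex.Im (c%:R : C)).
set w := `|_|; rewrite /qre => w0 h.
have hE2 : E%:R < H%:R :> R by rewrite ltr_nat.
have : `|(q0 q)%:R - (q2 q)%:R - (H * 2)%:R * c%:R| <= E%:R :> R by lra.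
rewrite ler_norml -natrM => /andP[h1 h2].
have a1 : (q2 q + H * 2 * c)%:R < (q0 q + H)%:R :> R by rewrite !natrD; lra.
have a2 : (q0 q + H)%:R < (q2 q + H * 2 * c + H * 2)%:R :> R by rewrite !natrD; lra.
rewrite ltr_nat in a1; rewrite ltr_nat in a2.
have -> : (q0 q + H - q2 q = c * (H * 2) + (q0 q + H - q2 q - c * (H * 2)))%N by lia.
by rewrite divn_cat //; lia.
Qed.

End Near.

Lemma isqrt_gt0 S c x : 6 * 3 <= S -> S * (S + c) %/ 2 < x.+1 ^ 2 -> 0 < x.
Proof.
move=> hS hx; rewrite lt0n; apply/eqP => x0; move: hx; rewrite x0 ltnS leqn0 -leqn0 -ltnS ltn_divLR //.
have : 2 * 1 <= S * (S + c) by apply: leq_mul; lia.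
lia.
Qed.

(** * Roots of unity by angle halving *)

Section Twiddles.

Variable R : rcfType.
Local Open Scope ring_scope.
Local Open Scope complex_scope.
Local Notation C := R[i].

(** Cosine of pi / 2^(i+1), with [gsin] the sine: the start is a right angle. The sine comes from
    the double-angle formula by a division, so only the cosine takes a square root. *)
Fixpoint gcos i : R := if i is j.+1 then Num.sqrt ((1 + gcos j) / 2) else 0.
Fixpoint gsin i : R := if i is j.+1 then gsin j / (2 * gcos j.+1) else 1.
Definition groot i : C := gcos i +i* gsin i.

Lemma gsinS j : gsin j.+1 = gsin j / (2 * gcos j.+1). Proof. by []. Qed.

Lemma half_circle (c t g s : R) : c ^+ 2 + t ^+ 2 = 1 -> g ^+ 2 = (1 + c) / 2 -> g != 0 ->
  2 * g * s = t -> g ^+ 2 + s ^+ 2 = 1.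
Proof.
move=> h h4 g0 e1; apply: (mulfI (_ : 4 * g ^+ 2 != 0)); first by rewrite mulf_neq0 ?expf_neq0 ?pnatr_eq0.
have -> : 4 * g ^+ 2 * (g ^+ 2 + s ^+ 2) = 4 * (g ^+ 2) ^+ 2 + (2 * g * s) ^+ 2 by ring.
have -> : (2 * g * s) ^+ 2 = 1 - c ^+ 2 by rewrite e1 -h; ring.
by rewrite h4; field.
Qed.

(** 2/3 is a rational below sqrt(1/2); it keeps the divisions by the cosine well conditioned. *)
Lemma gcos_spec i : [/\ 0 <= gcos i <= 1, 0 <= gsin i <= 1, gcos i ^+ 2 + gsin i ^+ 2 = 1,
  gcos i.+1 ^+ 2 = (1 + gcos i) / 2 & 2 / 3 <= gcos i.+1 <= 1].
Proof.
have S j : 0 <= gcos j <= 1 -> gcos j.+1 ^+ 2 = (1 + gcos j) / 2 /\ 2 / 3 <= gcos j.+1 <= 1.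
  move=> /andP[hj0 hj1]; have e : gcos j.+1 ^+ 2 = (1 + gcos j) / 2 by rewrite sqr_sqrtr // divr_ge0 ?addr_ge0.
  split=> //; have g0 : 0 <= gcos j.+1 by rewrite sqrtr_ge0.
  move: (gcos j.+1) (gcos j) hj0 hj1 e g0 => g c c0 c1 e g0; rewrite expr2 in e.
  apply/andP; split; rewrite leNgt; apply/negP => h.
    by have : 0 <= g * (2 / 3 - g) by [apply: mulr_ge0; lra]; rewrite mulrBr; lra.
  by have : 0 <= g * (g - 1) by [apply: mulr_ge0; lra]; rewrite mulrBr; lra.
suff H j : [/\ 0 <= gcos j <= 1, 0 <= gsin j <= 1 & gcos j ^+ 2 + gsin j ^+ 2 = 1].
  by have [h1 h2 h3] := H i; have [h4 h5] := S i h1.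
elim: j => [|j [h1 h2 h3]]; first by split; rewrite /= ?lexx ?ler01 // expr0n expr1n add0r.
have [h4 h5] := S j h1; have g0 : gcos j.+1 != 0 by case/andP: h5 => h5 _; rewrite gt_eqF //; lra.
have e1 : 2 * gcos j.+1 * gsin j.+1 = gsin j.
  by rewrite gsinS [LHS]mulrC divfK // mulf_neq0 // pnatr_eq0.
have e2 := half_circle h3 h4 g0 e1.
case/andP: h5 => h5 h6; have s0 : 0 <= gsin j.+1.
  by rewrite gsinS divr_ge0 //; [case/andP: h2 | rewrite mulr_ge0 // (le_trans _ h5) // divr_ge0].
split=> //; first by rewrite h6 (le_trans _ h5) // divr_ge0.
by rewrite s0 andTb -(@expr_le1 _ 2 _ isT s0) -[leRHS]e2 lerDr sqr_ge0.
Qed.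

Lemma groot_sq i : groot i.+1 ^+ 2 = groot i.
Proof.
have [h1 h2 h3 h4 h5] := gcos_spec i; have [_ _ h6 _ _] := gcos_spec i.+1.
have g0 : gcos i.+1 != 0 by case/andP: h5 => h5' _; rewrite gt_eqF //; lra.
have e1 : 2 * gcos i.+1 * gsin i.+1 = gsin i.
  by rewrite gsinS [LHS]mulrC divfK // mulf_neq0 // pnatr_eq0.
rewrite /groot expr2; move: (gcos i.+1) (gsin i.+1) h4 h6 e1 g0 => G T h4 h6 e1 g0.
congr (_ +i* _); last by rewrite -e1; ring.
have -> : T * T = 1 - G ^+ 2 by rewrite -h6; ring.
by rewrite -expr2 h4; field.
Qed.

Lemma groot_conj i : groot i * conjc (groot i) = 1.
Proof.
have [_ _ h _ _] := gcos_spec i; apply/eqP; rewrite eq_complex; apply/andP.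
by rewrite /groot; split; apply/eqP => /=; rewrite -?h; ring.
Qed.

(** Product of the roots [groot j] over the binary digits j of [b], that is, the roots in
    bit-reversed order. *)
Fixpoint root_tab i b : C :=
  if i is j.+1 then if (b < 2 ^ j)%N then root_tab j b else groot j * root_tab j (b - 2 ^ j)%N
  else 1.
Definition tw b := root_tab b b.

Lemma root_tabE i b : (b < 2 ^ i)%N -> root_tab i b = tw b.
Proof.
have S d j : (b < 2 ^ j)%N -> root_tab (j + d) b = root_tab j b.
  move=> h; elim: d => [|d IH]; first by rewrite addn0.
  by rewrite addnS /= (leq_trans h) // leq_exp2l // leq_addr.
move=> h; rewrite /tw; case: (leqP i b) => hib.
  by have := S (b - i)%N i h; rewrite subnKC.
by have := S (i - b)%N b (ltn_expl b (isT : (1 < 2)%N)); rewrite subnKC // ltnW.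
Qed.

Lemma twS i b : (b < 2 ^ i)%N -> tw (2 ^ i + b) = groot i * tw b.
Proof.
move=> h; rewrite -(@root_tabE i.+1) /=; last by rewrite expnS; lia.
by rewrite ltnNge leq_addr /= addKn root_tabE.
Qed.

Lemma tw0 : tw 0 = 1. Proof. by []. Qed.

Lemma tw_ind (P : nat -> Prop) : P 0%N -> (forall i b, (b < 2 ^ i)%N -> P b -> P (2 ^ i + b)%N) ->
  forall b, P b.
Proof.
move=> h0 hS b; suff H i : forall b, (b < 2 ^ i)%N -> P b by apply: (H b); rewrite ltn_expl.
elim: i => [|i IH] c hc; first by case: c hc => // c; rewrite expn0.
case: (ltnP c (2 ^ i)) => h; first exact: IH.
rewrite expnS in hc; rewrite -(subnKC h); apply: hS; first by lia.
by apply: IH; lia.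
Qed.

(** Squaring sends [groot j.+1] to [groot j] and so shifts the binary digits of [b] down; the digit
    shifted out contributes the square of [groot 0], which is -1. *)
Lemma tw_sq b : tw b ^+ 2 = node tw b.
Proof.
elim/tw_ind: b => [|i b hb IH]; first by rewrite /node tw0 mulr1 expr1n.
case: i hb => [|i] hb.
  have -> : (2 ^ 0 + b = 1)%N by move: hb; rewrite expn0; lia.
  rewrite /node /tw /= !mulr1; apply/eqP; rewrite eq_complex expr2 /=.
  by apply/andP; split; apply/eqP; ring.
have e1 : (odd (2 ^ i.+1 + b) = odd b)%N by rewrite oddD oddX /=.
have e2 : ((2 ^ i.+1 + b)./2 = 2 ^ i + b./2)%N.
  by rewrite halfD oddX /= -!divn2 expnS mulKn.
have hb2 : (b./2 < 2 ^ i)%N by rewrite ltn_half_double -mul2n -expnS.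
by rewrite twS // exprMn groot_sq IH /node e1 e2 twS //; ring.
Qed.

Lemma tw_conj b : tw b * conjc (tw b) = 1.
Proof.
elim/tw_ind: b => [|i b hb IH].
  by rewrite tw0; apply/eqP; rewrite eq_complex /= ; apply/andP; split; apply/eqP; ring.
rewrite twS // rmorphM /=.
have -> : groot i * tw b * (conjc (groot i) * conjc (tw b)) = groot i * conjc (groot i) * (tw b * conjc (tw b)) by ring.
by rewrite IH groot_conj mulr1.
Qed.

Lemma nrm_le2 (z : C) : z * conjc z = 1 -> nrm z <= 2.
Proof.
case: z => a b /(congr1 (@complex.Re R)) /= h; have {}h : a ^+ 2 + b ^+ 2 = 1 by rewrite -h; ring.
have H (x y : R) : x ^+ 2 + y ^+ 2 = 1 -> `|x| <= 1.
  by move=> e; rewrite -(@expr_le1 _ 2) // real_normK ?num_real // -[leRHS]e lerDl sqr_ge0.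
by rewrite /nrm /=; have := H a b h; have := H b a; rewrite addrC => /(_ h); lra.
Qed.

(** The error of the square root is the error of the radicand divided by x + S c1, which is at least
    2S/3. The error of the new sine combines that of [s] with that of [x], the latter weighted by t1
    <= 3/4. *)
Lemma half_real (S c s x y s' d1 d2 c0 t0 c1 t1 : R) :
  6 * (d1 + 3) <= S -> 0 <= d1 -> 0 <= c0 <= 1 -> 0 <= t0 <= 1 -> c1 ^+ 2 = (1 + c0) / 2 ->
  2 / 3 <= c1 -> t0 = 2 * c1 * t1 -> `|c - S * c0| <= d1 -> `|s - S * t0| <= d2 ->
  0 <= x -> y <= S * (S + c) / 2 <= y + 1 -> x ^+ 2 <= y <= x ^+ 2 + 2 * x + 1 ->
  s' * (2 * x) <= s * S <= (s' + 1) * (2 * x) ->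
  `|x - S * c1| <= d1 + 3 /\ `|s' - S * t1| <= d2 + 3 / 2 * (d1 + 3) + 1.
Proof.
move=> hS hd hc0 ht0 ec1 hc1 et0 hc hs hx hy hxy hs'.
move: hc hs; rewrite !ler_norml => /andP[hc1' hc2'] /andP[hs1' hs2'].
move: hc0 ht0 hy hxy hs' => /andP[? ?] /andP[? ?] /andP[? ?] /andP[? ?] /andP[? ?].
have S0 : 0 < S by lra.
set D := x + S * c1; have hD : 2 * S <= 3 * D by rewrite /D; nra.
have D0 : 0 < D by lra.
have eD : (x - S * c1) * D = x ^+ 2 - S ^+ 2 * (1 + c0) / 2.
  by rewrite -mulrA -ec1 /D; ring.
have k1 : S * (c - S * c0) <= S * d1 by rewrite ler_pM2l //; lra.
have k2 : S * - d1 <= S * (c - S * c0) by rewrite ler_pM2l //; lra.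
have k3 : S * d1 <= 3 / 2 * (d1 * D) by nra.
have k0 : S * (c - S * c0) / 2 = S * (S + c) / 2 - S ^+ 2 * (1 + c0) / 2 by field.
have xD : x <= D by rewrite /D; nra.
have u1 : x - S * c1 <= d1 + 3.
  by rewrite -(ler_pM2r D0) eD mulrDl; nra.
have u2 : - (d1 + 3) <= x - S * c1.
  by rewrite -(ler_pM2r D0) eD mulNr mulrDl; lra.
split; first by rewrite u1 u2.
have Sc : 2 / 3 * S <= S * c1 by rewrite mulrC ler_pM2l.
have x0 : S <= 2 * x by lra.
have t1a : 0 <= t1 by nra.
have t1b : t1 <= 3 / 4 by nra.
set w := d2 + 3 / 2 * (d1 + 3).
have p1 : (x - S * c1) * t1 <= (d1 + 3) * (3 / 4) by nra.
have p2 : - ((d1 + 3) * (3 / 4)) <= (x - S * c1) * t1 by nra.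
have e3 : s - 2 * x * t1 = s - S * t0 - 2 * ((x - S * c1) * t1) by rewrite et0; ring.
have w0 : 0 <= w by rewrite /w; lra.
have q1 : S * (s - 2 * x * t1) <= S * w by rewrite ler_pM2l // e3 /w; lra.
have q2 : S * - w <= S * (s - 2 * x * t1) by rewrite ler_pM2l // e3 /w; lra.
have q3 : S * w <= 2 * x * w by rewrite ler_wpM2r.
have xx : 0 < 2 * x by lra.
have e4 : S * (s - 2 * x * t1) = s * S - S * t1 * (2 * x) by ring.
rewrite -/w; apply/andP; split; rewrite -(ler_pM2r xx); lra.
Qed.

(** The factor 16 is generous and chosen so that errors of the form 16^i - 1 reproduce
    themselves. *)
Lemma half_near S d c s x i : near S d (Quad c s 0 0) (groot i) -> (6 * (d + 3) <= S)%N ->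
  (x ^ 2 <= S * (S + c) %/ 2 < x.+1 ^ 2)%N ->
  near S (16 * d + 15) (Quad x (s * S %/ (2 * x)) 0 0) (groot i.+1).
Proof.
move=> hn hS /andP[hx1 hx2]; have [h1 h2 h3 h4 h5] := gcos_spec i.
have g0 : gcos i.+1 != 0 by case/andP: h5 => h5' _; rewrite gt_eqF //; lra.
have e1 : gsin i = 2 * gcos i.+1 * gsin i.+1.
  by rewrite gsinS [RHS]mulrC divfK // mulf_neq0 // pnatr_eq0.
move: hn; rewrite /near /qre /qim /= !subr0.
pose d1 : R := `|c%:R - S%:R * gcos i|; pose d2 : R := `|s%:R - S%:R * gsin i|.
rewrite -/d1 -/d2 => hd; have d10 : 0 <= d1 := normr_ge0 _; have d20 : 0 <= d2 := normr_ge0 _.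
have hS' : 6 * (d%:R + 3) <= S%:R :> R by rewrite -[3]/(3%:R) -natrD -[6]/(6%:R) -natrM ler_nat.
set y := (S * (S + c) %/ 2)%N in hx1 hx2.
have hy : (y%:R : R) <= S%:R * (S%:R + c%:R) / 2 <= (y%:R + 1 : R).
  have e := divn_eq (S * (S + c)) 2; have hm : (S * (S + c) %% 2 <= 2)%N by rewrite ltnW // ltn_mod.
  have : S%:R * (S%:R + c%:R) = y%:R * 2 + ((S * (S + c)) %% 2)%N%:R :> R.
    by rewrite -natrD -natrM {1}e natrD natrM.
  move: hm; rewrite -(ler_nat R); have : 0 <= ((S * (S + c)) %% 2)%N%:R :> R by [].
  by move=> a1 a2 ->; apply/andP; split; lra.
have hxy : (x%:R : R) ^+ 2 <= y%:R <= (x%:R ^+ 2 + 2 * x%:R + 1 : R).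
  have -> : x%:R ^+ 2 + 2 * x%:R + 1 = (x ^ 2 + 2 * x + 1)%N%:R :> R by rewrite (natrD _ (x ^ 2 + 2 * x)) (natrD _ (x ^ 2)) natrX natrM.
  have e : (x.+1 ^ 2 = x ^ 2 + 2 * x + 1)%N by rewrite -addn1 sqrnD muln1 exp1n addnAC.
  by rewrite -natrX !ler_nat hx1 -e (ltnW hx2).
set s' := (s * S %/ (2 * x))%N.
have x_gt0 : (0 < x)%N.
  by apply: (isqrt_gt0 _ hx2); apply: leq_trans hS; rewrite mulnDr leq_addl.
have hs' : (s'%:R : R) * (2 * x%:R) <= s%:R * S%:R <= (s'%:R + 1) * (2 * x%:R : R).
  rewrite natr1 -[2]/(2%:R) -!natrM !ler_nat leq_trunc_div /= ltnW // ltn_ceil //.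
  by rewrite muln_gt0.
have g23 : 2 / 3 <= gcos i.+1 by case/andP: h5.
have dS : 6 * (d1 + 3) <= S%:R by lra.
have := half_real dS d10 h1 h2 h4 g23 e1 (lexx _) (lexx _) (ler0n R x) hy hxy hs'.
rewrite (natrD _ (16 * d) 15) (natrM _ 16 d); case; rewrite -/d1 -/d2.
have -> : Num.sqrt ((1 + gcos i) / 2) = gcos i.+1 by [].
have -> : gsin i / (2 * gcos i.+1) = gsin i.+1 by [].
by lra.
Qed.

End Twiddles.

(** * Error propagation through the fixed-point transforms *)

Section QuadFFT.

Variables (S : nat) (T : nat -> quad).

Definition qfwd hf (a : nat -> quad) i :=
  let b := i %/ hf.*2 in
  if i %% hf.*2 < hf then qadd (a i) (qmul S (a (i + hf)) (T b))
  else qsub (a (i - hf)) (qmul S (a i) (T b)).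

Definition qbwd hf (a : nat -> quad) i :=
  let b := i %/ hf.*2 in
  if i %% hf.*2 < hf then qadd (a i) (a (i + hf))
  else qmul S (qsub (a (i - hf)) (a i)) (qconj (T b)).

Fixpoint qfft k j a := if j is j'.+1 then qfwd (2 ^ (k - j)) (qfft k j' a) else a.
Fixpoint qifft j a := if j is j'.+1 then qbwd (2 ^ j') (qifft j' a) else a.

Definition qconv k a b := qifft k (fun i => qmul S (qfft k k a i) (qfft k k b i)).

Lemma half_lo_lt hf N i : 0 < hf -> hf.*2 %| N -> i < N -> i %% hf.*2 < hf -> i + hf < N.
Proof.
move=> h0 /dvdnP[q eN] hi h; have : i %/ hf.*2 < q by rewrite ltn_divLR -?eN; lia.
rewrite {2}(divn_eq i hf.*2) eN -addnA => hq.
by apply: (leq_trans _ (leq_mul hq (leqnn hf.*2))); rewrite mulSn; lia.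
Qed.

Lemma div_half_lt hf N i : 0 < hf -> hf.*2 %| N -> i < N -> i %/ hf.*2 < N./2.
Proof.
move=> h0 /dvdnP[q eN] hi; rewrite ltn_divLR ?double_gt0 // -[N./2]divn2 mulnC -muln2 -mulnA.
have -> : 2 * (N %/ 2) = N by rewrite mulnC divnK // eN -muln2 mulnA dvdn_mull.
by apply: leq_trans hi _; rewrite leq_pmull.
Qed.

Lemma qsum_qadd p r : qsum (qadd p r) = qsum p + qsum r.
Proof. by case: p => ????; case: r => ????; rewrite /qsum /=; lia. Qed.

Lemma qsum_qsub p r : qsum (qsub p r) = qsum p + qsum r.
Proof. by case: p => ????; case: r => ????; rewrite /qsum /=; lia. Qed.

Lemma qsum_qconj p : qsum (qconj p) = qsum p.
Proof. by case: p => ????; rewrite /qsum /=; lia. Qed.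

Lemma qsum_qmul M p r : 0 < S -> qsum p <= M -> qsum r <= 3 * S -> qsum (qmul S p r) <= 3 * M.
Proof.
move=> hS h1 h2; have := qsum_div (qprod p r) hS; rewrite qsum_prod => h.
by rewrite -(leq_pmul2l hS); apply: leq_trans h _; have := leq_mul h1 h2; lia.
Qed.

Variables (R : rcfType) (k eta : nat).
Local Notation C := (R[i])%C.
Local Notation N := (2 ^ k).
Hypothesis S_gt0 : 0 < S.
Hypothesis T_near : forall b, b < N./2 -> near S eta (T b) (tw R b).
Hypothesis T_sum : forall b, b < N./2 -> qsum (T b) <= 3 * S.

Definition approx E M (a : nat -> quad) (z : nat -> C) :=
  forall i, i < N -> near S E (a i) (z i) /\ qsum (a i) <= M.

Lemma nrm_tw b : (nrm (tw R b) <= 2)%R. Proof. exact/nrm_le2/tw_conj. Qed.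
Lemma nrm_tw_conj b : (nrm (conjc (tw R b)) <= 2)%R.
Proof. by apply: nrm_le2; rewrite conjcK mulrC tw_conj. Qed.

Lemma approx_fwd hf E M e a z : 0 < hf -> hf.*2 %| N -> M * eta <= S * e ->
  approx E M a z -> approx (4 * E + e + 2) (4 * M) (qfwd hf a) (fwd (tw R) hf z).
Proof.
move=> h0 hN he ha i hi; have hb := div_half_lt h0 hN hi; have tn := T_near hb.
have ts := T_sum hb; have tr := nrm_tw (i %/ hf.*2).
rewrite /qfwd /fwd; case: ltnP => h; last first.
  have [h1 _ _] := half_hi h0 h; have hi2 : i - hf < N by apply: leq_ltn_trans hi; rewrite leq_subr.
  have [a1 a2] := ha i hi; have [b1 b2] := ha _ hi2; split.
    apply: (near_le (_ : E + (2 * E + e + 2) <= _)); first by lia.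
    by apply: near_sub b1 _; rewrite mulrC; apply: (near_mul S_gt0 a1 tn tr a2 he).
  by rewrite qsum_qsub; have := qsum_qmul S_gt0 a2 ts; lia.
have hi2 := half_lo_lt h0 hN hi h.
have [a1 a2] := ha i hi; have [b1 b2] := ha _ hi2; split.
  apply: (near_le (_ : E + (2 * E + e + 2) <= _)); first by lia.
  by apply: near_add a1 _; rewrite mulrC; apply: (near_mul S_gt0 b1 tn tr b2 he).
by rewrite qsum_qadd; have := qsum_qmul S_gt0 b2 ts; lia.
Qed.

Lemma approx_bwd hf E M e a z : 0 < hf -> hf.*2 %| N -> 2 * M * eta <= S * e ->
  approx E M a z -> approx (4 * E + e + 2) (6 * M) (qbwd hf a) (bwd (fun b => conjc (tw R b)) hf z).
Proof.
move=> h0 hN he ha i hi; have hb := div_half_lt h0 hN hi; have tn := near_conj (T_near hb).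
have ts := T_sum hb; have tr := nrm_tw_conj (i %/ hf.*2).
rewrite /qbwd /bwd; case: ltnP => h; last first.
  have [h1 _ _] := half_hi h0 h; have hi2 : i - hf < N by apply: leq_ltn_trans hi; rewrite leq_subr.
  have [a1 a2] := ha i hi; have [b1 b2] := ha _ hi2.
  have hs : qsum (qsub (a (i - hf)) (a i)) <= 2 * M by rewrite qsum_qsub; lia.
  split; last by rewrite -qsum_qconj in ts; have := qsum_qmul S_gt0 hs ts; lia.
  apply: (near_le (_ : 2 * (E + E) + e + 2 <= _)); first by lia.
  exact: (near_mul S_gt0 (near_sub b1 a1) tn tr hs he).
have hi2 := half_lo_lt h0 hN hi h.
have [a1 a2] := ha i hi; have [b1 b2] := ha _ hi2; split; last by rewrite qsum_qadd; lia.
by apply: (near_le (_ : E + E <= _)); [lia|apply: near_add].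
Qed.

Lemma approx_le E E' M M' a z : E <= E' -> M <= M' -> approx E M a z -> approx E' M' a z.
Proof. by move=> h1 h2 h i hi; have [a1 a2] := h i hi; split; [apply: near_le a1|lia]. Qed.

(** Sizes grow by 4 per level here and by 6 in the inverse; both are relaxed to 8, since 8^k is the
    cube of the length. Likewise 4^k, which governs the error, is its square. *)
Lemma approx_fft E M e a z j : j <= k -> 2 * (8 ^ k * M) * eta <= S * e -> approx E M a z ->
  approx (4 ^ j * (E + e + 2) - (e + 2)) (8 ^ j * M) (qfft k j a) (fft (tw R) k j z).
Proof.
move=> hj he ha; elim: j hj => [|j IH] hj.
  by apply: approx_le ha; rewrite ?mul1n; lia.
have {}IH := IH (ltnW hj).
have h8 : 8 ^ j * M <= 8 ^ k * M by rewrite leq_mul2r leq_pexp2l ?orbT // ltnW.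
apply: approx_le (approx_fwd _ _ _ IH); rewrite ?expn_gt0 //.
- have : e + 2 <= 4 ^ j * (E + e + 2) by rewrite (@leq_trans (1 * (e + 2))) ?leq_mul ?expn_gt0 //; lia.
  instantiate (1 := e); rewrite !expnS; lia.
- by rewrite expnS; lia.
- by rewrite -mul2n -expnS dvdn_exp2l //; lia.
- by apply: leq_trans he; rewrite leq_mul2r; apply/orP; right; lia.
Qed.

Lemma approx_ifft E M e a z j : j <= k -> 2 * (8 ^ k * M) * eta <= S * e -> approx E M a z ->
  approx (4 ^ j * (E + e + 2) - (e + 2)) (8 ^ j * M) (qifft j a)
    (ifft (fun b => conjc (tw R b)) j z).
Proof.
move=> hj he ha; elim: j hj => [|j IH] hj.
  by apply: approx_le ha; rewrite ?mul1n; lia.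
have {}IH := IH (ltnW hj).
have h8 : 8 ^ j * M <= 8 ^ k * M by rewrite leq_mul2r leq_pexp2l ?orbT // ltnW.
apply: approx_le (approx_bwd _ _ _ IH); rewrite ?expn_gt0 //.
- have : e + 2 <= 4 ^ j * (E + e + 2) by rewrite (@leq_trans (1 * (e + 2))) ?leq_mul ?expn_gt0 //; lia.
  instantiate (1 := e); rewrite !expnS; lia.
- by rewrite expnS; lia.
- by rewrite -mul2n -expnS dvdn_exp2l.
- by apply: leq_trans he; rewrite leq_mul2r; apply/orP; right; lia.
Qed.

Lemma near_scale E q c (z : C) : near S E q (c%:R * z)%R -> near (S * c) E q z.
Proof.
case: z => za zb; rewrite /near.
have -> : (c%:R * (Complex za zb) = Complex (c%:R * za) (c%:R * zb) :> C)%R.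
  have -> : (c%:R = Complex c%:R 0 :> C)%R.
    by elim: c => // c IH; rewrite -!natr1 IH; congr (Complex _ _); rewrite addr0.
  by congr (Complex _ _); rewrite mul0r ?subr0 ?addr0.
by rewrite /= natrM -!mulrA.
Qed.

Definition digit_quad (d : nat) := Quad (S * d) 0 0 0.

(** The errors of the transforms and of the pointwise product add up to at most 12 N^11 B^2 (eta +
    1). It has to stay below half of the final denominator S N, whence the hypothesis on S. *)
Lemma qconv_correct H B (a b : nat -> nat) la lb i :
  (forall i, la <= i -> a i = 0) -> (forall i, lb <= i -> b i = 0) -> la + lb <= N ->
  (forall i, a i <= B) -> (forall i, b i <= B) -> 0 < B -> H * 2 = S * N ->
  24 * N ^ 10 * B ^ 2 * (eta + 1) < S -> i < N ->
  let q := qconv k (digit_quad \o a) (digit_quad \o b) i in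
  (q0 q + H - q2 q) %/ (H * 2) = \sum_(j < i.+1) a j * b (i - j).
Proof.
move=> ha hb hab haB hbB B0 eH hS hi q.
pose za (j : nat) : C := ((a j)%:R)%R; pose zb (j : nat) : C := ((b j)%:R)%R.
have dq (u : nat -> nat) : (forall i, u i <= B) ->
    approx 0 (S * B) (digit_quad \o u) (fun j => (u j)%:R)%R.
  move=> hu j _; split; last by rewrite /digit_quad /qsum /= !addn0 leq_mul2l hu orbT.
  rewrite /near; have -> : ((u j)%:R = Complex (u j)%:R 0 :> C)%R.
    by elim: (u j) => // c IH; rewrite -!natr1 IH; congr (Complex _ _); rewrite addr0.
  by rewrite /qre /qim /= natrM mulr0 !subr0 subrr !normr0 addr0.
set n8 := 8 ^ k; set n4 := 4 ^ k.
have N0 : 0 < N by rewrite expn_gt0.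
have e8 : n8 = N ^ 3 by rewrite /n8 -expnM mulnC expnM.
have e4 : n4 = N ^ 2 by rewrite /n4 -expnM mulnC expnM.
(* [e1] bounds the error caused per level by inexact roots, for sizes up to N^3 S B; [g1] is what
   has accumulated after all levels. *)
set e1 := 2 * N ^ 3 * B * eta; set g1 := N ^ 2 * (e1 + 2).
have he1 : 2 * (n8 * (S * B)) * eta <= S * e1 by rewrite e8 /e1; lia.
have [Fa Fb] : approx g1 (N ^ 3 * (S * B)) (qfft k k (digit_quad \o a)) (fft (tw R) k k za) /\
    approx g1 (N ^ 3 * (S * B)) (qfft k k (digit_quad \o b)) (fft (tw R) k k zb).
  by split; apply: approx_le (approx_fft (leqnn k) he1 (dq _ _)); rewrite -/n4 -/n8 ?e4 ?e8 /g1 //; lia.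
have hN j : 1 <= N ^ j by rewrite expn_gt0 N0.
have P1 : N ^ 10 = N ^ 5 * N ^ 5 by rewrite -expnD.
have P2 : N ^ 5 = N ^ 2 * N ^ 3 by rewrite -expnD.
have g1_le : g1 <= 2 * N ^ 5 * B * (eta + 1).
  rewrite /g1 /e1 P2; have := hN 3; move: (N ^ 3) (N ^ 2) => u v hu.
  have h : 1 <= u * B by rewrite muln_gt0 hu.
  by have := leq_mul (leqnn (2 * v)) h; lia.
have S_big : g1 <= S.
  apply: (leq_trans g1_le); apply: ltnW; apply: leq_ltn_trans hS.
  rewrite leq_mul2r; apply/orP; right; rewrite P1 -mulnn; have := hN 5; move: (N ^ 5) => u hu.
  have h : 1 <= u * B by rewrite muln_gt0 hu.
  by have := leq_mul h (leqnn (u * B)); lia.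
set e2 := 3 * (N ^ 3 * B) * g1.
have Fm : approx (e2 + 2) (N ^ 6 * S * B ^ 2)
    (fun i => qmul S (qfft k k (digit_quad \o a) i) (qfft k k (digit_quad \o b) i))
    (fun i => fft (tw R) k k za i * fft (tw R) k k zb i)%R.
  move=> j hj; have [a1 a2] := Fa j hj; have [b1 b2] := Fb j hj; split.
    apply: (near_mul2 S_gt0 a1 b1 a2 b2); last by rewrite /e2; lia.
    apply: (leq_trans S_big); rewrite mulnCA -{1}(muln1 S) leq_mul2l; apply/orP; right.
    by rewrite muln_gt0 hN.
  rewrite -(leq_pmul2l S_gt0); apply: leq_trans (qsum_div _ S_gt0) _; rewrite qsum_prod.
  apply: leq_trans (leq_mul a2 b2) _.
  by rewrite (_ : N ^ 6 = N ^ 3 * N ^ 3) -?expnD // -mulnn; lia.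
set e3 := 2 * N ^ 9 * B ^ 2 * eta.
have he3 : 2 * (n8 * (N ^ 6 * S * B ^ 2)) * eta <= S * e3.
  by rewrite e8 /e3 (_ : N ^ 9 = N ^ 3 * N ^ 6) -?expnD //; lia.
have [h1 _] := approx_ifft (leqnn k) he3 Fm hi.
rewrite (@ifft_conv _ (tw R) _ (@tw_sq R) (@tw_conj R) k za zb la lb) // in h1;
  try by move=> j hj; rewrite /za /zb ?ha ?hb.
(* The factor 2^k left by the inverse transform is moved into the denominator. *)
have h2 : near (S * N) (N ^ 2 * (e2 + 2 + e3 + 2)) q (conv za zb i).
  by apply: near_scale; rewrite natrX; apply: near_le h1; rewrite -/n4 e4; lia.
have ec : conv za zb i = ((\sum_(j < i.+1) a j * b (i - j))%N%:R)%R.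
  by rewrite natr_sum; apply: eq_bigr => j _; rewrite natrM.
rewrite ec -eH in h2; apply: near_round h2.
  by have : 0 < H * 2; [rewrite eH muln_gt0 S_gt0|lia].
have E_le : N ^ 2 * (e2 + 2 + e3 + 2) <= 12 * N ^ 11 * B ^ 2 * (eta + 1).
  have P3 : N ^ 11 = N ^ 2 * N ^ 9 by rewrite -expnD.
  have P4 : N ^ 9 = N * N ^ 3 * N ^ 5 by rewrite -expnS -expnD.
  have e2_le : e2 <= 6 * N ^ 9 * B ^ 2 * (eta + 1).
    rewrite /e2 P4; apply: leq_trans (leq_mul (leqnn _) g1_le) _.
    rewrite -mulnn; move: (N ^ 3) (N ^ 5) => u v.
    have h : u * v <= N * u * v by rewrite -mulnA leq_pmull.
    by have := leq_mul h (leqnn (6 * (B * B) * (eta + 1))); lia.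
  have h4 : 4 <= 4 * N ^ 9 * B ^ 2 by rewrite -mulnA leq_pmulr // muln_gt0 hN expn_gt0 B0.
  rewrite P3 /e3; have := leq_mul (leqnn (N ^ 2)) (_ : e2 + 2 + e3 + 2 <= 12 * N ^ 9 * B ^ 2 * (eta + 1)).
  by rewrite /e3 => /(_ _) h; apply: leq_trans (h _) _; lia.
apply: leq_ltn_trans E_le _.
have : 24 * N ^ 11 * B ^ 2 * (eta + 1) < S * N.
  rewrite (_ : N ^ 11 = N * N ^ 10) -?expnS //.
  by have : 24 * N ^ 10 * B ^ 2 * (eta + 1) * N < S * N; [rewrite ltn_pmul2r|lia].
by rewrite -eH; lia.
Qed.

End QuadFFT.

(** * Products of numbers packed in slots *)

Definition nconv (a b : nat -> nat) i := \sum_(j < i.+1) a j * b (i - j).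

Lemma sum_extend l N (F : nat -> nat) : l <= N -> (forall i, l <= i -> F i = 0) ->
  \sum_(i < N) F i = \sum_(i < l) F i.
Proof.
move=> hl hF; rewrite -(subnKC hl) big_split_ord /= [X in _ + X]big1 ?addn0 // => i _.
by rewrite hF // leq_addr.
Qed.

Lemma nconv_sum x la lb N a b : (forall i, la <= i -> a i = 0) -> (forall i, lb <= i -> b i = 0) ->
  la + lb <= N ->
  \sum_(i < N) nconv a b i * x ^ i = (\sum_(i < la) a i * x ^ i) * (\sum_(i < lb) b i * x ^ i).
Proof.
move=> ha hb hN; rewrite (eq_bigr (fun i : 'I_N => \sum_(j < N | j <= i) a j * b (i - j) * x ^ i)).
  rewrite (exchange_big_dep xpredT) //= big_distrl /=.
  rewrite (@sum_extend la N (fun j => \sum_(i < N | j <= i) a j * b (i - j) * x ^ i)); [|lia|].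
    2: by move=> j hj; apply: big1 => i _; rewrite ha.
  apply: eq_bigr => j _; have hj := ltn_ord j.
  pose F l := b l * x ^ (l + j).
  have -> : \sum_(i < N | j <= i) a j * b (i - j) * x ^ i = a j * \sum_(l < N - j) F l.
    rewrite big_distrr /= -(big_mkord (fun i => j <= i) (fun i => a j * b (i - j) * x ^ i)).
    rewrite (@big_cat_nat _ _ _ j) /=; [|by []|lia].
    rewrite big_nat_cond [X in X + _]big1 ?add0n; last by move=> i; lia.
    rewrite -{1}(add0n j) big_addn big_mkord.
    apply: eq_big => [i|i _]; first by rewrite leq_addl.
    by rewrite addnK /F mulnA.
  rewrite -mulnA (@sum_extend lb (N - j) F); [|lia|by move=> l hl; rewrite /F hb].
  by rewrite [in RHS]big_distrr /=; congr (_ * _); apply: eq_bigr => l _; rewrite /F expnD; lia.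
move=> i _; rewrite /nconv big_distrl /=.
rewrite (big_ord_widen N (fun j => a j * b (i - j) * x ^ i)) ?ltn_ord //.
Qed.

Fixpoint carry B c i := if i is j.+1 then (c j + carry B c j) %/ B else 0.
Definition carried B c i := (c i + carry B c i) %% B.

Lemma carry_lo B (c : nat -> nat) i : 0 < B -> exists2 lo, lo < B ^ i &
  \sum_(j < i) c j * B ^ j = lo + carry B c i * B ^ i.
Proof.
move=> B0; elim: i => [|i [lo hlo e]]; first by exists 0; rewrite ?expn0 // big_ord0.
have hm : (c i + carry B c i) %% B < B by rewrite ltn_mod.
exists (lo + (c i + carry B c i) %% B * B ^ i).
  by rewrite expnS; have := leq_mul hm (leqnn (B ^ i)); rewrite mulSn; lia.
rewrite big_ord_recr /= e expnS; have := divn_eq (c i + carry B c i) B.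
move: (_ %/ B) (_ %% B) => u v h; have := congr1 (muln^~ (B ^ i)) h; rewrite /=; lia.
Qed.

Lemma carriedE B (c : nat -> nat) i N : 0 < B -> i < N ->
  carried B c i = (\sum_(j < N) c j * B ^ j) %/ B ^ i %% B.
Proof.
move=> B0 hi; rewrite -(subnKC hi) big_split_ord /= big_ord_recr /=.
have [lo hlo ->] := carry_lo c i B0.
have -> : \sum_(j < N - i.+1) c (i.+1 + j) * B ^ (i.+1 + j) =
    (\sum_(j < N - i.+1) c (i.+1 + j) * B ^ j) * B * B ^ i.
  by rewrite big_distrl big_distrl /=; apply: eq_bigr => j _; rewrite expnD expnS; lia.
set w := \sum_(_ < _) _; have -> : lo + carry B c i * B ^ i + c i * B ^ i + w * B * B ^ i =
  (w * B + (c i + carry B c i)) * B ^ i + lo by lia.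
by rewrite divnMDl ?expn_gt0 ?B0 // (divn_small hlo) addn0 modnMDl.
Qed.

Lemma digits_sum B d x : 0 < B -> \sum_(i < d) (x %/ B ^ i %% B) * B ^ i = x %% B ^ d.
Proof.
move=> B0; elim: d => [|d IH]; first by rewrite big_ord0 modn1.
rewrite big_ord_recr /= IH expnSr [in RHS](divn_eq x (B ^ d)).
rewrite {2}(divn_eq (x %/ B ^ d) B) mulnDl -addnA -mulnA [B * B ^ d]mulnC modnMDl.
rewrite [RHS]modn_small; first by rewrite addnC.
have h1 : x %/ B ^ d %% B < B by rewrite ltn_mod.
have h2 : x %% B ^ d < B ^ d by rewrite ltn_mod expn_gt0 B0.
by have := leq_mul h1 (leqnn (B ^ d)); rewrite mulSn; lia.
Qed.

Lemma slot_digit B d K (w : nat -> nat) k i : 0 < B -> (forall k, k < K -> w k < B ^ d) -> k < K -> i < d ->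
  (\sum_(j < K) w j * (B ^ d) ^ j) %/ B ^ (k * d + i) %% B = w k %/ B ^ i %% B.
Proof.
move=> B0 hw hk hi; have Bd : 0 < B ^ d by rewrite expn_gt0 B0.
have lo_lt l : l <= K -> \sum_(j < l) w j * (B ^ d) ^ j < (B ^ d) ^ l.
  elim: l => [|l IH] hl; first by rewrite big_ord0.
  rewrite big_ord_recr /= expnS; have := IH (ltnW hl); have := hw l hl.
  set u := \sum_(_ < _) _; move=> h1 h2.
  by have := leq_mul h1 (leqnn ((B ^ d) ^ l)); rewrite mulSn; lia.
have := lo_lt k (ltnW hk); rewrite -(subnKC hk) big_split_ord /= big_ord_recr /=.
set lo := \sum_(_ < k) _ => hlo.
have -> : \sum_(j < K - k.+1) w (k.+1 + j) * (B ^ d) ^ (k.+1 + j) =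
    (\sum_(j < K - k.+1) w (k.+1 + j) * (B ^ d) ^ j) * B ^ d * (B ^ d) ^ k.
  by rewrite big_distrl big_distrl /=; apply: eq_bigr => j _; rewrite expnD expnS; lia.
set r := \sum_(_ < _) _; have -> : lo + w k * (B ^ d) ^ k + r * B ^ d * (B ^ d) ^ k =
  (r * B ^ d + w k) * (B ^ d) ^ k + lo by lia.
have eB : B ^ (k * d + i) = (B ^ d) ^ k * B ^ i by rewrite expnD [k * d]mulnC expnM.
rewrite eB divnMA divnMDl ?expn_gt0 ?B0 // (divn_small hlo) addn0.
have e : B ^ d = B ^ (d - i.+1) * B * B ^ i by rewrite -expnSr -expnD; congr (_ ^ _); lia.
by rewrite {1}e mulnA divnMDl ?expn_gt0 ?B0 // mulnA modnMDl.
Qed.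

(* an array [al] holds the numbers [u 0], ..., [u h.-1] in slots of [d] digits *)
Definition slots B d h (u al : nat -> nat) :=
  [/\ forall m, m < h -> \sum_(i < d) al (m * d + i) * B ^ i = u m,
      forall i, h * d <= i -> al i = 0 & forall m, h <= m -> u m = 0].

Lemma slots_sum B d h u al : slots B d h u al ->
  \sum_(i < h * d) al i * B ^ i = \sum_(m < h) u m * (B ^ d) ^ m.
Proof.
move=> [hs _ _]; elim: h hs => [|h IH] hs; first by rewrite mul0n !big_ord0.
rewrite mulSnr big_split_ord big_ord_recr /= IH; last by move=> m hm; apply: hs; lia.
rewrite -hs // big_distrl /=; congr (_ + _); apply: eq_bigr => i _.
by rewrite expnD (mulnC h d) expnM; lia.
Qed.

(** Kronecker substitution: convolving digits and convolving slots give the same integer, and as no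
    slot overflows, its digits can be read slot by slot. *)
Lemma mul_slots B d h h' u v al be N k i : 0 < B -> slots B d h u al -> slots B d h' v be ->
  (h + h') * d <= N -> (forall k, k < h + h' -> nconv u v k < B ^ d) -> k < h + h' -> i < d ->
  carried B (nconv al be) (k * d + i) = nconv u v k %/ B ^ i %% B.
Proof.
move=> B0 hu hv hN hw hk hi; have [_ u2 u3] := hu; have [_ v2 v3] := hv.
have hkN : k * d + i < N.
  by apply: leq_trans hN; have := leq_mul hk (leqnn d); rewrite mulSn; lia.
rewrite (@carriedE _ _ _ N) // (nconv_sum _ u2 v2) -?mulnDl // (slots_sum hu) (slots_sum hv).
by rewrite -(nconv_sum _ u3 v3 (leqnn _)) slot_digit.
Qed.

Lemma nconvC u v k : nconv u v k = nconv v u k.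
Proof.
rewrite /nconv (reindex_inj rev_ord_inj) /=; apply: eq_bigr => j _.
by have := ltn_ord j => hj; rewrite mulnC; congr (v _ * u _); lia.
Qed.

(** * Newton doubling for the recurrence *)

Section Doubling.

Variables (s : nat) (f a : nat -> nat).
Hypothesis f0 : f 0 = 1.
Hypothesis fE : forall m, 0 < m -> f m = \sum_(1 <= l < m.+1) a l * f (m - l).
Hypothesis a0 : a 0 = 0.

Definition cut h (u : nat -> nat) i := if i < h then u i else 0.

(* the recurrence with the part of the history before [h] split off *)
Definition source h i := nconv (cut h f) (cut h.*2 a) (h + i).

(* one step of Newton's iteration for the inverse of 1 - sum a_l x^l *)
Lemma doubling h m : 0 < h -> m < h -> f (h + m) = nconv (cut h (source h)) (cut h f) m.
Proof.
(* The recurrence for f (h + m) is split at l = m. Larger l refer to terms before h and form the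
   source. Smaller l refer to new terms, to which the induction hypothesis applies; exchanging the
   sums then restores the recurrence of f (m - i). *)
move=> h0; elim/ltn_ind: m => m IH hm.
have srcE : source h m = \sum_(m.+1 <= l < (h + m).+1) a l * f (h + m - l).
  rewrite /source /nconv -(big_mkord xpredT (fun j => cut h f j * cut h.*2 a (h + m - j))).
  rewrite (@big_cat_nat _ _ _ h) /=; [|by []|lia].
  rewrite [X in _ + X]big_nat_cond [X in _ + X]big1 ?addn0; last first.
    by move=> j hj; rewrite /cut ltnNge (_ : h <= j) //; lia.
  rewrite big_nat_rev /= -[X in _ = \sum_(X <= _ < _) _](add0n m.+1) big_addn subSS addnK.
  rewrite !big_nat; apply: eq_bigr => j hj; rewrite /cut.
  have -> : h - j.+1 < h by lia.
  have -> : h + m - (h - j.+1) = j + m.+1 by lia.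
  have -> : j + m.+1 < h.*2 by lia.
  by rewrite mulnC; congr (_ * f _); lia.
have -> : nconv (cut h (source h)) (cut h f) m = \sum_(0 <= i < m.+1) source h i * f (m - i).
  rewrite big_mkord; apply: eq_bigr => i _; have hi := ltn_ord i.
  by rewrite /cut !ifT //; lia.
rewrite big_nat_recr //= subnn f0 muln1 fE; last by lia.
rewrite (@big_cat_nat _ _ _ m.+1) /=; [|by []|lia].
rewrite -srcE; congr (_ + _).
have -> : \sum_(1 <= l < m.+1) a l * f (h + m - l) =
    \sum_(1 <= l < m.+1) \sum_(0 <= i < m | i + l <= m) source h i * (a l * f (m - i - l)).
  rewrite !big_nat; apply: eq_bigr => l hl.
  have -> : h + m - l = h + (m - l) by lia.
  rewrite IH; [|lia|lia]; rewrite /nconv big_distrr /=.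
  rewrite -(big_mkord xpredT (fun i => a l * (cut h (source h) i * cut h f (m - l - i)))).
  rewrite (@big_nat_widen _ _ _ _ _ m); last by lia.
  rewrite big_nat_cond [RHS]big_nat_cond; apply: eq_big => [i|i /andP[hi _]]; first by lia.
  by rewrite /cut !ifT; [rewrite mulnCA; congr (_ * (_ * f _)); lia|lia|lia].
rewrite (exchange_big_dep_nat xpredT) //= !big_nat; apply: eq_bigr => i hi.
rewrite (fE (_ : 0 < m - i)); last by lia.
rewrite big_distrr /= [RHS](@big_nat_widen _ _ _ _ _ m.+1); last by lia.
rewrite big_nat_cond [RHS]big_nat_cond; apply: eq_bigl => l; lia.
Qed.

Hypothesis s_gt1 : 1 < s.
Hypothesis f_le : forall m, f m <= s ^ m.
Hypothesis a_le : forall l, a l <= s.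

Lemma geo_le h : \sum_(j < h) s ^ j <= s ^ h.
Proof.
elim: h => [|h IH]; first by rewrite big_ord0.
by rewrite big_ord_recr /= expnS (leq_trans (leq_add IH (leqnn _))) // addnn -mul2n leq_mul2r s_gt1 orbT.
Qed.

Lemma nconv_le h c (u v : nat -> nat) k : (forall j, u j <= c) ->
  nconv u (cut h v) k <= c * \sum_(j < h) v j.
Proof.
move=> hu; rewrite /nconv (reindex_inj rev_ord_inj) /= big_distrr /=.
have e (j : 'I_k.+1) : u (k.+1 - j.+1) * cut h v (k - (k.+1 - j.+1)) = u (k - j) * cut h v j.
  by have := ltn_ord j => hj; congr (u _ * cut _ _ _); lia.
rewrite (eq_bigr _ (fun j _ => e j)).
rewrite (@leq_trans (\sum_(j < k.+1 | j < h) c * v j)) //.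
  rewrite [X in _ <= X]big_mkcond; apply: leq_sum => j _; rewrite /cut; case: ifP => _.
    by rewrite leq_mul2r hu orbT.
  by rewrite muln0.
rewrite -(big_mkord (fun j => j < h) (fun j => c * v j)).
rewrite -[X in _ <= X](big_mkord xpredT (fun j => c * v j)).
case: (leqP h k.+1) => hk.
  by rewrite [X in _ <= X](@big_nat_widen _ _ _ 0 h k.+1).
rewrite [X in _ <= X](@big_cat_nat _ _ _ k.+1) //=; last by apply: ltnW.
by apply: leq_trans (leq_addr _ _); rewrite big_mkcond; apply: leq_sum => j _; case: ifP.
Qed.

Lemma sum_f_le h : \sum_(j < h) f j <= s ^ h.
Proof. by apply: leq_trans (geo_le h); apply: leq_sum. Qed.

(** The first [h] values of f sum to at most s^h by the geometric series, and a coefficient costs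
    one more factor; the slots have to hold such values. *)
Lemma first_product_le h k : nconv (cut h f) (cut h.*2 a) k <= s ^ h.+1.
Proof.
rewrite nconvC; apply: leq_trans (@nconv_le h s _ f k _) _.
  by move=> j; rewrite /cut; case: ifP.
by rewrite expnS leq_mul2l sum_f_le orbT.
Qed.

Lemma second_product_le h k : nconv (cut h (source h)) (cut h f) k <= s ^ h.*2.+1.
Proof.
apply: leq_trans (@nconv_le h (s ^ h.+1) _ f k _) _.
  by move=> j; rewrite /cut; case: ifP => // _; apply: first_product_le.
by rewrite -addnn -addSn expnD leq_mul2l sum_f_le orbT.
Qed.

End Doubling.

(** * Transforms on the word RAM *)

Definition Q st tag i := Quad (arr st tag i) (arr st tag.+1 i) (arr st tag.+2 i) (arr st tag.+3 i).
Definition V4 st x := Quad (var st x) (var st x.+1) (var st x.+2) (var st x.+3).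

Lemma qsumE a b c d : qsum (Quad a b c d) = a + b + c + d. Proof. by []. Qed.

Section Transform.

Variables (ok : nat -> Prop) (lim X S : nat).
Hypothesis okX : forall v, v <= X -> ok v.
Local Notation runs := (runs ok lim).

Definition cmul p0 p1 p2 p3 r0 r1 r2 r3 :=
  33 ::= (p0 *' r0 +' p1 *' r3 +' p2 *' r2 +' p3 *' r1) /' Var 24 ;;
  34 ::= (p0 *' r1 +' p1 *' r0 +' p2 *' r3 +' p3 *' r2) /' Var 24 ;;
  35 ::= (p0 *' r2 +' p1 *' r1 +' p2 *' r0 +' p3 *' r3) /' Var 24 ;;
  36 ::= (p0 *' r3 +' p1 *' r2 +' p2 *' r1 +' p3 *' r0) /' Var 24.

(** [cmul] writes its four results one after another, so the operands must not depend on variables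
    33 to 36. *)
Definition stable e := forall st x v, 33 <= x <= 36 -> eval (setv st x v) e = eval st e.

Lemma stable_get a x : ~~ (33 <= x <= 36) -> stable (Get a (Var x)).
Proof. by move=> h st y v hy; rewrite /= /update; case: eqP => // e; case/negP: h; rewrite e. Qed.

Lemma stable_var x : ~~ (33 <= x <= 36) -> stable (Var x).
Proof. by move=> h st y v hy; rewrite /= /update; case: eqP => // e; case/negP: h; rewrite e. Qed.

Lemma cmul_spec p0 p1 p2 p3 r0 r1 r2 r3 st :
  [/\ stable p0, stable p1, stable p2 & stable p3] ->
  [/\ stable r0, stable r1, stable r2 & stable r3] -> var st 24 = S ->
  let p := Quad (eval st p0) (eval st p1) (eval st p2) (eval st p3) in
  let r := Quad (eval st r0) (eval st r1) (eval st r2) (eval st r3) in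
  qsum (qmul S p r) <= X ->
  runs (cmul p0 p1 p2 p3 r0 r1 r2 r3) st (fun t st' => t <= 4 /\ V4 st' 33 = qmul S p r).
Proof.
move=> [a0 a1 a2 a3] [b0 b1 b2 b3] hS p r hX; have [h0 h1 h2 h3] :
  [/\ q0 (qmul S p r) <= X, q1 (qmul S p r) <= X, q2 (qmul S p r) <= X & q3 (qmul S p r) <= X].
  by move: hX; rewrite /qsum => hX; split; lia.
have st0 e x v st' : 33 <= x <= 36 -> stable e -> eval (setv st' x v) e = eval st' e by auto.
have v24 x v st' : 33 <= x <= 36 -> var (setv st' x v) 24 = var st' 24.
  by move=> hx; rewrite /= /update; case: eqP => // e; lia.
have e1 : eval st ((p0 *' r0 +' p1 *' r3 +' p2 *' r2 +' p3 *' r1) /' Var 24) = q0 (qmul S p r).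
  by rewrite -hS.
apply: runs_seq; apply: runs_asg; rewrite e1; first exact: okX.
set s1 := setv _ _ _.
have e2 : eval s1 ((p0 *' r1 +' p1 *' r0 +' p2 *' r3 +' p3 *' r2) /' Var 24) = q1 (qmul S p r).
  by rewrite -hS ![eval _ (Bin _ _ _)]/= !st0 // -[var s1 24]/(var st 24).
apply: runs_seq; apply: runs_asg; rewrite e2; first exact: okX.
set s2 := setv _ _ _.
have e3 : eval s2 ((p0 *' r2 +' p1 *' r1 +' p2 *' r0 +' p3 *' r3) /' Var 24) = q2 (qmul S p r).
  by rewrite -hS ![eval _ (Bin _ _ _)]/= !st0 // -[var s2 24]/(var st 24).
apply: runs_seq; apply: runs_asg; rewrite e3; first exact: okX.
set s3 := setv _ _ _.
have e4 : eval s3 ((p0 *' r3 +' p1 *' r2 +' p2 *' r1 +' p3 *' r0) /' Var 24) = q3 (qmul S p r).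
  by rewrite -hS ![eval _ (Bin _ _ _)]/= !st0 // -[var s3 24]/(var st 24).
by apply: runs_asg; rewrite e4; first exact: okX.
Qed.

(** The lower entry of butterfly x is x plus the number of upper entries in the preceding blocks, (x
    / hf) hf. *)
Definition pair_index :=
  30 ::= Var 3 /' Var 29 ;; 31 ::= Var 3 +' Var 30 *' Var 29 ;; 32 ::= Var 31 +' Var 29.

(** The upper entry is written first, since it needs the old lower one. Adding components shifted by
    two subtracts, as t^2 acts as -1. *)
Definition fwd_body := pair_index ;;
  cmul (Get 8 (Var 32)) (Get 9 (Var 32)) (Get 10 (Var 32)) (Get 11 (Var 32))
       (Get 4 (Var 30)) (Get 5 (Var 30)) (Get 6 (Var 30)) (Get 7 (Var 30)) ;;
  Put 8 (Var 32) (Get 8 (Var 31) +' Var 35) ;; Put 9 (Var 32) (Get 9 (Var 31) +' Var 36) ;;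
  Put 10 (Var 32) (Get 10 (Var 31) +' Var 33) ;; Put 11 (Var 32) (Get 11 (Var 31) +' Var 34) ;;
  Put 8 (Var 31) (Get 8 (Var 31) +' Var 33) ;; Put 9 (Var 31) (Get 9 (Var 31) +' Var 34) ;;
  Put 10 (Var 31) (Get 10 (Var 31) +' Var 35) ;; Put 11 (Var 31) (Get 11 (Var 31) +' Var 36).

(** The difference is saved in variables 14 to 17 before its operands are overwritten; exchanging
    arrays 5 and 7 conjugates the root. *)
Definition bwd_body := pair_index ;;
  14 ::= Get 8 (Var 31) +' Get 10 (Var 32) ;; 15 ::= Get 9 (Var 31) +' Get 11 (Var 32) ;;
  16 ::= Get 10 (Var 31) +' Get 8 (Var 32) ;; 17 ::= Get 11 (Var 31) +' Get 9 (Var 32) ;;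
  cmul (Var 14) (Var 15) (Var 16) (Var 17)
       (Get 4 (Var 30)) (Get 7 (Var 30)) (Get 6 (Var 30)) (Get 5 (Var 30)) ;;
  Put 8 (Var 31) (Get 8 (Var 31) +' Get 8 (Var 32)) ;;
  Put 9 (Var 31) (Get 9 (Var 31) +' Get 9 (Var 32)) ;;
  Put 10 (Var 31) (Get 10 (Var 31) +' Get 10 (Var 32)) ;;
  Put 11 (Var 31) (Get 11 (Var 31) +' Get 11 (Var 32)) ;;
  Put 8 (Var 32) (Var 33) ;; Put 9 (Var 32) (Var 34) ;; Put 10 (Var 32) (Var 35) ;;
  Put 11 (Var 32) (Var 36).

Lemma pair_index_spec st x hf : var st 3 = x -> var st 29 = hf -> x + x %/ hf * hf + hf <= X ->
  runs pair_index st (fun t st' => t <= 3 /\ [/\ var st' 30 = x %/ hf,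
    var st' 31 = x + x %/ hf * hf & var st' 32 = x + x %/ hf * hf + hf]).
Proof.
move=> h3 h29 hX; have hd := leq_div x hf.
apply: runs_seq; apply: runs_asg; first by apply: okX; rewrite /= h3 h29; lia.
apply: runs_seq; apply: runs_asg; first by apply: okX; simp_store; rewrite h3 h29; lia.
apply: runs_asg; first by apply: okX; simp_store; rewrite h3 h29; lia.
by simp_store; rewrite h3 h29.
Qed.

Definition set_pair (a : nat -> quad) i0 i1 u v i :=
  if i == i0 then u else if i == i1 then v else a i.

Lemma fwd_body_spec st x hf : 0 < hf -> var st 3 = x -> var st 29 = hf -> var st 24 = S ->
  let b := x %/ hf in let i0 := x + b * hf in let i1 := i0 + hf in
  let v := qmul S (Q st 8 i1) (Q st 4 b) in
  i1 <= X -> qsum (Q st 8 i0) + qsum v <= X ->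
  runs fwd_body st (fun t st' => t <= 15 /\ forall i, Q st' 8 i =
    set_pair (Q st 8) i0 i1 (qadd (Q st 8 i0) v) (qsub (Q st 8 i0) v) i).
Proof.
move=> h0 h3 h29 h24 b i0 i1 v hi hX.
apply: runs_seq; apply: runs_call (pair_index_spec h3 h29 hi) _ => t1 s1 f1 [ht1 [e30 e31 e32]].
rewrite -/b -/i0 -/i1 in e30 e31 e32.
have A a : arr s1 a = arr st a by case: f1 => _ -> .
apply: runs_seq; apply: runs_call (cmul_spec _ _ _ _) _.
- by split; apply: stable_get.
- by split; apply: stable_get.
- by use_frame f1.
- by rewrite /= e30 e32 !A -/(Q st 8 i1) -/(Q st 4 b) -/v; lia.
rewrite /= e30 e32 !A -/(Q st 8 i1) -/(Q st 4 b) -/v => t2 s2 f2 [ht2 ev].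
have A2 a : arr s2 a = arr st a by case: f2 => _ -> //; rewrite A.
have g31 : var s2 31 = i0 by use_frame f2.
have g32 : var s2 32 = i1 by use_frame f2.
have ne : (i0 == i1) = false by rewrite /i1; lia.
move: hX; rewrite -ev /V4 /Q !qsumE => hX.
do 7![apply: runs_seq; apply: runs_put;
  first by apply: okX; simp_store; rewrite ?g31 ?g32 ?ne /= ?g31 ?g32 ?A2 ?ne; lia].
apply: runs_put; first by apply: okX; simp_store; rewrite ?g31 ?g32 ?ne /= ?g31 ?g32 ?A2 ?ne; lia.
split; first by lia.
move=> i; rewrite /Q /set_pair; simp_store; rewrite ?g31 ?g32 ?ne ?A2 /=.
by case: (i == i0); [|case: (i == i1)].
Qed.

Lemma bwd_body_spec st x hf : 0 < hf -> var st 3 = x -> var st 29 = hf -> var st 24 = S ->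
  let b := x %/ hf in let i0 := x + b * hf in let i1 := i0 + hf in
  let v := qmul S (qsub (Q st 8 i0) (Q st 8 i1)) (qconj (Q st 4 b)) in
  i1 <= X -> qsum (Q st 8 i0) + qsum (Q st 8 i1) <= X -> qsum v <= X ->
  runs bwd_body st (fun t st' => t <= 19 /\ forall i, Q st' 8 i =
    set_pair (Q st 8) i0 i1 (qadd (Q st 8 i0) (Q st 8 i1)) v i).
Proof.
move=> h0 h3 h29 h24 b i0 i1 v hi hX hv.
apply: runs_seq; apply: runs_call (pair_index_spec h3 h29 hi) _ => t1 s1 f1 [ht1 [e30 e31 e32]].
rewrite -/b -/i0 -/i1 in e30 e31 e32.
have A a : arr s1 a = arr st a by case: f1 => _ -> .
have ne : (i0 == i1) = false by rewrite /i1; lia.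
have e24 : var s1 24 = S by use_frame f1.
move: hX; rewrite /Q !qsumE => hX.
do 4![apply: runs_seq; apply: runs_asg; first by apply: okX; simp_store; rewrite e31 e32 !A; lia].
apply: runs_seq; apply: runs_call (cmul_spec _ _ _ _) _.
- by split; apply: stable_var.
- by split; apply: stable_get.
- by simp_store.
- by simp_store; rewrite e30 e31 e32 !A; exact: hv.
simp_store; rewrite e30 e31 e32 !A => t2 s2 f2 [ht2 ev].
have {}ev : V4 s2 33 = v by [].
have A2 a : arr s2 a = arr st a by case: f2 => _ -> //; rewrite /= A.
have g31 : var s2 31 = i0 by use_frame f2; simp_store.
have g32 : var s2 32 = i1 by use_frame f2; simp_store.
move: hv; rewrite -ev /V4 !qsumE => hv.
do 7![apply: runs_seq; apply: runs_put;
  first by apply: okX; simp_store; rewrite ?g31 ?g32 ?ne /= ?g31 ?g32 ?A2 ?ne; lia].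
apply: runs_put; first by apply: okX; simp_store; rewrite ?g31 ?g32 ?ne /= ?g31 ?g32 ?A2 ?ne; lia.
split; first by lia.
move=> i; rewrite /set_pair; simp_store; rewrite ?g31 ?g32 ?ne ?A2 /=.
by case: (@eqP _ i i0) => [e0|_]; case: (@eqP _ i i1) => [e1|_] //; move: ne; rewrite -e0 -e1 eqxx.
Qed.

End Transform.

Lemma sum_ord_const k c : \sum_(i < k) c = k * c.
Proof. by rewrite big_const_ord iter_addn_0 mulnC. Qed.

Section Levels.

Variables (ok : nat -> Prop) (lim X S : nat).
Hypothesis okX : forall v, v <= X -> ok v.
Local Notation runs := (runs ok lim).

Definition level body := 3 ::= Num 0 ;; For 3 (Var 28 /' Num 2) body.

Definition butterfly hf (lo hi : quad -> quad -> quad -> quad) (T a : nat -> quad) i :=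
  let b := i %/ hf.*2 in
  if i %% hf.*2 < hf then lo (T b) (a i) (a (i + hf)) else hi (T b) (a (i - hf)) (a i).

(** The butterfly to which entry [i] belongs; the loop invariant tells by it which entries are
    already new. *)
Definition pair_of hf i := i %/ hf.*2 * hf + i %% hf.*2 %% hf.

Lemma pair_first hf x : 0 < hf -> let i := x + x %/ hf * hf in
  [/\ i %/ hf.*2 = x %/ hf, i %% hf.*2 = x %% hf & (i + hf) %/ hf.*2 = x %/ hf /\
      (i + hf) %% hf.*2 = x %% hf + hf].
Proof.
move=> h0 i; have hm : x %% hf < hf by rewrite ltn_mod.
have e : i = x %/ hf * hf.*2 + x %% hf by rewrite /i {1}(divn_eq x hf) -muln2; lia.
have l1 : x %% hf < hf.*2 by lia.
have l2 : x %% hf + hf < hf.*2 by lia.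
by rewrite e -addnA modn_cat // divn_cat // modn_cat // divn_cat.
Qed.

Lemma pair_lt hf q x : 0 < hf -> x < q * hf -> x + x %/ hf * hf + hf < q * hf.*2.
Proof.
move=> h0 hx; have hb : x %/ hf < q by rewrite ltn_divLR.
have hm : x %% hf < hf by rewrite ltn_mod.
rewrite {1}(divn_eq x hf); move: (x %/ hf) (x %% hf) hb hm => b r hb hm.
by have := leq_mul hb (leqnn hf); rewrite mulSn -muln2; lia.
Qed.

Lemma pair_ofE hf x i : 0 < hf -> pair_of hf i = x ->
  i = x + x %/ hf * hf \/ i = x + x %/ hf * hf + hf.
Proof.
move=> h0 <-; rewrite /pair_of; set r := _ %% hf; have hr : r < hf by rewrite ltn_mod.
rewrite divnMDl // (divn_small hr) addn0; have := divn_eq i hf.*2.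
have h2 : i %% hf.*2 < hf.*2 by rewrite ltn_mod double_gt0.
rewrite /r; move: (i %/ hf.*2) (i %% hf.*2) h2 => b o h2 ->; case: (ltnP o hf) => h.
  by left; rewrite modn_small // -muln2; lia.
have -> : o %% hf = o - hf by rewrite -{1}(subnK h) modnDr modn_small //; lia.
by right; rewrite -muln2; lia.
Qed.

Lemma pair_of_pair hf x : 0 < hf -> let i := x + x %/ hf * hf in
  pair_of hf i = x /\ pair_of hf (i + hf) = x.
Proof.
move=> h0 i; have [a1 a2 [a3 a4]] := pair_first x h0; rewrite -/i in a1 a2 a3 a4.
by rewrite /pair_of a1 a2 a3 a4 modnDr !modn_mod -divn_eq.
Qed.

Variables (body : cmd) (lo hi : quad -> quad -> quad -> quad) (M : nat).
Hypothesis body_vars : all (fun x => x \notin vars_set body) [:: 3; 24; 28; 29].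
Hypothesis body_arrs : all (fun a => a \notin arrs_set body) [:: 4; 5; 6; 7].
Hypothesis body_spec : forall st x hf, 0 < hf -> var st 3 = x -> var st 29 = hf -> var st 24 = S ->
  let b := x %/ hf in let i0 := x + b * hf in let i1 := i0 + hf in
  i1 <= X -> qsum (Q st 8 i0) <= M -> qsum (Q st 8 i1) <= M -> qsum (Q st 4 b) <= 3 * S ->
  runs body st (fun t st' => t <= 19 /\ forall i, Q st' 8 i = set_pair (Q st 8) i0 i1
    (lo (Q st 4 b) (Q st 8 i0) (Q st 8 i1)) (hi (Q st 4 b) (Q st 8 i0) (Q st 8 i1)) i).

Lemma level_spec st N hf : 0 < hf -> hf.*2 %| N -> N <= X -> var st 28 = N -> var st 29 = hf ->
  var st 24 = S -> (forall i, i < N -> qsum (Q st 8 i) <= M) ->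
  (forall b, b < N./2 -> qsum (Q st 4 b) <= 3 * S) ->
  runs (level body) st (fun t st' => t <= N * 11 + 2 /\
    forall i, i < N -> Q st' 8 i = butterfly hf lo hi (Q st 4) (Q st 8) i).
Proof.
move=> h0 hN hNX h28 h29 h24 hM hT.
move: body_vars body_arrs => /and5P[v3 v24 v28 v29 _] /and5P[a4 a5 a6 a7 _].
apply: runs_seq; apply: runs_asg; first exact: okX.
pose I x st' := forall i, i < N ->
  Q st' 8 i = if pair_of hf i < x then butterfly hf lo hi (Q st 4) (Q st 8) i else Q st 8 i.
have [q eN] := dvdnP hN; have eN2 : N %/ 2 = q * hf by rewrite eN -muln2 mulnA mulnK.
have hhalf : N./2 = N %/ 2 by rewrite divn2.
apply: (@runs_for _ _ _ _ _ _ 0 (N %/ 2) I (fun=> 19)) => //.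
- by move=> i /andP[_ hi']; apply: okX; apply: leq_trans hi' (leq_trans (leq_div _ _) hNX).
- move=> i st' hi' hI hv [f1 _ _]; rewrite /= f1 /= ?inE ?mem_cat ?negb_or ?v28 //.
  by rewrite /update /= h28.
- move=> x st' /andP[_ hx] hI hv [f1 f2 _].
  have e24 : var st' 24 = S by rewrite f1 /= ?inE ?mem_cat ?negb_or ?v24.
  have e29 : var st' 29 = hf by rewrite f1 /= ?inE ?mem_cat ?negb_or ?v29.
  have eT b : Q st' 4 b = Q st 4 b by rewrite /Q !f2 //= ?cats0.
  have [c1 c2 [c3 c4]] := pair_first x h0; have [d1 d2] := pair_of_pair x h0.
  set b := x %/ hf in c1 c2 c3 c4 d1 d2; set i0 := x + b * hf in c1 c2 c3 c4 d1 d2.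
  have hbq : b < q by rewrite ltn_divLR // -eN2.
  have hi1 : i0 + hf < N by rewrite eN; apply: pair_lt => //; rewrite -eN2.
  have hi0 : i0 < N by apply: leq_ltn_trans hi1; apply: leq_addr.
  have g0 : Q st' 8 i0 = Q st 8 i0 by rewrite hI // d1 ltnn.
  have g1 : Q st' 8 (i0 + hf) = Q st 8 (i0 + hf) by rewrite hI // d2 ltnn.
  have hm : x %% hf < hf by rewrite ltn_mod.
  apply: runs_call (body_spec h0 hv e29 e24 _ _ _ _) _; rewrite -/b -/i0.
  + by apply: leq_trans (ltnW hi1) hNX.
  + by rewrite g0; apply: hM.
  + by rewrite g1; apply: hM.
  + rewrite eT; apply: hT; rewrite hhalf eN2; apply: leq_trans hbq _; exact: leq_pmulr.
  move=> t1 s1 fr [ht hs]; split=> // _ i hiN.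
  have -> : Q (setv s1 3 x.+1) 8 i = Q s1 8 i by [].
  rewrite hs /set_pair g0 g1 eT; case: eqP => [->|n0].
    by rewrite d1 ltnSn /butterfly c1 c2 hm.
  case: eqP => [->|n1].
    by rewrite d2 ltnSn /butterfly c3 c4 ltnNge leq_addl addnK.
  rewrite hI // ltnS [pair_of hf i <= x]leq_eqVlt; case: (@eqP _ (pair_of hf i) x) => // e.
  by case: (pair_ofE h0 e) => e'; [case: n0|case: n1].
- move=> t st' _; rewrite sum_cost => ht hI _; split.
    have H u : u * 2 <= N -> t <= (u - 0) * (19 + 2) + 1 -> 1 + t <= N * 11 + 2 by clear; lia.
    exact: H (leq_trunc_div N 2) ht.
  move=> i hiN; rewrite hI //; have -> // : pair_of hf i < N %/ 2.
  rewrite eN2 /pair_of; have : i %/ hf.*2 < q by rewrite ltn_divLR ?double_gt0 // -eN.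
  have : i %% hf.*2 %% hf < hf by rewrite ltn_mod.
  by move=> h1 h2; apply: ltn_cat.
Qed.

End Levels.

Definition run_fft :=
  29 ::= Var 28 /' Num 2 ;;
  While (Num 1) (Var 29) (level fwd_body ;; 29 ::= Var 29 /' Num 2).

Definition run_ifft :=
  29 ::= Num 1 ;;
  While (Var 29 +' Num 1) (Var 28) (level bwd_body ;; 29 ::= Var 29 *' Num 2).

Section FFT.

Variables (ok : nat -> Prop) (lim X S M k : nat).
Hypothesis okX : forall v, v <= X -> ok v.
Hypothesis MX : 6 * M <= X.
Hypothesis NX : 2 ^ k <= X.
Hypothesis S_gt0 : 0 < S.
Local Notation runs := (runs ok lim).
Local Notation N := (2 ^ k).

Lemma butterfly_local hf lo hi T a a' i : 0 < hf -> hf.*2 %| N -> i < N ->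
  (forall i, i < N -> a i = a' i) -> butterfly hf lo hi T a i = butterfly hf lo hi T a' i.
Proof.
move=> h0 hN hiN e; rewrite /butterfly; case: ltnP => h.
  by rewrite !e // (half_lo_lt h0 hN).
by rewrite !e // (leq_ltn_trans (leq_subr _ _)).
Qed.

Lemma fft_spec st : var st 28 = N -> var st 24 = S ->
  (forall b, b < N./2 -> qsum (Q st 4 b) <= 3 * S) ->
  (forall j i, j <= k -> i < N -> qsum (qfft S (Q st 4) k j (Q st 8) i) <= M) ->
  runs run_fft st (fun t st' => t <= k * (N * 11 + 4) + 3 /\
    forall i, i < N -> Q st' 8 i = qfft S (Q st 4) k k (Q st 8) i).
Proof.
move=> h28 h24 hT hM; apply: runs_seq; apply: runs_asg.
  by apply: okX; rewrite /= h28; have := leq_div N 2; lia.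
pose I j st' := var st' 29 = 2 ^ (k - j) %/ 2 /\
  forall i, i < N -> Q st' 8 i = qfft S (Q st 4) k j (Q st 8) i.
apply: (@runs_while _ _ _ _ _ _ k I (fun=> N * 11 + 3)).
- by split; rewrite ?subn0 // /= h28.
- move=> j st' hj [e29 hI] fr.
  have e : k - j = (k - j.+1).+1 by lia.
  set hf := 2 ^ (k - j.+1); have h0 : 0 < hf by rewrite expn_gt0.
  have {}e29 : var st' 29 = hf by rewrite e29 e expnS mulKn.
  split; first by rewrite /= e29.
  have eT b : Q st' 4 b = Q st 4 b by rewrite /Q; use_frame fr.
  have hN : hf.*2 %| N by rewrite -mul2n -expnS dvdn_exp2l //; lia.
  apply: runs_seq; apply: runs_call (@level_spec ok lim X S okX fwd_body
    (fun T u v => qadd u (qmul S v T)) (fun T u v => qsub u (qmul S v T)) M _ _ _ st' N hf _ _ _ _ _ _ _ _) _ => //.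
  + move=> st1 x hf1 a1 a2 a3 a4 b i0 i1 a5 a6 a7 a8.
    have h3 := qsum_qmul S_gt0 a7 a8.
    have h4 : qsum (Q st1 8 i0) + qsum (qmul S (Q st1 8 i1) (Q st1 4 b)) <= X by lia.
    have K := @fwd_body_spec ok lim X S okX st1 x hf1 a1 a2 a3 a4 a5 h4.
    apply: (runs_call K) => t1 s1 f1 [ht1 hq]; split; last exact: hq.
    by apply: leq_trans ht1 _.
  + by use_frame fr.
  + by use_frame fr.
  + by move=> i hi; rewrite hI //; apply: hM => //; lia.
  + by move=> b hb; rewrite eT; apply: hT.
  move=> t1 s1 f1 [ht1 hq].
  have e29' : var s1 29 = hf by use_frame f1.
  apply: runs_asg; first by apply: okX; rewrite /= e29'; apply: leq_trans (leq_div _ _) (leq_trans _ NX); rewrite leq_pexp2l // leq_subr.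
  split; first by lia.
  split; first by rewrite /= e29'.
  move=> i hi; rewrite [LHS]hq // (butterfly_local _ _ _ h0 hN hi hI) /= -/hf.
  by rewrite /butterfly /qfwd eT.
- by move=> st' [e29 _] fr; rewrite /= e29 subnn expn0.
- move=> t st' fr ht [_ hI]; split=> //.
  by rewrite sum_ord_const -addn1 -addnA in ht; lia.
Qed.

Lemma ifft_spec st : var st 28 = N -> var st 24 = S ->
  (forall b, b < N./2 -> qsum (Q st 4 b) <= 3 * S) ->
  (forall j i, j <= k -> i < N -> qsum (qifft S (Q st 4) j (Q st 8) i) <= M) ->
  runs run_ifft st (fun t st' => t <= k * (N * 11 + 4) + 3 /\
    forall i, i < N -> Q st' 8 i = qifft S (Q st 4) k (Q st 8) i).
Proof.
have N0 : 0 < N by rewrite expn_gt0.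
move=> h28 h24 hT hM; apply: runs_seq; apply: runs_asg; first by apply: okX; rewrite /=; lia.
pose I j st' := var st' 29 = 2 ^ j /\
  forall i, i < N -> Q st' 8 i = qifft S (Q st 4) j (Q st 8) i.
apply: (@runs_while _ _ _ _ _ _ k I (fun=> N * 11 + 3)).
- by [].
- move=> j st' hj [e29 hI] fr; set hf := 2 ^ j in e29; have h0 : 0 < hf by rewrite expn_gt0.
  have e28 : var st' 28 = N by use_frame fr; simp_store.
  have hN2 : hf.*2 <= N by rewrite -mul2n -expnS leq_pexp2l.
  split; first by rewrite /= e29 e28; lia.
  have eT b : Q st' 4 b = Q st 4 b by rewrite /Q; use_frame fr.
  have hN : hf.*2 %| N by rewrite -mul2n -expnS dvdn_exp2l.
  apply: runs_seq; apply: runs_call (@level_spec ok lim X S okX bwd_body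
    (fun T u v => qadd u v) (fun T u v => qmul S (qsub u v) (qconj T)) M _ _ _ st' N hf _ _ _ _ _ _ _ _) _ => //.
  + move=> st1 x hf1 a1 a2 a3 a4 b i0 i1 a5 a6 a7 a8.
    have a9 : qsum (qsub (Q st1 8 i0) (Q st1 8 i1)) <= 2 * M by rewrite qsum_qsub; lia.
    have a10 : qsum (qconj (Q st1 4 b)) <= 3 * S by rewrite qsum_qconj.
    have h3 := qsum_qmul S_gt0 a9 a10.
    have h4 : qsum (Q st1 8 i0) + qsum (Q st1 8 i1) <= X by lia.
    have h5 : qsum (qmul S (qsub (Q st1 8 i0) (Q st1 8 i1)) (qconj (Q st1 4 b))) <= X by lia.
    have K := @bwd_body_spec ok lim X S okX st1 x hf1 a1 a2 a3 a4 a5 h4 h5.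
    by apply: (runs_call K) => t1 s1 f1 [ht1 hq].
  + by use_frame fr.
  + by move=> i hi; rewrite hI //; apply: hM => //; lia.
  + by move=> b hb; rewrite eT; apply: hT.
  move=> t1 s1 f1 [ht1 hq].
  have e29' : var s1 29 = hf by use_frame f1.
  apply: runs_asg; first by apply: okX; rewrite /= e29' muln2; lia.
  split; first by lia.
  split; first by rewrite /= /update /= e29' expnS mulnC.
  move=> i hi; rewrite [LHS]hq // (butterfly_local _ _ _ h0 hN hi hI) /= -/hf.
  by rewrite /butterfly /qbwd eT.
- move=> st' [e29 _] fr.
  by have e28 : var st' 28 = N by [use_frame fr; simp_store]; rewrite /= e29 e28 addn1.
- move=> t st' fr ht [_ hI]; split=> //.
  by rewrite sum_ord_const -addn1 -addnA in ht; lia.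
Qed.

End FFT.

Definition load_digits ehi e := 3 ::= Num 0 ;;
  For 3 (Var 28)
    (Cond (Var 3 +' Num 1) ehi (Put 8 (Var 3) (Var 24 *' e)) (Put 8 (Var 3) (Num 0)) ;;
     Put 9 (Var 3) (Num 0) ;; Put 10 (Var 3) (Num 0) ;; Put 11 (Var 3) (Num 0)).

Definition copy_transform := 3 ::= Num 0 ;;
  For 3 (Var 28)
    (Put 12 (Var 3) (Get 8 (Var 3)) ;; Put 13 (Var 3) (Get 9 (Var 3)) ;;
     Put 14 (Var 3) (Get 10 (Var 3)) ;; Put 15 (Var 3) (Get 11 (Var 3))).

Definition pointwise := 3 ::= Num 0 ;;
  For 3 (Var 28)
    (cmul (Get 8 (Var 3)) (Get 9 (Var 3)) (Get 10 (Var 3)) (Get 11 (Var 3))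
          (Get 12 (Var 3)) (Get 13 (Var 3)) (Get 14 (Var 3)) (Get 15 (Var 3)) ;;
     Put 8 (Var 3) (Var 33) ;; Put 9 (Var 3) (Var 34) ;; Put 10 (Var 3) (Var 35) ;;
     Put 11 (Var 3) (Var 36)).

(** The quotient rounds to the nearest integer as in [near_round], with denominator S N; the carry
    never exceeds N B^2. *)
Definition propagate := 37 ::= Num 0 ;; 3 ::= Num 0 ;;
  For 3 (Var 28)
    (33 ::= (Get 8 (Var 3) +' Var 24 *' Var 28 /' Num 2 -' Get 10 (Var 3)) /' (Var 24 *' Var 28)
            +' Var 37 ;;
     Put 3 (Var 3) (Var 33 %' Var 21) ;; 37 ::= Var 33 /' Var 21).

Definition product := run_fft ;; pointwise ;; run_ifft ;; propagate.

Section QsumBounds.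

Variables (S : nat) (T : nat -> quad) (k : nat).
Local Notation N := (2 ^ k).
Hypothesis S_gt0 : 0 < S.
Hypothesis T_sum : forall b, b < N./2 -> qsum (T b) <= 3 * S.

Lemma qsum_fft a M j i : (forall i, i < N -> qsum (a i) <= M) -> j <= k -> i < N ->
  qsum (qfft S T k j a i) <= 8 ^ j * M.
Proof.
move=> ha; elim: j i => [|j IH] i hj hi; first by rewrite mul1n; apply: ha.
have h0 : 0 < 2 ^ (k - j.+1) by rewrite expn_gt0.
have hN : (2 ^ (k - j.+1)).*2 %| N by rewrite -mul2n -expnS dvdn_exp2l //; lia.
have ts := T_sum (div_half_lt h0 hN hi); have b1 := IH i (ltnW hj) hi.
rewrite /= /qfwd expnS; case: ltnP => h.
  have b2 := IH _ (ltnW hj) (half_lo_lt h0 hN hi h).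
  by rewrite qsum_qadd; have := qsum_qmul S_gt0 b2 ts; lia.
have b2 := IH (i - 2 ^ (k - j.+1)) (ltnW hj) (leq_ltn_trans (leq_subr _ _) hi).
by rewrite qsum_qsub; have := qsum_qmul S_gt0 b1 ts; lia.
Qed.

Lemma qsum_ifft a M j i : (forall i, i < N -> qsum (a i) <= M) -> j <= k -> i < N ->
  qsum (qifft S T j a i) <= 8 ^ j * M.
Proof.
move=> ha; elim: j i => [|j IH] i hj hi; first by rewrite mul1n; apply: ha.
have h0 : 0 < 2 ^ j by rewrite expn_gt0.
have hN : (2 ^ j).*2 %| N by rewrite -mul2n -expnS dvdn_exp2l.
have ts := T_sum (div_half_lt h0 hN hi); have b1 := IH i (ltnW hj) hi.
rewrite /= /qbwd expnS; case: ltnP => h.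
  by have b2 := IH _ (ltnW hj) (half_lo_lt h0 hN hi h); rewrite qsum_qadd; lia.
have b2 := IH (i - 2 ^ j) (ltnW hj) (leq_ltn_trans (leq_subr _ _) hi).
rewrite -qsum_qconj in ts; have hs : qsum (qsub (qifft S T j a (i - 2 ^ j)) (qifft S T j a i)) <=
  2 * (8 ^ j * M) by rewrite qsum_qsub; lia.
by have := qsum_qmul S_gt0 hs ts; lia.
Qed.

Lemma qfft_local a a' j i : (forall i, i < N -> a i = a' i) -> j <= k -> i < N ->
  qfft S T k j a i = qfft S T k j a' i.
Proof.
move=> e; elim: j i => [|j IH] i hj hi; first exact: e.
have h0 : 0 < 2 ^ (k - j.+1) by rewrite expn_gt0.
have hN : (2 ^ (k - j.+1)).*2 %| N by rewrite -mul2n -expnS dvdn_exp2l //; lia.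
rewrite /= /qfwd; case: ltnP => h; rewrite !IH //; try exact: ltnW.
  exact: half_lo_lt.
exact: leq_ltn_trans (leq_subr _ _) hi.
Qed.

Lemma qifft_local a a' j i : (forall i, i < N -> a i = a' i) -> j <= k -> i < N ->
  qifft S T j a i = qifft S T j a' i.
Proof.
move=> e; elim: j i => [|j IH] i hj hi; first exact: e.
have h0 : 0 < 2 ^ j by rewrite expn_gt0.
have hN : (2 ^ j).*2 %| N by rewrite -mul2n -expnS dvdn_exp2l.
rewrite /= /qbwd; case: ltnP => h; rewrite !IH //; try exact: ltnW.
  exact: half_lo_lt.
exact: leq_ltn_trans (leq_subr _ _) hi.
Qed.

End QsumBounds.

(** All numbers in a product are dominated by the size reached in the inverse transform, n^9 S B^2
    for transform length n. *)
Lemma size_arith n S B : 0 < n -> 0 < S -> 0 < B ->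
  [/\ n <= 6 * (n ^ 9 * S * B ^ 2), S * B <= 6 * (n ^ 9 * S * B ^ 2),
      2 * n * B ^ 2 <= 6 * (n ^ 9 * S * B ^ 2) & n ^ 3 * (S * B) <= n ^ 9 * S * B ^ 2].
Proof.
move=> n0 S0 B0; have hn j : 0 < n ^ j by rewrite expn_gt0 n0.
have e9 : n ^ 9 = n ^ 3 * n ^ 6 by rewrite -expnD.
have e9' : n ^ 9 = n * n ^ 8 by rewrite -expnS.
have B2 : B ^ 2 = B * B by rewrite mulnn.
split.
- have -> : 6 * (n ^ 9 * S * B ^ 2) = n * (6 * (n ^ 8 * S * B ^ 2)) by rewrite e9'; lia.
  by rewrite leq_pmulr // !(expn_gt0, muln_gt0) n0 S0 B0.
- have -> : 6 * (n ^ 9 * S * B ^ 2) = S * B * (6 * (n ^ 9 * B)) by rewrite B2; lia.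
  by rewrite leq_pmulr // !(expn_gt0, muln_gt0) n0 B0.
- have -> : 6 * (n ^ 9 * S * B ^ 2) = 2 * n * B ^ 2 * (3 * (n ^ 8 * S)) by rewrite e9'; lia.
  by rewrite leq_pmulr // !(expn_gt0, muln_gt0) n0 S0.
- have -> : n ^ 9 * S * B ^ 2 = n ^ 3 * (S * B) * (n ^ 6 * B) by rewrite e9 B2; lia.
  by rewrite leq_pmulr // !(expn_gt0, muln_gt0) n0 B0.
Qed.

Section Product.

Variables (ok : nat -> Prop) (lim X S B k : nat).
Local Notation N := (2 ^ k).
Hypothesis okX : forall v, v <= X -> ok v.
Hypothesis S_gt0 : 0 < S.
Hypothesis B_gt1 : 1 < B.
Hypothesis k_gt0 : 0 < k.
Hypothesis MX : 6 * (N ^ 9 * S * B ^ 2) <= X.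
Local Notation runs := (runs ok lim).

Lemma sized_bounds : [/\ N <= X, S * B <= X, 2 * N * B ^ 2 <= X & N ^ 3 * (S * B) <= N ^ 9 * S * B ^ 2].
Proof.
have [a1 a2 a3 a4] := size_arith (expn_gt0 2 k) S_gt0 (ltnW B_gt1).
by split=> //; apply: leq_trans MX.
Qed.

Lemma load_digits_spec st hi al ehi e : var st 28 = N -> var st 24 = S ->
  (forall x, x < N -> al x <= B) ->
  (forall st' x, x < N -> frame (load_digits ehi e) st st' -> var st' 3 = x ->
    eval st' ehi = hi /\ (x < hi -> eval st' e = al x)) ->
  runs (load_digits ehi e) st (fun t st' => t <= N * 7 + 2 /\
    forall i, i < N -> Q st' 8 i = digit_quad S (if i < hi then al i else 0)).
Proof.
move=> h28 h24 hal he; have [x1 x2 _ _] := sized_bounds.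
apply: runs_seq; apply: runs_asg; first exact: okX.
pose I x st' := forall i, i < x -> Q st' 8 i = digit_quad S (if i < hi then al i else 0).
apply: (@runs_for _ _ _ _ _ _ 0 N I (fun=> 5)) => //.
- by move=> i hi'; apply: okX; lia.
- by move=> i st' hi' hI hv fr; simp_store; use_frame fr; simp_store.
- move=> x st' /andP[_ hx] hI hv fr.
  have fr' : frame (load_digits ehi e) st st'.
    case: fr => f1 f2 f3; split=> [y|a ha|hio]; [|exact: f2|exact: f3].
    by rewrite [vars_set _]/= in_cons negb_or => /andP[y3 hy]; rewrite f1 //= /update (negbTE y3).
  have [e1 e2] := he st' x hx fr' hv; have e24 : var st' 24 = S by use_frame fr.
  have tail st1 v : var st1 3 = x -> arr st1 8 x = v ->
      (forall i, i < x -> Q st1 8 i = Q st' 8 i) -> v = S * (if x < hi then al x else 0) ->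
      runs (Put 9 (Var 3) (Num 0) ;; Put 10 (Var 3) (Num 0) ;; Put 11 (Var 3) (Num 0)) st1
      (fun t st2 => t <= 3 /\ I x.+1 (setv st2 3 x.+1)).
    move=> a1 a2 a3 a4; do 2![apply: runs_seq; apply: runs_put; first exact: okX].
    apply: runs_put; first exact: okX.
    split=> // i; rewrite ltnS leq_eqVlt => /orP[/eqP->|hi'].
      by rewrite /Q; simp_store; rewrite a1 eqxx a2 a4.
    rewrite -hI // -a3 // /Q; simp_store; rewrite a1.
    by have -> : (i == x) = false by rewrite ltn_eqF.
  apply: runs_seq; apply: runs_cond; rewrite [eval _ (Var 3 +' _)]/= hv addn1 e1 => hc.
    apply: runs_put; first by apply: okX; rewrite /= e24 e2 //; apply: leq_trans x2; rewrite leq_mul2l hal ?orbT.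
    apply: runs_call (tail _ (S * al x) _ _ _ _) _.
    + by simp_store.
    + by simp_store; rewrite hv eqxx e24 e2.
    + by move=> i hi'; rewrite /Q; simp_store; rewrite hv ltn_eqF.
    + by rewrite hc.
    by move=> t s2 _ [ht hI2]; split=> //; lia.
  apply: runs_put; first exact: okX.
  apply: runs_call (tail _ 0 _ _ _ _) _.
  + by simp_store.
  + by simp_store; rewrite hv eqxx.
  + by move=> i hi'; rewrite /Q; simp_store; rewrite hv ltn_eqF.
  + by rewrite ltnNge -ltnS hc muln0.
  by move=> t s2 _ [ht hI2]; split=> //; lia.
- by move=> t st' fr; rewrite sum_cost => ht hI _; split; [lia|].
Qed.

Lemma copy_transform_spec st : var st 28 = N ->
  (forall i, i < N -> qsum (Q st 8 i) <= X) ->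
  runs copy_transform st (fun t st' => t <= N * 6 + 2 /\
    forall i, i < N -> Q st' 12 i = Q st 8 i).
Proof.
move=> h28 hq; have [x1 _ _ _] := sized_bounds.
apply: runs_seq; apply: runs_asg; first exact: okX.
pose I x st' := forall i, i < x -> Q st' 12 i = Q st 8 i.
apply: (@runs_for _ _ _ _ _ _ 0 N I (fun=> 4)) => //.
- by move=> i hi'; apply: okX; lia.
- by move=> i st' hi' hI hv fr; simp_store; use_frame fr; simp_store.
- move=> x st' /andP[_ hx] hI hv fr.
  have [f1 f2 _] := fr.
  have [e8 e9 e10 e11] : [/\ arr st' 8 = arr st 8, arr st' 9 = arr st 9, arr st' 10 = arr st 10 &
    arr st' 11 = arr st 11] by rewrite !f2.
  have := hq x hx; rewrite /Q qsumE => hqx.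
  do 3![apply: runs_seq; apply: runs_put;
    first by apply: okX; simp_store; rewrite hv ?e8 ?e9 ?e10 ?e11; lia].
  apply: runs_put; first by apply: okX; simp_store; rewrite hv ?e8 ?e9 ?e10 ?e11; lia.
  split=> // _ i; rewrite ltnS leq_eqVlt => /orP[/eqP->|hi'].
    by rewrite /Q; simp_store; rewrite hv eqxx e8 e9 e10 e11.
  by rewrite -hI // /Q; simp_store; rewrite hv ltn_eqF.
- by move=> t st' fr; rewrite sum_cost => ht hI _; split; [lia|].
Qed.

Lemma pointwise_spec st : var st 28 = N -> var st 24 = S ->
  (forall i, i < N -> qsum (qmul S (Q st 8 i) (Q st 12 i)) <= X) ->
  runs pointwise st (fun t st' => t <= N * 10 + 2 /\
    forall i, i < N -> Q st' 8 i = qmul S (Q st 8 i) (Q st 12 i)).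
Proof.
move=> h28 h24 hq; have [x1 _ _ _] := sized_bounds.
apply: runs_seq; apply: runs_asg; first exact: okX.
pose I x st' := forall i, i < N ->
  Q st' 8 i = if i < x then qmul S (Q st 8 i) (Q st 12 i) else Q st 8 i.
apply: (@runs_for _ _ _ _ _ _ 0 N I (fun=> 8)) => //.
- by move=> i hi'; apply: okX; lia.
- by move=> i st' hi' hI hv fr; simp_store; use_frame fr; simp_store.
- move=> x st' /andP[_ hx] hI hv fr.
  have e24 : var st' 24 = S by use_frame fr.
  have e12 : Q st' 12 x = Q st 12 x by rewrite /Q; use_frame fr.
  have e8 : Q st' 8 x = Q st 8 x by rewrite hI // ltnn.
  apply: runs_seq; apply: runs_call (@cmul_spec ok lim X S okX _ _ _ _ _ _ _ _ st' _ _ e24 _) _.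
  + by split; apply: stable_get.
  + by split; apply: stable_get.
  + by rewrite /= hv -/(Q st' 8 x) -/(Q st' 12 x) e8 e12; apply: hq.
  rewrite /= hv -/(Q st' 8 x) -/(Q st' 12 x) e8 e12 => t1 s1 f1 [ht1 ev].
  have e3 : var s1 3 = x by use_frame f1.
  have eQ i : Q s1 8 i = Q st' 8 i by rewrite /Q; use_frame f1.
  have := hq x hx; rewrite -ev /V4 qsumE => hqx.
  do 3![apply: runs_seq; apply: runs_put; first by apply: okX; simp_store; lia].
  apply: runs_put; first by apply: okX; simp_store; lia.
  split; first by lia.
  move=> _ i hi; rewrite ltnS leq_eqVlt; case: eqP => [->|ne] /=.
    by rewrite -ev /Q; simp_store; rewrite e3 eqxx.
  rewrite -hI // -eQ /Q; simp_store; rewrite e3.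
  by have -> : (i == x) = false by apply/eqP.
- by move=> t st' fr; rewrite sum_cost => ht hI _; split; [lia|move=> i hi; rewrite hI ?hi].
Qed.

Lemma propagate_spec st c : var st 28 = N -> var st 24 = S -> var st 21 = B ->
  (forall i, i < N -> (arr st 8 i + S * N %/ 2 - arr st 10 i) %/ (S * N) = c i) ->
  (forall i, i < N -> c i <= N * B ^ 2) ->
  runs propagate st (fun t st' => t <= N * 5 + 3 /\
    forall i, i < N -> arr st' 3 i = carried B c i).
Proof.
move=> h28 h24 h21 hc hcb; have [x1 _ x3 _] := sized_bounds.
apply: runs_seq; apply: runs_asg; first exact: okX.
apply: runs_seq; apply: runs_asg; first exact: okX.
have cb x : x <= N -> carry B c x <= N * B ^ 2.
  elim: x => // x IH hx; have := IH (ltnW hx); have := hcb x hx => h1 h2.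
  rewrite /= -ltnS ltn_divLR ?(ltnW B_gt1) //.
  by have := leq_mul (leqnn (N * B ^ 2).+1) B_gt1; lia.
pose I x st' := var st' 37 = carry B c x /\ forall i, i < x -> arr st' 3 i = carried B c i.
apply: (@runs_for _ _ _ _ _ _ 0 N I (fun=> 3)) => //.
- by move=> i hi'; apply: okX; lia.
- by move=> i st' hi' hI hv fr; simp_store; use_frame fr; simp_store.
- move=> x st' /andP[_ hx] [i1 i2] hv fr.
  have e24 : var st' 24 = S by use_frame fr; simp_store.
  have e21 : var st' 21 = B by use_frame fr; simp_store.
  have e28 : var st' 28 = N by use_frame fr; simp_store.
  have e8 : arr st' 8 = arr st 8 by use_frame fr.
  have e10 : arr st' 10 = arr st 10 by use_frame fr.
  have hb1 := cb x (ltnW hx); have hb2 := hcb x hx.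
  have hle : c x + carry B c x <= X by lia.
  have ev : eval st' ((Get 8 (Var 3) +' Var 24 *' Var 28 /' Num 2 -' Get 10 (Var 3)) /'
      (Var 24 *' Var 28) +' Var 37) = c x + carry B c x.
    by rewrite /= hv e24 e28 e8 e10 i1 hc.
  apply: runs_seq; apply: runs_asg; rewrite ev; first exact: okX.
  apply: runs_seq; apply: runs_put.
    by apply: okX; simp_store; rewrite e21; apply: leq_trans (leq_mod _ _) hle.
  apply: runs_asg; first by apply: okX; simp_store; rewrite e21; apply: leq_trans (leq_div _ _) hle.
  split=> // _; split; simp_store; rewrite ?e21 ?hv //.
  move=> i; rewrite ltnS leq_eqVlt; case: eqP => [->|ne] //= hi; exact: i2.
- by move=> t st' fr; rewrite sum_cost => ht [_ hI] _; split; [lia|].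
Qed.

Section Correct.

Variables (R : rcfType) (eta : nat) (T : nat -> quad).
Hypothesis T_near : forall b, b < N./2 -> near S eta (T b) (tw R b).
Hypothesis T_sum : forall b, b < N./2 -> qsum (T b) <= 3 * S.
Hypothesis S_big : 24 * N ^ 10 * B ^ 2 * (eta + 1) < S.

Lemma digits_fft_bound al j i : (forall i, al i <= B) -> j <= k -> i < N ->
  qsum (qfft S T k j (digit_quad S \o al) i) <= N ^ 3 * (S * B).
Proof.
move=> hal hj hi; apply: leq_trans (qsum_fft S_gt0 T_sum (M := S * B) _ hj hi) _.
  by move=> l _; rewrite /digit_quad /qsum /= !addn0 leq_mul2l hal orbT.
have -> : N ^ 3 = 8 ^ k by rewrite -expnM mulnC expnM.
by rewrite leq_mul2r leq_exp2l // hj orbT.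
Qed.

Lemma fft_digits_spec st al : var st 28 = N -> var st 24 = S ->
  (forall b, b < N./2 -> Q st 4 b = T b) -> (forall i, al i <= B) ->
  (forall i, i < N -> Q st 8 i = digit_quad S (al i)) ->
  runs run_fft st (fun t st' => t <= k * (N * 11 + 4) + 3 /\
    forall i, i < N -> Q st' 8 i = qfft S T k k (digit_quad S \o al) i).
Proof.
move=> h28 h24 hT hal h8; have [x1 x2 x3 x4] := sized_bounds.
have eT a j i : j <= k -> i < N -> qfft S (Q st 4) k j a i = qfft S T k j a i.
  elim: j i => [|j IH] i hj hi //=.
  have h0 : 0 < 2 ^ (k - j.+1) by rewrite expn_gt0.
  have hN : (2 ^ (k - j.+1)).*2 %| N by rewrite -mul2n -expnS dvdn_exp2l //; lia.
  rewrite /qfwd hT ?(div_half_lt h0 hN) //; case: ltnP => h; rewrite !IH //; try exact: ltnW.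
    exact: half_lo_lt.
  exact: leq_ltn_trans (leq_subr _ _) hi.
have e8 j i : j <= k -> i < N ->
    qfft S (Q st 4) k j (Q st 8) i = qfft S T k j (digit_quad S \o al) i.
  by move=> hj hi; rewrite eT //; apply: qfft_local.
apply: runs_call (@fft_spec ok lim X S (N ^ 9 * S * B ^ 2) k okX MX x1 S_gt0 st h28 h24 _ _) _.
- by move=> b hb; rewrite hT //; apply: T_sum.
- by move=> j i hj hi; rewrite e8 //; apply: leq_trans (digits_fft_bound _ _ _) x4.
- by move=> t s1 _ [ht hq]; split=> // i hi; rewrite hq // e8.
Qed.

(** Only the first factor is transformed here. The transform of the second waits in arrays 12 to 15,
    so that a Newton step can use it twice. *)
Lemma product_spec st al be la lb : var st 28 = N -> var st 24 = S -> var st 21 = B ->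
  (forall b, b < N./2 -> Q st 4 b = T b) ->
  (forall i, al i <= B) -> (forall i, be i <= B) ->
  (forall i, la <= i -> al i = 0) -> (forall i, lb <= i -> be i = 0) -> la + lb <= N ->
  (forall i, i < N -> Q st 8 i = digit_quad S (al i)) ->
  (forall i, i < N -> Q st 12 i = qfft S T k k (digit_quad S \o be) i) ->
  runs product st (fun t st' => t <= (k + 1) * (N * 22 + 20) /\
    forall i, i < N -> arr st' 3 i = carried B (nconv al be) i).
Proof.
move=> h28 h24 h21 hT hal hbe sal sbe hN h8 h12; have [x1 x2 x3 x4] := sized_bounds.
apply: runs_seq; apply: runs_call (fft_digits_spec h28 h24 hT hal h8) _ => t1 s1 f1 [ht1 q1].
have v28 : var s1 28 = N by use_frame f1.
have v24 : var s1 24 = S by use_frame f1.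
have q12 i : Q s1 12 i = Q st 12 i by rewrite /Q; use_frame f1.
pose pr i := qmul S (qfft S T k k (digit_quad S \o al) i) (qfft S T k k (digit_quad S \o be) i).
have prb i : i < N -> qsum (pr i) <= N ^ 6 * S * B ^ 2.
  move=> hi; rewrite -(leq_pmul2l S_gt0); apply: leq_trans (qsum_div _ S_gt0) _.
  rewrite qsum_prod; apply: leq_trans (leq_mul (digits_fft_bound hal (leqnn k) hi) (digits_fft_bound hbe (leqnn k) hi)) _.
  by rewrite (_ : N ^ 6 = N ^ 3 * N ^ 3) -?expnD // -mulnn; lia.
have le9 : N ^ 6 * S * B ^ 2 <= N ^ 9 * S * B ^ 2.
  by apply: leq_mul => //; apply: leq_mul => //; rewrite leq_pexp2l // expn_gt0.
apply: runs_seq; apply: runs_call (pointwise_spec v28 v24 _) _.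
  by move=> i hi; rewrite q1 // q12 h12 // -/(pr i); apply: leq_trans (prb i hi) _; lia.
move=> t2 s2 f2 [ht2 q2].
have w28 : var s2 28 = N by use_frame f2.
have w24 : var s2 24 = S by use_frame f2.
have wT b : b < N./2 -> Q s2 4 b = T b.
  by move=> hb; rewrite -hT // /Q; use_frame f2; use_frame f1.
have {}q2 i : i < N -> Q s2 8 i = pr i by move=> hi; rewrite q2 // q1 // q12 h12.
have eT a j i : j <= k -> i < N -> qifft S (Q s2 4) j a i = qifft S T j a i.
  elim: j i => [|j IH] i hj hi //=.
  have h0 : 0 < 2 ^ j by rewrite expn_gt0.
  have hN2 : (2 ^ j).*2 %| N by rewrite -mul2n -expnS dvdn_exp2l.
  rewrite /qbwd wT ?(div_half_lt h0 hN2) //; case: ltnP => h; rewrite !IH //; try exact: ltnW.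
    exact: half_lo_lt.
  exact: leq_ltn_trans (leq_subr _ _) hi.
have e2 j i : j <= k -> i < N -> qifft S (Q s2 4) j (Q s2 8) i = qifft S T j pr i.
  by move=> hj hi; rewrite eT //; exact: (@qifft_local S T k _ pr j i q2 hj hi).
apply: runs_seq; apply: runs_call (@ifft_spec ok lim X S (N ^ 9 * S * B ^ 2) k okX MX x1 S_gt0 s2 w28 w24 _ _) _.
- by move=> b hb; rewrite wT //; apply: T_sum.
- move=> j i hj hi; rewrite e2 //; apply: leq_trans (qsum_ifft S_gt0 T_sum prb hj hi) _.
  have -> : N ^ 9 * S * B ^ 2 = N ^ 3 * (N ^ 6 * S * B ^ 2).
    have e9 : N ^ 9 = N ^ 3 * N ^ 6 by rewrite -expnD.
    by rewrite e9; lia.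
  have -> : N ^ 3 = 8 ^ k by rewrite -expnM mulnC expnM.
  by apply: leq_mul => //; rewrite leq_exp2l.
move=> t3 s3 f3 [ht3 q3].
have {}q3 i : i < N -> Q s3 8 i = qconv S T k (digit_quad S \o al) (digit_quad S \o be) i.
  by move=> hi; rewrite q3 // e2.
have eH : S * N %/ 2 * 2 = S * N.
  by rewrite divnK // dvdn_mull // -(prednK k_gt0) expnS dvdn_mulr.
apply: runs_call (@propagate_spec s3 (nconv al be) _ _ _ _ _) _.
- by use_frame f3.
- by use_frame f3.
- by use_frame f3; use_frame f2; use_frame f1.
- move=> i hi; have := qconv_correct S_gt0 T_near T_sum sal sbe hN hal hbe (ltnW B_gt1) eH S_big hi.
  by rewrite /= -(q3 i hi) eH.
- move=> i hi; apply: leq_trans (_ : \sum_(j < i.+1) B ^ 2 <= _).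
    by apply: leq_sum => j _; rewrite -mulnn leq_mul.
  by rewrite sum_ord_const leq_mul2r hi orbT.
move=> t4 s4 _ [ht4 q4]; split=> //.
by rewrite mulnDl mul1n; lia.
Qed.

End Correct.

End Product.

(** * The table of roots of unity *)

Section TableStep.

Variable R : rcfType.

Lemma nrm_groot i : (nrm (groot R i) <= 2)%R. Proof. exact/nrm_le2/groot_conj. Qed.

(** After normalization the size is the l1 norm: at most 2S for the number itself, plus the
    error. *)
Lemma near_qsum_red S E p (z : R[i]%C) : near S E p z -> (nrm z <= 2)%R -> E <= S ->
  qsum (qred p) <= 3 * S.
Proof.
case: z => a b; rewrite /near /nrm /= => h hz hE; rewrite -(ler_nat R) qsum_red natrM.
have S0 : (0 <= S%:R :> R)%R by [].
have hE2 : (E%:R <= S%:R :> R)%R by rewrite ler_nat.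
have h1 := ler_normD (qre R p - S%:R * a)%R (S%:R * a)%R.
have h2 := ler_normD (qim R p - S%:R * b)%R (S%:R * b)%R.
rewrite !subrK !normrM !(ger0_norm S0) in h1 h2.
have h3 : (S%:R * (`|a| + `|b|) <= S%:R * 2 :> R)%R by rewrite ler_wpM2l.
rewrite mulrDr in h3; move: (`|a|)%R (`|b|)%R h h1 h2 h3 => x y; lra.
Qed.

(** With D = 16^i - 1 the product has error at most 5D + 2, which fits the budget 16D + 15 of the
    angle halving. *)
Lemma near_tw_step S i b p g : 0 < S -> b < 2 ^ i -> 16 ^ i.+1 <= S ->
  near S (16 ^ i - 1) p (tw R b) -> near S (16 ^ i - 1) g (groot R i) -> qsum p <= 3 * S ->
  near S (16 ^ i.+1 - 1) (qred (qmul S p g)) (tw R (2 ^ i + b)) /\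
  qsum (qred (qmul S p g)) <= 3 * S.
Proof.
move=> hS hb h16 hp hg hs; have h1 : 0 < 16 ^ i by rewrite expn_gt0.
set D := 16 ^ i - 1 in hp hg; have eD : 16 ^ i = D + 1 by rewrite /D; lia.
have hn : near S (16 ^ i.+1 - 1) (qmul S p g) (tw R (2 ^ i + b)).
  rewrite twS // mulrC; apply: near_le (near_mul (e := 3 * D) hS hp hg (nrm_groot i) hs _); first by rewrite expnS eD; lia.
  by lia.
split; first exact: near_red.
apply: near_qsum_red hn _ _; last by lia.
exact/nrm_le2/tw_conj.
Qed.

Lemma near_groot_le S d c s i : near S d (Quad c s 0 0) (groot R i) -> c <= S + d /\ s <= S + d.
Proof.
have [/andP[c0 c1] /andP[s0 s1] _ _ _] := gcos_spec R i.
rewrite /near /qre /qim /= !subr0 => h.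
have S0 : (0 <= S%:R :> R)%R by [].
have h1 : (S%:R * gcos R i <= S%:R * 1 :> R)%R by rewrite ler_wpM2l.
have h2 : (S%:R * gsin R i <= S%:R * 1 :> R)%R by rewrite ler_wpM2l.
have := ler_norm (c%:R - S%:R * gcos R i)%R; have := ler_norm (s%:R - S%:R * gsin R i)%R.
have := normr_ge0 (c%:R - S%:R * gcos R i)%R; have := normr_ge0 (s%:R - S%:R * gsin R i)%R.
move=> *; split; rewrite -(ler_nat R) natrD; lra.
Qed.

Lemma near_groot0 S : near S 0 (Quad 0 S 0 0) (groot R 0).
Proof. by rewrite /near /qre /qim /= mulr0 mulr1 !subr0 subrr !normr0 addr0. Qed.

Lemma near_tw0 S : near S 0 (Quad S 0 0 0) (tw R 0).
Proof. by rewrite /near /qre /qim /= mulr0 mulr1 !subr0 subrr !normr0 addr0. Qed.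

End TableStep.

(* Variables of the word program: 21 is the digit base B = sigma^e, 22 is e, 23
   the number d of digits of a slot, 24 the fixed-point scale S, 20 a power of 2
   above 2S, 25 the size of the table of roots, 26 and 27 the scaled cosine and
   sine of the current angle, 28 the length of the transforms, 18 the number of
   known terms of the recurrence. Arrays: 1 the coefficients, 2 the digits of
   these terms, 3 the digits of a product, 4-7 the table of roots, 8-11 and 12-15
   the transforms. *)
Definition setup :=
  21 ::= Var 1 ;; 22 ::= Num 1 ;;
  While (Var 21 +' Num 1) (Var 0) (21 ::= Var 21 *' Var 1 ;; 22 ::= Var 22 +' Num 1) ;;
  23 ::= Num 4 *' Var 0 /' Var 22 +' Num 1 ;;
  24 ::= Var 21 *' Var 21 ;; 24 ::= Var 24 *' Var 24 ;; 24 ::= Var 24 *' Var 24 ;;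
  24 ::= Var 24 *' Var 24 ;; 24 ::= Var 24 *' Var 24 ;; 24 ::= Var 24 *' Var 24 ;;
  24 ::= Var 24 *' Var 24 ;; 24 ::= Var 24 *' Var 24 ;;
  20 ::= Num 1 ;; While (Var 20) (Num 2 *' Var 24) (20 ::= Var 20 *' Num 2).

(** The current root, in variables 26 and 27, extends the table by [twS]; the truncated differences
    carry out [qred]. *)
Definition double_table := 3 ::= Num 0 ;;
  For 3 (Var 25)
    (cmul (Get 4 (Var 3)) (Get 5 (Var 3)) (Get 6 (Var 3)) (Get 7 (Var 3))
          (Var 26) (Var 27) (Num 0) (Num 0) ;;
     Put 4 (Var 25 +' Var 3) (Var 33 -' Var 35) ;; Put 5 (Var 25 +' Var 3) (Var 34 -' Var 36) ;;
     Put 6 (Var 25 +' Var 3) (Var 35 -' Var 33) ;; Put 7 (Var 25 +' Var 3) (Var 36 -' Var 34)).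

(** Variable 33 becomes the integer square root of S (S + c) / 2, found bit by bit from the top. *)
Definition half_angle :=
  31 ::= Var 24 *' (Var 24 +' Var 26) /' Num 2 ;; 33 ::= Num 0 ;; 34 ::= Var 20 ;;
  While (Num 2) (Var 34)
    (34 ::= Var 34 /' Num 2 ;;
     Cond ((Var 33 +' Var 34) *' (Var 33 +' Var 34)) (Var 31) (33 ::= Var 33 +' Var 34) skip) ;;
  27 ::= Var 27 *' Var 24 /' (Num 2 *' Var 33) ;; 26 ::= Var 33.

Definition table :=
  25 ::= Num 1 ;; 26 ::= Num 0 ;; 27 ::= Var 24 ;;
  Put 4 (Num 0) (Var 24) ;; Put 5 (Num 0) (Num 0) ;; Put 6 (Num 0) (Num 0) ;; Put 7 (Num 0) (Num 0) ;;
  While (Var 25 +' Num 1) (Num 3 *' Var 0 *' Var 23)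
    (double_table ;; half_angle ;; 25 ::= Var 25 *' Num 2).

Lemma up_log_lt p n i : 1 < p -> i < up_log p n -> p ^ i < n.
Proof. by move=> hp hi; rewrite ltnNge; apply/negP => /(up_log_min hp); rewrite leqNgt hi. Qed.

Lemma exp_mono m a b : a <= b -> a ^ m <= b ^ m.
Proof. by case: m => // m h; rewrite leq_exp2r. Qed.

(** * Digit base, slot length and scale *)

Section Sizes.

Variables (s n : nat).
Hypothesis s_gt1 : 1 < s.
Hypothesis n_gt0 : 0 < n.

(** Least exponent with s^e >= n, but at least 1, so that the base exceeds 1 also for n = 1. *)
Definition digit_exp := maxn 1 (up_log s n).
Definition base := s ^ digit_exp.
(** A slot of this many digits spans more than 4n letters. *)
Definition slot_len := 4 * n %/ digit_exp + 1.
Definition scale := base ^ 256.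
Definition scale_log := up_log 2 (2 * scale).+1.

Lemma base_gt1 : 1 < base.
Proof. by rewrite -[1](exp1n digit_exp) ltn_exp2r // leq_maxl. Qed.

Lemma base_ge_n : n <= base.
Proof. by apply: leq_trans (up_logP n s_gt1) _; rewrite leq_exp2l // leq_maxr. Qed.

Lemma base_ge_s : s <= base.
Proof. by rewrite -{1}(expn1 s) leq_exp2l // leq_maxl. Qed.

Lemma digit_exp_le : digit_exp <= n.
Proof.
rewrite /digit_exp geq_max n_gt0 /=; apply: up_log_min => //.
by apply: ltnW; apply: ltn_expl.
Qed.

(** By minimality of the exponent one letter less would give a power below n; thus the base takes at
    most two machine words. *)
Lemma base_le : base <= n * s.
Proof.
rewrite /base /digit_exp; case: (leqP (up_log s n) 1) => h.
  by rewrite expn1 leq_pmull.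
have := up_log_lt (p := s) (n := n) (i := (up_log s n).-1) s_gt1 ltac:(lia).
move=> h2; rewrite -(prednK (_ : 0 < up_log s n)); last lia.
by rewrite expnSr leq_mul2r (ltnW h2) orbT.
Qed.

Lemma scale_log_spec : 2 * scale < 2 ^ scale_log /\ 2 ^ scale_log <= 4 * scale.
Proof.
have h := up_logP (2 * scale).+1 (isT : 1 < 2); rewrite -/scale_log in h; split=> //.
have S0 : 0 < scale by rewrite expn_gt0 (ltnW base_gt1).
have l0 : 0 < scale_log by rewrite lt0n; apply/eqP => e; rewrite e in h; lia.
have := @up_log_lt 2 (2 * scale).+1 scale_log.-1 isT; rewrite -/scale_log => /(_ ltac:(lia)).
by rewrite -{2}(prednK l0) expnS; lia.
Qed.

End Sizes.

Section Setup.

Variables (ok : nat -> Prop) (lim X s n : nat).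
Hypothesis okX : forall v, v <= X -> ok v.
Hypothesis s_gt1 : 1 < s.
Hypothesis n_gt0 : 0 < n.
Local Notation runs := (runs ok lim).

Local Notation digit_exp := (digit_exp s n).
Local Notation base := (base s n).
Local Notation slot_len := (slot_len s n).
Local Notation scale := (scale s n).
Local Notation scale_log := (scale_log s n).

Hypothesis baseX : base ^ 600 <= X.

(** Factors 2 are absorbed as further powers of the base. The largest demand is a small multiple of
    the squared scale, base^512, which 600 covers. *)
Lemma okB v m j : v <= 2 ^ m * base ^ j -> m + j <= 600 -> ok v.
Proof.
move=> h hm; apply: okX; apply: leq_trans baseX; apply: leq_trans h _.
apply: (@leq_trans (base ^ m * base ^ j)); first by rewrite leq_mul2r exp_mono ?orbT ?(base_gt1 n s_gt1).
by rewrite -expnD leq_exp2l // (base_gt1 n s_gt1).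
Qed.

Definition ready st := [/\ var st 21 = base, var st 22 = digit_exp, var st 23 = slot_len,
  var st 24 = scale & var st 20 = 2 ^ scale_log].

Lemma runs_square j c st Q : var st 24 = base ^ j -> j + j <= 600 ->
  runs c (setv st 24 (base ^ (j + j))) (fun t => Q (1 + t)) ->
  runs (24 ::= Var 24 *' Var 24 ;; c) st Q.
Proof.
move=> h hj hc; have e : eval st (Var 24 *' Var 24) = base ^ (j + j) by rewrite /= h expnD.
by apply: runs_seq; apply: runs_asg; rewrite e //; apply: (@okB _ 0 (j + j)); rewrite ?mul1n.
Qed.

Lemma setup_spec st : var st 0 = n -> var st 1 = s ->
  runs setup st (fun t st' => t <= 3 * digit_exp + 2 * scale_log + 14 /\ ready st').
Proof.
move=> h0 h1; have b1 := (base_gt1 n s_gt1); have bn := (base_ge_n n s_gt1); have bs := (base_ge_s n s_gt1).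
have en := (digit_exp_le s_gt1 n_gt0); have e0 : 0 < digit_exp by rewrite leq_maxl.
have ok1 v : v <= 4 * base + 1 -> ok v by move=> h; apply: (@okB v 3 1); rewrite ?expn1; lia.
apply: runs_seq; apply: runs_asg; first by apply: ok1; rewrite /=; lia.
apply: runs_seq; apply: runs_asg; first by apply: ok1; rewrite /=; lia.
apply: runs_seq.
apply: (@runs_while _ _ _ _ _ _ digit_exp.-1 (fun i st' => var st' 21 = s ^ i.+1 /\ var st' 22 = i.+1) (fun=> 2)).
- by simp_store; rewrite h1 expn1.
- move=> i st' hi [e21 e22] fr.
  have e1 : var st' 1 = s by use_frame fr; simp_store.
  have e0' : var st' 0 = n by use_frame fr; simp_store.
  split.
    rewrite /= e21 e0' addn1; apply: up_log_lt => //.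
    by move: hi; rewrite /digit_exp; case: (leqP (up_log s n) 1); lia.
  have hb : s ^ i.+2 <= base by rewrite leq_exp2l //; lia.
  apply: runs_seq; apply: runs_asg; first by apply: ok1; rewrite /= e21 e1 -expnSr; lia.
  apply: runs_asg; first by apply: ok1; simp_store; rewrite e22; lia.
  by split=> //; simp_store; rewrite e21 e22 e1 -expnSr addn1.
- move=> st' [e21 e22] fr; have e0' : var st' 0 = n by use_frame fr; simp_store.
  by rewrite /= e21 e0' prednK // addn1 ltnS.
move=> t1 s1 f1; rewrite sum_ord_const prednK // => ht1 [e21 e22].
have e0' : var s1 0 = n by use_frame f1; simp_store.
have dB : 4 * n %/ digit_exp <= 4 * base by apply: leq_trans (leq_div _ _) _; lia.
apply: runs_seq; apply: runs_asg; first by apply: ok1; rewrite /= e22 e0'; lia.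
apply: runs_seq; apply: runs_asg.
  by apply: (@okB _ 0 2); rewrite // mul1n; simp_store; rewrite e21 mulnn.
simp_store; rewrite e21 e22 e0' -/base mulnn.
apply: (@runs_square 2) => //; apply: (@runs_square 4) => //; apply: (@runs_square 8) => //.
apply: (@runs_square 16) => //; apply: (@runs_square 32) => //; apply: (@runs_square 64) => //.
apply: (@runs_square 128) => //; rewrite -[base ^ (128 + 128)]/scale; set st9 := setv _ 24 scale.
apply: runs_seq; apply: runs_asg; first by apply: ok1; rewrite /= addn1.
have [l1 l2] := (scale_log_spec s_gt1 n_gt0).
apply: (@runs_while _ _ _ _ _ _ scale_log (fun i st' => var st' 20 = 2 ^ i) (fun=> 1)).
- by [].
- move=> i st' hi e20 fr; have e24 : var st' 24 = scale by use_frame fr; simp_store.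
  split; first by rewrite /= e20 e24 -ltnS; apply: up_log_lt.
  apply: runs_asg; last by simp_store; rewrite e20 expnSr.
  apply: (@okB _ 2 256) => //; rewrite /= e20 -expnSr; apply: leq_trans l2.
  by rewrite leq_exp2l.
- move=> st' e20 fr; have e24 : var st' 24 = scale by use_frame fr; simp_store.
  by rewrite /= e20 e24.
move=> t st' fr; rewrite sum_ord_const => ht e20; split; first by lia.
by split=> //; use_frame fr; simp_store.
Qed.

Lemma half_angle_spec st c sn : ready st -> var st 26 = c -> var st 27 = sn ->
  c <= 2 * scale -> sn <= 2 * scale ->
  runs half_angle st (fun t st' => t <= 4 * scale_log + 6 /\ exists x,
   [/\ x ^ 2 <= scale * (scale + c) %/ 2 < x.+1 ^ 2, var st' 26 = x &
       var st' 27 = sn * scale %/ (2 * x)]).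
Proof.
move=> [h21 h22 h23 h24 h20] h26 h27 hc hsn; have [l1 l2] := (scale_log_spec s_gt1 n_gt0).
set y := scale * (scale + c) %/ 2.
have hy : y < (2 ^ scale_log) ^ 2.
  have h : scale * (scale + c) <= scale * (3 * scale) by rewrite leq_mul2l; apply/orP; right; lia.
  rewrite /y ltn_divLR //; apply: leq_ltn_trans h _; rewrite -mulnn.
  by have := leq_mul l1 l1; lia.
have okS v : v <= 4 * (scale * scale) -> ok v.
  by move=> h; apply: (@okB v 2 512) => //; rewrite (_ : base ^ 512 = scale * scale) // -expnD.
have S0 : 0 < scale by rewrite expn_gt0 (ltnW (base_gt1 n s_gt1)).
have SS : scale <= scale * scale by rewrite leq_pmulr.
apply: runs_seq; apply: runs_asg.
  rewrite /= h24 h26 -/y; apply: okS; rewrite /y; apply: leq_trans (leq_div _ _) _.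
  by apply: (@leq_trans (scale * (4 * scale))); [rewrite leq_mul2l; apply/orP; right|]; lia.
apply: runs_seq; apply: runs_asg; first exact: okS.
apply: runs_seq; apply: runs_asg; first by apply: okS; simp_store; rewrite h20; lia.
simp_store; rewrite h24 h26 h20 -/y; set st3 := setv _ _ _.
apply: runs_seq.
(* Variable 33 holds the bits already settled; the root lies in the interval of length variable 34
   above it, which is halved at each turn. *)
apply: (@runs_while _ _ _ _ _ _ scale_log (fun i st' => var st' 34 = 2 ^ (scale_log - i) /\
    var st' 33 ^ 2 <= y < (var st' 33 + var st' 34) ^ 2) (fun=> 3)).
- by simp_store; rewrite subn0 add0n.
- move=> i st' hi [e34 /andP[i1 i2]] fr.
  have e31 : var st' 31 = y by use_frame fr; simp_store.
  have ei : scale_log - i = (scale_log - i.+1).+1 by lia.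
  set h := 2 ^ (scale_log - i.+1); have h0 : 0 < h by rewrite expn_gt0.
  have {}e34 : var st' 34 = 2 * h by rewrite e34 ei expnS.
  have hle : 2 * h <= 2 ^ scale_log by rewrite -expnS leq_exp2l //; lia.
  split; first by rewrite /= e34; lia.
  apply: runs_seq; apply: runs_asg; first by apply: okS; rewrite /= e34 mulKn //; lia.
  rewrite [eval st' _]/= e34 mulKn //.
  apply: runs_cond; simp_store; rewrite e31 => hcd.
    apply: runs_asg.
      apply: okS; simp_store.
      have hx : var st' 33 + h <= 2 ^ scale_log.
        rewrite leqNgt; apply/negP => hx; rewrite -mulnn in hy; have := leq_mul (ltnW hx) (ltnW hx); lia.
      by lia.
    split=> //; simp_store; split=> //; rewrite -mulnn hcd /=.
    by move: i2; rewrite e34 (_ : var st' 33 + 2 * h = var st' 33 + h + h) //; lia.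
  apply: runs_skip; first exact: okS.
  by split=> //; simp_store; split=> //; rewrite i1 -mulnn.
- by move=> st' [e34 _] fr; rewrite /= e34 subnn.
move=> t st' fr; rewrite sum_ord_const subnn => ht [e34 /andP[i1 i2]].
set x := var st' 33 in i1 i2; rewrite e34 expn0 addn1 in i2.
have e27 : var st' 27 = sn by use_frame fr; simp_store.
have e24 : var st' 24 = scale by use_frame fr; simp_store.
have xS : x <= 4 * (scale * scale).
  rewrite leqNgt; apply/negP => hx; have := leq_trans i1 (ltnW hy); rewrite leq_exp2r // => hx2; lia.
apply: runs_seq; apply: runs_asg.
  apply: okS; rewrite /= e27 e24; apply: leq_trans (leq_div _ _) _.
  by apply: (@leq_trans (2 * scale * scale)); [rewrite leq_mul2r hsn orbT|lia].
apply: runs_asg; first by apply: okS; simp_store.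
split; first by lia.
by exists x; split; simp_store; rewrite ?i1 ?i2 // e27 e24.
Qed.

Variable R : rcfType.

Definition good_table i (T : nat -> quad) := forall b, b < 2 ^ i ->
  near scale (16 ^ i - 1) (T b) (tw R b) /\ qsum (T b) <= 3 * scale.

Lemma double_table_spec st i : ready st -> var st 25 = 2 ^ i -> 16 ^ i.+1 <= scale ->
  2 ^ i.+1 <= scale ->
  good_table i (Q st 4) -> near scale (16 ^ i - 1) (Quad (var st 26) (var st 27) 0 0) (groot R i) ->
  runs double_table st (fun t st' => t <= 10 * 2 ^ i + 2 /\ good_table i.+1 (Q st' 4)).
Proof.
move=> [h21 h22 h23 h24 h20] h25 h16 h2 hT hG.
have S0 : 0 < scale by rewrite expn_gt0 (ltnW (base_gt1 n s_gt1)).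
have okS v : v <= 12 * scale -> ok v.
  by move=> h; apply: (@okB v 4 256) => //; apply: leq_trans h _; rewrite leq_mul2r orbT.
have SX : 12 * scale <= X.
  apply: leq_trans baseX; apply: (@leq_trans (base ^ 4 * base ^ 256)).
    rewrite leq_mul2r; apply/orP; right; have := (base_gt1 n s_gt1); move: base => B hB.
    by apply: (@leq_trans (2 ^ 4)) => //; rewrite leq_exp2r.
  by rewrite -expnD leq_exp2l // (base_gt1 n s_gt1).
apply: runs_seq; apply: runs_asg; first exact: okS.
pose I x st' := forall b, Q st' 4 b = if (b < 2 ^ i) || (2 ^ i + x <= b) then Q st 4 b else
  qred (qmul scale (Q st 4 (b - 2 ^ i)) (Quad (var st 26) (var st 27) 0 0)).
have e2 : 2 ^ i.+1 = 2 ^ i + 2 ^ i by rewrite expnS; lia.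
apply: (@runs_for _ _ _ _ _ _ 0 (2 ^ i) I (fun=> 8)) => //.
- by move=> b; rewrite addn0 orbC; case: leqP.
- by move=> x hx; apply: okS; lia.
- by move=> x st' hx hI hv fr; simp_store; use_frame fr; simp_store.
- move=> x st' /andP[_ hx] hI hv fr.
  have e24 : var st' 24 = scale by use_frame fr; simp_store.
  have e25 : var st' 25 = 2 ^ i by use_frame fr; simp_store.
  have e26 : var st' 26 = var st 26 by use_frame fr; simp_store.
  have e27 : var st' 27 = var st 27 by use_frame fr; simp_store.
  have eT : Q st' 4 x = Q st 4 x by rewrite hI hx.
  have [t1 t2] := hT x hx.
  have [g1 g2] := near_groot_le hG.
  have hq : qsum (qmul scale (Q st 4 x) (Quad (var st 26) (var st 27) 0 0)) <= 12 * scale.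
    have l3 : 16 ^ i <= scale by apply: leq_trans h16; rewrite leq_exp2l.
    rewrite -(leq_pmul2l S0); apply: leq_trans (qsum_div _ S0) _; rewrite qsum_prod.
    have hg : qsum (Quad (var st 26) (var st 27) 0 0) <= 4 * scale by rewrite qsumE; lia.
    by have := leq_mul t2 hg; lia.
  apply: runs_seq; apply: runs_call (@cmul_spec ok lim X scale okX _ _ _ _ _ _ _ _ st' _ _ e24 _) _.
  + by split; apply: stable_get.
  + by split=> //; apply: stable_var.
  + by rewrite /= hv -/(Q st' 4 x) eT e26 e27; apply: leq_trans hq SX.
  rewrite /= hv -/(Q st' 4 x) eT e26 e27 => u1 s1 f1 [hu1 ev].
  have v3 : var s1 3 = x by use_frame f1.
  have v25 : var s1 25 = 2 ^ i by use_frame f1.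
  have eQ b : Q s1 4 b = Q st' 4 b by rewrite /Q; use_frame f1.
  move: hq; rewrite -ev /V4 qsumE => hq.
  do 3![apply: runs_seq; apply: runs_put; first by apply: okS; simp_store; lia].
  apply: runs_put; first by apply: okS; simp_store; lia.
  split; first by lia.
  move=> _ b; case: (eqVneq b (2 ^ i + x)) => [->|ne].
    have -> : (2 ^ i + x < 2 ^ i) || (2 ^ i + x.+1 <= 2 ^ i + x) = false by lia.
    by rewrite addKn -ev /Q; simp_store; rewrite v3 v25 eqxx.
  have -> : (b < 2 ^ i) || (2 ^ i + x.+1 <= b) = (b < 2 ^ i) || (2 ^ i + x <= b) by lia.
  by rewrite -hI -eQ /Q; simp_store; rewrite v3 v25 (negbTE ne).
- move=> t st' fr; rewrite sum_cost => ht hI _; split; first by lia.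
  move=> b hb; rewrite hI; case: ltnP => hbi /=.
    have [t1 t2] := hT b hbi; split=> //; apply: near_le t1.
    by apply: leq_sub2r; rewrite leq_exp2l.
  have -> : (2 ^ i + 2 ^ i <= b) = false by lia.
  have hb2 : b - 2 ^ i < 2 ^ i by lia.
  have [t1 t2] := hT _ hb2.
  by have := near_tw_step S0 hb2 h16 t1 hG t2; rewrite subnKC.
Qed.

Definition table_log := up_log 2 (3 * n * slot_len).
Hypothesis table_small : 6 * (16 ^ table_log + 2) <= scale.

Lemma table_spec st : ready st -> var st 0 = n ->
  runs table st (fun t st' => t <= 10 * 2 ^ table_log + table_log * (4 * scale_log + 12) + 8 /\
    good_table table_log (Q st' 4)).
Proof.
move=> hr h0; have [h21 h22 h23 h24 h20] := hr.
have okS v : v <= 4 * scale -> ok v by move=> h; apply: (@okB v 2 256).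
have S0 : 0 < scale by rewrite expn_gt0 (ltnW (base_gt1 n s_gt1)).
do 3![apply: runs_seq; apply: runs_asg; first by apply: okS; simp_store; rewrite ?h24; lia].
do 4![apply: runs_seq; apply: runs_put; first by apply: okS; simp_store; rewrite ?h24; lia].
simp_store; rewrite h24; set st7 := seta _ _ _ _.
pose I i st' := [/\ var st' 25 = 2 ^ i, good_table i (Q st' 4) &
  near scale (16 ^ i - 1) (Quad (var st' 26) (var st' 27) 0 0) (groot R i)].
have r2 i : 2 ^ i <= 16 ^ i by apply: exp_mono.
apply: (@runs_while _ _ _ _ _ _ table_log I (fun i => 10 * 2 ^ i + 4 * scale_log + 11)).
- split=> //; last exact: near_groot0.
  move=> b; rewrite expn0 ltnS leqn0 => /eqP->; split; first exact: near_tw0.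
  by rewrite -[Q _ _ _]/(Quad scale 0 0 0) qsumE; lia.
- move=> i st' hi [e25 eT eG] fr.
  have hr' : ready st' by split; use_frame fr; simp_store.
  have e0 : var st' 0 = n by use_frame fr; simp_store.
  have [_ _ e23 e24 _] := hr'.
  have l16 : 16 ^ i.+1 <= 16 ^ table_log by rewrite leq_exp2l.
  have l16' : 16 ^ i <= 16 ^ table_log by rewrite leq_exp2l //; lia.
  have l2 := r2 i.+1.
  split; first by rewrite /= e25 e23 e0 addn1; apply: up_log_lt.
  apply: runs_seq; apply: runs_call (double_table_spec hr' e25 _ _ eT eG) _; [lia|lia|].
  move=> t1 s1 f1 [ht1 eT1].
  have hr1 : ready s1 by case: hr' => *; split; use_frame f1.
  have [g1 g2] := near_groot_le eG.
  apply: runs_seq; apply: runs_call (half_angle_spec hr1 erefl erefl _ _) _.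
  + by use_frame f1; lia.
  + by use_frame f1; lia.
  move=> t2 s2 f2 [ht2 [x [hx e26 e27]]].
  have e25' : var s2 25 = 2 ^ i by use_frame f2; use_frame f1.
  apply: runs_asg; first by apply: okS; rewrite /= e25' -expnSr; lia.
  split; first by lia.
  split; simp_store.
  + by rewrite e25' -expnSr.
  + by move=> b hb; have := eT1 b hb; rewrite /Q; use_frame f2.
  + rewrite e26 e27; have v26 : var s1 26 = var st' 26 by use_frame f1.
    have v27 : var s1 27 = var st' 27 by use_frame f1.
    rewrite v26 in hx; rewrite v27.
    apply: near_le (half_near eG _ hx); last by lia.
    by have h16 : 0 < 16 ^ i; [rewrite expn_gt0|rewrite expnS; lia].
- move=> st' [e25 _ _] fr; have hr' : ready st' by split; use_frame fr; simp_store.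
  have e0 : var st' 0 = n by use_frame fr; simp_store.
  have [_ _ e23 _ _] := hr'.
  by rewrite /= e25 e23 e0 addn1 ltnS; apply: up_logP.
move=> t st' fr ht [_ eT _]; split=> //.
have hs : \sum_(i < table_log) (10 * 2 ^ i + 4 * scale_log + 11).+1 <=
    10 * 2 ^ table_log + table_log * (4 * scale_log + 12).
  elim: table_log => [|l IH]; first by rewrite big_ord0.
  rewrite big_ord_recr /= (leq_trans (leq_add IH (leqnn _))) // expnS mulSn; lia.
by lia.
Qed.

End Setup.

(** * Doubling the number of known terms *)

(** The factor 3 covers the larger product: h slots of f times 2h slots of coefficients. *)
Definition grow :=
  While (Var 28 +' Num 1) (Num 3 *' Var 18 *' Var 23) (28 ::= Var 28 *' Num 2).

(** A coefficient is at most s, hence at most the base, so it is placed in the lowest digit of its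
    slot. *)
Definition load_coefs := load_digits (Num 0) (Num 0) ;; 3 ::= Num 0 ;;
  For 3 (Num 2 *' Var 18) (Put 8 (Var 3 *' Var 23) (Var 24 *' Get 1 (Var 3))).

Definition append := 3 ::= Num 0 ;;
  For 3 (Var 18 *' Var 23) (Put 2 (Var 18 *' Var 23 +' Var 3) (Get 3 (Var 3))).

(** The transform of the known terms is kept for both products: first with the coefficients, which
    yields the source, then with the source. *)
Definition newton_step :=
  grow ;;
  load_digits (Var 18 *' Var 23) (Get 2 (Var 3)) ;; run_fft ;; copy_transform ;;
  load_coefs ;; product ;;
  load_digits (Var 18 *' Var 23) (Get 3 (Var 18 *' Var 23 +' Var 3)) ;; product ;;
  append ;; 18 ::= Var 18 *' Num 2.

Definition newton :=
  18 ::= Num 1 ;; 28 ::= Num 2 ;;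
  3 ::= Num 0 ;; For 3 (Var 23) (Put 2 (Var 3) (Num 0)) ;; Put 2 (Num 0) (Num 1) ;;
  While (Var 18) (Var 0) newton_step.

Lemma baseE s n : base s n = s ^ digit_exp s n. Proof. by []. Qed.
Lemma scaleE s n : scale s n = base s n ^ 256. Proof. by []. Qed.
Lemma slot_lenE s n : slot_len s n = 4 * n %/ digit_exp s n + 1. Proof. by []. Qed.
Lemma table_logE s n : table_log s n = up_log 2 (3 * n * slot_len s n). Proof. by []. Qed.

(* packaged so that [lia] does not see the large powers *)
Definition big_base s n X := base s n ^ 600 <= X.
Definition room s n X k := 6 * ((2 ^ k) ^ 9 * scale s n * base s n ^ 2) <= X /\
  24 * (2 ^ k) ^ 10 * base s n ^ 2 * ((16 ^ table_log s n - 1) + 1) < scale s n.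

(* otherwise the comparison of atoms by [lia] unfolds these numbers *)
Opaque base scale slot_len table_log.

Lemma slack_arith u v S : 0 < u -> 1 * 1 <= v -> 24 * v * u < S -> 6 * (u + 2) <= S.
Proof. by move=> hu hv; have := leq_mul hv (leqnn (24 * u)); lia. Qed.

Lemma step_cost m N L K t1 t2 t3 t4 t5 t6 t7 t8 t9 : 0 < m -> N <= 6 * m -> L <= K ->
  t1 <= 2 * K + 1 -> t2 <= N * 7 + 2 -> t3 <= L * (N * 11 + 4) + 3 -> t4 <= N * 6 + 2 ->
  t5 <= 10 * N + 4 -> t6 <= (L + 1) * (N * 22 + 20) -> t7 <= N * 7 + 2 ->
  t8 <= (L + 1) * (N * 22 + 20) -> t9 <= 3 * m + 2 ->
  t1 + (t2 + (t3 + (t4 + (t5 + (t6 + (t7 + (t8 + (t9 + 1)))))))) <= (K + 1) * (700 * m).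
Proof.
move=> m0 hN hL; have c1 : (L + 1) * N <= (K + 1) * (6 * m) by apply: leq_mul => //; lia.
have c2 : L * N <= K * (6 * m) by apply: leq_mul.
have c3 : K * 1 <= K * m by apply: leq_mul.
have -> : (K + 1) * (700 * m) = 700 * (K * m) + 700 * m by lia.
have -> : L * (N * 11 + 4) = 11 * (L * N) + 4 * L by lia.
have -> : (L + 1) * (N * 22 + 20) = 22 * (L * N) + 22 * N + 20 * L + 20 by lia.
rewrite mulnCA in c2; move: c2 c3; rewrite muln1; move: (L * N) (K * m) => p q; clear c1; lia.
Qed.

Section Sizes.

Variables (X s n : nat).
Hypothesis s_gt1 : 1 < s.
Hypothesis n_gt0 : 0 < n.
Local Notation B := (base s n).
Local Notation S := (scale s n).
Local Notation d := (slot_len s n).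
Local Notation K := (table_log s n).

Let B1 : 1 < B := base_gt1 n s_gt1.
Let B0 : 0 < B := ltnW B1.
Let d0 : 0 < d. Proof. by rewrite slot_lenE addn1. Qed.

Lemma slot_len_le : d <= 5 * n.
Proof. by rewrite slot_lenE; have := leq_div (4 * n) (digit_exp s n); lia. Qed.

(** 3n is enough for the exponent 2h + 1 of the second product with h <= n. *)
Lemma slot_lt m : m <= 3 * n -> s ^ m < B ^ d.
Proof.
move=> hm; rewrite baseE -expnM ltn_exp2l //.
have e0 : 0 < digit_exp s n by rewrite leq_maxl.
have := ltn_ceil (4 * n) e0; rewrite slot_lenE addn1 mulnC; lia.
Qed.

Lemma table_log_spec : 3 * n * d <= 2 ^ K /\ 2 ^ K <= 6 * (n * d).
Proof.
have h := up_logP (3 * n * d) (isT : 1 < 2); rewrite table_logE; split=> //.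
have h3 : 3 <= 3 * n * d by rewrite -mulnA leq_pmulr // muln_gt0 n_gt0 d0.
have l0 : 0 < up_log 2 (3 * n * d).
  by rewrite lt0n; apply/eqP => e; rewrite e expn0 in h; have := leq_trans h3 h.
have := @up_log_lt 2 (3 * n * d) (up_log 2 (3 * n * d)).-1 isT => /(_ ltac:(lia)).
by rewrite -{2}(prednK l0) expnS; lia.
Qed.

(** From 2^K <= 6 n d, d <= 5n and n <= B: at most 2^5 B^2. *)
Lemma table_log_small : 2 ^ K <= B ^ 7.
Proof.
have [_ h] := table_log_spec; apply: leq_trans h _.
have hn := base_ge_n n s_gt1; have hd := slot_len_le.
have h1 := leq_mul hn hn; have h2 : n * d <= n * (5 * n) by rewrite leq_mul2l hd orbT.
apply: (@leq_trans (B ^ 5 * (B * B))); last by rewrite mulnn -expnD.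
apply: (@leq_trans (2 ^ 5 * (B * B))); last by rewrite leq_mul2r exp_mono ?orbT.
have -> : 2 ^ 5 = 32 by []. lia.
Qed.

(** 24 is at most B^5, the length contributes B^70 and the root error 16^K = (2^K)^4 contributes
    B^28: in total B^105. *)
Lemma error_small k : k <= K -> 24 * (2 ^ k) ^ 10 * B ^ 2 * ((16 ^ K - 1) + 1) < S.
Proof.
move=> hk; have hN : 2 ^ k <= B ^ 7 by apply: leq_trans table_log_small; rewrite leq_exp2l.
have h16 : 16 ^ K <= B ^ 28.
  have -> : 16 ^ K = (2 ^ K) ^ 4 by rewrite -expnM mulnC expnM.
  by apply: leq_trans (exp_mono 4 table_log_small) _; rewrite -expnM.
have h160 : 0 < 16 ^ K by rewrite expn_gt0.
have b3 : 6 <= B ^ 3 by apply: (@leq_trans (2 ^ 3)); rewrite ?exp_mono.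
have b5 : 24 <= B ^ 5 by apply: (@leq_trans (2 ^ 5)); rewrite ?exp_mono.
rewrite subnK //; apply: (@leq_ltn_trans (B ^ 5 * B ^ 70 * B ^ 2 * B ^ 28)).
  apply: leq_mul => //; apply: leq_mul => //; apply: leq_mul => //.
  by apply: leq_trans (exp_mono 10 hN) _; rewrite -expnM.
by rewrite scaleE -!expnD ltn_exp2l.
Qed.

Lemma table_small : 6 * (16 ^ K + 2) <= S.
Proof.
have := error_small (leqnn K); have h : 0 < 16 ^ K by rewrite expn_gt0.
have p2 : 0 < B ^ 2 by rewrite expn_gt0 B0.
have p1 : 0 < (2 ^ K) ^ 10 by rewrite -expnM expn_gt0.
rewrite subnK // -[24 * _ * _]mulnA; have p := leq_mul p1 p2.
exact: slack_arith h p.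
Qed.

Definition len_log h := up_log 2 (3 * h * d).

Lemma len_log_spec h : 0 < h -> h <= n ->
  [/\ 1 < len_log h, len_log h <= K, 3 * h * d <= 2 ^ len_log h & 2 ^ len_log h <= 6 * (h * d)].
Proof.
move=> h0 hn; have hP := up_logP (3 * h * d) (isT : 1 < 2); rewrite -/(len_log h) in hP.
have h3 : 3 <= 3 * h * d by rewrite -mulnA leq_pmulr // muln_gt0 h0 d0.
have l1 : 1 < len_log h.
  rewrite ltnNge; apply/negP => l; have l2 : 2 ^ len_log h <= 2 ^ 1 by rewrite leq_exp2l.
  by have := leq_trans h3 (leq_trans hP l2).
split=> //.
  by rewrite table_logE; apply: leq_up_log; rewrite leq_mul2r leq_mul2l hn !orbT.
have := @up_log_lt 2 (3 * h * d) (len_log h).-1 isT; rewrite -/(len_log h) => /(_ ltac:(lia)).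
by rewrite -{2}(prednK (ltnW l1)) expnS; lia.
Qed.

Hypothesis baseX : big_base s n X.

Lemma size_ok k : k <= K -> room s n X k.
Proof.
move=> hk; split; last exact: error_small.
have hN : 2 ^ k <= B ^ 7 by apply: leq_trans table_log_small; rewrite leq_exp2l.
have b3 : 6 <= B ^ 3 by apply: (@leq_trans (2 ^ 3)); rewrite ?exp_mono.
  apply: (@leq_trans (B ^ 600)); last exact: baseX.
  apply: (@leq_trans (B ^ 3 * (B ^ 63 * S * B ^ 2))).
    apply: leq_mul => //; apply: leq_mul => //; apply: leq_mul => //.
    by apply: leq_trans (exp_mono 9 hN) _; rewrite -expnM.
  by rewrite scaleE -!expnD leq_exp2l.
Qed.

End Sizes.

Section Newton.

Variables (ok : nat -> Prop) (lim X s n : nat).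
Hypothesis okX : forall v, v <= X -> ok v.
Hypothesis s_gt1 : 1 < s.
Hypothesis n_gt0 : 0 < n.
Local Notation runs := (runs ok lim).
Local Notation B := (base s n).
Local Notation S := (scale s n).
Local Notation d := (slot_len s n).
Local Notation K := (table_log s n).
Local Notation len_log := (len_log s n).
Hypothesis baseX : big_base s n X.

Variable R : rcfType.
Variable T : nat -> quad.
Hypothesis T_good : good_table s n R K T.

Variables (f a : nat -> nat).
Hypothesis f0 : f 0 = 1.
Hypothesis fE : forall m, 0 < m -> f m = \sum_(1 <= l < m.+1) a l * f (m - l).
Hypothesis a0 : a 0 = 0.
Hypothesis f_le : forall m, f m <= s ^ m.
Hypothesis a_le : forall l, a l <= s.

Let B1 : 1 < B := base_gt1 n s_gt1.
Let B0 : 0 < B := ltnW B1.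
Let S0 : 0 < S. Proof. by rewrite scaleE expn_gt0 B0. Qed.
Let d0 : 0 < d. Proof. by rewrite slot_lenE addn1. Qed.

Definition digits_of h st := forall m i, m < h -> i < d -> arr st 2 (m * d + i) = f m %/ B ^ i %% B.
Definition setting st := [/\ ready s n st, var st 0 = n, forall l, arr st 1 l = a l &
  forall b, Q st 4 b = T b].

Let okK v j : v <= 2 ^ j * B ^ 8 -> j <= 500 -> ok v.
Proof. by move=> h hj; apply: (okB okX s_gt1 baseX h); lia. Qed.

Let K_ok v : v <= 4 * 2 ^ K -> ok v.
Proof.
move=> h; apply: (@okK _ 2) => //; apply: leq_trans h _; rewrite leq_mul2l /=.
by apply: leq_trans (table_log_small s_gt1 n_gt0) _; rewrite leq_exp2l.
Qed.

Lemma grow_spec st h k : 0 < h -> h <= n -> var st 18 = h -> var st 23 = d -> var st 28 = 2 ^ k ->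
  k <= len_log h ->
  runs grow st (fun t st' => t <= 2 * K + 1 /\ var st' 28 = 2 ^ len_log h).
Proof.
move=> h0 hn h18 h23 h28 hk; have [l1 l2 l3 l4] := len_log_spec s_gt1 n_gt0 h0 hn.
apply: (@runs_while _ _ _ _ _ _ (len_log h - k) (fun i st' => var st' 28 = 2 ^ (k + i)) (fun=> 1)).
- by rewrite addn0.
- move=> i st' hi e28 fr; have e18 : var st' 18 = h by use_frame fr.
  have e23 : var st' 23 = d by use_frame fr.
  split; first by rewrite /= e28 e18 e23 addn1; apply: up_log_lt => //; rewrite -/(len_log h); lia.
  apply: runs_asg; last by simp_store; rewrite e28 -expnSr addnS.
  apply: K_ok; rewrite /= e28 -expnSr; apply: (@leq_trans (2 ^ K)); last lia.
  by rewrite leq_exp2l //; lia.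
- move=> st' e28 fr; have e18 : var st' 18 = h by use_frame fr.
  have e23 : var st' 23 = d by use_frame fr.
  by rewrite /= e28 e18 e23 subnKC // addn1 ltnS.
by move=> t st' fr; rewrite sum_ord_const subnKC // => ht e28; split=> //; lia.
Qed.

Definition coef_digits h i := if (d %| i) && (i < h.*2 * d) then a (i %/ d) else 0.

Lemma coef_slots h : slots B d h.*2 (cut h.*2 a) (coef_digits h).
Proof.
split=> [m hm|i hi|m hm]; last by rewrite /cut ltnNge hm.
  rewrite -(big_mkord xpredT (fun i => coef_digits h (m * d + i) * B ^ i)) big_ltn //.
  rewrite big_nat_cond big1 ?addn0 => [|i /andP[/andP[i1 hi] _]].
    rewrite /coef_digits /cut hm expn0 muln1 dvdn_mull // mulnK //=.
    by rewrite ltn_mul2r d0 hm.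
  rewrite /coef_digits dvdn_addr ?dvdn_mull // /dvdn (modn_small hi).
  by case: i i1 hi.
by rewrite /coef_digits ltnNge hi andbF.
Qed.

Lemma load_coefs_spec st h : 0 < h -> h <= n -> setting st -> var st 18 = h ->
  var st 28 = 2 ^ len_log h ->
  runs load_coefs st (fun t st' => t <= 10 * 2 ^ len_log h + 4 /\
    forall i, i < 2 ^ len_log h -> Q st' 8 i = digit_quad S (coef_digits h i)).
Proof.
move=> h0 hn [[h21 h22 h23 h24 h20] e0 ha hT] h18 h28; have [l1 l2 l3 l4] := len_log_spec s_gt1 n_gt0 h0 hn.
have rm := size_ok s_gt1 n_gt0 baseX l2; have k0 : 0 < len_log h by apply: ltnW.
have K1 := @load_digits_spec ok lim X S B (len_log h) okX S0 B1 k0 (proj1 rm) st 0 (fun=> 0)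
  (Num 0) (Num 0) h28 h24 (fun _ _ => leq0n _) (fun _ _ _ _ _ => conj erefl (fun _ => erefl)).
apply: runs_seq; apply: (runs_call K1).
move=> t1 s1 f1 [ht1 q1].
apply: runs_seq; apply: runs_asg; first exact: (@K_ok 0).
pose I l st' := forall i, i < 2 ^ len_log h ->
  Q st' 8 i = digit_quad S (if (d %| i) && (i < l * d) then a (i %/ d) else 0).
have x2 : 2 * h <= 2 ^ len_log h.
  by apply: leq_trans l3; have := leq_mul (leqnn (3 * h)) d0; lia.
have lK : 2 ^ len_log h <= 2 ^ K by rewrite leq_exp2l.
apply: (@runs_for _ _ _ _ _ _ 0 (2 * h) I (fun=> 1)) => //.
- by move=> i hi; rewrite -[LHS]/(Q s1 8 i) q1 // andbF.
- by move=> i hi; apply: K_ok; lia.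
- by move=> i st' hi hI hv fr; simp_store; use_frame fr; simp_store; use_frame f1; rewrite h18.
- move=> l st' /andP[_ hl] hI hv fr.
  have e23 : var st' 23 = d by use_frame fr; simp_store; use_frame f1.
  have e24 : var st' 24 = S by use_frame fr; simp_store; use_frame f1.
  have ea : arr st' 1 l = a l by use_frame fr; simp_store; use_frame f1.
  have hld : l * d < 2 ^ len_log h.
    apply: leq_trans l3; have := leq_mul hl d0; have := leq_mul hl (leqnn d); lia.
  have hQ := hI _ hld.
  apply: runs_put.
    rewrite /= e24 hv ea; apply: (okB okX s_gt1 baseX (m := 0) (j := 257)) => //.
    rewrite mul1n expnSr leq_mul2l; apply/orP; right.
    by apply: leq_trans (a_le l) (base_ge_s n s_gt1).
  split=> // _ i hi; rewrite /Q; simp_store; rewrite e23 e24 hv ea.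
  have := hI i hi; rewrite /Q => -[q8 q9 q10 q11]; rewrite q9 q10 q11.
  case: eqP => [->|ne].
    by rewrite dvdn_mull // mulnK // ltn_mul2r d0 ltnSn.
  rewrite q8; congr (Quad (S * _) 0 0 0); case: (boolP (d %| i)) => //= /dvdnP[c ec].
  have nec : c <> l by move=> e; apply: ne; rewrite ec e.
  by rewrite ec !ltn_mul2r d0 !andTb ltnS [c <= l]leq_eqVlt; case: eqP.
- move=> t st' fr; rewrite sum_cost => ht hI _; split; first by lia.
  by move=> i hi; rewrite hI // /coef_digits mul2n.
Qed.

Lemma slot_digits_slots h u al : (forall m, m < h -> u m < B ^ d) ->
  (forall m i, m < h -> i < d -> al (m * d + i) = u m %/ B ^ i %% B) ->
  slots B d h (cut h u) (fun i => if i < h * d then al i else 0).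
Proof.
move=> hu hal; split=> [m hm|i hi|m hm]; last by rewrite /cut ltnNge hm.
  rewrite /cut hm -[RHS](modn_small (hu m hm)) -digits_sum //; apply: eq_bigr => i _.
  by rewrite (ltn_cat hm (ltn_ord i)) hal.
by rewrite ltnNge hi.
Qed.

Lemma append_spec st h : 0 < h -> h <= n -> var st 18 = h -> var st 23 = d ->
  digits_of h st ->
  (forall m i, m < h -> i < d -> arr st 3 (m * d + i) = f (h + m) %/ B ^ i %% B) ->
  runs append st (fun t st' => t <= 3 * (h * d) + 2 /\ digits_of h.*2 st').
Proof.
move=> h0 hn h18 h23 hF hP; have [l1 l2 l3 l4] := len_log_spec s_gt1 n_gt0 h0 hn.
have lK : 2 ^ len_log h <= 2 ^ K by rewrite leq_exp2l.
have hP' x : x < h * d -> arr st 3 x = f (h + x %/ d) %/ B ^ (x %% d) %% B.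
  move=> hx; rewrite {1}(divn_eq x d) hP ?ltn_mod //; by rewrite ltn_divLR.
apply: runs_seq; apply: runs_asg; first exact: (@K_ok 0).
pose I x st' := forall i, arr st' 2 i = if h * d <= i < h * d + x then arr st 3 (i - h * d) else arr st 2 i.
apply: (@runs_for _ _ _ _ _ _ 0 (h * d) I (fun=> 1)) => //.
- by move=> i; case: (leqP (h * d) i) => //= hi; rewrite addn0 ltnNge hi.
- by move=> x hx; apply: K_ok; lia.
- by move=> x st' hx hI hv fr; simp_store; use_frame fr; simp_store; rewrite h18 h23.
- move=> x st' /andP[_ hx] hI hv fr.
  have e18 : var st' 18 = h by use_frame fr; simp_store.
  have e23 : var st' 23 = d by use_frame fr; simp_store.
  have e3 : arr st' 3 = arr st 3 by use_frame fr.
  apply: runs_put.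
    rewrite /= hv e3 hP' //; apply: (@okK _ 0) => //; rewrite mul1n.
    apply: (@leq_trans B); first by rewrite ltnW // ltn_mod.
    by rewrite -{1}(expn1 B) leq_exp2l.
  split=> // _ i; simp_store; rewrite e18 e23 e3 hv.
  case: eqP => [->|ne]; first by rewrite leq_addr addKn ltn_add2l ltnSn.
  by rewrite hI; congr (if _ then _ else _); lia.
- move=> t st' fr; rewrite sum_cost => ht hI _; split; first by lia.
  move=> m i hm hi; rewrite hI; have hd2 : h.*2 * d = h * d + h * d by rewrite -addnn mulnDl.
  have hmi := ltn_cat hm hi; rewrite hd2 in hmi; rewrite hmi andbT.
  case: leqP => hle; last first.
    by apply: hF => //; have := leq_ltn_trans (leq_addr i (m * d)) hle; rewrite ltn_mul2r d0.
  have hhm : h <= m.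
    rewrite leqNgt; apply/negP => hlt; have := ltn_cat hlt hi; lia.
  have -> : m * d + i - h * d = (m - h) * d + i by rewrite mulnBl; have := leq_mul hhm (leqnn d); lia.
  by rewrite hP ?subnKC //; lia.
Qed.

Lemma newton_step_spec st h k : 0 < h -> h <= n -> setting st -> var st 18 = h ->
  var st 28 = 2 ^ k -> k <= len_log h -> digits_of h st ->
  runs newton_step st (fun t st' => t <= (K + 1) * (700 * (h * d)) /\
    [/\ var st' 18 = h.*2, var st' 28 = 2 ^ len_log h & digits_of h.*2 st']).
Proof.
move=> h0 hn hst h18 h28 hk hF; have [l1 l2 l3 l4] := len_log_spec s_gt1 n_gt0 h0 hn.
have [[h21 h22 h23 h24 h20] e0 ha hT] := hst.
have rm := size_ok s_gt1 n_gt0 baseX l2; have k0 : 0 < len_log h by apply: ltnW.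
set L := len_log h in l1 l2 l3 l4 rm k0 *.
have fb m : m < h -> f m < B ^ d by move=> hm; apply: leq_ltn_trans (f_le m) (slot_lt s_gt1 n_gt0 _); lia.
have sb m : source f a h m < B ^ d.
  apply: leq_ltn_trans (@first_product_le s f a f0 a0 s_gt1 f_le a_le h _) (slot_lt s_gt1 n_gt0 _); lia.
have T_near b : b < (2 ^ L)./2 -> near S (16 ^ K - 1) (T b) (tw R b).
  move=> hb; case: (T_good (b := b)) => //; apply: leq_trans hb _.
  by rewrite -divn2; apply: leq_trans (leq_div _ _) _; rewrite leq_exp2l.
have T_sum b : b < (2 ^ L)./2 -> qsum (T b) <= 3 * S.
  move=> hb; case: (T_good (b := b)) => //; apply: leq_trans hb _.
  by rewrite -divn2; apply: leq_trans (leq_div _ _) _; rewrite leq_exp2l.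
have dB x y : x %/ y %% B <= B by rewrite ltnW // ltn_mod.
have hdN : h * d <= 2 ^ L by apply: leq_trans l3; lia.
apply: runs_seq; apply: runs_call (grow_spec h0 hn h18 h23 h28 hk) _ => t1 s1 f1 [ht1 g28].
pose al i := if i < h * d then f (i %/ d) %/ B ^ (i %% d) %% B else 0.
have alB i : al i <= B by rewrite /al; case: ifP.
have al_slots : slots B d h (cut h f) al.
  apply: (@slot_digits_slots h f (fun i => f (i %/ d) %/ B ^ (i %% d) %% B)) => // m i hm hi.
  by rewrite divn_cat // modn_cat.
have F1 i : i < h * d -> arr st 2 i = al i.
  by move=> hi; rewrite /al hi {1}(divn_eq i d) hF ?ltn_mod // ltn_divLR.
have v24 : var s1 24 = S by use_frame f1.
apply: runs_seq; apply: runs_call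
  (@load_digits_spec ok lim X S B L okX S0 B1 k0 (proj1 rm) s1 (h * d) al _ _ g28 v24 _ _) _.
- by move=> x _; exact: alB.
- move=> st' x hx fr hv; split.
    by rewrite /=; use_frame fr; use_frame f1; rewrite h18 h23.
  by move=> hx2; rewrite /= hv; use_frame fr; use_frame f1; rewrite F1.
move=> t2 s2 f2 [ht2 q2].
have {}q2 i : i < 2 ^ L -> Q s2 8 i = digit_quad S (al i).
  by move=> hi; rewrite q2 // /al; case: (i < h * d).
have w28 : var s2 28 = 2 ^ L by use_frame f2.
have w24 : var s2 24 = S by use_frame f2.
have wT b : Q s2 4 b = T b by rewrite -hT /Q; use_frame f2; use_frame f1.
apply: runs_seq; apply: runs_call
  (@fft_digits_spec ok lim X S B L okX S0 B1 k0 (proj1 rm) (16 ^ K - 1) T T_sum (proj2 rm) s2 al w28 w24 (fun b _ => wT b) alB q2) _.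
move=> t3 s3 f3 [ht3 q3].
have x28 : var s3 28 = 2 ^ L by use_frame f3.
apply: runs_seq; apply: runs_call (@copy_transform_spec ok lim X S B L okX S0 B1 k0 (proj1 rm) s3 x28 _) _.
  move=> i hi; rewrite q3 //; apply: leq_trans (digits_fft_bound S0 T_sum alB (leqnn L) hi) _.
  have [_ _ _ x4] := sized_bounds S0 B1 (proj1 rm).
  by apply: leq_trans x4 _; apply: leq_trans (proj1 rm); rewrite leq_pmull.
move=> t4 s4 f4 [ht4 q4].
have st4 : setting s4.
  split.
  - by split; use_frame f4; use_frame f3; use_frame f2; use_frame f1.
  - by use_frame f4; use_frame f3; use_frame f2; use_frame f1.
  - by move=> l; use_frame f4; use_frame f3; use_frame f2; use_frame f1.
  - by move=> b; rewrite -hT /Q; use_frame f4; use_frame f3; use_frame f2; use_frame f1.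
have y18 : var s4 18 = h by use_frame f4; use_frame f3; use_frame f2; use_frame f1.
have y28 : var s4 28 = 2 ^ L by use_frame f4.
apply: runs_seq; apply: runs_call (load_coefs_spec h0 hn st4 y18 y28) _ => t5 s5 f5 [ht5 q5].
have cdB i : coef_digits h i <= B.
  by rewrite /coef_digits; case: ifP => // _; apply: leq_trans (a_le _) (base_ge_s n s_gt1).
have cs := coef_slots h.
have Y5 i : i < 2 ^ L -> Q s5 12 i = qfft S T L L (digit_quad S \o al) i.
  by move=> hi; rewrite -q3 // -q4 // /Q; use_frame f5.
have [[_ _ r23 r24 _] _ _ rT] := st4; have [[r21 _ _ _ _] _ _ _] := st4.
have hsum : h.*2 * d + h * d <= 2 ^ L by apply: leq_trans l3; rewrite -muln2; lia.
apply: runs_seq; apply: runs_call (@product_spec ok lim X S B L okX S0 B1 k0 (proj1 rm) R (16 ^ K - 1) T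
  T_near T_sum (proj2 rm) s5 (coef_digits h) al (h.*2 * d) (h * d) _ _ _ _ cdB alB _ _ hsum q5 Y5) _.
- by use_frame f5.
- by use_frame f5.
- by use_frame f5.
- by move=> b _; rewrite -rT /Q; use_frame f5.
- by case: cs.
- by case: al_slots.
move=> t6 s6 f6 [ht6 q6].
(* Slots h to 2h - 1 of the first product are the source. *)
have P6 m i : m < h -> i < d -> arr s6 3 (h * d + (m * d + i)) = source f a h m %/ B ^ i %% B.
  move=> hm hi; rewrite addnA -mulnDl.
  have hk3 : h + m < h.*2 + h by rewrite -addnn; lia.
  have hN3 : (h.*2 + h) * d <= 2 ^ L by rewrite mulnDl.
  rewrite q6; last by apply: leq_trans hN3; apply: ltn_cat.
  rewrite (mul_slots B0 cs al_slots hN3 _ hk3 hi); first by rewrite /source nconvC.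
  by move=> k' _; rewrite nconvC; apply: leq_ltn_trans (@first_product_le s f a f0 a0 s_gt1 f_le a_le h _) (slot_lt s_gt1 n_gt0 _); lia.
pose al2 i := if i < h * d then source f a h (i %/ d) %/ B ^ (i %% d) %% B else 0.
have al2B i : al2 i <= B by rewrite /al2; case: ifP.
have al2_slots : slots B d h (cut h (source f a h)) al2.
  apply: (@slot_digits_slots h (source f a h) (fun i => source f a h (i %/ d) %/ B ^ (i %% d) %% B)) => //.
  by move=> m i hm hi; rewrite divn_cat // modn_cat.
have z18 : var s6 18 = h by use_frame f6; use_frame f5.
have z23 : var s6 23 = d by use_frame f6; use_frame f5.
have z24 : var s6 24 = S by use_frame f6; use_frame f5.
have z28 : var s6 28 = 2 ^ L by use_frame f6; use_frame f5.
apply: runs_seq; apply: runs_call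
  (@load_digits_spec ok lim X S B L okX S0 B1 k0 (proj1 rm) s6 (h * d) al2 _ _ z28 z24 _ _) _.
- by move=> x _; exact: al2B.
- move=> st' x hx fr hv; split; first by rewrite /=; use_frame fr; rewrite z18 z23.
  move=> hx2; rewrite /= hv; use_frame fr; rewrite z18 z23 {1}(divn_eq x d) P6 ?ltn_mod ?ltn_divLR //.
  by rewrite /al2 hx2.
move=> t7 s7 f7 [ht7 q7].
have {}q7 i : i < 2 ^ L -> Q s7 8 i = digit_quad S (al2 i).
  by move=> hi; rewrite q7 // /al2; case: (i < h * d).
have Y7 i : i < 2 ^ L -> Q s7 12 i = qfft S T L L (digit_quad S \o al) i.
  by move=> hi; rewrite -Y5 // /Q; use_frame f7; use_frame f6.
have hsum2 : h * d + h * d <= 2 ^ L by apply: leq_trans l3; lia.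
apply: runs_seq; apply: runs_call (@product_spec ok lim X S B L okX S0 B1 k0 (proj1 rm) R (16 ^ K - 1) T
  T_near T_sum (proj2 rm) s7 al2 al (h * d) (h * d) _ _ _ _ al2B alB _ _ hsum2 q7 Y7) _.
- by use_frame f7.
- by use_frame f7.
- by use_frame f7; use_frame f6; use_frame f5.
- by move=> b _; rewrite -rT /Q; use_frame f7; use_frame f6; use_frame f5.
- by case: al2_slots.
- by case: al_slots.
move=> t8 s8 f8 [ht8 q8].
have P8 m i : m < h -> i < d -> arr s8 3 (m * d + i) = f (h + m) %/ B ^ i %% B.
  move=> hm hi; have hk2 : m < h + h by lia.
  have hN2 : (h + h) * d <= 2 ^ L by rewrite mulnDl.
  rewrite q8; last by apply: leq_trans hN2; apply: ltn_cat.
  rewrite (mul_slots B0 al2_slots al_slots hN2 _ hk2 hi) -?(doubling f0 fE a0) //.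
  move=> k' _; apply: leq_ltn_trans (@second_product_le s f a f0 a0 s_gt1 f_le a_le h _) (slot_lt s_gt1 n_gt0 _).
  by rewrite -addnn; lia.
have u18 : var s8 18 = h by use_frame f8; use_frame f7.
have u23 : var s8 23 = d by use_frame f8; use_frame f7.
have F8 : digits_of h s8.
  move=> m i hm hi; rewrite -hF //.
  by use_frame f8; use_frame f7; use_frame f6; use_frame f5; use_frame f4; use_frame f3; use_frame f2; use_frame f1.
apply: runs_seq; apply: runs_call (append_spec h0 hn u18 u23 F8 P8) _ => t9 s9 f9 [ht9 F9].
have w18 : var s9 18 = h by use_frame f9.
apply: runs_asg.
  by apply: K_ok; rewrite /= w18; have : 2 ^ L <= 2 ^ K by [rewrite leq_exp2l|]; have := leq_mul (leqnn h) d0; lia.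
split; last first.
  by split; simp_store; rewrite ?w18 ?muln2 //; use_frame f9; use_frame f8; use_frame f7.
have hd0 : 0 < h * d by rewrite muln_gt0 h0 d0.
exact: step_cost hd0 l4 l2 ht1 ht2 ht3 ht4 ht5 ht6 ht7 ht8 ht9.
Qed.

Lemma sum_pow2 m : \sum_(i < m) 2 ^ i <= 2 ^ m.
Proof.
elim: m => [|m IH]; first by rewrite big_ord0.
by rewrite big_ord_recr /= expnS mul2n -addnn leq_add2r.
Qed.

(** The rounds have h = 1, 2, 4, ... up to n, so their costs form a geometric series dominated by
    the last one. *)
Lemma newton_spec st : setting st ->
  runs newton st (fun t st' => t <= (K + 1) * (1500 * (n * d)) /\ digits_of n.+1 st').
Proof.
move=> hst; have [[h21 h22 h23 h24 h20] e0 ha hT] := hst.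
have [k1 k2] := (table_log_spec s_gt1 n_gt0).
have dn : d <= n * d by rewrite leq_pmull.
apply: runs_seq; apply: runs_asg; first by apply: K_ok; rewrite /=; lia.
apply: runs_seq; apply: runs_asg; first by apply: K_ok; rewrite /=; lia.
apply: runs_seq; apply: runs_asg; first by apply: K_ok; rewrite /=; lia.
apply: runs_seq.
apply: (@runs_for _ _ _ _ _ _ 0 d (fun x st' => forall i, i < x -> arr st' 2 i = 0) (fun=> 1)) => //.
- by move=> i hi; apply: K_ok; lia.
- by move=> i st' hi hI hv fr; simp_store; use_frame fr; simp_store.
- move=> x st' hx hI hv fr; apply: runs_put; first by apply: K_ok.
  split=> // _ i; rewrite ltnS; simp_store; rewrite hv; case: eqP => // ne hi.
  by apply: hI; lia.
move=> t1 s1 f1; rewrite sum_cost => ht1 hz _.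
apply: runs_seq; apply: runs_put; first by apply: K_ok; rewrite /=; lia.
(* Of the transform length left by the previous round only this is needed: a power of two from which
   [grow] can reach the next length. *)
pose I j st' := [/\ setting st', var st' 18 = 2 ^ j, exists2 k, k <= len_log (2 ^ j) & var st' 28 = 2 ^ k &
  digits_of (2 ^ j) st'].
have /andP[n1 n2] := trunc_log_bounds (isT : 1 < 2) n_gt0.
apply: (@runs_while _ _ _ _ _ _ (trunc_log 2 n).+1 I (fun j => (K + 1) * (700 * (2 ^ j * d)))).
- split.
  + split.
    * by split; simp_store; use_frame f1; simp_store.
    * by simp_store; use_frame f1; simp_store.
    * by move=> l; simp_store; use_frame f1; simp_store.
    * by move=> b; rewrite -hT /Q; simp_store; use_frame f1; simp_store.
  + by simp_store; use_frame f1; simp_store.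
  + exists 1; last by simp_store; use_frame f1; simp_store.
    by have [l1 _ _ _] := len_log_spec s_gt1 n_gt0 (isT : 0 < 1) n_gt0; rewrite expn0 ltnW.
  + move=> m i; rewrite expn0 ltnS leqn0 => /eqP-> hi; rewrite mul0n add0n f0; simp_store.
    case: eqP => [->|ne]; first by rewrite expn0 divn1 modn_small.
    rewrite hz // divn_small ?mod0n // -{1}(expn0 B) ltn_exp2l //; lia.
- move=> j st' hj [sst e18 [k hk e28] hF] fr.
  have hjn : 2 ^ j <= n by apply: leq_trans n1; rewrite leq_exp2l.
  have p0 : 0 < 2 ^ j by rewrite expn_gt0.
  have [[g21 g22 g23 g24 g20] g0 ga gT] := sst.
  split; first by rewrite /= e18 g0.
  apply: runs_call (newton_step_spec p0 hjn sst e18 e28 hk hF) _ => t2 s2 f2 [ht2 [v18 v28 F2]].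
  split=> //; split.
  + split.
    * by split; use_frame f2.
    * by use_frame f2.
    * by move=> l; use_frame f2.
    * by move=> b; rewrite -gT /Q; use_frame f2.
  + by rewrite v18 expnS mul2n.
  + exists (len_log (2 ^ j)) => //; apply: leq_up_log.
    by rewrite leq_mul2r leq_mul2l leq_exp2l // leqnSn !orbT.
  + by rewrite expnS mul2n.
- by move=> st' [[_ g0 _ _] e18 _ _] fr; rewrite /= e18 g0.
move=> t st' fr ht [_ _ _ hF]; split; last by move=> m i hm hi; apply: hF => //; apply: leq_trans n2.
have hs : \sum_(i < (trunc_log 2 n).+1) ((K + 1) * (700 * (2 ^ i * d))).+1 <= (K + 1) * (701 * (2 * n * d)).
  apply: (@leq_trans (\sum_(i < (trunc_log 2 n).+1) (K + 1) * (701 * d) * 2 ^ i)).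
    apply: leq_sum => i _; have p0 : 0 < 2 ^ i by rewrite expn_gt0.
    have h1 : 1 <= (K + 1) * (2 ^ i * d) by rewrite !muln_gt0 p0 d0 addn1.
    lia.
  rewrite -big_distrr /= -mulnA leq_mul2l; apply/orP; right.
  have h2 : \sum_(i < (trunc_log 2 n).+1) 2 ^ i <= 2 * n.
    by apply: leq_trans (sum_pow2 _) _; rewrite expnS leq_mul2l n1 orbT.
  have -> : 701 * (2 * n * d) = 701 * d * (2 * n) by rewrite [2 * n * d]mulnC mulnA.
  by rewrite leq_mul2l h2 orbT.
have h1 : 1 <= n * d by rewrite muln_gt0 n_gt0 d0.
have h3 : n * d <= (K + 1) * (n * d) by rewrite leq_pmull // addn1.
by lia.
Qed.

End Newton.

(** * Arithmetic on machine words *)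

Definition word r v k := v %/ r ^ k %% r.

(** The weighted sum is taken digit by digit without carries; each total stays below n (n s B), a
    constant number of machine words. *)
Definition sum_counts := 3 ::= Num 0 ;;
  For 3 (Var 23)
    (33 ::= Num 0 ;; 4 ::= Num 1 ;;
     For 4 (Var 0 +' Num 1)
       (33 ::= Var 33 +' Var 4 *' Get 1 (Var 4) *' Get 2 ((Var 0 -' Var 4) *' Var 23 +' Var 3)) ;;
     Put 16 (Var 3) (Var 33)).

Definition clear tag := 4 ::= Num 0 ;; For 4 (Var 38) (Put tag (Var 4) (Num 0)).

Definition muladd tag em ea := 37 ::= ea ;; 4 ::= Num 0 ;;
  For 4 (Var 38)
    (33 ::= Get tag (Var 4) *' em +' Var 37 ;; Put tag (Var 4) (Var 33 %' Var 2) ;;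
     37 ::= Var 33 /' Var 2).

(** Converts from base B to the machine radix; the digits may exceed B, as [muladd] accepts any
    small number. *)
Definition horner := clear 17 ;; 5 ::= Var 23 ;;
  While (Num 1) (Var 5) (5 ::= Var 5 -' Num 1 ;; muladd 17 (Var 21) (Get 16 (Var 5))) ;;
  muladd 17 (Num 1) (Var 12).

Definition total := clear 18 ;; muladd 18 (Num 1) (Num 1 +' Var 13) ;; 3 ::= Num 0 ;;
  For 3 (Var 0) (muladd 18 (Var 1) (Num 0)) ;;
  muladd 18 (Num 1) (Num 1 +' Var 11).

Definition subtract := 37 ::= Num 0 ;; 4 ::= Num 0 ;;
  For 4 (Var 38)
    (33 ::= Get 17 (Var 4) +' Var 37 ;;
     34 ::= (Get 18 (Var 4) +' Var 33 *' (Var 2 -' Num 1)) %' Var 2 ;;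
     Out (Var 4) (Var 34) ;;
     37 ::= (Var 33 +' Var 34 -' Get 18 (Var 4)) /' Var 2).

Definition output := 38 ::= Var 0 +' Num 2 ;; sum_counts ;; horner ;; total ;; subtract ;;
  0 ::= Var 38.

(** The carry into word [k] is the quotient by r^k of what the lower words of [v] produce, which
    turns the loop into a statement about numbers. *)
Lemma muladd_word r v m a k : 0 < r ->
  let t := word r v k * m + (v %% r ^ k * m + a) %/ r ^ k in
  t %% r = word r (v * m + a) k /\ t %/ r = (v %% r ^ k.+1 * m + a) %/ r ^ k.+1.
Proof.
move=> r0; have p0 : 0 < r ^ k by rewrite expn_gt0 r0.
have e1 : v %% r ^ k.+1 = word r v k * r ^ k + v %% r ^ k.
  rewrite /word {1}(divn_eq v (r ^ k)) {1}(divn_eq (v %/ r ^ k) r) expnSr.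
  rewrite mulnDl -mulnA [r * _]mulnC -addnA modnMDl modn_small //.
  rewrite [X in _ < X]mulnC; apply: ltn_cat; rewrite ltn_mod //.
have e2 : (v %% r ^ k.+1 * m + a) %/ r ^ k = word r v k * m + (v %% r ^ k * m + a) %/ r ^ k.
  by rewrite e1 mulnDl mulnAC -addnA divnMDl.
split; last by rewrite -e2 -divnMA -expnSr.
rewrite /word -/(word r v k) -e2.
have -> : v * m + a = v %/ r ^ k.+1 * m * r * r ^ k + (v %% r ^ k.+1 * m + a).
  by rewrite {1}(divn_eq v (r ^ k.+1)) expnSr; lia.
by rewrite [in RHS]divnMDl // modnMDl.
Qed.

(* modulo [r], subtracting [t] is adding [t * (r - 1)] *)
Lemma borrow r V t : 1 < r -> V < r -> t <= r -> let o := (V + t * (r - 1)) %% r in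
  [/\ o < r, (t + o - V) %/ r <= 1 & V + (t + o - V) %/ r * r = t + o].
Proof.
move=> r1 hV ht o; have r0 : 0 < r by apply: ltnW.
case: (leqP t V) => h.
  have eo : o = V - t.
    have e : V + t * (r - 1) = t * r + (V - t) by rewrite mulnBr muln1; have := leq_mul (leqnn t) (ltnW r1); lia.
    by rewrite /o e modnMDl modn_small //; lia.
  by rewrite eo subnKC // subnn div0n; split=> //; lia.
have eo : o = r + V - t.
  have e : V + t * (r - 1) = (t - 1) * r + (r + V - t).
    rewrite mulnBr muln1 mulnBl mul1n.
    by have := leq_mul (leqnn t) (ltnW r1); have := leq_mul (_ : 1 <= t) (leqnn r); lia.
  by rewrite /o e modnMDl modn_small //; lia.
have -> : t + o - V = r by rewrite eo; lia.
by rewrite divnn r0 mul1n eo; split=> //; lia.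
Qed.

Lemma borrow_step x y z p r V Z bp o b : x + bp * p = y + z -> V + b * r = Z + bp + o ->
  x + V * p + b * (r * p) = y + Z * p + (z + o * p).
Proof. by move=> h1 h2; have := congr1 (muln^~ p) h2; rewrite /= !mulnDl; lia. Qed.

Section Output.

Variables (ok : nat -> Prop) (lim X r W : nat).
Hypothesis okX : forall v, v <= X -> ok v.
Hypothesis r_gt1 : 1 < r.
Hypothesis WX : W <= X.
Hypothesis rX : r <= X.
Hypothesis W_lim : W <= lim.
Local Notation runs := (runs ok lim).

Let r0 : 0 < r := ltnW r_gt1.

Definition holds tag v st := forall k, k < W -> arr st tag k = word r v k.

Lemma clear_spec tag st : var st 38 = W -> runs (clear tag) st (fun t st' => t <= 3 * W + 2 /\
  holds tag 0 st').
Proof.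
move=> h; apply: runs_seq; apply: runs_asg; first exact: okX.
apply: (@runs_for _ _ _ _ _ _ 0 W (fun k st' => forall j, j < k -> arr st' tag j = 0) (fun=> 1)) => //.
- by move=> i hi; apply: okX; lia.
- by move=> i st' hi hI hv fr; simp_store; use_frame fr; simp_store.
- move=> i st' hi hI hv fr; apply: runs_put; first exact: okX.
  split=> // _ j; rewrite ltnS; simp_store; rewrite eqxx hv; case: eqP => // ne hj.
  by apply: hI; lia.
- move=> t st' fr; rewrite sum_cost => ht hI _; split; first lia.
  by move=> k hk; rewrite hI // /word div0n mod0n.
Qed.

Lemma muladd_spec tag em ea st v m : var st 38 = W -> var st 2 = r -> holds tag v st ->
  (forall st', var st' 1 = var st 1 -> var st' 21 = var st 21 -> eval st' em = m) ->
  r * m + m + eval st ea <= X ->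
  runs (muladd tag em ea) st (fun t st' => t <= 5 * W + 3 /\ holds tag (v * m + eval st ea) st').
Proof.
move=> h38 h2 hv hm hX; set a := eval st ea in hX *.
apply: runs_seq; apply: runs_asg; first by apply: okX; rewrite -/a; lia.
rewrite -/a; apply: runs_seq; apply: runs_asg; first exact: okX.
pose I k st' := var st' 37 = (v %% r ^ k * m + a) %/ r ^ k /\
  forall j, j < W -> arr st' tag j = if j < k then word r (v * m + a) j else word r v j.
have cb k : (v %% r ^ k * m + a) %/ r ^ k <= m + a.
  have p0 : 0 < r ^ k by rewrite expn_gt0 r0.
  have h : v %% r ^ k <= r ^ k by rewrite ltnW // ltn_mod.
  apply: (@leq_trans ((m * r ^ k + a) %/ r ^ k)).
    by apply: leq_div2r; rewrite leq_add2r mulnC leq_mul2l h orbT.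
  by rewrite divnMDl // leq_add2l leq_div.
apply: (@runs_for _ _ _ _ _ _ 0 W I (fun=> 3)) => //.
- by split; [simp_store; rewrite modn1 mul0n add0n divn1|move=> j hj; apply: hv].
- by move=> i hi; apply: okX; lia.
- by move=> i st' hi hI hv' fr; simp_store; use_frame fr; simp_store.
- move=> k st' /andP[_ hk] [i1 i2] hk' fr.
  have e2 : var st' 2 = r by use_frame fr; simp_store.
  have em' st2 : (forall x, x \notin [:: 33; 37; 4] -> var st2 x = var st' x) -> eval st2 em = m.
    by move=> e; apply: hm; rewrite e //; use_frame fr; simp_store.
  have [w1 w2] := muladd_word v m a k r0.
  have ev : eval st' (Get tag (Var 4) *' em +' Var 37) = word r v k * m + (v %% r ^ k * m + a) %/ r ^ k.
    by rewrite /= hk' i1 i2 // ltnn em'.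
  have hle : word r v k * m + (v %% r ^ k * m + a) %/ r ^ k <= X.
    apply: leq_trans hX; rewrite -addnA; apply: leq_add (cb k).
    by rewrite leq_mul2r ltnW ?orbT // ltn_mod.
  apply: runs_seq; apply: runs_asg; rewrite ev; first exact: okX.
  apply: runs_seq; apply: runs_put.
    by apply: okX; simp_store; rewrite e2; apply: leq_trans (leq_mod _ _) hle.
  apply: runs_asg; first by apply: okX; simp_store; rewrite e2; apply: leq_trans (leq_div _ _) hle.
  split=> // _; split; simp_store; rewrite ?e2 //.
  move=> j hj; rewrite eqxx hk'; case: eqP => [->|ne]; first by rewrite ltnSn w1.
  by rewrite i2 // ltnS [j <= k]leq_eqVlt; case: eqP ne.
- move=> t st' fr; rewrite sum_cost => ht [_ hI] _; split; first by lia.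
  by move=> k hk; rewrite hI // hk.
Qed.

Lemma subtract_spec st v z : var st 38 = W -> var st 2 = r -> holds 17 z st -> holds 18 v st ->
  z <= v -> v < r ^ W ->
  runs subtract st (fun t st' => [/\ t <= 6 * W + 3, forall i, i < W -> io st' i < r &
    v - z = \sum_(i < W) io st' i * r ^ i]).
Proof.
move=> h38 h2 hz hv zv vW.
apply: runs_seq; apply: runs_asg; first exact: okX.
apply: runs_seq; apply: runs_asg; first exact: okX.
pose I k st' := [/\ var st' 37 <= 1, forall j, j < k -> io st' j < r &
  \sum_(j < k) word r v j * r ^ j + var st' 37 * r ^ k =
  \sum_(j < k) word r z j * r ^ j + \sum_(j < k) io st' j * r ^ j].
apply: (@runs_for _ _ _ _ _ _ 0 W I (fun=> 4)) => //.
- by split=> //; rewrite !big_ord0.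
- by move=> i hi; apply: okX; lia.
- by move=> i st' hi hI hv' fr; simp_store; use_frame fr; simp_store.
- move=> k st' /andP[_ hk] [i1 i2 i3] hk' fr.
  have e2 : var st' 2 = r by use_frame fr; simp_store.
  have e17 : arr st' 17 k = word r z k by use_frame fr; apply: hz.
  have e18 : arr st' 18 k = word r v k by use_frame fr; apply: hv.
  have wz : word r z k < r by rewrite ltn_mod.
  have wv : word r v k < r by rewrite ltn_mod.
  have ht : word r z k + var st' 37 <= r by lia.
  have [b1 b2 b3] := borrow r_gt1 wv ht.
  set o := (_ %% r) in b1 b2 b3; set b := (_ %/ r) in b2 b3.
  apply: runs_seq; apply: runs_asg; first by apply: okX; rewrite /= hk' e17; lia.
  apply: runs_seq; apply: runs_asg.
    by apply: okX; simp_store; rewrite hk' e17 e18 e2 -/o; lia.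
  apply: runs_seq; apply: runs_out.
  + by simp_store; rewrite hk'; lia.
  + by apply: okX; simp_store; rewrite hk' e17 e18 e2 -/o; lia.
  apply: runs_asg.
    by apply: okX; simp_store; rewrite hk' e17 e18 e2 -/o -/b; lia.
  simp_store; rewrite hk' e17 e18 e2 -/o -/b; split=> // _; split; simp_store.
  + exact: b2.
  + move=> j; rewrite ltnS leq_eqVlt; case: eqP => //= _; exact: i2.
  + rewrite !big_ord_recr /= eqxx.
    have -> : \sum_(j < k) (if j == k :> nat then o else io st' j) * r ^ j = \sum_(j < k) io st' j * r ^ j.
      by apply: eq_bigr => j _; rewrite ltn_eqF.
    by rewrite expnS; apply: (borrow_step i3 b3).
- move=> t st' fr; rewrite sum_cost => ht [i1 i2 i3] _; split=> //; first by lia.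
  have zW : z < r ^ W by apply: leq_ltn_trans zv vW.
  have d1 : \sum_(j < W) word r v j * r ^ j = v by rewrite digits_sum // modn_small.
  have d2 : \sum_(j < W) word r z j * r ^ j = z by rewrite digits_sum // modn_small.
  rewrite d1 d2 in i3.
  (* The final borrow is worth r^W; as the output is below r^W and z <= v, it must be 0. *)
  have hlt : \sum_(j < W) io st' j * r ^ j < r ^ W.
    move: i2; elim: (W) => [|k IH] h; first by rewrite big_ord0.
    rewrite big_ord_recr /= expnS addnC; apply: ltn_cat; first exact: h.
    by apply: IH => j hj; apply: h; lia.
  by move: (var st' 37) i1 i3 => [|[|//]] _ ; rewrite ?mul0n ?mul1n; lia.
Qed.

Section Answer.

Variables (n s B d : nat) (f a : nat -> nat).
Hypothesis B_gt0 : 0 < B.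
Hypothesis WE : W = n + 2.
Hypothesis a_le : forall l, a l <= s.
Hypothesis f_lt : forall m, m <= n -> f m < B ^ d.
Hypothesis accX : n * (n * s * B) <= X.
Hypothesis hornerX : r * B + B + n * (n * s * B) <= X.
Hypothesis powerX : r * s + s + n + 2 <= X.
Hypothesis r_small : r + r + n + 2 <= X.
Hypothesis dX : d <= X.

Definition acc i := \sum_(1 <= l < n.+1) l * a l * (f (n - l) %/ B ^ i %% B).

Lemma acc_le i k : k <= n -> \sum_(1 <= l < k.+1) l * a l * (f (n - l) %/ B ^ i %% B) <= n * (n * s * B).
Proof.
move=> hk; apply: (@leq_trans (\sum_(1 <= l < k.+1) n * s * B)).
  rewrite !big_nat; apply: leq_sum => l hl; apply: leq_mul; first by apply: leq_mul => //; lia.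
  by rewrite ltnW // ltn_mod.
by rewrite sum_nat_const_nat subSS subn0 leq_mul2r hk orbT.
Qed.

Lemma acc_sum : \sum_(i < d) acc i * B ^ i = \sum_(1 <= l < n.+1) l * a l * f (n - l).
Proof.
rewrite (eq_bigr (fun i : 'I_d => \sum_(1 <= l < n.+1) l * a l * (f (n - l) %/ B ^ i %% B * B ^ i))).
  rewrite exchange_big /= !big_nat; apply: eq_bigr => l hl.
  by rewrite -big_distrr /= digits_sum // modn_small // f_lt // leq_subr.
by move=> i _; rewrite /acc big_distrl /=; apply: eq_bigr => l _; rewrite mulnA.
Qed.

Lemma sum_counts_spec st : var st 0 = n -> var st 23 = d -> (forall l, arr st 1 l = a l) ->
  (forall m i, m <= n -> i < d -> arr st 2 (m * d + i) = f m %/ B ^ i %% B) ->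
  runs sum_counts st (fun t st' => t <= d * (3 * n + 6) + 2 /\ forall i, i < d -> arr st' 16 i = acc i).
Proof.
move=> h0 h23 h1 h2; have nX : n + 2 <= X by lia.
apply: runs_seq; apply: runs_asg; first exact: okX.
pose I k st' := forall i, i < k -> arr st' 16 i = acc i.
apply: (@runs_for _ _ _ _ _ _ 0 d I (fun=> 3 * n + 4)) => //.
- by move=> i hi; apply: okX; lia.
- by move=> i st' hi hI hv fr; simp_store; use_frame fr; simp_store.
- move=> i st' /andP[_ hi] hI hv fr.
  apply: runs_seq; apply: runs_asg; first exact: okX.
  apply: runs_seq; apply: runs_asg; first by apply: okX; rewrite /=; lia.
  apply: runs_seq.
  pose J k st2 := var st2 33 = \sum_(1 <= l < k) l * a l * (f (n - l) %/ B ^ i %% B).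
  apply: (@runs_for _ _ _ _ _ _ 1 n.+1 J (fun=> 1)) => //.
  + by rewrite /J; simp_store; rewrite big_geq.
  + by move=> l hl; apply: okX; lia.
  + move=> l st2 hl hJ hv2 fr2; simp_store; use_frame fr2; simp_store; use_frame fr; simp_store.
    by rewrite h0 addn1.
  + move=> l st2 /andP[l1 l2] hJ hv2 fr2.
    have e1 : arr st2 1 l = a l by use_frame fr2; simp_store; use_frame fr; simp_store.
    have e3 : var st2 3 = i by use_frame fr2; simp_store.
    have e0 : var st2 0 = n by use_frame fr2; simp_store; use_frame fr; simp_store.
    have e23 : var st2 23 = d by use_frame fr2; simp_store; use_frame fr; simp_store.
    have e2 : arr st2 2 ((n - l) * d + i) = f (n - l) %/ B ^ i %% B.
      by use_frame fr2; simp_store; use_frame fr; simp_store; rewrite h2 // leq_subr.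
    have ev : eval st2 (Var 33 +' Var 4 *' Get 1 (Var 4) *' Get 2 ((Var 0 -' Var 4) *' Var 23 +' Var 3)) =
        \sum_(1 <= l < l.+1) l * a l * (f (n - l) %/ B ^ i %% B).
      by rewrite /= hv2 hJ e0 e1 e3 e23 e2 [RHS]big_nat_recr.
    apply: runs_asg; rewrite ev; first by apply: okX; apply: leq_trans (acc_le _ _) accX; lia.
    by split.
  move=> t2 st2 fr2; rewrite sum_cost => ht2 hJ _.
  have e3 : var st2 3 = i by use_frame fr2; simp_store.
  apply: runs_put; first by apply: okX; rewrite /= hJ; apply: leq_trans (acc_le _ _) accX.
  split; first by lia.
  move=> _ j; rewrite ltnS; simp_store; rewrite e3; case: eqP => [-> _|ne hj]; first exact: hJ.
  by use_frame fr2; simp_store; apply: hI; lia.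
- by move=> t st' fr; rewrite sum_cost => ht hI _; split; first by lia.
Qed.

Lemma horner_spec st neg : var st 38 = W -> var st 2 = r -> var st 21 = B -> var st 23 = d ->
  var st 12 = neg -> neg <= n -> (forall i, i < d -> arr st 16 i = acc i) ->
  runs horner st (fun t st' => t <= d * (5 * W + 5) + 8 * W + 8 /\
    holds 17 (\sum_(1 <= l < n.+1) l * a l * f (n - l) + neg) st').
Proof.
move=> h38 h2 h21 h23 h12 hneg h16.
apply: runs_seq; apply: runs_call (clear_spec 17 h38) _ => t1 s1 f1 [ht1 hz].
have v23 : var s1 23 = d by use_frame f1.
apply: runs_seq; apply: runs_asg; first by apply: okX; rewrite /= v23.
apply: runs_seq.
(* Horner's partial value, formed by the top [j] digits. *)
pose H j := \sum_(i < j) acc (d - j + i) * B ^ i.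
apply: (@runs_while _ _ _ _ _ _ d (fun j st' => var st' 5 = d - j /\ holds 17 (H j) st') (fun=> 5 * W + 4)).
- split; first by simp_store; rewrite v23 subn0.
  by move=> k hk; rewrite /H big_ord0; apply: hz.
- move=> j st' hj [e5 hI] fr; split; first by rewrite /= e5; lia.
  have e38 : var st' 38 = W by use_frame fr; simp_store; use_frame f1.
  have e2 : var st' 2 = r by use_frame fr; simp_store; use_frame f1.
  have e21 : var st' 21 = B by use_frame fr; simp_store; use_frame f1.
  have e16 i : i < d -> arr st' 16 i = acc i by move=> hi; use_frame fr; simp_store; use_frame f1; apply: h16.
  apply: runs_seq; apply: runs_asg; first by apply: okX; rewrite /= e5; lia.
  have ea : eval (setv st' 5 (eval st' (Var 5 -' Num 1))) (Get 16 (Var 5)) = acc (d - j.+1).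
    by simp_store; rewrite e5 (_ : d - j - 1 = d - j.+1) ?e16 //; lia.
  apply: runs_call (@muladd_spec 17 (Var 21) (Get 16 (Var 5)) _ (H j) B _ _ _ _ _) _.
  + by simp_store.
  + by simp_store.
  + exact: hI.
  + by move=> st2 _ /= ->; simp_store.
  + by rewrite ea; apply: leq_trans hornerX; rewrite leq_add2l; apply: acc_le.
  rewrite ea => t2 s2 f2 [ht2 hh]; split; first by lia.
  split; first by use_frame f2; simp_store; rewrite e5; lia.
  move=> k hk; rewrite hh //; congr word; rewrite /H big_ord_recl addn0 muln1 addnC big_distrl /=.
  congr (_ + _); apply: eq_bigr => i _; rewrite /bump /= expnS.
  by rewrite (_ : d - j.+1 + (1 + i) = d - j + i); lia.
- by move=> st' [e5 _] fr; rewrite /= e5 subnn.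
move=> t2 s2 f2; rewrite big_const_ord iter_addn_0 => ht2 [_ hH].
have e12 : var s2 12 = neg by use_frame f2; simp_store; use_frame f1.
apply: runs_call (@muladd_spec 17 (Num 1) (Var 12) s2 (H d) 1 _ _ hH _ _) _ => //.
- by use_frame f2; simp_store; use_frame f1.
- by use_frame f2; simp_store; use_frame f1.
- by rewrite /= e12; lia.
rewrite /= e12 muln1 => t3 s3 f3 [ht3 hh]; split; first by lia.
move=> k hk; rewrite hh // -acc_sum /H; congr (word _ (_ + _)); apply: eq_bigr => i _.
by rewrite subnn add0n.
Qed.

Lemma total_spec st pos flag : var st 38 = W -> var st 2 = r -> var st 0 = n -> var st 1 = s ->
  var st 11 = pos -> var st 13 = flag -> pos <= n -> flag <= 1 ->
  runs total st (fun t st' => t <= n * (5 * W + 5) + 13 * W + 13 /\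
    holds 18 (s ^ n * (1 + flag) + 1 + pos) st').
Proof.
move=> h38 h2 h0 h1 h11 h13 hpos hflag.
apply: runs_seq; apply: runs_call (clear_spec 18 h38) _ => t1 s1 f1 [ht1 hz].
have e13 : var s1 13 = flag by use_frame f1.
apply: runs_seq; apply: runs_call (@muladd_spec 18 (Num 1) (Num 1 +' Var 13) s1 0 1 _ _ hz _ _) _ => //.
- by use_frame f1.
- by use_frame f1.
- by rewrite /= e13; lia.
rewrite /= e13 mul0n add0n => t2 s2 f2 [ht2 hh].
apply: runs_seq; apply: runs_asg; first exact: okX.
apply: runs_seq.
apply: (@runs_for _ _ _ _ _ _ 0 n (fun j st' => holds 18 (s ^ j * (1 + flag)) st') (fun=> 5 * W + 3)) => //.
- by rewrite mul1n.
- by move=> i hi; apply: okX; lia.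
- by move=> i st' hi hI hv fr; simp_store; use_frame fr; simp_store; use_frame f2; use_frame f1.
- move=> i st' hi hI hv fr.
  have e1 : var st' 1 = s by use_frame fr; simp_store; use_frame f2; use_frame f1.
  apply: runs_call (@muladd_spec 18 (Var 1) (Num 0) st' _ s _ _ hI _ _) _.
  + by use_frame fr; simp_store; use_frame f2; use_frame f1.
  + by use_frame fr; simp_store; use_frame f2; use_frame f1.
  + by move=> st2 /= ->.
  + by rewrite /=; lia.
  move=> t3 s3 f3 [ht3 hh3]; split=> // _ k hk.
  by rewrite -[LHS]/(arr s3 18 k) hh3 // addn0 expnSr mulnAC.
move=> t3 s3 f3; rewrite sum_cost => ht3 hh3 _.
have e11 : var s3 11 = pos by use_frame f3; simp_store; use_frame f2; use_frame f1.
apply: runs_call (@muladd_spec 18 (Num 1) (Num 1 +' Var 11) s3 _ 1 _ _ hh3 _ _) _ => //.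
- by use_frame f3; simp_store; use_frame f2; use_frame f1.
- by use_frame f3; simp_store; use_frame f2; use_frame f1.
- by rewrite /= e11; lia.
rewrite /= e11 muln1 addnA => t4 s4 f4 [ht4 hh4]; split=> //; lia.
Qed.

Lemma output_spec st pos flag neg v : var st 0 = n -> var st 1 = s -> var st 2 = r ->
  var st 21 = B -> var st 23 = d -> var st 11 = pos -> var st 12 = neg -> var st 13 = flag ->
  pos <= n -> neg <= n -> flag <= 1 ->
  (forall l, arr st 1 l = a l) ->
  (forall m i, m <= n -> i < d -> arr st 2 (m * d + i) = f m %/ B ^ i %% B) ->
  v + \sum_(1 <= l < n.+1) l * a l * f (n - l) + neg = s ^ n * (1 + flag) + 1 + pos ->
  s ^ n * (1 + flag) + 1 + pos < r ^ W ->
  runs output st (fun t st' => t <= d * (8 * n + 21) + n * (5 * n + 15) + 27 * (n + 2) + 40 /\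
    [/\ var st' 0 = W, forall i, i < W -> io st' i < r & v = \sum_(i < W) io st' i * r ^ i]).
Proof.
move=> h0 h1 h2 h21 h23 h11 h12 h13 hpos hneg hflag ha hf hv hW.
apply: runs_seq; apply: runs_asg; first by apply: okX; rewrite /= h0 -WE.
rewrite [eval _ _]/= h0 -WE; set st1 := setv _ _ _.
apply: runs_seq; apply: runs_call (@sum_counts_spec st1 h0 h23 ha hf) _ => t1 s1 f1 [ht1 hacc].
apply: runs_seq; apply: runs_call (@horner_spec s1 neg _ _ _ _ _ hneg hacc) _; try by use_frame f1.
move=> t2 s2 f2 [ht2 hh].
apply: runs_seq; apply: runs_call (@total_spec s2 pos flag _ _ _ _ _ _ hpos hflag) _;
  try by use_frame f2; use_frame f1.
move=> t3 s3 f3 [ht3 ht].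
have hh3 : holds 17 (\sum_(1 <= l < n.+1) l * a l * f (n - l) + neg) s3.
  by move=> k hk; use_frame f3; apply: hh.
apply: runs_seq; apply: runs_call (@subtract_spec s3 _ _ _ _ hh3 ht _ hW) _.
- by use_frame f3; use_frame f2; use_frame f1.
- by use_frame f3; use_frame f2; use_frame f1.
- by rewrite -hv; lia.
move=> t4 s4 f4 [ht4 hio hval].
have e38 : var s4 38 = W by use_frame f4; use_frame f3; use_frame f2; use_frame f1.
apply: runs_asg; first by apply: okX; rewrite /= e38.
split; last by split=> //; rewrite -hval -hv; lia.
move: ht1 ht2 ht3 ht4; rewrite WE; clear; nia.
Qed.

End Answer.

End Output.

Definition word_main :=
  Cond (Var 1) (Num 1) (Out (Num 0) (Num 1) ;; 0 ::= Num 1)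
    (string_phase ;; setup ;; table ;; newton ;; output).

Lemma coef_le s q p l : 0 < s -> coef s q p l <= s.
Proof. by move=> hs; rewrite /coef; case: ifP => // _; case: eqP => _; lia. Qed.

(** * Running time in terms of n^2 log sigma *)

Section Cost.

Variables (s n : nat).
Hypothesis s_gt1 : 1 < s.
Hypothesis n_gt0 : 0 < n.
Local Notation lg := (log2 s).
Local Notation e := (digit_exp s n).
Local Notation d := (slot_len s n).
Local Notation K := (table_log s n).
Local Notation nb := (scale_log s n).
Local Notation U := (n ^ 2 * lg).

Lemma base_pow2 : base s n <= 2 ^ (2 * (e * lg)).
Proof.
have h : s <= 2 ^ (2 * lg).
  have /andP[_ h] := trunc_log_bounds (isT : 1 < 2) (ltnW s_gt1).
  apply: leq_trans (ltnW h) _; rewrite leq_exp2l // /log2.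
  have := leq_maxl 1 (trunc_log 2 s); have := leq_maxr 1 (trunc_log 2 s); lia.
by rewrite baseE; apply: leq_trans (exp_mono e h) _; rewrite -expnM leq_exp2l //; lia.
Qed.

(** The key to the running time: the logarithm of a transform length brings a factor e log s, and
    together with the d digits of a slot the e disappears into O(n). *)
Lemma exp_slot : e * d <= 5 * n.
Proof.
have := leq_trunc_div (4 * n) e; have := digit_exp_le s_gt1 n_gt0; rewrite slot_lenE; lia.
Qed.

(** The linear bound serves the angle halvings, each of O(e log s) steps; the bound in e log s
    serves the transforms. *)
Lemma table_log_le : K <= 5 + 2 * n /\ K <= 5 + 4 * (e * lg).
Proof.
have [_ h] := table_log_spec s_gt1 n_gt0; have hd := slot_len_le s_gt1 n_gt0.
have h1 : 2 ^ K <= 2 ^ 5 * (n * n).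
  apply: leq_trans h _; have h2 : n * d <= n * (5 * n) by rewrite leq_mul2l hd orbT.
  have -> : 2 ^ 5 = 32 by []. lia.
have n2 : n <= 2 ^ n by apply: ltnW; apply: ltn_expl.
have nB := leq_trans (base_ge_n n s_gt1) base_pow2.
split; rewrite -(@leq_exp2l 2) //; apply: leq_trans h1 _; rewrite expnD leq_mul2l /=.
  by apply: leq_trans (leq_mul n2 n2) _; rewrite -expnD leq_exp2l //; lia.
by apply: leq_trans (leq_mul nB nB) _; rewrite -expnD leq_exp2l //; lia.
Qed.

Lemma scale_log_le : nb <= 2 + 512 * (e * lg).
Proof.
have [_ h] := scale_log_spec s_gt1 n_gt0; rewrite -(@leq_exp2l 2) //; apply: leq_trans h _.
rewrite expnD leq_mul2l /= scaleE; apply: leq_trans (exp_mono 256 base_pow2) _.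
by rewrite -expnM leq_exp2l //; lia.
Qed.

(** In the constant, 1500 * 50 comes from the transforms of Newton's iteration, 7 * 2068 from the
    angle halvings, and 3000 covers all other terms. *)
Lemma total_cost t1 t2 t3 t4 t5 : t1 <= 70 * n ^ 2 -> t2 <= 3 * e + 2 * nb + 14 ->
  t3 <= 10 * 2 ^ K + K * (4 * nb + 12) + 8 -> t4 <= (K + 1) * (1500 * (n * d)) ->
  t5 <= d * (8 * n + 21) + n * (5 * n + 15) + 27 * (n + 2) + 40 ->
  (t1 + (t2 + (t3 + (t4 + t5)))).+1 <= (1500 * 50 + 7 * 2068 + 3000) * U.
Proof.
have l1 : 1 <= lg by rewrite leq_maxl.
have he : e <= n := digit_exp_le s_gt1 n_gt0.
have hd := slot_len_le s_gt1 n_gt0; have hed := exp_slot; have [k1 k2] := table_log_le.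
have hnb := scale_log_le; have [_ h2K] := table_log_spec s_gt1 n_gt0.
have nn : n ^ 2 = n * n by rewrite mulnn.
have n1 : n <= n * n by rewrite leq_pmulr.
have a1 : n * n <= U by rewrite nn leq_pmulr.
have a2 : n * d <= 5 * (n * n) by have := leq_mul (leqnn n) hd; lia.
have a3 : n * lg <= U by rewrite nn leq_mul2r n1 orbT.
have a4 : e * lg <= n * lg by rewrite leq_mul2r he orbT.
have a5 : n * lg * (e * d) <= 5 * U by have := leq_mul (leqnn (n * lg)) hed; rewrite nn; lia.
have b4 : (K + 1) * (n * d) <= 50 * U.
  have := leq_mul k2 (leqnn (n * d)).
  have -> : (5 + 4 * (e * lg)) * (n * d) = 5 * (n * d) + 4 * (n * lg * (e * d)) by lia.
  by rewrite mulnDl mul1n; lia.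
have b3 : K * (4 * nb + 12) <= 7 * (2068 * U).
  have c1 : 4 * nb + 12 <= 2068 * (n * lg) by have : 1 <= n * lg; [rewrite muln_gt0 n_gt0|lia].
  have c2 : K <= 7 * n by lia.
  by have := leq_mul c2 c1; rewrite nn; lia.
have b5 : d * (8 * n + 21) = 8 * (n * d) + 21 * d by lia.
have b6 : n * (5 * n + 15) = 5 * (n * n) + 15 * n by lia.
have b7 : (K + 1) * (1500 * (n * d)) = 1500 * ((K + 1) * (n * d)) by lia.
rewrite b5 b6 b7 {1}nn.
move: (n ^ 2 * lg) a1 a3 a5 b3 b4 => u a1 a3 a5 b3 b4 *; lia.
Qed.

End Cost.

(** * Assembly of the word RAM program *)

Section Word.

Variables (ok : nat -> Prop) (X lim s m r : nat).
Hypothesis okX : forall v, v <= X -> ok v.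
Hypothesis s_gt1 : 1 < s.
Hypothesis r_gt1 : 1 < r.
Hypothesis s_le : s <= r.
Hypothesis n_le : m.+1 <= r.
Hypothesis baseX : big_base s m.+1 X.
Hypothesis rX : r ^ 8 <= X.
Hypothesis lim_ge : m.+3 <= lim.
Local Notation n := m.+1.
Local Notation runs := (runs ok lim).

Lemma pow_le c j v : v <= 2 ^ c * r ^ j -> c + j <= 8 -> v <= X.
Proof.
move=> h hc; apply: leq_trans rX; apply: leq_trans h _.
apply: (@leq_trans (r ^ c * r ^ j)); first by rewrite leq_mul2r exp_mono ?orbT.
by rewrite -expnD leq_exp2l.
Qed.

Lemma base_le_r : base s n <= r * r.
Proof. by apply: leq_trans (base_le s_gt1 (isT : 0 < n)) _; apply: leq_mul. Qed.

Lemma word_main_spec (w : n.-tuple 'I_s) st : var st 0 = n -> var st 1 = s -> var st 2 = r ->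
  (forall i, i < n -> io st i = nth 0 (letters w) i) -> (forall l, arr st 1 l = 0) ->
  runs word_main st (fun t st' => [/\ t <= (1500 * 50 + 7 * 2068 + 3000) * (n ^ 2 * log2 s),
    var st' 0 = n + 2, forall i, i < n + 2 -> io st' i < r &
    occ w (dB s n) = \sum_(i < n + 2) io st' i * r ^ i]).
Proof.
move=> h0 h1 h2 hio hz; apply: runs_cond; rewrite /= h1 => hc; first by lia.
have r1 : r <= r ^ 1 by rewrite expn1.
have small v : v <= m + s + 3 -> ok v by move=> hv; apply: okX; apply: (@pow_le 2 1) => //; lia.
have hlim : m < lim by lia.
apply: runs_seq; apply: runs_call (@string_phase_spec ok lim s m s_gt1 small hlim w st h0 h1 hio hz) _.
move=> t1 s1 f1 [ht1 [q [p [[hp hq ha] [v0 v1 v11 v12 v13] hocc]]]].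
have p0 : 0 < p by case/andP: hp.
have hpn : p <= n by case/andP: hp.
have n0 : 0 < n by [].
apply: runs_seq; apply: runs_call (@setup_spec ok lim X s n okX s_gt1 n0 baseX s1 v0 v1) _.
move=> t2 s2 f2 [ht2 rdy].
have u0 : var s2 0 = n by use_frame f2.
have tsm := table_small s_gt1 n0.
(* The error analysis works over any real closed field; the algebraic reals provide one. *)
apply: runs_seq; apply: runs_call (@table_spec ok lim X s n okX s_gt1 n0 baseX realalg tsm s2 rdy u0) _.
move=> t3 s3 f3 [ht3 good].
have set3 : setting s n (Q s3 4) (coef s q p) s3.
  split=> //; first by case: rdy => *; split; use_frame f3.
    by use_frame f3.
  by move=> l; use_frame f3; use_frame f2.
have a_le l : coef s q p l <= s by apply: coef_le; apply: ltnW.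
have N0 := (@newton_spec ok lim X s n okX s_gt1 n0 baseX realalg (Q s3 4) good
  (returns s q p) (coef s q p) (returns0 _ _ _) (returnsE hq p0) erefl (returns_le _ _ _) a_le s3 set3).
apply: runs_seq; apply: (runs_call N0).
move=> t4 s4 f4 [ht4 hF].
have B0 : 0 < base s n by apply: ltnW; apply: base_gt1.
have Br := base_le_r.
have [[g21 _ g23 _ _] _ _ _] := set3.
have e0 : var s4 0 = n by use_frame f4; use_frame f3.
have e1 : var s4 1 = s by use_frame f4; use_frame f3; use_frame f2.
have e2 : var s4 2 = r by use_frame f4; use_frame f3; use_frame f2; use_frame f1.
have e21 : var s4 21 = base s n by use_frame f4.
have e23 : var s4 23 = slot_len s n by use_frame f4.
have e11 : var s4 11 = var s1 11 by use_frame f4; use_frame f3; use_frame f2.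
have e12 : var s4 12 = var s1 12 by use_frame f4; use_frame f3; use_frame f2.
have e13 : var s4 13 = var s1 13 by use_frame f4; use_frame f3; use_frame f2.
have ea l : arr s4 1 l = coef s q p l by use_frame f4; use_frame f3; use_frame f2.
have hF2 k i : k <= n -> i < slot_len s n ->
    arr s4 2 (k * slot_len s n + i) = returns s q p k %/ base s n ^ i %% base s n.
  by move=> hk hi; apply: hF.
have f_lt k : k <= n -> returns s q p k < base s n ^ slot_len s n.
  move=> hk; apply: leq_ltn_trans (returns_le _ _ _ _) (slot_lt s_gt1 n0 _); lia.
have rr : r <= r * r by rewrite leq_pmulr // ltnW.
have q5 : n * (n * s * base s n) <= r ^ 5.
  have h := leq_mul n_le (leq_mul (leq_mul n_le s_le) Br).
  by apply: leq_trans h _; rewrite !expnS expn0 muln1; lia.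
have r5 : r ^ 3 <= r ^ 5 by rewrite leq_exp2l.
have r25 : r ^ 2 <= r ^ 5 by rewrite leq_exp2l.
have r15 : r ^ 1 <= r ^ 5 by rewrite leq_exp2l.
have e3 : r ^ 3 = r * (r * r) by rewrite !expnS expn0 muln1.
have e2' : r ^ 2 = r * r by rewrite mulnn.
have c2 : r * s + s + n + 2 <= X.
  apply: (@pow_le 2 2) => //; have := leq_mul (leqnn r) s_le; have := leq_mul r_gt1 r_gt1; rewrite e2'; lia.
have c1 : r * base s n + base s n + n * (n * s * base s n) <= X.
  apply: (@pow_le 2 5) => //; have := leq_mul (leqnn r) Br; lia.
have c0 : n * (n * s * base s n) <= X by apply: (@pow_le 0 5); rewrite ?mul1n.
have c3 : r + r + n + 2 <= X by apply: (@pow_le 2 1) => //; lia.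
have c4 : slot_len s n <= X.
  by apply: (@pow_le 3 1) => //; have := slot_len_le s_gt1 n0; lia.
have WX : n + 2 <= X by lia.
have rX1 : r <= X by lia.
have Wl : n + 2 <= lim by lia.
have hcs := closed_sumE s q hpn.
have hv : occ w (dB s n) + \sum_(1 <= l < n.+1) l * coef s q p l * returns s q p (n - l) + var s1 12 =
  s ^ n * (1 + var s1 13) + 1 + var s1 11 by rewrite -hcs.
(* The number that is subtracted from is at most 2 s^n + 1 + n, so two words beyond the n words of
   r^n suffice. *)
have hW : s ^ n * (1 + var s1 13) + 1 + var s1 11 < r ^ (n + 2).
  have sn : s ^ n <= r ^ n by apply: exp_mono.
  have rn : r <= r ^ n by rewrite -{1}(expn1 r) leq_exp2l.
  have h4 : 4 <= r * r by apply: (leq_mul r_gt1 r_gt1).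
  have h5 := leq_mul (leqnn (r ^ n)) h4.
  have h6 : s ^ n * (1 + var s1 13) <= r ^ n * 2 by apply: leq_mul => //; lia.
  by rewrite expnD e2'; lia.
apply: runs_call (@output_spec ok lim X r (n + 2) okX r_gt1 WX rX1 Wl n s (base s n) (slot_len s n)
  (returns s q p) (coef s q p) B0 erefl a_le f_lt c0 c1 c2 c3 c4 s4 (var s1 11) (var s1 13) (var s1 12)
  (occ w (dB s n)) e0 e1 e2 e21 e23 e11 e12 e13 v11 v12 v13 ea hF2 hv hW) _.
move=> t5 s5 f5 [ht5 [a1 a2 a3]]; split=> //.
have TC := total_cost s_gt1 n0 ht1 ht2 ht3 ht4 ht5.
exact: TC.
Qed.

End Word.

(** Exceeds the degree of every expression of the program; intermediate values stay below this power
    of the bound on stored values. *)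
Definition word_degree := 400.

Lemma word_main_wf : wf word_degree word_main. Proof. by []. Qed.

Section Fits.

Variables (X D : nat).
Hypothesis X_gt1 : 1 < X.

Definition fits d v := v <= X ^ d.

Lemma fits_mono d d' v : d <= d' -> fits d v -> fits d' v.
Proof. by move=> h /leq_trans; apply; rewrite leq_exp2l. Qed.

Lemma fits_num k : fits k.+1 k.
Proof. by apply: ltnW; apply: leq_ltn_trans (leqnSn k) (ltn_expl _ X_gt1). Qed.

Lemma fits_bin o d1 d2 x y : 0 < d1 -> 0 < d2 -> fits d1 x -> fits d2 y ->
  fits (d1 + d2) (eval_binop o x y).
Proof.
move=> h1 h2 hx hy; have p2 d : 0 < d -> 1 < X ^ d.
  by move=> hd; rewrite -(exp1n d) ltn_exp2r.
have big : x <= X ^ (d1 + d2) by apply: leq_trans hx _; rewrite leq_exp2l // leq_addr.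
case: o => /=; rewrite /fits.
- rewrite expnD; apply: leq_trans (leq_add hx hy) _.
  move: (X ^ d1) (X ^ d2) (p2 d1 h1) (p2 d2 h2) => u v hu hv; nia.
- by apply: leq_trans big; rewrite leq_subr.
- by rewrite expnD leq_mul.
- by apply: leq_trans (leq_div _ _) big.
- by apply: leq_trans (leq_mod _ _) big.
Qed.

End Fits.

Lemma occ_word : exists (P : program) (c C : nat),
  forall (sigma n b : nat) (w : n.-tuple 'I_sigma),
    1 <= n -> 1 <= b -> sigma <= 2 ^ b -> n <= 2 ^ b ->
    word_computes P c b (C * (n ^ 2 * log2 sigma)) n w (occ w (dB sigma n)).
Proof.
pose Cw := 1500 * 50 + 7 * 2068 + 3000.
(* Stored values are at most r^1200, because B^600 is required and B <= n s <= r^2. Intermediate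
   values are at most r^(1200 * word_degree), and one more machine word makes the bound strict. *)
exists (compile word_main), (1200 * word_degree + 1), (4 + size (comp word_main 4) * Cw).
move=> s n b w hn hb hs hnb.
case: n w hn hnb => // m w _ hnb; set n := m.+1.
have hs0 : 0 < s by have := tnth w ord0; case: (s) => // -[].
set r := 2 ^ b; have r1 : 1 < r by rewrite -(exp1n b) ltn_exp2r.
set X := r ^ 1200; have rX j : j <= 1200 -> r ^ j <= X by move=> hj; rewrite leq_exp2l.
have rX1 : r <= X by rewrite -{1}(expn1 r); apply: rX.
have X1 : 1 < X by apply: leq_trans r1 rX1.
set regs := [:: n; s; r].
have okX v : v <= X -> fits X 1 v by rewrite /fits expn1.
have hlim : m.+3 <= 2 * nth 0 regs 0 + 2 by rewrite /= /n; lia.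
have hexec : exists t st, Lang.exec (fits X 1) (2 * nth 0 regs 0 + 2) word_main
    (initial_store regs (letters w)) t st /\ [/\ t <= Cw * (n ^ 2 * log2 s),
    var st 0 <= n + 2, forall i, i < var st 0 -> io st i < r &
    occ w (dB s n) = \sum_(i < var st 0) io st i * r ^ i].
  case: (ltnP 1 s) => hs1.
    have baseX : big_base s n X.
      rewrite /big_base; apply: (@leq_trans ((r * r) ^ 600)).
        by apply: exp_mono; apply: (@base_le_r s m r).
      by rewrite mulnn -expnM; apply: rX.
    have [t [st [h1 [h2 h3 h4 h5]]]] := @word_main_spec (fits X 1) X _ s m r okX hs1 r1 hs hnb baseX (rX 8 isT) hlim w
      (initial_store regs (letters w)) erefl erefl erefl (fun _ _ => erefl) (fun _ => erefl).
    by exists t, st; split=> //; rewrite h3; split.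
  have es : s = 1 by lia.
  exists 3, (setv (seto (initial_store regs (letters w)) 0 1) 0 1); split.
    apply: ExecCond1; first by rewrite /= es.
    by apply: (@Lang.ExecSeq _ _ _ _ _ _ _ 1 1); [apply: ExecOut; rewrite ?addn2 //; apply: okX; apply: ltnW|apply: ExecAsg; apply: okX; apply: ltnW].
  split=> //.
  - by rewrite (@leq_trans (3 * 1)) // leq_mul ?muln_gt0 ?expn_gt0 ?leq_maxl // /Cw; lia.
  - by case=> // _; rewrite /= /update.
  - rewrite big_ord1 /= /update /= expn0 muln1.
    by move: w; rewrite /n es => w; rewrite occ_unary.
have [t [st [hx [ht hv hlt hocc]]]] := hexec.
have sz : size (letters w) = n by rewrite size_letters size_tuple.
have hsz : size (letters w) <= 2 * nth 0 regs 0 + 2 by rewrite sz /=; lia.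
have hT : 4 + size (comp word_main 4) * t <= (4 + size (comp word_main 4) * Cw) * (n ^ 2 * log2 s).
  rewrite mulnDl -mulnA; apply: leq_add.
    by rewrite leq_pmulr // muln_gt0 expn_gt0 leq_maxl.
  by rewrite leq_mul2l ht orbT.
have sX : s <= X by apply: leq_trans hs rX1.
have nX : n <= X by apply: leq_trans hnb rX1.
have nlim : fits X 1 (2 * nth 0 regs 0 + 2).
  rewrite /fits expn1 /=; apply: leq_trans (rX 3 isT).
  have : 2 * 2 <= r * r by apply: leq_mul.
  have h3 : r * (2 * 2) <= r * (r * r) by apply: leq_mul => //; apply: leq_mul.
  have e3 : r ^ 3 = r * (r * r) by rewrite !expnS expn0 muln1.
  move=> _; rewrite e3; apply: leq_trans h3; move: hnb r1; rewrite -/r -/n; clear; move: r n => u v; lia.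
have norm_ok D v : D <= word_degree -> fits X D v -> word_norm (1200 * word_degree + 1) b v = v.
  move=> hD hv2; rewrite /word_norm modn_small //; apply: leq_ltn_trans hv2 _.
  rewrite /X /r -!expnM ltn_exp2l //; move: word_degree hD => W hW.
  by have := leq_mul (leqnn (b * 1200)) hW; lia.
have regs_ok x : fits X 1 (nth 0 regs x).
  by rewrite /fits expn1; case: x => [|[|[|x]]] //=; rewrite nth_nil.
have cells_ok i : fits X 1 (nth 0 (letters w) i).
  rewrite /fits expn1; case: (ltnP i (size (letters w))) => hi; last by rewrite nth_default.
  by apply: leq_trans sX; apply: ltnW; apply: (allP (all_letters w)); apply: mem_nth.
have [h1 h2 h3] := @compile_correct (word_norm (1200 * word_degree + 1) b) (fits X) word_degree regs
  (letters w) (@fits_mono X X1) (@fits_num X X1) (@fits_bin X X1) norm_ok nlim regs_ok cells_ok hsz isT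
  word_main t st _ word_main_wf hx hT.
split=> //; rewrite /word_output h2 //; split.
  by move=> i hi; rewrite h3; [apply: hlt|rewrite /=; lia].
rewrite hocc; apply: eq_bigr => i _; rewrite h3 //.
by have := ltn_ord i; rewrite /=; lia.
Qed.

Theorem theorem3 :
  (exists (P : program) (c C : nat),
     forall (sigma n b : nat) (w : n.-tuple 'I_sigma),
       1 <= n -> 1 <= b -> sigma <= 2 ^ b -> n <= 2 ^ b ->
       word_computes P c b (C * (n ^ 2 * log2 sigma)) n w (occ w (dB sigma n)))
  /\
  (exists (P : program) (C : nat),
     forall (sigma n : nat) (w : n.-tuple 'I_sigma),
       1 <= n ->
       unit_computes P (C * n ^ 2) n w (occ w (dB sigma n))).
Proof. by split; [exact: occ_word | exact: occ_unit_cost]. Qed.
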